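(* Let $N\ge2$, $0<s<1$ and $1\le q<2^*_s=\frac{2N}{N-2s}$. Let $\Omega\subset\mathbb{R}^N$ be an open bounded set satisfying one of the following conditions: (A) either $\partial\Omega$ is Lipschitz and $\Omega$ satisfies the exterior ball condition, with radius $\rho$; (B) or $\partial\Omega$ is $C^{1,\alpha}$, for some $0<\alpha<1$. Then, for every $N$-dimensional ball $B\subset\mathbb{R}^N$, \[ |\Omega|^{\frac2q-1+\frac{2s}{N}}\,\lambda_{s,q}(\Omega)-|B|^{\frac2q-1+\frac{2s}{N}}\,\lambda_{s,q}(B)\ \ge\ \frac{C}{1-s}\,\mathcal{A}(\Omega)^{2+\frac1s}, \] for a constant $C>0$ depending on $N,s,q$ and on: $\rho$ and the Lipschitz constant of $\partial\Omega$ (in case (A)), or the $C^{1,\alpha}$ norm of $\partial\Omega$ (in case (B)).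
   Context: For measurable $u:\mathbb{R}^N\to\mathbb{R}$ set $[u]^2_{W^{s,2}(\mathbb{R}^N)}=\iint_{\mathbb{R}^N\times\mathbb{R}^N}\frac{|u(x)-u(y)|^2}{|x-y|^{N+2s}}\,dx\,dy$. For a (nonempty) open set $\Omega\subset\mathbb{R}^N$, $\mathcal{D}^{s,2}_0(\Omega)$ is the completion of $C_0^\infty(\Omega)$ with respect to the norm $[\,\cdot\,]_{W^{s,2}(\mathbb{R}^N)}$ (for $N\ge2$ a function space included in $L^{2^*_s}(\mathbb{R}^N)$). For $1\le q<2^*_s$, \[ \lambda_{s,q}(\Omega)=\min_{u\in\mathcal{D}^{s,2}_0(\Omega)}\left\{[u]^2_{W^{s,2}(\mathbb{R}^N)}\,:\,\|u\|_{L^q(\Omega)}=1\right\}. \] $|\cdot|$ is $N$-dimensional Lebesgue measure, $\Delta$ the symmetric difference, and the Fraenkel asymmetry is $\mathcal{A}(\Omega)=\inf\left\{\frac{|\Omega\Delta B|}{|\Omega|}\,:\,B\text{ a ball with }|B|=|\Omega|\right\}$. The exterior ball condition with radius $\rho$ means that for every point of $\partial\Omega$ there is a ball of radius $\rho$ contained in $\mathbb{R}^N\setminus\Omega$ whose closure contains that point. *)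

(* Defs.v *)
From HB Require Import structures.
From mathcomp Require Import all_boot all_order all_algebra.
From mathcomp Require Import all_classical all_reals all_analysis.
Set Implicit Arguments.
Unset Strict Implicit.
Unset Printing Implicit Defensive.
Import Order.TTheory GRing.Theory Num.Theory.
Import numFieldNormedType.Exports.
Local Open Scope classical_set_scope.
Local Open Scope ring_scope.

(* The norm carried by ['rV[R]_N] in MathComp-Analysis is the sup norm. It
   induces the usual topology, boundedness and derivatives, but distances and
   balls below have to be Euclidean. *)
Section Euclidean.
Context {R : realType} {N : nat}.
Implicit Types x y nu : 'rV[R]_N.

Definition dot x y : R := \sum_i x 0 i * y 0 i.

Definition enorm x : R := Num.sqrt (\sum_i x 0 i ^+ 2).

Definition eball x (r : R) : set 'rV[R]_N := [set y | enorm (y - x) < r].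

Definition is_eball (B : set 'rV[R]_N) : Prop :=
  exists x r, 0 < r /\ B = eball x r.

Definition bdry (A : set 'rV[R]_N) : set 'rV[R]_N := closure A `\` interior A.

(* Orthogonal projection onto the hyperplane orthogonal to a unit vector. *)
Definition tang nu x : 'rV[R]_N := x - dot x nu *: nu.

End Euclidean.

(* N-dimensional Lebesgue measure: the Lebesgue outer measure, defined with
   countable covers by open boxes, restricted to its Caratheodory sigma-algebra
   (i.e. to the Lebesgue measurable sets). *)
Section Lebesgue.
Context {R : realType} {N : nat}.

Definition box (I : 'rV[R]_N * 'rV[R]_N) : set 'rV[R]_N :=
  [set x | forall i, I.1 0 i < x 0 i < I.2 0 i].

Definition box_vol (I : 'rV[R]_N * 'rV[R]_N) : R :=
  \prod_i Num.max 0 (I.2 0 i - I.1 0 i).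

(* A cover is a sequence of optional boxes, so that finite (and empty) covers
   are allowed also when N = 0, where every box has volume 1. *)
Definition obox (I : option ('rV[R]_N * 'rV[R]_N)) : set 'rV[R]_N :=
  if I is Some J then box J else set0.

Definition obox_vol (I : option ('rV[R]_N * 'rV[R]_N)) : \bar R :=
  if I is Some J then (box_vol J)%:E else 0%E.

Definition leb_outer (A : set 'rV[R]_N) : \bar R :=
  ereal_inf [set (\sum_(k <oo) obox_vol (F k))%E
            | F in [set F | A `<=` \bigcup_k obox (F k)]].

Local Open Scope ereal_scope.

Let obox_vol_ge0 I : 0 <= obox_vol I.
Proof.
case: I => //= I; rewrite lee_fin; apply: prodr_ge0 => i _.
by rewrite le_max lexx.
Qed.

Let leb_outer_ge0 A : 0 <= leb_outer A.
Proof.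
by apply: le_ereal_inf_tmp => _ [F _ <-]; exact: nneseries_ge0.
Qed.

Let leb_outer0 : leb_outer set0 = 0.
Proof.
apply/eqP; rewrite eq_le leb_outer_ge0 andbT.
apply: ereal_inf_lbound; exists (fun=> None); first by [].
by rewrite eseries0.
Qed.

Let le_leb_outer : {homo leb_outer : A B / A `<=` B >-> A <= B}.
Proof.
move=> A B AB; apply/ereal_inf_le_tmp => _ [F BF <-].
by exists F => //; exact: subset_trans AB BF.
Qed.

Let leb_outer_sigma_subadditive : sigma_subadditive leb_outer.
Proof.
move=> A; have [[i ioo]|] := pselect (exists i, leb_outer (A i) = +oo).
  rewrite (eseries_pinfty _ _ ioo) ?leey// => n _.
  by rewrite -ltNye (lt_le_trans _ (leb_outer_ge0 _)).
rewrite -forallNE => Aoo.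
suff add2e (e : {posnum R}) :
    leb_outer (\bigcup_n A n) <= \sum_(i <oo) leb_outer (A i) + e%:num%:E.
  by apply/lee_addgt0Pr => _/posnumP[].
rewrite (le_trans _ (epsilon_trick _ _ _))//.
pose P n (B : nat -> option ('rV[R]_N * 'rV[R]_N)) :=
  A n `<=` \bigcup_k obox (B k) /\
  \sum_(k <oo) obox_vol (B k) <= leb_outer (A n) + (e%:num / (2 ^ n.+1)%:R)%:E.
have [G PG] : {G & forall n, P n (G n)}.
  apply: (@choice _ _ P) => n; rewrite /P.
  have Afin : leb_outer (A n) \is a fin_num.
    by rewrite ge0_fin_numE// ltey; apply/eqP/Aoo.
  have en1 : (0 < e%:num / (2 ^ n.+1)%:R)%R by [].
  have [_ [B AnB <-] /ltW ?] := lb_ereal_inf_adherent en1 Afin.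
  by exists B.
have G_ge0 x : 0 <= (obox_vol \o uncurry G) x by exact: obox_vol_ge0.
apply: (@le_trans _ _ (\esum_(i in setT) (obox_vol \o uncurry G) i)).
  apply: ereal_inf_lbound => /=.
  have /card_esym/ppcard_eqP[f] := card_nat2.
  exists (uncurry G \o f).
    move=> t [i _ /(PG i).1 [j _ Gt]]; exists (f^-1%FUN (i, j)) => //=.
    by rewrite invK ?inE.
  rewrite -(esum_pred_image (obox_vol \o uncurry G) _ xpredT) ?[fun=> _]set_true//.
  by rewrite image_eq.
rewrite (_ : esum _ _ = \sum_(i <oo) \sum_(j <oo) obox_vol (G i j)); last first.
  pose J : nat -> set (nat * nat) := fun i => [set (i, j) | j in setT].
  rewrite (_ : setT = \bigcup_k J k); last first.
    by rewrite predeqE => -[a b]; split => // _; exists a => //; exists b.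
  rewrite esum_bigcupT //=; last first.
    apply/trivIsetP => i j _ _ ij.
    rewrite predeqE => -[n m] /=; split => //= -[] [_] _ [<-{n} _].
    by move=> [m' _] [] /esym/eqP; rewrite (negbTE ij).
  rewrite -(image_id [set: nat]) -fun_true esum_pred_image//; last first.
    by move=> n _; exact: esum_ge0.
  apply: eq_eseriesr => /= j _.
  rewrite -(esum_pred_image (obox_vol \o uncurry G) (pair j) predT)//=; last first.
    by move=> ? ? _ _; exact: (@can_inj _ _ _ snd).
  by congr esum; rewrite predeqE => -[a b]; split; move=> [i _ <-]; exists i.
apply: lee_nneseries => [n *|n *]; last exact: (PG n).2.
by apply: nneseries_ge0 => m *; exact: (G_ge0 (n, m)).
Qed.

HB.instance Definition _ := isOuterMeasure.Build R 'rV[R]_N leb_outer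
  leb_outer0 leb_outer_ge0 le_leb_outer leb_outer_sigma_subadditive.

End Lebesgue.

Definition leb_om (R : realType) (N : nat) :
  {outer_measure set 'rV[R]_N -> \bar R} := @leb_outer R N.

Notation RN R N := (caratheodory_type (leb_om R N)).

Definition leb (R : realType) (N : nat) : {measure set (RN R N) -> \bar R} :=
  (leb_om R N : set (RN R N) -> \bar R).

Definition crit_exp {R : realType} (N : nat) (s : R) : R :=
  2 * N%:R / (N%:R - 2 * s).

Section FractionalSobolev.
Context {R : realType} {N : nat}.
Implicit Types (u f : 'rV[R]_N -> R) (Omega B : set 'rV[R]_N).

Local Notation mu := (leb R N).

(* On the diagonal, which is negligible, the integrand is 0 / 0 = 0. *)
Definition seminorm2 (s : R) u : \bar R :=
  (\int[mu \x mu]_z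
     (`|u z.1 - u z.2| ^+ 2 / enorm (z.1 - z.2) `^ (N%:R + 2 * s))%:E)%E.

Fixpoint Ck (k : nat) f {struct k} : Prop :=
  continuous f /\
  if k is k'.+1 then
    forall i : 'I_N, (forall x, derivable f x (delta_mx 0 i)) /\
      Ck k' (fun x => 'D_(delta_mx 0 i) f x)
  else True.

Definition test_fun Omega f : Prop :=
  [/\ forall k, Ck k f, compact (closure [set x | f x != 0]) &
      closure [set x | f x != 0] `<=` Omega].

(* The completion of C_0^oo(Omega) for the seminorm, realized (N >= 2) as a
   space of functions in L^(2^*_s)(R^N): by the fractional Sobolev inequality a
   Cauchy sequence of test functions has a limit in L^(2^*_s), which determines
   its class in the completion. *)
Definition D0 (s : R) Omega u : Prop :=
  [/\ measurable_fun [set: RN R N] (u : RN R N -> R),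
      (Lnorm mu (crit_exp N s)%:E (EFin \o u) < +oo)%E &
      exists phi : nat -> 'rV[R]_N -> R,
        [/\ forall k, test_fun Omega (phi k),
            (fun k => seminorm2 s (phi k \- u)) @ \oo --> 0%E &
            (fun k => Lnorm mu (crit_exp N s)%:E (EFin \o (phi k \- u)))
              @ \oo --> 0%E]].

Definition Lq_norm (q : R) Omega u : \bar R :=
  ((\int[mu]_(x in Omega) (`|u x| `^ q)%:E) `^ q^-1)%E.

Definition lambda (s q : R) Omega : \bar R :=
  ereal_inf [set seminorm2 s u | u in
    [set u | D0 s Omega u /\ Lq_norm q Omega u = 1%E]].

Definition fraenkel Omega : \bar R :=
  ereal_inf [set (mu (Omega `+` B) / mu Omega)%E | B in
    [set B | is_eball B /\ mu B = mu Omega]].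

End FractionalSobolev.

Section BoundaryRegularity.
Context {R : realType} {N : nat}.
Implicit Types (Omega : set 'rV[R]_N) (x nu : 'rV[R]_N) (g : 'rV[R]_N -> R).

(* Within the ball of radius r around x0, Omega is the region below the graph
   of g in the direction nu. The function g is a function on the hyperplane
   orthogonal to nu: only its values there matter. *)
Definition graph_chart Omega (x0 : 'rV[R]_N) (r : R) nu g : Prop :=
  enorm nu = 1 /\
  forall x, eball x0 r x ->
    (Omega x <-> dot (x - x0) nu < g (tang nu (x - x0))).

Definition lipschitz_boundary (L : R) Omega : Prop :=
  forall x0, bdry Omega x0 ->
  exists r nu g, [/\ 0 < r, graph_chart Omega x0 r nu g &
    forall y z, dot y nu = 0 -> dot z nu = 0 ->
      `|g y - g z| <= L * enorm (y - z)].

Definition exterior_ball (rho : R) Omega : Prop :=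
  forall x, bdry Omega x ->
  exists z, eball z rho `<=` ~` Omega /\ closure (eball z rho) x.

Definition disc nu (r : R) : set 'rV[R]_N :=
  [set y | dot y nu = 0 /\ enorm y < r].

Definition unit_tangent nu : set 'rV[R]_N :=
  [set v | dot v nu = 0 /\ enorm v = 1].

(* sup |g| + sup |grad g| + [grad g]_alpha on the disc of radius r; the length
   of a gradient on the hyperplane is the supremum of its components along unit
   tangent vectors. *)
Definition C1alpha_norm (alpha : R) nu (r : R) g : \bar R :=
  (ereal_sup [set e | exists2 y, disc nu r y & e = `|g y|%:E] +
   ereal_sup [set e | exists y v,
     [/\ disc nu r y, unit_tangent nu v & e = `|'D_v g y|%:E]] +
   ereal_sup [set e | exists y z v,
     [/\ disc nu r y, disc nu r z, y != z, unit_tangent nu v &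
        e = (`|'D_v g y - 'D_v g z| / enorm (y - z) `^ alpha)%:E]])%E.

(* The boundary is C^(1,alpha) with norm at most M. The norm of a boundary has
   to account for the size of the charts as well (in arbitrarily small charts
   every smooth boundary has arbitrarily small norm), so a bound M means charts
   of radius 1/M given by functions of norm at most M. Increasing M weakens the
   condition, and every bounded open set with C^(1,alpha) boundary satisfies it
   for some M. *)
Definition C1alpha_boundary (alpha M : R) Omega : Prop :=
  0 < M /\
  forall x0, bdry Omega x0 ->
  exists nu g, [/\ graph_chart Omega x0 M^-1 nu g,
    (forall y v, disc nu M^-1 y -> dot v nu = 0 -> derivable g y v) &
    (C1alpha_norm alpha nu M^-1 g <= M%:E)%E].

End BoundaryRegularity.

(* Main.v *)
(* Let v be the symmetric decreasing rearrangement of u = |phi|, phi a test function.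
   It is obtained here by minimizing the second moment among the functions that are
   equimeasurable with u and have no larger energy, for which polarization in
   half-spaces containing the origin provides competitors. Subtracting from the
   kernel |x|^(-N-2s) a small multiple of a truncated quadratic kernel leaves a
   decreasing kernel, so the energy deficit of u controls the deficit for the
   quadratic one. That deficit is a difference of second moments about suitable
   centers, which the bathtub principle bounds below, level by level, in terms of
   b = min |B \ Omega| over the balls B with |B| = |Omega|: each level up to a
   height of order b gains b^2, in total b^3, unless a low superlevel set of v is
   smaller than B by a fixed proportion of b, and then scaling gains b. Hence the
   scale-invariant deficit is at least C b^3. Finally b is at least a multiple of the asymmetry A, and
   A^(2+1/s) <= 2^(1/s-1) A^3 because A <= 2; the factor 1/(1-s) is absorbed by the
   constant, which may depend on s. *)

From HB Require Import structures.
Require Import Defs.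
From mathcomp Require Import all_boot all_order all_algebra.
From mathcomp Require Import all_classical all_reals all_analysis.
From mathcomp Require Import measurable_realfun ring lra.
Set Implicit Arguments.
Unset Strict Implicit.
Unset Printing Implicit Defensive.
Import Order.TTheory GRing.Theory Num.Theory.
Import numFieldNormedType.Exports.
Local Open Scope classical_set_scope.
Local Open Scope ring_scope.

(** * Lebesgue measure *)

(** The comparison kernel is quadratic because the self-interaction of a function under |x-y|^2 is a
    multiple of its mass times its second moment about the barycenter, and second moments can be
    compared level by level. The barycenter is the same for all levels, whereas the superlevel sets
    of u need not be centered there; this is why b is a minimum over all balls. Since u may be
    spread out, the quadratic kernel has to be cut off. It is made to fall twice as fast beyond
    distance 2, and this surplus pays for the mass of u far from the chosen center. No extremal
    function appears. The constant [Lam] of the unit ball is the best constant over radially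
    decreasing Lipschitz functions supported in it. A lower bound on the eigenvalue of an open set
    is obtained from |phi|, phi a test function, and an upper bound for balls from smoothing such
    radial functions. Compactness is therefore only needed for uniformly bounded Lipschitz families
    with a common support, in which the second moment attains its minimum. *)

Section slicing.
Context {R : realType}.

Lemma nneseries_ge_term (u : nat -> \bar R) k :
  (forall i, 0 <= u i)%E -> (u k <= \sum_(i <oo) u i)%E.
Proof.
move=> u0; apply: (@le_trans _ _ (\sum_(0 <= i < k.+1) u i)%E).
  rewrite big_nat_recr//= leeDr//; apply: sume_ge0 => i _; exact: u0.
by apply: nneseries_lim_ge => n _ _; exact: u0.
Qed.

Lemma box_cover_vol n (a b : nat -> R) (P : nat -> bool) (c d : nat -> nat -> R) :
  (forall x : nat -> R, (forall i, (i < n)%N -> a i < x i < b i) ->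
     exists k, P k /\ forall i, (i < n)%N -> c k i < x i < d k i) ->
  ((\prod_(i < n) Num.max 0 (b i - a i))%:E <=
   \sum_(k <oo) (if P k then (\prod_(i < n) Num.max 0 (d k i - c k i))%:E else 0))%E.
Proof.
elim: n P => [|n IH] P cov.
  (* In dimension 0 the empty product is 1, and covering the only point forces some [k] with
     [P k]. *)
  have [k [Pk _]] := cov (fun=> 0) (fun i => ltac:(by [])).
  rewrite big_ord0; apply: le_trans (nneseries_ge_term k _).
    by rewrite Pk big_ord0.
  by move=> i; case: ifP => // _; rewrite big_ord0 lee_fin.
pose v k := \prod_(i < n) Num.max 0 (d k i - c k i).
have v0 k : 0 <= v k by apply: prodr_ge0 => i _; rewrite le_max lexx.
rewrite big_ord_recr/=.
have [ban|abn] := leP (b n) (a n).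
  rewrite (max_idPl _) ?subr_le0// mulr0; apply: nneseries_ge0 => k _ _.
  by case: ifP => // _; rewrite lee_fin prodr_ge0// => i _; rewrite le_max lexx.
rewrite (max_idPr _) ?subr_ge0 ?(ltW abn)//.
set w := \prod_(i < n) _.
have w0 : 0 <= w by apply: prodr_ge0 => i _; rewrite le_max lexx.
have slice t : a n < t < b n ->
    (w%:E <= \sum_(k <oo) ((if P k then (v k)%:E else 0) *
      (\1_(`]c k n, d k n[ : set R) t)%:E))%E.
  move=> abt; apply: (le_trans (IH (fun k => P k && (c k n < t < d k n)) _)).
    move=> x xab; pose y i := if i == n then t else x i.
    have [i|k [Pk ky]] := cov y.
      rewrite ltnS leq_eqVlt /y; case: eqP => [->//|_ /= ilt]; exact: xab.
    exists k; split.
      by rewrite Pk/=; have := ky n (ltnSn n); rewrite /y eqxx.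
    move=> i ilt; have := ky i (ltnW ilt); rewrite /y.
    by case: eqP => // ein; move: ilt; rewrite ein ltnn.
  apply: lee_nneseries => k _; first by case: ifP => // _; rewrite lee_fin v0.
  rewrite indicE; case: (P k) => /=; last by rewrite mul0e.
  case: ifP => ct; first by rewrite mem_set ?mule1//= in_itv.
  by rewrite mule_ge0// lee_fin.
have mI k : measurable_fun [set: R] (fun t : R => (\1_(`]c k n, d k n[ : set R) t)%:E : \bar R).
  by apply/measurable_EFinP; exact: measurable_indic.
have Pv0 k : (0 <= (if P k then (v k)%:E else 0) :> \bar R)%E.
  by case: ifP => // _; rewrite lee_fin.
rewrite EFinM -[(b n - a n)%:E](_ : lebesgue_measure `]a n, b n[ = _)%E; last first.
  by rewrite lebesgue_measure_itv/= lte_fin abn EFinB.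
rewrite -integral_cst//=.
apply: (@le_trans _ _ (\int[lebesgue_measure]_(t in `]a n, b n[)
   (\sum_(k <oo) ((if P k then (v k)%:E else 0) *
      (\1_(`]c k n, d k n[ : set R) t)%:E)))%E).
  apply: ge0_le_integral => //.
  by apply: ge0_emeasurable_sum => // k *; [rewrite mule_ge0// lee_fin|
     exact: measurable_funS (measurable_funeM _ (mI k))].
rewrite integral_nneseries//; last 2 first.
- by move=> k; exact: measurable_funS (measurable_funeM _ (mI k)).
- by move=> k t _; rewrite mule_ge0// lee_fin.
apply: lee_nneseries => k _.
  by move=> _; apply: integral_ge0 => t _; rewrite mule_ge0// lee_fin.
rewrite ge0_integralZl//; last exact: measurable_funS (mI k).
case: (P k); last by rewrite mul0e.
rewrite big_ord_recr/= EFinM lee_wpmul2l ?lee_fin//.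
rewrite integral_indic//; apply: (@le_trans _ _ (lebesgue_measure (`]c k n, d k n[ : set R))).
  apply: le_measure; rewrite ?inE//; exact: measurableI.
rewrite lebesgue_measure_itv/= lte_fin; case: ifP => cd.
  by rewrite -EFinB lee_fin le_max lexx orbT.
by rewrite lee_fin le_max lexx.
Qed.

End slicing.

Section lebesgue.
Context {R : realType} {N : nat}.
Notation V := 'rV[R]_N.
Notation lo := (@leb_outer R N).
Implicit Types (A : set V) (I : V * V).

Lemma box_vol_ge0 I : 0 <= box_vol I.
Proof. by apply: prodr_ge0 => i _; rewrite le_max lexx. Qed.

Lemma obox_vol_ge0 (J : option (V * V)) : (0 <= obox_vol J)%E.
Proof. by case: J => //= J; rewrite lee_fin box_vol_ge0. Qed.

Lemma leb_outer_le_cover A (F : nat -> option (V * V)) :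
  A `<=` \bigcup_k obox (F k) -> (lo A <= \sum_(k <oo) obox_vol (F k))%E.
Proof. by move=> AF; apply: ereal_inf_lbound; exists F. Qed.

Lemma leb_outer_sub A B : A `<=` B -> (lo A <= lo B)%E.
Proof. exact: le_outer_measure. Qed.

Lemma leb_outer_box_le I : (lo (box I) <= (box_vol I)%:E)%E.
Proof.
pose F (k : nat) : option (V * V) := if k is 0 then Some I else None.
have -> : ((box_vol I)%:E = \sum_(k <oo) obox_vol (F k))%E.
  rewrite nneseries_recl//; last by move=> k _; exact: obox_vol_ge0.
  by rewrite eseries0 ?adde0// => -[].
by apply: leb_outer_le_cover => x Ix; exists 0.
Qed.

Lemma leb_outer_box I : lo (box I) = (box_vol I)%:E.
Proof.
apply/eqP; rewrite eq_le leb_outer_box_le/=.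
apply: le_ereal_inf_tmp => _ [F IF <-].
pose ext (y : V) k := if insub k is Some i then y 0 i else 0.
have extE (y : V) (i : 'I_N) : ext y i = y 0 i by rewrite /ext valK.
pose G k := if F k is Some J then J else (0, 0).
have := @box_cover_vol R N (ext I.1) (ext I.2) (fun k => isSome (F k))
  (fun k => ext (G k).1) (fun k => ext (G k).2).
have -> : \prod_(i < N) Num.max 0 (ext I.2 i - ext I.1 i) = box_vol I.
  by apply: eq_bigr => i _; rewrite !extE.
move=> H; apply: le_trans (H _) _.
  move=> x xI; have [|k _ kx] := IF (\row_i x i).
    by move=> i; rewrite mxE -!extE; exact: xI.
  exists k; rewrite /G; move: kx; case: (F k) => //= J Jx; split=> // i iN.
  by have := Jx (Ordinal iN); rewrite mxE -!extE.
apply: lee_nneseries => [k _|k _].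
  by case: ifP => // _; rewrite lee_fin prodr_ge0// => i _; rewrite le_max lexx.
rewrite /G; case: (F k) => //= J; rewrite lee_fin.
rewrite le_eqVlt; apply/orP; left; apply/eqP/eq_bigr => i _; by rewrite !extE.
Qed.

Lemma leb_outer_hyperplane (i : 'I_N) c : lo [set x : V | x 0 i = c] = 0%E.
Proof.
pose A n : set V := [set x | x 0 i = c /\ forall j, `|x 0 j| < n.+1%:R].
have sub : [set x : V | x 0 i = c] `<=` \bigcup_n A n.
  move=> x xc; pose M := \sum_j `|x 0 j|.
  have [n Mn] : exists n : nat, M < n%:R.
    by exists (Num.truncn M).+1; rewrite truncnS_gt.
  exists n => //; split=> // j; apply: (@le_lt_trans _ _ M).
    by rewrite /M (bigD1 j)//= lerDl sumr_ge0.
  by rewrite (lt_le_trans Mn)// ler_nat.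
have A0 n : lo (A n) = 0%E.
  apply/eqP; rewrite eq_le outer_measure_ge0 andbT; apply/lee_addgt0Pr => e e0.
  rewrite add0e.
  pose C := \prod_(j < N | j != i) Num.max 0 (n.+1%:R - - n.+1%:R : R).
  have C0 : 0 <= C by apply: prodr_ge0 => j _; rewrite le_max lexx.
  (* A slab of thickness 2d over a face of area C has volume at most e; C + 1 avoids a division by
     zero. *)
  pose d := e / (2 * (C + 1)).
  have d0 : 0 < d by rewrite divr_gt0// mulr_gt0// ltr_wpDl.
  pose I : V * V := (\row_j (if j == i then c - d else - n.+1%:R),
                     \row_j (if j == i then c + d else n.+1%:R)).
  apply: (@le_trans _ _ (lo (box I))).
    apply: leb_outer_sub => x [xc xn] j; rewrite !mxE.
    case: eqP => [->|_]; first by rewrite xc ltrDl gtrDl oppr_lt0 d0.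
    by rewrite -ltr_norml.
  rewrite leb_outer_box lee_fin /box_vol (bigD1 i)//= !mxE eqxx.
  rewrite (_ : \prod_(j < N | j != i) _ = C); last first.
    by apply: eq_bigr => j /negPf ji; rewrite !mxE ji.
  rewrite (_ : c + d - (c - d) = 2 * d); last by ring.
  rewrite (max_idPr (mulr_ge0 _ (ltW d0)))//.
  have E : 2 * d * (C + 1) = e by rewrite /d; field; rewrite gt_eqF// ltr_wpDl.
  by rewrite -E ler_wpM2l ?lerDl//; exact: mulr_ge0 (ltW d0).
apply/eqP; rewrite eq_le outer_measure_ge0 andbT.
apply: (le_trans (leb_outer_sub sub)).
apply: (le_trans (outer_measure_sigma_subadditive lo A)).
by rewrite eseries0// => k _ _; exact: A0.
Qed.

Definition cut_left (i : 'I_N) (c : R) I : V * V :=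
  (I.1, \row_j (if j == i then Num.min (I.2 0 i) c else I.2 0 j)).
Definition cut_right (i : 'I_N) (c : R) I : V * V :=
  (\row_j (if j == i then Num.max (I.1 0 i) c else I.1 0 j), I.2).

Lemma box_vol_cut i c I :
  box_vol (cut_left i c I) + box_vol (cut_right i c I) <= box_vol I.
Proof.
rewrite /box_vol (bigD1 i)//= [X in _ + X <= _](bigD1 i)//= [leRHS](bigD1 i)//= !mxE eqxx.
set P := \prod_(j < N | j != i) Num.max 0 (I.2 0 j - I.1 0 j).
have P0 : 0 <= P by apply: prodr_ge0 => j _; rewrite le_max lexx.
rewrite (_ : \prod_(j < N | j != i) _ = P); last first.
  by apply: eq_bigr => j /negPf ji; rewrite !mxE ji.
rewrite (_ : \prod_(j < N | j != i) Num.max 0 (I.2 0 j - (\row__ _) 0 j) = P);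
  last by apply: eq_bigr => j /negPf ji; rewrite !mxE ji.
rewrite -mulrDl ler_wpM2r//.
by rewrite /Num.max /Num.min; repeat case: ifPn; rewrite -?leNgt => *; lra.
Qed.

(** Cutting every box of a cover along the hyperplane gives covers of both halves without increasing
    the total volume. The cut pieces are open, so the hyperplane itself is lost, but it is null. *)
Lemma halfspace_measurable (i : 'I_N) c :
  measurable ([set x | x 0 i < c] : set (RN R N)).
Proof.
apply: le_caratheodory_measurable => X; rewrite /leb_om/=.
pose H : set V := [set x | x 0 i < c].
change (lo (X `&` H) + lo (X `&` ~` H) <= lo X)%E.
have XC : (lo (X `&` ~` H) <= lo (X `&` [set x : V | (c < x 0 i)%R]))%E.
  rewrite -[leRHS]adde0 -(leb_outer_hyperplane i c).
  apply: le_trans (outer_measureU2 lo _ _); apply: leb_outer_sub => x [Xx /negP].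
  rewrite -leNgt le_eqVlt => /orP[/eqP->|cx]; [by right|by left].
apply: (le_trans (leeD2l _ XC)).
apply: le_ereal_inf_tmp => _ [F XF <-].
pose F1 k := omap (cut_left i c) (F k).
pose F2 k := omap (cut_right i c) (F k).
apply: (@le_trans _ _ (\sum_(k <oo) obox_vol (F1 k) + \sum_(k <oo) obox_vol (F2 k))%E).
  apply: leeD; apply: leb_outer_le_cover => x [/XF[k _ Fkx] xc]; exists k => //.
    rewrite /F1; move: Fkx; case: (F k) => //= J Jx j; rewrite mxE.
    have := Jx j; case: eqP => [->|_//] /andP[-> ?]/=; rewrite lt_min; exact/andP.
  rewrite /F2; move: Fkx; case: (F k) => //= J Jx j; rewrite mxE.
  by have := Jx j; case: eqP => [->|_//] /andP[? ->]/=; rewrite andbT gt_max; exact/andP.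
rewrite -nneseriesD; [|by move=> *; exact: obox_vol_ge0..].
apply: lee_nneseries => [k _|k _]; first by rewrite adde_ge0 ?obox_vol_ge0.
rewrite /F1 /F2; case: (F k) => [J|]/=; last by rewrite adde0.
by rewrite -EFinD lee_fin box_vol_cut.
Qed.

Lemma coord_measurable (i : 'I_N) D :
  measurable_fun D (fun x : RN R N => (x : V) 0 i).
Proof.
move=> mD; apply: (measurability _ (RGenInftyO.measurableE R)) => //.
move=> _ [_ [c ->] <-]; apply: measurableI => //.
rewrite (_ : _ @^-1` _ = [set x : V | x 0 i < c]); first exact: halfspace_measurable.
by apply/seteqP; split=> x /=; rewrite in_itv.
Qed.

Lemma box_measurable I : measurable (box I : set (RN R N)).
Proof.
rewrite (_ : box I = \bigcap_(i in [set: 'I_N])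
  ((fun x : RN R N => (x : V) 0 i) @^-1` `]I.1 0 i, I.2 0 i[)); last first.
  by apply/seteqP; split=> [x Ix i _|x Ix i]/=; [rewrite in_itv; exact: Ix|
    have := Ix i Logic.I; rewrite /= in_itv].
apply: fin_bigcap_measurable => // i _; rewrite -[X in measurable X]setTI.
exact: coord_measurable.
Qed.

Lemma leb_sigma_finite : sigma_finite [set: RN R N] (leb R N).
Proof.
exists (fun n => box (const_mx (- n%:R), const_mx n%:R)).
  apply/seteqP; split=> // x _.
  pose M := \sum_j `|(x : V) 0 j|.
  have [n Mn] : exists n : nat, M < n%:R.
    by exists (Num.truncn M).+1; rewrite truncnS_gt.
  exists n => // j; rewrite !mxE -ltr_norml; apply: le_lt_trans Mn.
  by rewrite /M (bigD1 j)//= lerDl sumr_ge0.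
move=> n; split; first exact: box_measurable.
by rewrite [leb R N _]leb_outer_box ltry.
Qed.

Lemma open_leb_measurable A : open A -> measurable (A : set (RN R N)).
Proof.
move=> oA.
pose bx (pk : 'rV[rat]_N * nat) : set V :=
  box (\row_j (ratr (pk.1 0 j) - pk.2.+1%:R^-1), \row_j (ratr (pk.1 0 j) + pk.2.+1%:R^-1)).
rewrite (_ : A = \bigcup_pk (if `[< bx pk `<=` A >] then bx pk else set0)).
  apply: countable_bigcupT_measurable => // pk.
  by case: ifP => // _; exact: box_measurable.
apply/seteqP; split=> [x Ax|x [pk _]]; last by case: asboolP => // h /h.
have [e /= e0 eA] : exists2 e : R, 0 < e & ball x e `<=` A.
  by have := open_nbhs_nbhs (conj oA Ax); rewrite -nbhs_ballE => -[e /= e0 ?]; exists e.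
pose k := Num.truncn (2 / e).
have ke : 2 / e < k.+1%:R by rewrite truncnS_gt.
have k0 : 0 < (k.+1%:R^-1 : R) by rewrite invr_gt0.
have ke2 : k.+1%:R^-1 * 2 < e.
  by rewrite mulrC ltr_pdivrMr// mulrC -ltr_pdivrMr.
have /choice[p px] : forall j, exists q : rat, `|x 0 j - ratr q| < k.+1%:R^-1.
  move=> j; move: k0; set d := _^-1 => d0.
  have [|q] := @rat_in_itvoo R (x 0 j - d) (x 0 j + d); first by lra.
  rewrite in_itv/= => /andP[q1 q2]; exists q; rewrite ltr_norml; apply/andP; split; lra.
exists (\row_j p j, k) => //=; case: asboolP => [_|[]].
  move=> j; rewrite !mxE/=; have := px j; rewrite ltr_norml.
  by set d := _^-1 => /andP[? ?]; apply/andP; split; lra.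
move=> y yb; apply: eA; split=> // z j.
rewrite ord1 -ball_normE /ball_/=; move: (yb j) (px j) ke2; rewrite !mxE/= !ltr_norml.
by set d := _^-1 => /andP[? ?] /andP[? ?] ?; apply/andP; split; lra.
Qed.

(** A copy of [leb] to which sigma-finiteness is attached, as required by the product measure and
    Tonelli. *)
Definition lebm : set (RN R N) -> \bar R := leb R N.

HB.instance Definition _ := Measure.on lebm.
HB.instance Definition _ := Measure_isSigmaFinite.Build _ _ _ lebm leb_sigma_finite.

End lebesgue.
Arguments lebm R N : clear implicits.

(** * Behaviour of Lebesgue measure under dilations *)

Section affine.
Context {R : realType} {N : nat}.
Notation V := 'rV[R]_N.
Notation lo := (@leb_outer R N).
Implicit Types (x y n : V) (A : set V).

(** Stated for all sets, not only measurable ones: the measurability of f is itself deduced from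
    this through the Caratheodory condition. *)
Definition leb_scales (f : V -> V) (c : R) :=
  forall A, lo (f @^-1` A) = (c%:E * lo A)%E.

Definition dil (t : R) (a : V) x : V := t *: x + a.

Lemma dilK t a : t != 0 -> cancel (dil t a) (dil t^-1 (- (t^-1 *: a))).
Proof. by move=> t0 x; rewrite /dil scalerDr scalerA mulVf// scale1r addrK. Qed.

Lemma dilKV t a : t != 0 -> cancel (dil t^-1 (- (t^-1 *: a))) (dil t a).
Proof.
by move=> t0 x; rewrite /dil scalerDr scalerN !scalerA mulfV// !scale1r subrK.
Qed.

Let dil_box (t : R) (a : V) (I : V * V) : V * V :=
  if 0 < t then (\row_j ((I.1 0 j - a 0 j) / t), \row_j ((I.2 0 j - a 0 j) / t))
  else (\row_j ((I.2 0 j - a 0 j) / t), \row_j ((I.1 0 j - a 0 j) / t)).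

Let dil_boxE t a I : t != 0 -> dil t a @^-1` box I = box (dil_box t a I).
Proof.
move=> t0; apply/seteqP; split=> x /= Ix j; have := Ix j; rewrite /dil_box /dil;
  move: t0; rewrite neq_lt => /orP[t0|t0]; rewrite ?t0 ?(le_gtF (ltW t0)) !mxE/=;
  rewrite ?(ltr_pdivlMr _ _ t0) ?(ltr_pdivrMr _ _ t0) ?(ltr_ndivlMr _ _ t0)
   ?(ltr_ndivrMr _ _ t0) ![_ * t]mulrC; lra.
Qed.

Let dil_box_vol t a I : t != 0 -> box_vol (dil_box t a I) = (`|t| ^- N) * box_vol I.
Proof.
move=> t0; have nt0 : 0 < `|t| by rewrite normr_gt0.
rewrite /box_vol -exprVn -[X in _ ^+ X](card_ord N) -prodr_const -big_split/=.
apply: eq_bigr => j _.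
have -> : (dil_box t a I).2 0 j - (dil_box t a I).1 0 j = `|t|^-1 * (I.2 0 j - I.1 0 j).
  rewrite /dil_box; case: ifPn => tp; rewrite !mxE.
    by rewrite gtr0_norm//; field.
  by rewrite -leNgt in tp; rewrite ler0_norm//; field.
by rewrite -[X in Num.max X _](mulr0 `|t|^-1) maxr_pMr// invr_ge0 ltW.
Qed.

Let dil_scales_le t a A : t != 0 ->
  (lo (dil t a @^-1` A) <= (`|t| ^- N)%:E * lo A)%E.
Proof.
move=> t0; have nt0 : 0 < `|t| ^+ N by rewrite exprn_gt0// normr_gt0.
rewrite -lee_pdivrMl ?invr_gt0//.
apply: le_ereal_inf_tmp => _ [F AF <-].
rewrite lee_pdivrMl ?invr_gt0// -nneseriesZl; last by move=> *; exact: obox_vol_ge0.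
pose G k := omap (dil_box t a) (F k).
rewrite (_ : (\sum_(k <oo) _ = \sum_(k <oo) obox_vol (G k))%E); last first.
  apply: eq_eseriesr => k _; rewrite /G; case: (F k) => [J|]/=; last by rewrite mule0.
  by rewrite dil_box_vol.
apply: leb_outer_le_cover => x /AF[k _ Fk]; exists k => //.
rewrite /G; move: Fk; case: (F k) => //= J Jx.
by rewrite -dil_boxE.
Qed.

Lemma dil_scales t a : t != 0 -> leb_scales (dil t a) (`|t| ^- N).
Proof.
move=> t0 A; have nt0 : 0 < `|t| ^+ N by rewrite exprn_gt0// normr_gt0.
apply/eqP; rewrite eq_le dil_scales_le//=.
rewrite -lee_pdivlMl ?invr_gt0// invrK.
have := @dil_scales_le t^-1 (- (t^-1 *: a)) (dil t a @^-1` A) (invr_neq0 t0).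
rewrite normfV exprVn invrK -comp_preimage.
rewrite (_ : (dil t a \o _) @^-1` A = A)//.
by apply/seteqP; split=> x /=; rewrite dilKV.
Qed.

Lemma scales_measurable (f g : V -> V) c : 0 < c -> cancel f g -> cancel g f ->
  leb_scales f c -> measurable_fun setT (f : RN R N -> RN R N).
Proof.
move=> c0 fK gK fc _ A mA; rewrite setTI.
suff: (leb_om R N).-caratheodory (f @^-1` A) by [].
have {}mA : (leb_om R N).-caratheodory A := mA.
move=> X; rewrite /leb_om/=.
have XE Y : X `&` f @^-1` Y = f @^-1` (g @^-1` X `&` Y).
  by apply/seteqP; split=> x /=; rewrite fK.
rewrite preimage_setC !XE !fc.
rewrite [X in lo X](_ : _ = f @^-1` (g @^-1` X)); last first.
  by apply/seteqP; split=> x /=; rewrite fK.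
rewrite fc; have := mA (g @^-1` X); rewrite /leb_om/= => ->.
by rewrite ge0_muleDr//; exact: outer_measure_ge0.
Qed.

Lemma scales_integral (f g : V -> V) c (h : RN R N -> \bar R) :
  0 < c -> cancel f g -> cancel g f -> leb_scales f c ->
  measurable_fun setT h -> (forall x, 0 <= h x)%E ->
  (\int[lebm R N]_x h (f x) = c%:E * \int[lebm R N]_x h x)%E.
Proof.
move=> c0 fK gK fc mh h0; have mf := scales_measurable c0 fK gK fc.
rewrite -[LHS]/(\int[lebm R N]_(x in f @^-1` setT) (h \o f) x)%E.
rewrite -(ge0_integral_pushforward mf)//=.
rewrite (eq_measure_integral (mscale (NngNum (ltW c0)) (lebm R N))).
  by rewrite ge0_integral_mscale.
by move=> A mA _; rewrite /pushforward /mscale/=; exact: fc.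
Qed.

End affine.

Lemma mule_inj {R : realType} (w : R) (a b : \bar R) :
  0 < w -> (w%:E * a = w%:E * b)%E -> a = b.
Proof.
move=> w0 H; have h (x y : \bar R) : (w%:E * x <= w%:E * y)%E = (x <= y)%E.
  by rewrite lee_pmul2l// lte_fin.
by apply/eqP; rewrite eq_le -(h a) -(h b) H lexx.
Qed.

(** * Euclidean geometry and reflections *)

Section euclid.
Context {R : realType} {N : nat}.
Notation V := 'rV[R]_N.
Implicit Types (x y z n c : V) (a b r : R).

Lemma dotC x y : dot x y = dot y x.
Proof. by apply: eq_bigr => i _; rewrite mulrC. Qed.

Lemma dotDl x y z : dot (x + y) z = dot x z + dot y z.
Proof. by rewrite -big_split/=; apply: eq_bigr => i _; rewrite mxE mulrDl. Qed.

Lemma dotZl a x y : dot (a *: x) y = a * dot x y.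
Proof. by rewrite mulr_sumr; apply: eq_bigr => i _; rewrite mxE mulrA. Qed.

Lemma dotNl x y : dot (- x) y = - dot x y.
Proof. by rewrite -scaleN1r dotZl mulN1r. Qed.

Lemma dotBl x y z : dot (x - y) z = dot x z - dot y z.
Proof. by rewrite dotDl dotNl. Qed.

Lemma dotDr x y z : dot z (x + y) = dot z x + dot z y.
Proof. by rewrite dotC dotDl !(dotC z). Qed.

Lemma dotZr a x y : dot x (a *: y) = a * dot x y.
Proof. by rewrite dotC dotZl (dotC x). Qed.

Lemma dotNr x y : dot x (- y) = - dot x y.
Proof. by rewrite dotC dotNl (dotC x). Qed.

Definition dotE := (dotDl, dotDr, dotNl, dotNr, dotZl, dotZr).

Lemma dot_ge0 x : 0 <= dot x x.
Proof. by apply: sumr_ge0 => i _; rewrite -expr2 sqr_ge0. Qed.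

Lemma dot_eq0 x : dot x x = 0 -> x = 0.
Proof.
move=> /eqP; rewrite psumr_eq0; last by move=> i _; rewrite -expr2 sqr_ge0.
move=> /allP x0; apply/rowP => i; rewrite mxE; apply/eqP.
by rewrite -sqrf_eq0 expr2; apply: (implyP (x0 i _)); rewrite ?mem_index_enum.
Qed.

Lemma dot_gt0 x : x != 0 -> 0 < dot x x.
Proof.
by move=> x0; rewrite lt_neqAle dot_ge0 andbT eq_sym; apply: contra_neq x0; exact: dot_eq0.
Qed.

Lemma dot_diff_gt0 x y : x != y -> 0 < dot (x - y) (x - y).
Proof. by move=> xy; rewrite dot_gt0// subr_eq0. Qed.

Lemma cauchy_schwarz x y : dot x y ^+ 2 <= dot x x * dot y y.
Proof.
have [->|y0] := eqVneq y 0.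
  by rewrite -(scale0r 0) !dotE !mul0r mulr0 expr0n.
have yy := dot_gt0 y0.
have := dot_ge0 (dot y y *: x - dot x y *: y).
rewrite !dotE (dotC y x).
rewrite (_ : _ + _ = dot y y * (dot x x * dot y y - dot x y ^+ 2)); last by ring.
by rewrite pmulr_rge0// subr_ge0.
Qed.

Lemma enormE x : enorm x = Num.sqrt (dot x x).
Proof. by congr Num.sqrt; apply: eq_bigr => i _; rewrite expr2. Qed.

Lemma enorm_ge0 x : 0 <= enorm x. Proof. exact: sqrtr_ge0. Qed.

Lemma enorm_sqr x : enorm x ^+ 2 = dot x x.
Proof. by rewrite enormE sqr_sqrtr// dot_ge0. Qed.

Lemma enorm0 : enorm (0 : V) = 0.
Proof. by rewrite enormE -(scale0r 0) dotZl mul0r sqrtr0. Qed.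

Lemma enorm_gt0 x : x != 0 -> 0 < enorm x.
Proof. by move=> x0; rewrite enormE sqrtr_gt0 dot_gt0. Qed.

Lemma enormZ a x : enorm (a *: x) = `|a| * enorm x.
Proof.
by rewrite !enormE !dotE mulrA -expr2 sqrtrM ?sqr_ge0// sqrtr_sqr.
Qed.

Lemma enormN x : enorm (- x) = enorm x.
Proof. by rewrite -scaleN1r enormZ normrN1 mul1r. Qed.

Lemma enormBC x y : enorm (x - y) = enorm (y - x).
Proof. by rewrite -enormN opprB. Qed.

Lemma dot_le_enorm x y : dot x y <= enorm x * enorm y.
Proof.
apply: (le_trans (ler_norm _)); rewrite -(@ler_pXn2r _ 2)// ?nnegrE ?mulr_ge0 ?enorm_ge0//.
by rewrite exprMn !enorm_sqr -normrX ger0_norm ?sqr_ge0// cauchy_schwarz.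
Qed.

Lemma enormD x y : enorm (x + y) <= enorm x + enorm y.
Proof.
rewrite -(@ler_pXn2r _ 2)// ?nnegrE ?addr_ge0 ?enorm_ge0//.
rewrite sqrrD !enorm_sqr !dotE (dotC y x); have := dot_le_enorm x y; lra.
Qed.

Lemma enormB x y z : enorm (x - z) <= enorm (x - y) + enorm (y - z).
Proof. by rewrite -[x - z](subrKA y) enormD. Qed.

Lemma enorm_lip x y : `|enorm x - enorm y| <= enorm (x - y).
Proof.
rewrite ler_norml; have := enormD (x - y) y; have := enormD (y - x) x.
rewrite !subrK (enormBC y x); lra.
Qed.

Lemma coord_le_enorm x (i : 'I_N) : `|x 0 i| <= enorm x.
Proof.
rewrite enormE -sqrtr_sqr ler_sqrt ?dot_ge0// /dot (bigD1 i)//= expr2 lerDl.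
by apply: sumr_ge0 => j _; rewrite -expr2 sqr_ge0.
Qed.

Lemma enorm_le_sum x : enorm x <= \sum_i `|x 0 i|.
Proof.
have s0 : 0 <= \sum_i `|x 0 i| by exact: sumr_ge0.
rewrite -(@ler_pXn2r _ 2)// ?nnegrE ?enorm_ge0// enorm_sqr expr2 mulr_suml.
apply: ler_sum => i _; rewrite -expr2 -real_normK ?num_real// expr2 ler_wpM2l//.
by rewrite (bigD1 i)//= lerDl; exact: sumr_ge0.
Qed.

(** Reflection across the hyperplane [dot x n = b]. The normal [n] is not normalized, so that the
    bisector of x and y can be taken with normal y - x. *)
Definition refl n (b : R) x : V := x - (2 * (dot x n - b) / dot n n) *: n.

Lemma reflK n b : n != 0 -> involutive (refl n b).
Proof.
move=> n0 x; have nn := dot_gt0 n0; rewrite /refl !dotE -addrA -opprD -scalerDl.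
rewrite (_ : 2 * _ / _ + 2 * _ / _ = 0 :> R) ?scale0r ?subr0//.
by field; exact: lt0r_neq0.
Qed.

Lemma refl_dot n b x y : n != 0 ->
  dot (refl n b x - refl n b y) (refl n b x - refl n b y) = dot (x - y) (x - y).
Proof.
move=> n0; have nn := dot_gt0 n0; rewrite /refl.
set s := _ / _; set t := _ / _.
rewrite (_ : _ - _ = (x - y) - (s - t) *: n); last first.
  by rewrite scalerBl; apply/rowP => i; rewrite !mxE; ring.
rewrite !dotE (dotC n) (dotC n).
rewrite (_ : s - t = 2 * (dot x n - dot y n) / dot n n); last by rewrite /s /t; field; exact: lt0r_neq0.
rewrite (dotC y x); field; exact: lt0r_neq0.
Qed.

Lemma refl_enorm n b x y : n != 0 ->
  enorm (refl n b x - refl n b y) = enorm (x - y).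
Proof. by move=> n0; rewrite !enormE refl_dot. Qed.

(** The sign of the added term is what polarization rests on: points on the same side are nearer to
    each other than to each other's image, points on opposite sides are farther. *)
Lemma refl_cross n b x y : n != 0 ->
  dot (x - refl n b y) (x - refl n b y) =
  dot (x - y) (x - y) + 4 * (dot x n - b) * (dot y n - b) / dot n n.
Proof.
move=> n0; have nn := dot_gt0 n0; rewrite /refl.
set t := _ / _.
rewrite (_ : _ - _ = (x - y) + t *: n); last first.
  by apply/rowP => i; rewrite !mxE; ring.
rewrite !dotE (dotC n x) (dotC n y) (dotC y x) /t; field; exact: lt0r_neq0.
Qed.

(** [refl n 0] is the linear part of [refl n b] and is an involution. *)
Lemma refl_shift n b x y : n != 0 ->
  refl n b (y - refl n 0 x) = refl n b y - x.
Proof.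
move=> n0; have nn := dot_gt0 n0.
have -> : refl n b (y - refl n 0 x) =
  y - x + ((2 * dot x n / dot n n) - 2 * (dot y n - dot x n + 2 * dot x n - b) / dot n n) *: n.
  rewrite /refl !dotE subr0; apply/rowP => i; rewrite !mxE; field; exact: lt0r_neq0.
rewrite /refl; apply/rowP => i; rewrite !mxE; field; exact: lt0r_neq0.
Qed.

End euclid.

(** * Measurability of expressions in the coordinates *)

Section measurable_coord.
Context {R : realType} {N : nat} {d} {T : measurableType d}.
Notation V := 'rV[R]_N.

(** Weaker than measurability into [RN], whose sigma-algebra contains all null sets. It passes
    through sums, products and norms, hence applies to differences such as [z.1 - z.2] on the
    product space. *)
Definition mcoord (f : T -> V) := forall i, measurable_fun setT (fun t => f t 0 i : R).

Lemma mcoord_cst c : mcoord (fun=> c). Proof. by move=> i. Qed.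

Lemma mcoordD f g : mcoord f -> mcoord g -> mcoord (fun t => f t + g t).
Proof. by move=> mf mg i; under eq_fun do rewrite mxE; exact: measurable_funD. Qed.

Lemma mcoordN f : mcoord f -> mcoord (fun t => - f t).
Proof.
by move=> mf i; under eq_fun do rewrite mxE; exact: (measurableT_comp _ (mf i)).
Qed.

Lemma mcoordB f g : mcoord f -> mcoord g -> mcoord (fun t => f t - g t).
Proof. by move=> mf mg; apply: mcoordD => //; exact: mcoordN. Qed.

Lemma mcoordZ (a : T -> R) f : measurable_fun setT a -> mcoord f ->
  mcoord (fun t => a t *: f t).
Proof. by move=> ma mf i; under eq_fun do rewrite mxE; exact: measurable_funM. Qed.

Lemma measurable_dot f g : mcoord f -> mcoord g ->
  measurable_fun setT (fun t => dot (f t) (g t)).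
Proof. by move=> mf mg; apply: measurable_sum => i; exact: measurable_funM. Qed.

Lemma measurable_sqrt : measurable_fun [set: R] (@Num.sqrt R).
Proof.
by apply: nondecreasing_measurable => // x y xy; exact: ler_wsqrtr.
Qed.

Lemma measurable_enorm f : mcoord f -> measurable_fun setT (fun t => enorm (f t)).
Proof.
move=> mf; under eq_fun do rewrite enormE.
exact: measurableT_comp measurable_sqrt (measurable_dot mf mf).
Qed.

Lemma mcoord_refl n b f : mcoord f -> mcoord (fun t => refl n b (f t)).
Proof.
move=> mf; apply: mcoordB => //; apply: mcoordZ (mcoord_cst _).
apply: measurable_funM => //; apply: measurable_funM => //.
by apply: measurable_funB => //; exact: measurable_dot.
Qed.

Lemma measurable_lt (f g : T -> R) : measurable_fun setT f -> measurable_fun setT g ->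
  measurable [set t | f t < g t].
Proof.
move=> mf mg; have := measurable_fun_ltr mf mg measurableT (_ : measurable [set true]).
by rewrite setTI; apply.
Qed.

Lemma mcoord_box f I : mcoord f -> measurable [set t | box I (f t)].
Proof.
move=> mf; rewrite (_ : [set _ | _] = \bigcap_(i in [set: 'I_N])
    ([set t | I.1 0 i < f t 0 i] `&` [set t | f t 0 i < I.2 0 i])); last first.
  by apply/seteqP; split=> [t h i _|t h i] /=; [exact/andP/h|apply/andP; exact: (h i Logic.I)].
by apply: fin_bigcap_measurable => // i _; apply: measurableI; exact: measurable_lt.
Qed.

End measurable_coord.

Section rN_measurable.
Context {R : realType} {N : nat}.
Notation V := 'rV[R]_N.
Notation RN := (RN R N).

Lemma mcoord_id : mcoord (fun x : RN => x : V).
Proof. by move=> i; exact: coord_measurable. Qed.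

Lemma mcoord_fst : mcoord (fun z : RN * RN => z.1 : V).
Proof. by move=> i; exact: (measurableT_comp (@coord_measurable R N i setT) (@measurable_fst _ _ RN RN)). Qed.

Lemma mcoord_snd : mcoord (fun z : RN * RN => z.2 : V).
Proof. by move=> i; exact: (measurableT_comp (@coord_measurable R N i setT) (@measurable_snd _ _ RN RN)). Qed.

Lemma eball_measurable c r : measurable (eball c r : set RN).
Proof.
suff H : measurable [set y : RN | enorm ((y : V) - c) < r] by exact: H.
have mf : measurable_fun setT (fun y : RN => enorm ((y : V) - c)).
  by apply: measurable_enorm; apply: mcoordB (mcoord_cst _); exact: mcoord_id.
have := measurable_lt mf (measurable_cst r); exact.
Qed.

End rN_measurable.

(** * Volume of balls and invariance under reflections *)

Section balls.
Context {R : realType} {N : nat}.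
Notation V := 'rV[R]_N.
Notation lo := (@leb_outer R N).
Notation RN := (RN R N).
Notation mu := (lebm R N).

Lemma lebmE A : mu A = lo A. Proof. by []. Qed.

Definition omega : R := fine (lo (eball 0 1)).

Lemma leb_outer_eball01 : lo (eball 0 1) = omega%:E.
Proof.
rewrite fineK// ge0_fin_numE ?outer_measure_ge0//.
apply: (@le_lt_trans _ _ (lo (box (const_mx (-1), const_mx 1)))).
  apply: leb_outer_sub => x; rewrite /eball/= subr0 => x1 i; rewrite !mxE -ltr_norml.
  exact: le_lt_trans (coord_le_enorm _ _) x1.
by rewrite leb_outer_box ltry.
Qed.

Lemma omega_gt0 : 0 < omega.
Proof.
pose e : R := N.+1%:R^-1; have e0 : 0 < e by rewrite invr_gt0.
rewrite -lte_fin -leb_outer_eball01.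
apply: (@lt_le_trans _ _ (lo (box (const_mx (- e), const_mx e)))).
  rewrite leb_outer_box lte_fin; apply: prodr_gt0 => i _; rewrite !mxE lt_max.
  by apply/orP; right; lra.
apply: leb_outer_sub => x xe; rewrite /eball/= subr0.
apply: (le_lt_trans (enorm_le_sum _)).
apply: (@le_lt_trans _ _ (\sum_(i < N) e)).
  by apply: ler_sum => i _; have := xe i; rewrite !mxE -ltr_norml => /ltW.
rewrite sumr_const card_ord -mulr_natr mulrC ltr_pdivrMr// mul1r.
by rewrite ltr_nat.
Qed.

Lemma eball_dil (c : V) r : 0 < r ->
  eball c r = dil r^-1 (- (r^-1 *: c)) @^-1` eball 0 1.
Proof.
move=> r0; apply/seteqP; split=> x; rewrite /eball/= /dil subr0 -scalerBr enormZ.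
  by rewrite gtr0_norm ?invr_gt0// mulrC ltr_pdivrMr// mul1r.
by rewrite gtr0_norm ?invr_gt0// mulrC ltr_pdivrMr// mul1r.
Qed.

Lemma leb_outer_eball c r : 0 < r -> lo (eball c r) = (r ^+ N * omega)%:E.
Proof.
move=> r0; rewrite (eball_dil c r0) dil_scales ?gt_eqF ?invr_gt0//.
by rewrite leb_outer_eball01 -EFinM gtr0_norm ?invr_gt0// exprVn invrK.
Qed.

Lemma leb_sections (E : set (RN * RN)) : measurable E ->
  (\int[mu]_x lo (xsection E x) = \int[mu]_y lo (ysection E y))%E.
Proof.
move=> mE; have := @indic_fubini_tonelli _ _ RN RN R mu mu E mE.
by rewrite indic_fubini_tonelli_FE// indic_fubini_tonelli_GE.
Qed.

Lemma integral_cond_cst (A : set V) (w : \bar R) : measurable (A : set RN) ->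
  (\int[mu]_x (if x \in A then w else 0) = w * lo A)%E.
Proof.
move=> mA; rewrite -[LHS]/(\int[mu]_x ((cst w) \_ (A : set RN)) x)%E.
by rewrite -integral_mkcond integral_cst.
Qed.

(** A double count that only uses translations, the map x to -x, and the fact that reflections send
    balls to balls. The set [E] has unit balls as sections over the box, so its measure is [omega]
    times that of the box. The set [E'] has translates of the reflected box as sections over the
    unit ball, so its measure is [omega] times that of the reflected box. For fixed y, the sections
    of [E] and [E'] correspond under z to [refl n b y - z]. *)
Let refl_box n b (I : V * V) : n != 0 -> lo (refl n b @^-1` box I) = lo (box I).
Proof.
move=> n0; have o0 := ltW omega_gt0.
pose E : set (RN * RN) := [set z | box I z.1 /\ enorm (refl n b z.2 - z.1) < 1].
have mE : measurable E.
  apply: measurableI; first by apply: mcoord_box; exact: mcoord_fst.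
  apply: measurable_lt => //; apply: measurable_enorm; apply: mcoordB; last exact: mcoord_fst.
  by apply: mcoord_refl; exact: mcoord_snd.
pose E' : set (RN * RN) := [set z | box I (refl n b z.2 - z.1) /\ enorm z.1 < 1].
have mE' : measurable E'.
  apply: measurableI.
    apply: mcoord_box; apply: mcoordB; last exact: mcoord_fst.
    by apply: mcoord_refl; exact: mcoord_snd.
  by apply: measurable_lt => //; apply: measurable_enorm; exact: mcoord_fst.
have eq1 : (\int[mu]_x lo (xsection E x) = omega%:E * lo (box I))%E.
  rewrite -(integral_cond_cst _ (box_measurable I)).
  apply: eq_integral => x _; case: ifPn => [|] xI.
    rewrite -[RHS](_ : lo (eball (refl n b x) 1) = _); last first.
      by rewrite leb_outer_eball// expr1n mul1r.
    congr lo; apply/seteqP; split=> y; rewrite xsectionE/= /E /eball/=.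
      by case=> _; rewrite -{1}(reflK b n0 x) refl_enorm.
    by move=> h; split; [exact: set_mem|rewrite -{1}(reflK b n0 x) refl_enorm].
  rewrite (_ : xsection E x = set0) ?outer_measure0//.
  by apply/seteqP; split=> y //; rewrite xsectionE /E/= => -[/mem_set]; rewrite (negPf xI).
have eq2 : (\int[mu]_x lo (xsection E' x) = omega%:E * lo (refl n b @^-1` box I))%E.
  rewrite muleC -leb_outer_eball01 -(integral_cond_cst _ (eball_measurable 0 1)).
  apply: eq_integral => x _; case: ifPn => xB.
    transitivity (lo (dil 1 (- refl n 0 x) @^-1` (refl n b @^-1` box I))).
      congr lo; apply/seteqP; split=> y; rewrite xsectionE/= /E' /=.
        by case=> + _; rewrite /dil scale1r refl_shift.
      rewrite /dil scale1r refl_shift// => h; split=> //.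
      by move: xB; rewrite inE /eball/= subr0.
    by rewrite dil_scales ?oner_neq0// normr1 expr1n invr1 mul1e.
  rewrite (_ : xsection E' x = set0) ?outer_measure0//.
  apply/seteqP; split=> y //; rewrite xsectionE /E'/= => -[_ x1].
  by move/negP: xB; apply; rewrite inE /eball/= subr0.
have eq3 : (\int[mu]_y lo (ysection E y) = \int[mu]_y lo (ysection E' y))%E.
  apply: eq_integral => y _.
  have -> : ysection E' y = dil (-1) (refl n b y) @^-1` ysection E y.
    have ysE (S : set (RN * RN)) : ysection S y = [set x | S (x, y)].
      by apply/seteqP; split=> x; rewrite ysectionE.
    rewrite !ysE; apply/seteqP; split=> z;
    by rewrite /E /E'/= /dil scaleN1r [- z + _]addrC subKr.
  by rewrite dil_scales ?oppr_eq0 ?oner_neq0// normrN1 expr1n invr1 mul1e.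
have H := etrans (esym eq1) (etrans (leb_sections mE)
  (etrans eq3 (etrans (esym (leb_sections mE')) eq2))).
exact: mule_inj omega_gt0 (esym H).
Qed.

Lemma refl_scales n b : n != 0 -> leb_scales (refl n b : V -> V) 1.
Proof.
move=> n0.
have le A : (lo (refl n b @^-1` A) <= lo A)%E.
  apply: le_ereal_inf_tmp => _ [F AF <-].
  apply: (@le_trans _ _ (lo (\bigcup_k (refl n b @^-1` obox (F k))))).
    by apply: leb_outer_sub => x /AF[k _ Fk]; exists k.
  apply: (le_trans (outer_measure_sigma_subadditive lo _)).
  apply: lee_nneseries => [k _|k _]; first by move=> *; exact: outer_measure_ge0.
  case: (F k) => [J|]/=; last by rewrite preimage_set0 outer_measure0.
  by rewrite refl_box// leb_outer_box.
move=> A; rewrite mul1e; apply/eqP; rewrite eq_le le/=.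
have := le (refl n b @^-1` A); rewrite -comp_preimage.
by rewrite (_ : _ @^-1` A = A)//; apply/seteqP; split=> x /=; rewrite reflK.
Qed.

End balls.

(* Otherwise unification unfolds the measure down to the infimum over covers. *)
Opaque leb_outer leb_om.

(** * Polarization *)

Section abstract_integral.
Context {R : realType}.
Local Open Scope ereal_scope.

Lemma mul2e (a : \bar R) : 0 <= a -> a + a = 2%:E * a.
Proof. by move=> a0; rewrite -[2%R]/(1 + 1)%R EFinD ge0_muleDl// mul1e. Qed.

Lemma mul4e (a : \bar R) : 0 <= a -> a + a + (a + a) = 4%:E * a.
Proof.
move=> a0; have -> : (4 = 2 + 2 :> R)%R by ring.
by rewrite EFinD ge0_muleDl// -mul2e.
Qed.

Context d (T : measurableType d) (mu : {measure set T -> \bar R}).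
Implicit Types f g : T -> \bar R.

Lemma le_ge0_integral f g : measurable_fun setT f -> measurable_fun setT g ->
  (forall x, 0 <= f x) -> (forall x, f x <= g x) ->
  \int[mu]_x f x <= \int[mu]_x g x.
Proof. by move=> mf mg f0 fg; apply: ge0_le_integral. Qed.

Lemma ge0_integral_add f g : measurable_fun setT f -> measurable_fun setT g ->
  (forall x, 0 <= f x) -> (forall x, 0 <= g x) ->
  \int[mu]_x (f x + g x) = \int[mu]_x f x + \int[mu]_x g x.
Proof. by move=> mf mg f0 g0; rewrite ge0_integralD. Qed.

Lemma ge0_integral_scale (k : R) f : (0 <= k)%R -> measurable_fun setT f ->
  (forall x, 0 <= f x) -> \int[mu]_x (k%:E * f x) = k%:E * \int[mu]_x f x.
Proof. by move=> k0 mf f0; rewrite ge0_integralZl_EFin. Qed.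

End abstract_integral.

Section leb_map.
Context {R : realType} {N : nat}.
Notation V := 'rV[R]_N.
Notation RN := (RN R N).
Notation mu := (lebm R N).

Definition leb_map (f : V -> V) (c : R) :=
  [/\ 0 < c, leb_scales f c & exists2 g, cancel f g & cancel g f].

Lemma dil_map t a : t != 0 -> leb_map (dil t a) (`|t| ^- N).
Proof.
move=> t0; split; first by rewrite invr_gt0 exprn_gt0// normr_gt0.
  exact: dil_scales.
by eexists; [exact: dilK|exact: dilKV].
Qed.

Lemma refl_map n b : n != 0 -> leb_map (refl n b) 1.
Proof.
by move=> n0; split=> //; [exact: refl_scales|exists (refl n b); exact: reflK].
Qed.

Lemma leb_map_measurable f c : leb_map f c -> measurable_fun setT (f : RN -> RN).
Proof. by case=> c0 fc [g fK gK]; exact: scales_measurable fK gK fc. Qed.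

Lemma leb_map_integral f c (h : RN -> \bar R) : leb_map f c ->
  measurable_fun setT h -> (forall x, 0 <= h x)%E ->
  (\int[mu]_x h (f x) = c%:E * \int[mu]_x h x)%E.
Proof. by case=> c0 fc [g fK gK] mh h0; exact: scales_integral fK gK fc mh h0. Qed.

Section prod.
Variables (F : RN * RN -> \bar R).
Hypotheses (mF : measurable_fun setT F) (F0 : forall z, (0 <= F z)%E).

Lemma tonelli1 : (\int[mu \x mu]_z F z = \int[mu]_x \int[mu]_y F (x, y))%E.
Proof. exact: (@fubini_tonelli1 _ _ RN RN R mu mu F mF F0). Qed.

Lemma tonelli2 : (\int[mu \x mu]_z F z = \int[mu]_y \int[mu]_x F (x, y))%E.
Proof. exact: (@fubini_tonelli2 _ _ RN RN R mu mu F mF F0). Qed.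

Lemma tonelli_mF : measurable_fun setT (fun x : RN => \int[mu]_y F (x, y))%E.
Proof. exact: (@measurable_fun_fubini_tonelli_F _ _ RN RN R mu F mF F0). Qed.

Lemma tonelli_mG : measurable_fun setT (fun y : RN => \int[mu]_x F (x, y))%E.
Proof. exact: (@measurable_fun_fubini_tonelli_G _ _ RN RN R mu F mF F0). Qed.

End prod.

Lemma measurable_map1 f c (F : RN * RN -> \bar R) : leb_map f c -> measurable_fun setT F ->
  measurable_fun setT (fun z : RN * RN => F (f z.1, z.2)).
Proof.
move=> mf mF; apply: (measurableT_comp mF).
apply: measurable_fun_pair; last exact: (@measurable_snd _ _ RN RN).
exact: measurableT_comp (leb_map_measurable mf) (@measurable_fst _ _ RN RN).
Qed.

Lemma measurable_map2 f c (F : RN * RN -> \bar R) : leb_map f c -> measurable_fun setT F ->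
  measurable_fun setT (fun z : RN * RN => F (z.1, f z.2)).
Proof.
move=> mf mF; apply: (measurableT_comp mF).
apply: measurable_fun_pair; first exact: (@measurable_fst _ _ RN RN).
exact: measurableT_comp (leb_map_measurable mf) (@measurable_snd _ _ RN RN).
Qed.

Lemma leb_map_integral1 f c (F : RN * RN -> \bar R) : leb_map f c ->
  measurable_fun setT F -> (forall z, 0 <= F z)%E ->
  (\int[mu \x mu]_z F (f z.1, z.2) = c%:E * \int[mu \x mu]_z F z)%E.
Proof.
move=> mf mF F0; rewrite tonelli1//; last exact: measurable_map1 mf mF.
rewrite (tonelli1 mF F0) -(leb_map_integral mf (tonelli_mF mF F0))//.
by move=> x; apply: integral_ge0 => y _; exact: F0.
Qed.

Lemma leb_map_integral2 f c (F : RN * RN -> \bar R) : leb_map f c ->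
  measurable_fun setT F -> (forall z, 0 <= F z)%E ->
  (\int[mu \x mu]_z F (z.1, f z.2) = c%:E * \int[mu \x mu]_z F z)%E.
Proof.
move=> mf mF F0; rewrite tonelli2//; last exact: measurable_map2 mf mF.
rewrite (tonelli2 mF F0) -(leb_map_integral mf (tonelli_mG mF F0))//.
by move=> x; apply: integral_ge0 => y _; exact: F0.
Qed.

End leb_map.

Section reflection_averaging.
Context {R : realType} {N : nat}.
Notation V := 'rV[R]_N.
Notation RN := (RN R N).
Notation mu := (lebm R N).
Variables (n : V) (b : R).
Hypothesis n0 : n != 0.
Let s := refl n b.

(** Since the reflection preserves integrals, twice the integral of h is that of h + h o s, so
    comparing the sums over orbits {x, s x} suffices. *)
Lemma refl_average_le (f g : RN -> \bar R) :
  measurable_fun setT f -> measurable_fun setT g ->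
  (forall x, 0 <= f x)%E -> (forall x, 0 <= g x)%E ->
  (forall x, f x + f (s x) <= g x + g (s x))%E ->
  (\int[mu]_x f x <= \int[mu]_x g x)%E.
Proof.
move=> mf mg f0 g0 fg; have ms := leb_map_measurable (refl_map b n0).
have H (h : RN -> \bar R) : measurable_fun setT h -> (forall x, 0 <= h x)%E ->
    (\int[mu]_x (h x + h (s x)) = 2%:E * \int[mu]_x h x)%E.
  move=> mh h0; have mhs := measurableT_comp mh ms.
  rewrite ge0_integral_add; [|exact: mh|exact: mhs|exact: h0|by move=> x; exact: h0].
  rewrite (leb_map_integral (refl_map b n0))// mul1e mul2e//.
  by apply: integral_ge0 => x _; exact: h0.
rewrite -(@lee_pmul2l _ 2%:E) ?lte_fin// -!H//.
apply: le_ge0_integral.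
- exact: emeasurable_funD mf (measurableT_comp mf ms).
- exact: emeasurable_funD mg (measurableT_comp mg ms).
- by move=> x; rewrite adde_ge0.
- exact: fg.
Qed.

(** The two variables are reflected independently, which gives orbits of four pairs. Polarization
    does not lower the energy density pair by pair, only summed over such an orbit. *)
Lemma refl_average_le2 (F G : RN * RN -> \bar R) :
  measurable_fun setT F -> measurable_fun setT G ->
  (forall x, 0 <= F x)%E -> (forall x, 0 <= G x)%E ->
  (forall x y, (F (x, y) + F (s x, s y)) + (F (x, s y) + F (s x, y))
     <= (G (x, y) + G (s x, s y)) + (G (x, s y) + G (s x, y)))%E ->
  (\int[mu \x mu]_z F z <= \int[mu \x mu]_z G z)%E.
Proof.
move=> mF mG F0 G0 FG; have ms := refl_map b n0.
pose S (h : RN * RN -> \bar R) (z : RN * RN) :=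
  ((h (z.1, z.2) + h (s z.1, s z.2)) + (h (z.1, s z.2) + h (s z.1, z.2)))%E.
have m11 (h : RN * RN -> \bar R) : measurable_fun setT h -> measurable_fun setT (fun z : RN * RN => h (z.1, z.2)).
  by move=> mh; rewrite (_ : (fun _ => _) = h)//; apply/funext => -[].
have m1 h (mh : measurable_fun setT h) := measurable_map1 ms mh.
have m2 h (mh : measurable_fun setT h) := measurable_map2 ms mh.
have m12 h (mh : measurable_fun setT h) := measurable_map1 ms (measurable_map2 ms mh).
have mS h : measurable_fun setT h -> measurable_fun setT (S h).
  move=> mh; apply: emeasurable_funD; apply: emeasurable_funD;
  [exact: m11|exact: m12|exact: m2|exact: m1].
have H (h : RN * RN -> \bar R) : measurable_fun setT h -> (forall x, 0 <= h x)%E ->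
    (\int[mu \x mu]_z (S h z) = 4%:E * \int[mu \x mu]_z h z)%E.
  move=> mh h0.
  have E1 : (\int[mu \x mu]_z h (z.1, z.2) = \int[mu \x mu]_z h z)%E.
    by apply: eq_integral => -[].
  have E2 := leb_map_integral1 ms mh h0.
  have E3 := leb_map_integral2 ms mh h0.
  have E4 := leb_map_integral1 ms (m2 h mh) (fun z => h0 _).
  rewrite ge0_integral_add; last 4 first.
  - by apply: emeasurable_funD; [exact: m11|exact: m12].
  - by apply: emeasurable_funD; [exact: m2|exact: m1].
  - by move=> z; rewrite adde_ge0.
  - by move=> z; rewrite adde_ge0.
  rewrite (ge0_integral_add _ (m11 _ mh) (m12 _ mh))//.
  rewrite (ge0_integral_add _ (m2 _ mh) (m1 _ mh))//.
  rewrite E1 E2 E3 [X in (_ + X + _)%E]E4 E3 !mul1e mul4e//.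
  by apply: integral_ge0 => z _; exact: h0.
rewrite -(@lee_pmul2l _ 4%:E) ?lte_fin// -(H _ mF F0) -(H _ mG G0).
apply: le_ge0_integral.
- exact: mS.
- exact: mS.
- by move=> z; rewrite !adde_ge0.
- by move=> z; exact: FG.
Qed.

End reflection_averaging.

Section polarization.
Context {R : realType} {N : nat}.
Notation V := 'rV[R]_N.
Notation RN := (RN R N).
Notation mu := (lebm R N).
Implicit Types (u v : V -> R) (x y n : V) (h : R -> R).

Definition kernel_energy h u : \bar R :=
  (\int[mu \x mu]_z ((u z.1 - u z.2) ^+ 2 *
     h (dot ((z.1 : V) - z.2) ((z.1 : V) - z.2)))%:E)%E.

(** The larger value goes to the side [dot x n <= b], which contains the origin when [0 <= b]. *)
Definition polarize n b v x : R :=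
  if dot x n <= b then Num.max (v x) (v (refl n b x)) else Num.min (v x) (v (refl n b x)).

Lemma refl_side n b x : n != 0 -> dot (refl n b x) n - b = - (dot x n - b).
Proof.
by move=> n0; have nn := dot_gt0 n0; rewrite /refl !dotE; field; exact: lt0r_neq0.
Qed.

Lemma refl_fix n b x : dot x n = b -> refl n b x = x.
Proof. by move=> e; rewrite /refl e subrr mulr0 mul0r scale0r subr0. Qed.

Lemma polarize_le n b v x : n != 0 -> dot x n <= b ->
  polarize n b v x = Num.max (v x) (v (refl n b x)) /\
  polarize n b v (refl n b x) = Num.min (v x) (v (refl n b x)).
Proof.
move=> n0 xb; rewrite /polarize xb reflK//.
have := refl_side b x n0; have [e|ne] := eqVneq (dot x n) b.
  by rewrite refl_fix// e lexx maxxx minxx.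
case: ifPn => sb e; last by rewrite minC.
by exfalso; move/eqP: ne; apply; lra.
Qed.

Lemma polarize_ge n b v x : n != 0 -> b <= dot x n ->
  polarize n b v x = Num.min (v x) (v (refl n b x)) /\
  polarize n b v (refl n b x) = Num.max (v x) (v (refl n b x)).
Proof.
move=> n0 xb; have sb : dot (refl n b x) n <= b by have := refl_side b x n0; lra.
by have := polarize_le v n0 sb; rewrite reflK// maxC minC => -[].
Qed.

Lemma polarize_pair n b v x (P : R -> R -> Prop) : n != 0 ->
  P (Num.max (v x) (v (refl n b x))) (Num.min (v x) (v (refl n b x))) ->
  P (Num.min (v x) (v (refl n b x))) (Num.max (v x) (v (refl n b x))) ->
  P (polarize n b v x) (polarize n b v (refl n b x)).
Proof.
move=> n0 P1 P2; have [xb|xb] := leP (dot x n) b.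
  by have [-> ->] := polarize_le v n0 xb.
by have [-> ->] := polarize_ge v n0 (ltW xb).
Qed.

(** Everything except (h1 - h2)(AC + A'C') depends only on the sums and the squares, which sorting
    preserves, and AC + A'C' is largest when both pairs are sorted alike. The alternative hypothesis
    covers coinciding points, where the kernel at 0 cannot be compared with its other values. *)
Lemma four_point (a a' c c' h1 h2 : R) :
  h2 <= h1 \/ (a = c /\ a' = c') ->
  (Num.max a a' - Num.max c c') ^+ 2 * h1 + (Num.min a a' - Num.min c c') ^+ 2 * h1 +
  ((Num.max a a' - Num.min c c') ^+ 2 * h2 + (Num.min a a' - Num.max c c') ^+ 2 * h2) <=
  (a - c) ^+ 2 * h1 + (a' - c') ^+ 2 * h1 + ((a - c') ^+ 2 * h2 + (a' - c) ^+ 2 * h2).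
Proof.
move=> H.
have E (A A' C C' : R) : (A - C) ^+ 2 * h1 + (A' - C') ^+ 2 * h1 +
    ((A - C') ^+ 2 * h2 + (A' - C) ^+ 2 * h2) =
   (A ^+ 2 + A' ^+ 2 + C ^+ 2 + C' ^+ 2) * (h1 + h2) - 2 * (A + A') * (C + C') * h2
   - 2 * (h1 - h2) * (A * C + A' * C') by ring.
rewrite !E.
case: (leP a a') => aa'; case: (leP c c') => cc'.
- by rewrite [leLHS](_ : _ = (a ^+ 2 + a' ^+ 2 + c ^+ 2 + c' ^+ 2) * (h1 + h2) -
    2 * (a + a') * (c + c') * h2 - 2 * (h1 - h2) * (a * c + a' * c'));
    [exact: lexx|ring].
- case: H => [H|[e1 e2]]; last by exfalso; lra.
  have : 0 <= (h1 - h2) * ((a' - a) * (c - c')) by rewrite !mulr_ge0// subr_ge0// ltW.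
  nra.
- case: H => [H|[e1 e2]]; last by exfalso; lra.
  have : 0 <= (h1 - h2) * ((a - a') * (c' - c)) by rewrite !mulr_ge0// subr_ge0// ltW.
  nra.
- by exact: lexx.
Qed.

(** Monotonicity is restricted to positive arguments because the singular kernel takes the value 0
    at 0, by the convention for the inverse of 0. *)
Definition decreasing_kernel h := [/\ measurable_fun setT h, forall r, 0 <= h r &
  forall r r', 0 < r -> r <= r' -> h r' <= h r].

Lemma measurable_energy h u : measurable_fun setT h ->
  measurable_fun setT (u : RN -> R) ->
  measurable_fun setT (fun z : RN * RN => ((u z.1 - u z.2) ^+ 2 *
     h (dot ((z.1 : V) - z.2) ((z.1 : V) - z.2)))%:E : \bar R).
Proof.
move=> mh mu'; apply/measurable_EFinP; apply: measurable_funM.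
  apply: measurable_funX; apply: measurable_funB.
    exact: measurableT_comp mu' (@measurable_fst _ _ RN RN).
  exact: measurableT_comp mu' (@measurable_snd _ _ RN RN).
apply: (measurableT_comp mh); apply: measurable_dot;
  by apply: mcoordB; [exact: mcoord_fst|exact: mcoord_snd].
Qed.

Lemma measurable_polarize n b v : n != 0 ->
  measurable_fun setT (v : RN -> R) -> measurable_fun setT (polarize n b v : RN -> R).
Proof.
move=> n0 mv; have mvs : measurable_fun setT (fun x : RN => v (refl n b x)).
  exact: measurableT_comp mv (leb_map_measurable (refl_map b n0)).
apply: measurable_fun_ifT.
- apply: measurable_fun_ler; last exact: measurable_cst.
  by apply: measurable_dot; [exact: mcoord_id|exact: mcoord_cst].
- exact: measurable_maxr.
- exact: measurable_minr.
Qed.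

Lemma polarize_energy h n b v : n != 0 -> decreasing_kernel h ->
  measurable_fun setT (v : RN -> R) ->
  (kernel_energy h (polarize n b v) <= kernel_energy h v)%E.
Proof.
move=> n0 [mh h0 hd] mv; have mp := measurable_polarize b n0 mv.
rewrite /kernel_energy.
refine (@refl_average_le2 R N n b n0 _ _ _ _ _ _ _).
- exact: measurable_energy.
- exact: measurable_energy.
- by move=> z; rewrite lee_fin mulr_ge0// sqr_ge0.
- by move=> z; rewrite lee_fin mulr_ge0// sqr_ge0.
move=> x y /=; rewrite -!EFinD lee_fin refl_dot//.
have cr := refl_cross b x y n0.
have -> : dot (refl n b x - y) (refl n b x - y) = dot (x - refl n b y) (x - refl n b y).
  by have := refl_dot b x (refl n b y) n0; rewrite reflK.
set r1 := dot (x - y) (x - y) in cr *; set r2 := dot (x - refl n b y) _ in cr *.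
have nn := dot_gt0 n0.
pose al := dot x n - b; pose be := dot y n - b.
have crE : r2 - r1 = 4 / dot n n * (al * be).
  by rewrite cr /al /be; field; exact: lt0r_neq0.
have k0 : 0 < 4 / dot n n by rewrite divr_gt0.
(* [al] and [be] tell the sides of x and y. Whether they agree decides which of the squared
   distances r1 (from x to y) and r2 (from x to the image of y) is smaller, hence which kernel value
   plays the larger role in [four_point]; for points on opposite sides the roles of y and its image
   are exchanged. *)
have same : 0 <= al * be -> h r2 <= h r1 \/ (v x = v y /\ v (refl n b x) = v (refl n b y)).
  move=> ab; have [xy|xy] := eqVneq x y; first by rewrite xy; right.
  left; apply: hd; first exact: dot_diff_gt0.
  by rewrite -subr_ge0 crE mulr_ge0// ltW.
have opp : al * be <= 0 -> h r1 <= h r2 \/ (v x = v (refl n b y) /\ v (refl n b x) = v y).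
  move=> ab; have [xy|xy] := eqVneq x (refl n b y); first by rewrite xy reflK//; right.
  left; apply: hd; first exact: dot_diff_gt0.
  by rewrite -subr_ge0 -opprB crE -mulrN mulr_ge0 ?oppr_ge0// ltW.
have [xb|xb] := leP (dot x n) b; have [yb|yb] := leP (dot y n) b.
- have [-> ->] := polarize_le v n0 xb; have [-> ->] := polarize_le v n0 yb.
  by apply: four_point; apply: same; rewrite mulr_le0// /al /be subr_le0.
- have [-> ->] := polarize_le v n0 xb; have [-> ->] := polarize_ge v n0 (ltW yb).
  rewrite [leLHS]addrC [leRHS]addrC (minC (v y)) (maxC (v y)).
  apply: four_point; apply: opp.
  by rewrite mulr_le0_ge0// /al /be ?subr_le0 ?subr_ge0 ?(ltW yb).
- have [-> ->] := polarize_ge v n0 (ltW xb); have [-> ->] := polarize_le v n0 yb.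
  have := @four_point (v x) (v (refl n b x)) (v (refl n b y)) (v y) (h r2) (h r1).
  rewrite (minC _ (v y)) (maxC _ (v y)) => fp.
  have {}fp := fp (opp _); move: fp; rewrite /al /be mulr_ge0_le0 ?subr_le0 ?subr_ge0 ?(ltW xb)//.
  move=> /(_ isT); lra.
- have [-> ->] := polarize_ge v n0 (ltW xb); have [-> ->] := polarize_ge v n0 (ltW yb).
  have := @four_point (v x) (v (refl n b x)) (v y) (v (refl n b y)) (h r1) (h r2).
  move=> fp; have {}fp := fp (same _); move: fp; rewrite /al /be mulr_ge0 ?subr_ge0 ?(ltW xb) ?(ltW yb)//.
  move=> /(_ isT); lra.
Qed.

(** Polarization at most swaps the two values on each orbit, so the number of orbit points above t
    is unchanged. *)
Lemma polarize_level n b v t : n != 0 -> measurable_fun setT (v : RN -> R) ->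
  mu [set x | t < polarize n b v x] = mu [set x | t < v x].
Proof.
move=> n0 mv; have mp := measurable_polarize b n0 mv.
have m1 := measurable_lt (measurable_cst t) mp.
have m2 := measurable_lt (measurable_cst t) mv.
have I1 w : measurable [set x : RN | t < w x] -> mu [set x | t < w x] =
    (\int[mu]_x (\1_[set x : RN | t < w x] x)%:E)%E.
  by move=> mw; rewrite integral_indic// setIT.
have eqI x : (\1_[set x : RN | t < polarize n b v x] x)%:E +
      (\1_[set x : RN | t < polarize n b v x] (refl n b x))%:E =
    (\1_[set x : RN | t < v x] x)%:E + (\1_[set x : RN | t < v x] (refl n b x))%:E :> \bar R.
  rewrite !indicE -!EFinD; congr EFin.
  have mE (w : V -> R) (y : RN) : (y \in [set x : RN | t < w x]) = (t < w y).
    by apply/idP/idP; rewrite inE.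
  rewrite !mE.
  apply: (@polarize_pair n b v x (fun p q => (t < p)%R%:R + (t < q)%R%:R =
    (t < v x)%R%:R + (t < v (refl n b x))%R%:R :> R)) => //;
    rewrite lt_max lt_min; do 2 case: (t < _) => //=; rewrite ?addr0 ?add0r//.
rewrite !I1//; apply/eqP; rewrite eq_le; apply/andP; split; refine (@refl_average_le R N n b n0 _ _ _ _ _ _ _);
  try (by apply/measurable_EFinP; exact: measurable_indic);
  try (by move=> x; rewrite lee_fin indicE).
- by move=> x; rewrite eqI.
- by move=> x; rewrite eqI.
Qed.

End polarization.

(** * Symmetric decreasing rearrangement *)

Section abstract_limits.
Context {R : realType} d (T : measurableType d) (mu : {measure set T -> \bar R}).
Local Open Scope ereal_scope.

Lemma fatou_le (f : nat -> T -> \bar R) F c :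
  (forall n, measurable_fun setT (f n)) -> (forall n x, 0 <= f n x) ->
  (forall x, f n x @[n --> \oo] --> F x) ->
  (forall n, \int[mu]_x f n x <= c) -> \int[mu]_x F x <= c.
Proof.
move=> mf f0 fF fc.
have -> : \int[mu]_x F x = \int[mu]_x limn_einf (f^~ x).
  by apply: eq_integral => x _; rewrite (cvg_limn_einf_sup (fF x)).
apply: (le_trans (fatou _ measurableT mf (fun n x _ => f0 n x))).
rewrite limn_einf_lim; apply: lime_le; first exact: is_cvg_einfs.
apply: nearW => n; apply: le_trans (fc n).
by rewrite /einfs; apply: ereal_inf_lbound; exists n => //=.
Qed.

(** Continuity from below leaves room e between the levels, which is what a uniformly convergent
    sequence of functions needs in order to compare level sets. *)
Lemma level_le (g : T -> R) t c : measurable_fun setT g ->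
  (forall e, (0 < e)%R -> mu [set x | (t + e < g x)%R] <= c) ->
  mu [set x | (t < g x)%R] <= c.
Proof.
move=> mg gc; pose F k := [set x | (t + k.+1%:R^-1 < g x)%R].
have mF k : measurable (F k) by apply: measurable_lt.
have FE : [set x | (t < g x)%R] = \bigcup_k F k.
  apply/seteqP; split=> x /=.
    move=> tx; have tx0 : (0 < g x - t)%R by rewrite subr_gt0.
    have [k kx] : exists k : nat, (k.+1%:R^-1 < g x - t)%R.
      exists (Num.truncn (g x - t)^-1).
      by rewrite invf_plt ?posrE// truncnS_gt.
    by exists k => //; rewrite /F/= addrC -ltrBrDr.
  by case=> k _; apply: lt_trans; rewrite ltrDl invr_gt0.
rewrite FE.
have nd : nondecreasing_seq F.
  move=> m n mn; apply/subsetPset => x; apply: le_lt_trans.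
  by rewrite lerD2l lef_pV2 ?posrE// ler_nat.
have cv := @nondecreasing_cvg_mu _ _ _ mu F mF (bigcupT_measurable _ mF) nd.
rewrite -(cvg_lim _ cv)//; apply: lime_le; first by apply/cvg_ex; eexists; exact: cv.
by apply: nearW => k; apply: gc; rewrite invr_gt0.
Qed.

End abstract_limits.

(** * A class of Lipschitz functions stable under polarization *)

Section admissible.
Context {R : realType} {N : nat}.
Notation V := 'rV[R]_N.
Notation RN := (RN R N).
Notation mu := (lebm R N).
Implicit Types (u v w : V -> R) (x y n : V) (L rho M : R).

(** With fixed constants this class is preserved by polarization in half-spaces containing the
    origin and compact for uniform convergence, so the second moment can be minimized inside it. *)
Record admissible L rho M v : Prop := Admissible {
  adm_lip : forall x y, `|v x - v y| <= L * enorm (x - y);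
  adm_ge0 : forall x, 0 <= v x;
  adm_le : forall x, v x <= M;
  adm_supp : forall x, rho <= enorm x -> v x = 0 }.

Lemma enorm_ball x y e : ball x e y -> enorm (x - y) <= N%:R * e.
Proof.
move=> [e0 xy]; apply: (le_trans (enorm_le_sum _)).
have -> : N%:R * e = \sum_(i < N) e by rewrite sumr_const card_ord mulr_natl.
apply: ler_sum => i _; rewrite !mxE; apply: ltW; have := xy 0 i.
by rewrite -ball_normE.
Qed.

Lemma lipschitz_measurable L v : (forall x y, `|v x - v y| <= L * enorm (x - y)) ->
  measurable_fun setT (v : RN -> R).
Proof.
move=> vL mD; apply: (measurability _ (RGenOInfty.measurableE R)) => //.
move=> _ [_ [c ->] <-]; rewrite setTI.
suff : open [set x : V | c < v x].
  move=> /open_leb_measurable; congr (measurable _).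
  by apply/seteqP; split=> x /=; rewrite in_itv/= andbT.
rewrite openE => x /= cx; apply/nbhs_ballP.
pose K := `|L| * N%:R + 1.
have K0 : 0 < K by rewrite ltr_wpDl// mulr_ge0.
pose e := (v x - c) / K; have e0 : 0 < e by rewrite divr_gt0// subr_gt0.
exists e => //= y xy /=.
have := vL x y; have := ler_norm (v x - v y).
have : L * enorm (x - y) <= `|L| * (N%:R * e).
  apply: (@le_trans _ _ (`|L| * enorm (x - y))).
    by rewrite ler_wpM2r ?enorm_ge0// ler_norm.
  by rewrite ler_wpM2l//; exact: enorm_ball.
have : `|L| * (N%:R * e) < v x - c.
  rewrite [ltRHS](_ : _ = K * e); last by rewrite /e; field; exact: lt0r_neq0.
  by rewrite /K mulrDl mul1r mulrA ltrDl.
lra.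
Qed.

Lemma adm_measurable L rho M v : admissible L rho M v -> measurable_fun setT (v : RN -> R).
Proof. by move=> av; apply: lipschitz_measurable; exact: adm_lip av. Qed.

Lemma refl_enorm_sqr n b x : n != 0 ->
  dot (refl n b x) (refl n b x) = dot x x + 4 * b * (b - dot x n) / dot n n.
Proof.
by move=> n0; have nn := dot_gt0 n0; rewrite /refl !dotE (dotC n x); field; exact: lt0r_neq0.
Qed.

Lemma enorm_le_dot x y : (enorm x <= enorm y) = (dot x x <= dot y y).
Proof.
by rewrite -!enorm_sqr ler_pXn2r// nnegrE enorm_ge0.
Qed.

(** For x and y separated by the hyperplane, x is no farther from the image of y than from y, so the
    Lipschitz bound also controls the exchanged values. *)
Lemma polarize_admissible L rho M n b v : n != 0 -> 0 <= b -> 0 <= L ->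
  admissible L rho M v -> admissible L rho M (polarize n b v).
Proof.
move=> n0 b0 L0 [vL v0 vM vs]; split.
- move=> x y; have nn := dot_gt0 n0.
  have s1 := vL x y; have s2 := vL (refl n b x) (refl n b y).
  rewrite refl_enorm// in s2.
  have cr := refl_cross b x y n0.
  have s3 := vL x (refl n b y); have s4 := vL (refl n b x) y.
  have e34 : enorm (refl n b x - y) = enorm (x - refl n b y).
    by have := refl_enorm b x (refl n b y) n0; rewrite reflK.
  rewrite e34 in s4.
  have opp : (dot x n - b) * (dot y n - b) <= 0 ->
      L * enorm (x - refl n b y) <= L * enorm (x - y).
    move=> ab; rewrite ler_wpM2l// enorm_le_dot cr gerDl.
    rewrite (_ : 4 * _ * _ / _ = 4 / dot n n * ((dot x n - b) * (dot y n - b))).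
      by rewrite mulr_ge0_le0// divr_ge0// ltW.
    by field; exact: lt0r_neq0.
  move: s1 s2 s3 s4; rewrite !ler_norml.
  have [xb|xb] := leP (dot x n) b; have [yb|yb] := leP (dot y n) b.
  + have [-> _] := polarize_le v n0 xb; have [-> _] := polarize_le v n0 yb.
    by rewrite /Num.max; do 2 case: ifP; lra.
  + have [-> _] := polarize_le v n0 xb; have [-> _] := polarize_ge v n0 (ltW yb).
    have := opp _; rewrite mulr_le0_ge0 ?subr_le0 ?subr_ge0 ?(ltW yb)// => /(_ isT).
    by rewrite /Num.max /Num.min; do 2 case: ifP; lra.
  + have [-> _] := polarize_ge v n0 (ltW xb); have [-> _] := polarize_le v n0 yb.
    have := opp _; rewrite mulr_ge0_le0 ?subr_le0 ?subr_ge0 ?(ltW xb)// => /(_ isT).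
    by rewrite /Num.max /Num.min; do 2 case: ifP; lra.
  + have [-> _] := polarize_ge v n0 (ltW xb); have [-> _] := polarize_ge v n0 (ltW yb).
    by rewrite /Num.min; do 2 case: ifP; lra.
- by move=> x; rewrite /polarize; case: ifP; rewrite ?le_max ?le_min ?v0.
- by move=> x; rewrite /polarize; case: ifP; rewrite ?ge_max ?ge_min ?vM.
(* Outside the half-space the minimum with 0 is 0. Inside it, since [0 <= b], the image of x is at
   least as far from the origin as x, so both values vanish. *)
- move=> x rx; rewrite /polarize; case: ifPn => xb; rewrite (vs x rx); last first.
    by apply/min_idPl.
  rewrite vs ?maxxx//; apply: (le_trans rx); rewrite enorm_le_dot refl_enorm_sqr// lerDl.
  by rewrite divr_ge0 ?dot_ge0// mulr_ge0 ?subr_ge0// mulr_ge0.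
Qed.

End admissible.

(** * Compactness for uniform convergence *)

Section compactness.
Context {R : realType} {N : nat}.
Notation V := 'rV[R]_N.
Notation RN := (RN R N).
Implicit Types (u v w : V -> R) (x y n : V) (L rho M : R).

Lemma finite_net rho e : 0 < rho -> 0 < e -> exists s : seq V,
  forall x, enorm x <= rho -> exists2 y, y \in s & enorm (x - y) <= e.
Proof.
move=> r0 e0; pose dl := e / N.+1%:R.
have d0 : 0 < dl by rewrite divr_gt0.
pose K := Num.truncn (2 * rho / dl).
exists [seq (\row_i (- rho + dl * (f i)%:R) : V) | f : {ffun 'I_N -> 'I_K.+1}].
move=> x xr.
have q0 i : 0 <= (x 0 i + rho) / dl.
  rewrite divr_ge0 ?(ltW d0)//; have := le_trans (coord_le_enorm x i) xr.
  by rewrite ler_norml; lra.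
have fK i : (Num.truncn ((x 0 i + rho) / dl)%R < K.+1)%N.
  rewrite ltnS /K; apply: le_truncn; rewrite ler_pM2r ?invr_gt0//.
  by have := le_trans (coord_le_enorm x i) xr; rewrite ler_norml; lra.
exists (\row_i (- rho + dl * (Num.truncn ((x 0 i + rho) / dl))%:R)).
  apply/mapP; exists [ffun i => Ordinal (fK i)]; first by rewrite mem_enum.
  by apply/rowP => i; rewrite !mxE ffunE.
apply: (le_trans (enorm_le_sum _)).
apply: (@le_trans _ _ (\sum_(i < N) dl)); last first.
  rewrite sumr_const card_ord -mulr_natr /dl -mulrA ler_piMr ?(ltW e0)//.
  by rewrite mulrC ler_pdivrMr// mul1r ler_nat.
apply: ler_sum => i _; rewrite !mxE.
have /andP[t1 t2] := truncn_itv (q0 i).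
move: t1 t2; rewrite ler_pdivlMr// ltr_pdivrMr// -natr1 ler_norml.
set k := (Num.truncn _)%:R; nra.
Qed.

(** Tychonoff in the product of copies of [0, M] gives a cluster point: it is approached on any
    finite set of points by terms of arbitrarily large index. *)
Lemma pointwise_cluster (M : R) (w : nat -> V -> R) :
  (forall j x, 0 <= w j x <= M) ->
  exists v, forall (s : seq V) (e : R) k, 0 < e ->
    exists2 j, (k <= j)%N & forall x, x \in s -> `|w j x - v x| < e.
Proof.
move=> wM.
have := @tychonoff V (fun=> R) (fun=> `[0, M]%classic) (fun=> @segment_compact _ _ _).
move=> /(_ (w @ \oo) _) [].
  by exists 0 => // n _ x /=; rewrite in_itv/= wM.
move=> v [_ cv]; exists v => s e k e0.
have := cv (w @` [set j | (k <= j)%N]) [set f | forall x, x \in s -> `|f x - v x| < e].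
case.
- by exists k => // j kj /=; exists j.
- elim: s => [|a s IH]; first by apply: filterS filterT => f _ x.
  have aN : nbhs v [set f : V -> R | `|f a - v a| < e].
    have := @proj_continuous V (fun=> R) a v [set r | `|r - v a| < e]; apply.
    apply/nbhs_ballP; exists e => //= r; rewrite -ball_normE/= distrC; exact.
  apply: filterS2 aN IH => f fa fs x; rewrite inE => /orP[/eqP->//|]; exact: fs.
- by move=> _ [[j kj <-] js]; exists j.
Qed.

(** Closeness on a finite net of the ball of radius [rho] propagates to all points by the common
    Lipschitz constant, and outside the ball all functions vanish. *)
Lemma admissible_compact L rho M (w : nat -> V -> R) : 0 <= L -> 0 < rho ->
  (forall j, admissible L rho M (w j)) ->
  exists2 v, admissible L rho M v &
    forall (e : R) k, 0 < e -> exists2 j, (k <= j)%N & forall x, `|w j x - v x| <= e.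
Proof.
move=> L0 r0 aw.
have [j x|v cv] := @pointwise_cluster M w; first by rewrite (adm_ge0 (aw j)) (adm_le (aw j)).
have av : admissible L rho M v.
  split.
  - move=> x y; apply/ler_addgt0Pr => e e0.
    have e2 : 0 < e / 2 by rewrite divr_gt0.
    have [j _ jv] := cv [:: x; y] (e / 2) 0%N e2.
    have := jv x; have := jv y; have := adm_lip (aw j) x y.
    rewrite !inE !eqxx orbT => + /(_ isT) + /(_ isT); rewrite !ler_norml !ltr_norml; lra.
  - move=> x; apply/ler_addgt0Pr => e e0.
    have [j _ jv] := cv [:: x] e 0%N e0.
    have := jv x; have := adm_ge0 (aw j) x.
    rewrite !inE !eqxx => + /(_ isT); rewrite ltr_norml; lra.
  - move=> x; apply/ler_addgt0Pr => e e0.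
    have [j _ jv] := cv [:: x] e 0%N e0.
    have := jv x; have := adm_le (aw j) x.
    rewrite !inE !eqxx => + /(_ isT); rewrite ltr_norml; lra.
  - move=> x xr; apply/eqP; rewrite -normr_le0; apply/ler_addgt0Pr => e e0.
    have [j _ jv] := cv [:: x] e 0%N e0.
    have := jv x; rewrite (adm_supp (aw j) xr) !inE eqxx sub0r normrN => /(_ isT); lra.
exists v => // e k e0.
pose K := 2 * L + 1; have K0 : 0 < K by rewrite ltr_wpDl// mulr_ge0.
pose dl := e / 2 / K; have d0 : 0 < dl by rewrite !divr_gt0.
have [s net] := finite_net r0 d0.
have e2 : 0 < e / 2 by rewrite divr_gt0.
have [j kj jv] := cv s (e / 2) k e2.
exists j => // x; have [xr|xr] := leP rho (enorm x).
  by rewrite (adm_supp (aw j) xr) (adm_supp av xr) subrr normr0 ltW.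
have [y ys xy] := net x (ltW xr).
have := jv y ys; have := adm_lip (aw j) x y; have := adm_lip av x y.
have : L * enorm (x - y) <= L * dl by rewrite ler_wpM2l.
have : 2 * (L * dl) <= e / 2.
  rewrite [leRHS](_ : _ = K * dl); last by rewrite /dl; field; exact: lt0r_neq0.
  have -> : K * dl = 2 * (L * dl) + dl by rewrite /K; ring.
  by rewrite lerDl ltW.
rewrite !ler_norml !ltr_norml; lra.
Qed.

End compactness.

Section rearrangement.
Context {R : realType} {N : nat}.
Notation V := 'rV[R]_N.
Notation RN := (RN R N).
Notation mu := (lebm R N).
Implicit Types (u v w : V -> R) (x y n : V) (L rho M : R).

Definition moment v : \bar R := (\int[mu]_x (v x * dot x x)%:E)%E.

Lemma measurable_moment v : measurable_fun setT (v : RN -> R) ->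
  measurable_fun setT (fun x : RN => (v x * dot (x : V) x)%:E : \bar R).
Proof.
move=> mv; apply/measurable_EFinP; apply: measurable_funM; first exact: mv.
by apply: measurable_dot; exact: mcoord_id.
Qed.

Lemma mu_eball c r : 0 < r -> mu (eball c r) = (r ^+ N * omega (R := R) (N := N))%:E.
Proof. by move=> r0; rewrite lebmE leb_outer_eball. Qed.

Lemma moment_lty L rho M v : 0 < rho -> admissible L rho M v -> (moment v < +oo)%E.
Proof.
move=> r0 av; have M0 : 0 <= M := le_trans (adm_ge0 av 0) (adm_le av 0).
apply: (@le_lt_trans _ _ (\int[mu]_x (if x \in eball 0 rho then (M * rho ^+ 2)%:E else 0))%E).
  apply: le_ge0_integral.
  - exact/measurable_moment/adm_measurable/av.
  - apply: measurable_fun_ifT; [|exact: measurable_cst..].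
    apply: (measurable_fun_bool true); rewrite setTI.
    rewrite (_ : _ @^-1` _ = eball 0 rho); first exact: eball_measurable.
    by apply/seteqP; split=> x /=; [exact: set_mem|exact: mem_set].
  - by move=> x; rewrite lee_fin mulr_ge0 ?dot_ge0// (adm_ge0 av).
  - move=> x; case: ifPn => [|]; rewrite ?inE ?notin_setE /eball/= subr0.
      move=> xr; rewrite lee_fin ler_pM ?dot_ge0 ?(adm_ge0 av) ?(adm_le av)//.
      by rewrite -enorm_sqr ler_pXn2r ?nnegrE ?enorm_ge0 ?(ltW r0)// ltW.
    by move/negP; rewrite -leNgt => xr; rewrite (adm_supp av xr) mul0r.
rewrite integral_cond_cst; last exact: eball_measurable.
by rewrite -lebmE mu_eball// -EFinM ltry.
Qed.

(** On each orbit the larger value moves to the point nearer to the origin. *)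
Lemma polarize_moment n b v x : n != 0 -> 0 <= b ->
  polarize n b v x * dot x x + polarize n b v (refl n b x) * dot (refl n b x) (refl n b x) <=
  v x * dot x x + v (refl n b x) * dot (refl n b x) (refl n b x).
Proof.
move=> n0 b0; have nn := dot_gt0 n0; rewrite refl_enorm_sqr//.
have E : 4 * b * (b - dot x n) / dot n n = (4 * b / dot n n) * (b - dot x n).
  by field; exact: lt0r_neq0.
have k0 : 0 <= 4 * b / dot n n by rewrite divr_ge0 ?(ltW nn)// mulr_ge0.
rewrite E; set k := 4 * b / _ in k0 *; set s := dot x x.
have [xb|xb] := leP (dot x n) b.
  have [-> ->] := polarize_le v n0 xb.
  have : 0 <= k * (b - dot x n) by rewrite mulr_ge0// subr_ge0.
  by rewrite /Num.max /Num.min; case: ifP; nra.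
have [-> ->] := polarize_ge v n0 (ltW xb).
have : 0 <= k * (dot x n - b) by rewrite mulr_ge0// subr_ge0 ltW.
by rewrite /Num.max /Num.min; case: ifP; nra.
Qed.

(** The hyperplane is the perpendicular bisector of x and y; the second alternative covers a zero
    normal. *)
Lemma refl_bisector x y :
  refl (y - x) ((dot y y - dot x x) / 2) x = y \/ x = y.
Proof.
have [->|xy] := eqVneq x y; [by right|left].
have n0 : y - x != 0 by rewrite subr_eq0 eq_sym.
have nn := dot_gt0 n0; rewrite /refl.
rewrite (_ : 2 * _ / _ = -1) ?scaleN1r ?opprK ?subrKC//.
have -> : 2 * (dot x (y - x) - (dot y y - dot x x) / 2) = - dot (y - x) (y - x).
  by rewrite !dotE (dotC y x); field.
by rewrite mulNr divff// lt0r_neq0.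
Qed.

(* If polarization in a half-space containing the origin changes v, it strictly
   decreases the second moment. *)
Lemma moment_minimizer_radial L rho M v : 0 < rho -> 0 <= L -> admissible L rho M v ->
  (forall n b, n != 0 -> 0 <= b -> (moment v <= moment (polarize n b v))%E) ->
  forall x y, enorm x <= enorm y -> v y <= v x.
Proof.
move=> r0 L0 av vmin.
(* Equal norms reduce to strictly ordered ones: y is pushed outward slightly and the Lipschitz bound
   absorbs the change. *)
suff strict x y : enorm x < enorm y -> v y <= v x.
  move=> x y xy; apply/ler_addgt0Pr => e e0.
  have [y0|y0] := eqVneq y 0.
    have : enorm x <= 0 by rewrite (le_trans xy)// y0 enorm0.
    by rewrite y0 => x0; have [->|/enorm_gt0] := eqVneq x 0; [rewrite lerDl ltW|lra].
  have yp := enorm_gt0 y0.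
  pose K := L * enorm y + 1; have K0 : 0 < K by rewrite ltr_wpDl// mulr_ge0// enorm_ge0.
  pose t := e / K; have t0 : 0 < t by rewrite divr_gt0.
  have := strict x ((1 + t) *: y).
  rewrite enormZ gtr0_norm ?addr_gt0// => /(_ _)/wrap[].
    by rewrite (le_lt_trans xy)// mulrDl mul1r ltrDl mulr_gt0.
  have := adm_lip av y ((1 + t) *: y).
  rewrite (_ : y - _ = - t *: y); last by rewrite scalerDl scale1r opprD addNKr scaleNr.
  rewrite enormZ normrN (gtr0_norm t0) ler_norml.
  have : L * (t * enorm y) <= e.
    rewrite (_ : e = K * t); last by rewrite /t; field; exact: lt0r_neq0.
    by rewrite /K mulrDl mul1r [t * _]mulrC mulrA lerDl ltW.
  lra.
move=> xy; rewrite leNgt; apply/negP => vxy.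
have xy0 : x != y by apply: contraTneq xy => ->; rewrite ltxx.
pose n := y - x; have n0 : n != 0 by rewrite subr_eq0 eq_sym.
have nn := dot_gt0 n0.
pose b := (dot y y - dot x x) / 2.
have b0 : 0 < b.
  rewrite divr_gt0// subr_gt0 -!enorm_sqr ltr_pXn2r ?nnegrE ?enorm_ge0//.
have sx : refl n b x = y by have [//|e] := refl_bisector x y; rewrite e eqxx in xy0.
pose c := (v y - v x) / 2 * b.
have c0 : 0 < c by rewrite mulr_gt0// divr_gt0// subr_gt0.
have xnb : b - dot x n = dot n n / 2.
  by rewrite /b /n !dotE (dotC y x); field.
pose K1 := 4 * (L + 1); pose K2 := 4 * (enorm n + 1).
have K10 : 0 < K1 by rewrite mulr_gt0// ltr_wpDl.
have K20 : 0 < K2 by rewrite mulr_gt0// ltr_wpDl// enorm_ge0.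
(* Within r of x, half of the jump [v y - v x] survives by the Lipschitz bound, and so does half of
   [b - dot x n = dot n n / 2]. Swapping the values at z and its image then lowers the moment
   density on that orbit by at least c. *)
pose r := Num.min ((v y - v x) / K1) (dot n n / K2).
have rp : 0 < r by rewrite lt_min !divr_gt0// subr_gt0.
pose B := eball x r : set V.
have near z : B z -> dot z n <= b /\
    c <= (v (refl n b z) - v z) * (dot (refl n b z) (refl n b z) - dot z z).
  rewrite /B /eball/= => zx.
  have zx1 : enorm (z - x) * K1 <= v y - v x.
    by rewrite -ler_pdivlMr// ltW// (lt_le_trans zx)// ge_min lexx.
  have zx2 : enorm (z - x) * K2 <= dot n n.
    by rewrite -ler_pdivlMr// ltW// (lt_le_trans zx)// ge_min lexx orbT.
  have e0 := enorm_ge0 (z - x); have ne0 := enorm_ge0 n.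
  have dz : dot n n / 4 <= b - dot z n.
    have := dot_le_enorm (z - x) n; rewrite dotBl; move: zx2; rewrite /K2; nra.
  have dz0 : 0 <= b - dot z n by apply: le_trans dz; rewrite divr_ge0// ltW.
  have dv : (v y - v x) / 2 <= v (refl n b z) - v z.
    have := adm_lip av (refl n b z) y; rewrite -sx refl_enorm// sx.
    have := adm_lip av z x; move: zx1; rewrite !ler_norml /K1; nra.
  split; first by lra.
  rewrite refl_enorm_sqr// addrAC subrr add0r /c ler_pM//.
  - by rewrite divr_ge0// subr_ge0 ltW.
  - exact: ltW.
  - rewrite ler_pdivlMr//; move: dz; nra.
pose f z : R := polarize n b v z * dot z z + c / 2 * \1_B z.
have mB : measurable (B : set RN) by exact: eball_measurable.
have mp := measurable_polarize b n0 (adm_measurable av).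
have ap := polarize_admissible n0 (ltW b0) L0 av.
have p0 z : 0 <= polarize n b v z * dot z z by rewrite mulr_ge0 ?dot_ge0// (adm_ge0 ap).
have i0 z : (0 <= (c / 2)%:E * (\1_B z)%:E :> \bar R)%E.
  by rewrite -EFinM lee_fin mulr_ge0// divr_ge0// ltW.
have mI : measurable_fun setT (fun z : RN => (c / 2)%:E * (\1_B z)%:E : \bar R)%E.
  apply/measurable_EFinP; apply: measurable_funM => //; exact: measurable_indic.
(* The orbit of z gains c once; charging only c / 2 per point covers the case where z and its image
   both lie in [B]. *)
have fint : (moment (polarize n b v) + (c / 2)%:E * mu B <= moment v)%E.
  have <- : (\int[mu]_z ((polarize n b v z * dot (z : V) z)%:E + (c / 2)%:E * (\1_B z)%:E) =
      moment (polarize n b v) + (c / 2)%:E * mu B)%E.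
    rewrite ge0_integral_add; [|exact: measurable_moment|exact: mI|
      by move=> z; rewrite lee_fin; exact: p0|exact: i0].
    rewrite ge0_integral_scale; [|by rewrite divr_ge0// ltW|
      by apply/measurable_EFinP; exact: measurable_indic|by move=> z; rewrite lee_fin].
    by rewrite integral_indic ?setIT.
  refine (@refl_average_le R N n b n0 _ _ _ _ _ _ _).
  - by apply: emeasurable_funD; [exact: measurable_moment|exact: mI].
  - exact/measurable_moment/adm_measurable/av.
  - by move=> z; rewrite adde_ge0// lee_fin.
  - by move=> z; rewrite lee_fin mulr_ge0 ?dot_ge0// (adm_ge0 av).
  move=> z; rewrite -!EFinM -!EFinD lee_fin.
  have pm := polarize_moment v z n0 (ltW b0).
  have key z' : B z' -> polarize n b v z' * dot z' z' +
      polarize n b v (refl n b z') * dot (refl n b z') (refl n b z') + c <=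
      v z' * dot z' z' + v (refl n b z') * dot (refl n b z') (refl n b z').
    move=> /near[zb zc]; have [-> ->] := polarize_le v n0 zb.
    have d0 : 0 <= dot (refl n b z') (refl n b z') - dot z' z'.
      by rewrite refl_enorm_sqr// addrAC subrr add0r divr_ge0 ?(ltW nn)// mulr_ge0 ?subr_ge0// mulr_ge0// ltW.
    have vz : v z' <= v (refl n b z').
      rewrite leNgt; apply/negP => h.
      have : (v (refl n b z') - v z') * (dot (refl n b z') (refl n b z') - dot z' z') <= 0.
        by rewrite mulr_le0_ge0// subr_le0 ltW.
      lra.
    by rewrite (max_idPr vz) (min_idPl vz); nra.
  rewrite !indicE; case: (boolP (z \in B)) => [/set_mem zB|_].
    have := key z zB; case: (_ \in _); rewrite /= ?mulr1 ?mulr0; lra.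
  case: (boolP (refl n b z \in B)) => [/set_mem zB|_]; last by rewrite !mulr0; lra.
  have := key _ zB; rewrite reflK// ?mulr1 ?mulr0; lra.
have := le_trans fint (vmin n b n0 (ltW b0)).
have fin : moment (polarize n b v) \is a fin_num.
  rewrite ge0_fin_numE; first exact: moment_lty ap.
  by apply: integral_ge0 => z _; rewrite lee_fin.
rewrite -[X in (_ <= X)%E]adde0 leeD2lE// mu_eball// -EFinM lee_fin.
rewrite leNgt => /negP; apply.
apply: mulr_gt0; first by rewrite divr_gt0.
by apply: mulr_gt0; [rewrite exprn_gt0|exact: omega_gt0].
Qed.

(** The competitors [X] are closed under uniform limits (levels by [level_le] in both directions,
    energy by Fatou) and under polarization, so a minimizer of the second moment exists and cannot
    be improved by polarization, which makes it radially decreasing. *)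
Theorem symmetrization h L rho M u : decreasing_kernel h -> 0 < rho -> 0 <= L ->
  admissible L rho M u ->
  exists v, [/\ admissible L rho M v,
    forall t, mu [set x | t < v x] = mu [set x | t < u x],
    (kernel_energy h v <= kernel_energy h u)%E &
    forall x y, enorm x <= enorm y -> v y <= v x].
Proof.
move=> kh r0 L0 au.
pose X := [set v | [/\ admissible L rho M v,
    forall t, mu [set x | t < v x] = mu [set x | t < u x] &
    (kernel_energy h v <= kernel_energy h u)%E]].
have Xu : X u by [].
have mom0 v : admissible L rho M v -> (0 <= moment v)%E.
  by move=> av; apply: integral_ge0 => x _; rewrite lee_fin mulr_ge0 ?dot_ge0// (adm_ge0 av).
pose m := ereal_inf (moment @` X).
have mfin : m \is a fin_num.
  rewrite ge0_fin_numE; first by apply: (@le_lt_trans _ _ (moment u));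
    [apply: ereal_inf_lbound; exists u|exact: moment_lty au].
  by apply: le_ereal_inf_tmp => _ [v [av _ _] <-]; exact: mom0.
have /choice[w wX] : forall k : nat, exists w, X w /\ (moment w <= m + (k.+1%:R^-1)%:E)%E.
  move=> k; have k0 : 0 < (k.+1%:R^-1 : R) by rewrite invr_gt0.
  have [_ [w Xw <-] /ltW wm] := lb_ereal_inf_adherent k0 mfin.
  by exists w.
have aw j : admissible L rho M (w j) by have [[]] := wX j.
have [v av wv] := admissible_compact L0 r0 aw.
(* Choosing indices [J k >= k] with error at most 1/(k+1) turns the cluster point into the limit of
   a subsequence that is still minimizing. *)
have /choice[J Jp] : forall k : nat, exists j, (k <= j)%N /\ forall x, `|w j x - v x| <= k.+1%:R^-1.
  move=> k; have k0 : 0 < (k.+1%:R^-1 : R) by rewrite invr_gt0.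
  by have [j kj jv] := wv _ k k0; exists j.
pose g k := w (J k).
have gv x : g k x @[k --> \oo] --> v x.
  apply/cvgrPdist_le => e e0.
  have [K Ke] : exists k : nat, k.+1%:R^-1 < e.
    exists (Num.truncn e^-1); by rewrite invf_plt ?posrE// truncnS_gt.
  exists K => // k /= Kk; rewrite distrC; apply: (le_trans ((Jp k).2 x)).
  by rewrite (le_trans _ (ltW Ke))// lef_pV2 ?posrE// ler_nat.
have mv := adm_measurable av.
have mg k := adm_measurable (aw (J k)).
have vX : X v.
  split=> // [t|].
    apply/eqP; rewrite eq_le; apply/andP; split.
    - apply: level_le; [exact: mv|move=> e e0].
      have [k ke] : exists k : nat, k.+1%:R^-1 < e.
        exists (Num.truncn e^-1); by rewrite invf_plt ?posrE// truncnS_gt.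
      have [[_ <- _] _] := wX (J k).
      apply: le_measure; rewrite ?inE; [exact: measurable_lt|exact: measurable_lt|].
      move=> x /=; move: ke ((Jp k).2 x); set q : R := _^-1.
      by rewrite ler_norml => ? /andP[? ?] ?; lra.
    - apply: level_le; [exact: adm_measurable au|move=> e e0].
      have [k ke] : exists k : nat, k.+1%:R^-1 < e.
        exists (Num.truncn e^-1); by rewrite invf_plt ?posrE// truncnS_gt.
      have [[_ wl _] _] := wX (J k).
      change (mu [set x | (t + e < u x)%R] <= mu [set x | (t < v x)%R])%E; rewrite -wl.
      apply: le_measure; rewrite ?inE; [exact: measurable_lt|exact: measurable_lt|].
      move=> x /=; move: ke ((Jp k).2 x); set q : R := _^-1.
      by rewrite ler_norml => ? /andP[? ?] ?; lra.
  have [mh h0 _] := kh.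
  refine (@fatou_le R _ (RN * RN)%type (mu \x mu)%E
    (fun k z => ((g k z.1 - g k z.2) ^+ 2 *
     h (dot ((z.1 : V) - z.2) ((z.1 : V) - z.2)))%:E) _ _ _ _ _ _).
  - by move=> k; exact: (measurable_energy mh (mg k)).
  - by move=> k z; rewrite lee_fin mulr_ge0// sqr_ge0.
  - move=> z; apply: cvg_EFin; first exact: nearW.
    apply: cvgMl; rewrite expr2; under eq_fun do rewrite expr2.
    by apply: cvgM; apply: cvgB.
  - by move=> k; have [[]] := wX (J k).
(* Shifting the subsequence by [K] makes every term within e of the infimum, so that Fatou applies
   with a constant bound. *)
have vm : (moment v <= m)%E.
  apply/lee_addgt0Pr => e e0.
  have [K Ke] : exists k : nat, k.+1%:R^-1 < e.
    exists (Num.truncn e^-1); by rewrite invf_plt ?posrE// truncnS_gt.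
  refine (@fatou_le R _ RN mu
    (fun k x => (g (k + K)%N x * dot (x : V) x)%:E) _ _ _ _ _ _).
  - by move=> k; exact: (measurable_moment (mg _)).
  - by move=> k x; rewrite lee_fin mulr_ge0 ?dot_ge0// (adm_ge0 (aw _)).
  - move=> x; apply: cvg_EFin; first exact: nearW.
    by apply: cvgMl; rewrite (cvg_shiftn K (fun k => g k x)).
  - move=> k; have [_] := wX (J (k + K)%N); move/le_trans; apply.
    rewrite leeD2l// lee_fin (le_trans _ (ltW Ke))// lef_pV2 ?posrE// ler_nat ltnS.
    by rewrite (leq_trans _ (Jp _).1)// leq_addl.
exists v; have [av' vl vE] := vX; split=> //.
apply: (moment_minimizer_radial r0 L0 av) => n b n0 b0.
apply: (le_trans vm); apply: ereal_inf_lbound; exists (polarize n b v) => //.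
split; first exact: polarize_admissible.
  by move=> t; rewrite polarize_level.
by apply: le_trans vE; exact: polarize_energy.
Qed.

End rearrangement.

(** * Layer cake *)

Section nonneg_integrable.
Context {R : realType} {d} {T : measurableType d} (mu : {measure set T -> \bar R}).
Implicit Types f g : T -> R.

(** Integrals of such functions are real numbers ([nint]), so that long inequalities between them
    are ordinary real arithmetic. The price is that signed integrands must be avoided. *)
Definition nni f := [/\ measurable_fun setT f, forall x, 0 <= f x &
  (\int[mu]_x (f x)%:E < +oo)%E].

Definition nint f : R := fine (\int[mu]_x (f x)%:E)%E.

Lemma nni_measurable f : nni f -> measurable_fun setT f. Proof. by case. Qed.

Lemma nni_emeasurable f : nni f -> measurable_fun setT (fun x => (f x)%:E : \bar R).
Proof. by case=> mf _ _; exact/measurable_EFinP. Qed.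

Lemma nni_ge0 f x : nni f -> 0 <= f x. Proof. by case. Qed.

Lemma nintE f : nni f -> (\int[mu]_x (f x)%:E = (nint f)%:E)%E.
Proof.
case=> mf f0 foo; rewrite fineK// ge0_fin_numE//.
by apply: integral_ge0 => x _; rewrite lee_fin.
Qed.

Lemma nint_ge0 f : (forall x, 0 <= f x) -> 0 <= nint f.
Proof. by move=> f0; apply: fine_ge0; apply: integral_ge0 => x _; rewrite lee_fin. Qed.

Lemma nni_le f g : nni g -> measurable_fun setT f -> (forall x, 0 <= f x <= g x) -> nni f.
Proof.
move=> [mg g0 goo] mf fg; split=> //; first by move=> x; have /andP[] := fg x.
apply: le_lt_trans goo; apply: le_ge0_integral; [exact/measurable_EFinP..| |];
  by move=> x; have /andP[? ?] := fg x; rewrite lee_fin.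
Qed.

Lemma nint_le f g : nni f -> nni g -> (forall x, f x <= g x) -> nint f <= nint g.
Proof.
move=> nf ng fg; rewrite -lee_fin -!nintE//; apply: le_ge0_integral.
- exact: nni_emeasurable.
- exact: nni_emeasurable.
- by move=> x; rewrite lee_fin (nni_ge0 x nf).
- by move=> x; rewrite lee_fin.
Qed.

Let addE f g : nni f -> nni g ->
  (\int[mu]_x (f x + g x)%:E = (nint f + nint g)%:E)%E.
Proof.
move=> nf ng; rewrite EFinD -!nintE// -ge0_integral_add//.
- exact: nni_emeasurable.
- exact: nni_emeasurable.
- by move=> x; rewrite lee_fin (nni_ge0 x nf).
- by move=> x; rewrite lee_fin (nni_ge0 x ng).
Qed.

Lemma nniD f g : nni f -> nni g -> nni (fun x => f x + g x).
Proof.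
move=> nf ng; split; last by rewrite addE// ltry.
  by apply: measurable_funD; exact: nni_measurable.
by move=> x; rewrite addr_ge0// nni_ge0.
Qed.

Lemma nintD f g : nni f -> nni g -> nint (fun x => f x + g x) = nint f + nint g.
Proof. by move=> nf ng; rewrite {1}/nint addE. Qed.

Let scaleE (k : R) f : 0 <= k -> nni f ->
  (\int[mu]_x (k * f x)%:E = (k * nint f)%:E)%E.
Proof.
move=> k0 nf; rewrite EFinM -nintE// -ge0_integral_scale//.
- exact: nni_emeasurable.
- by move=> x; rewrite lee_fin (nni_ge0 x nf).
Qed.

Lemma nniZ (k : R) f : 0 <= k -> nni f -> nni (fun x => k * f x).
Proof.
move=> k0 nf; split; last by rewrite scaleE// ltry.
  by apply: measurable_funM => //; exact: nni_measurable.
by move=> x; rewrite mulr_ge0// nni_ge0.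
Qed.

Lemma nintZ (k : R) f : 0 <= k -> nni f -> nint (fun x => k * f x) = k * nint f.
Proof. by move=> k0 nf; rewrite {1}/nint scaleE. Qed.

Lemma nni0 : nni (fun=> 0).
Proof. by split=> //; rewrite integral0 ltry. Qed.

Lemma nint0 : nint (fun=> 0) = 0.
Proof. by rewrite /nint integral0. Qed.

Lemma nni_sum (I : eqType) (s : seq I) (f : I -> T -> R) : (forall i, nni (f i)) ->
  nni (fun x => \sum_(i <- s) f i x) /\
  nint (fun x => \sum_(i <- s) f i x) = \sum_(i <- s) nint (f i).
Proof.
move=> nf; elim: s => [|i s [IH1 IH2]].
  by rewrite big_nil; under eq_fun do rewrite big_nil; split; [exact: nni0|exact: nint0].
rewrite big_cons; under eq_fun do rewrite big_cons.
by split; [exact: nniD|rewrite nintD// IH2].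
Qed.

Lemma nni_indic (A : set T) : measurable A -> (mu A < +oo)%E -> nni (\1_A : T -> R).
Proof.
move=> mA Aoo; split; [exact: measurable_indic|by move=> x; rewrite indicE|].
by rewrite integral_indic ?setIT.
Qed.

Lemma nint_indic (A : set T) : measurable A -> nint (\1_A : T -> R) = fine (mu A).
Proof. by move=> mA; rewrite /nint integral_indic ?setIT. Qed.

Lemma nniM_indic f (A : set T) : measurable A -> nni f -> nni (fun x => \1_A x * f x).
Proof.
move=> mA nf; apply: (nni_le nf) => [|x].
  by apply: measurable_funM; [exact: measurable_indic|exact: nni_measurable].
by rewrite indicE; case: (_ \in _); rewrite /= ?mul1r ?mul0r ?lexx (nni_ge0 x nf).
Qed.

End nonneg_integrable.

Section nni_rN.
Context {R : realType} {N : nat}.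
Notation V := 'rV[R]_N.
Notation RN := (RN R N).
Notation mu := (lebm R N).
Notation omega := (omega (R := R) (N := N)).
Implicit Types f g : V -> R.

Definition mu2 : {measure set (RN * RN) -> \bar R} := (mu \x mu)%E.

Lemma mu_eball_lty c r : 0 < r -> (mu (eball c r) < +oo)%E.
Proof. by move=> r0; rewrite mu_eball// ltry. Qed.

Lemma nni_bounded f c r C : 0 < r -> measurable_fun setT (f : RN -> R) ->
  (forall x, 0 <= f x <= C) -> (forall x, r <= enorm (x - c) -> f x = 0) -> nni mu f.
Proof.
move=> r0 mf fC fs; have C0 : 0 <= C by have /andP[a b] := fC 0; exact: le_trans a b.
have n1 : nni mu (\1_(eball c r : set RN) : RN -> R).
  apply: nni_indic; first exact: eball_measurable.
  exact: mu_eball_lty.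
apply: (nni_le (nniZ C0 n1)) => // x; rewrite indicE.
have /andP[f0 fle] := fC x; rewrite f0/=.
case: (boolP (x \in _)) => [|xB]; first by rewrite mulr1.
rewrite fs ?mulr0// leNgt; apply/negP => h; move/negP: xB; apply.
by rewrite inE.
Qed.

Lemma mu2_tonelli1 (F : RN * RN -> \bar R) : measurable_fun setT F ->
  (forall z, 0 <= F z)%E -> (\int[mu2]_z F z = \int[mu]_x \int[mu]_y F (x, y))%E.
Proof. exact: tonelli1. Qed.

Lemma mu2_tonelli2 (F : RN * RN -> \bar R) : measurable_fun setT F ->
  (forall z, 0 <= F z)%E -> (\int[mu2]_z F z = \int[mu]_y \int[mu]_x F (x, y))%E.
Proof. exact: tonelli2. Qed.

Lemma measurable_fst_comp f : measurable_fun setT (f : RN -> R) ->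
  measurable_fun setT (fun z : RN * RN => f z.1).
Proof. by move=> mf; exact: measurableT_comp mf (@measurable_fst _ _ RN RN). Qed.

Lemma measurable_snd_comp f : measurable_fun setT (f : RN -> R) ->
  measurable_fun setT (fun z : RN * RN => f z.2).
Proof. by move=> mf; exact: measurableT_comp mf (@measurable_snd _ _ RN RN). Qed.

Lemma measurable_dist2 :
  measurable_fun setT (fun z : RN * RN => dot ((z.1 : V) - z.2) ((z.1 : V) - z.2)).
Proof. by apply: measurable_dot; (apply: mcoordB; [exact: mcoord_fst|exact: mcoord_snd]). Qed.

Lemma nni_prod f g : nni mu f -> nni mu g ->
  nni mu2 (fun z => f z.1 * g z.2) /\
  nint mu2 (fun z => f z.1 * g z.2) = nint mu f * nint mu g.
Proof.
move=> nf ng.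
have m : measurable_fun setT (fun z : RN * RN => f z.1 * g z.2).
  apply: measurable_funM; first exact: measurable_fst_comp (nni_measurable nf).
  exact: measurable_snd_comp (nni_measurable ng).
have z0 (z : RN * RN) : 0 <= f z.1 * g z.2.
  by rewrite mulr_ge0// ?(nni_ge0 _ nf) ?(nni_ge0 _ ng).
have E : (\int[mu2]_z (f z.1 * g z.2)%:E = (nint mu f * nint mu g)%:E)%E.
  rewrite mu2_tonelli1; last 2 first.
  - exact/measurable_EFinP.
  - by move=> z; rewrite lee_fin.
  transitivity (\int[mu]_x ((nint mu g)%:E * (f x)%:E))%E.
    apply: eq_integral => x _ /=; rewrite muleC -nintE//.
    rewrite -ge0_integral_scale ?(nni_ge0 _ nf)//; first exact: nni_emeasurable ng.
    by move=> y; rewrite lee_fin (nni_ge0 _ ng).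
  rewrite ge0_integral_scale.
  - by rewrite nintE// -EFinM mulrC.
  - by apply: nint_ge0 => x; exact: nni_ge0 ng.
  - exact: nni_emeasurable nf.
  - by move=> x; rewrite lee_fin (nni_ge0 _ nf).
by split; [split=> //; rewrite E ltry|rewrite {1}/nint E].
Qed.

End nni_rN.

Section equimeasurable.
Context {R : realType} {N : nat}.
Notation V := 'rV[R]_N.
Notation RN := (RN R N).
Notation mu := (lebm R N).
Notation leb1 := (@lebesgue_measure R).
Notation TR := (measurableTypeR R).
Implicit Types f g u v : V -> R.

Lemma tonelli_real (F : RN * TR -> \bar R) : measurable_fun setT F ->
  (forall z, 0 <= F z)%E ->
  (\int[mu]_x \int[leb1]_t F (x, t) = \int[leb1]_t \int[mu]_x F (x, t))%E.
Proof.
move=> mF F0.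
by rewrite -(@fubini_tonelli1 _ _ RN TR R mu leb1 F mF F0)
  -(@fubini_tonelli2 _ _ RN TR R mu leb1 F mF F0).
Qed.

Definition levelf u f (z : RN * TR) : R :=
  if (0 <= z.2) && (z.2 < u z.1) then f z.1 else 0.

Lemma measurable_levelf u f : measurable_fun setT (u : RN -> R) ->
  measurable_fun setT (f : RN -> R) -> measurable_fun setT (levelf u f).
Proof.
move=> mu' mf.
have msnd : measurable_fun setT (fun z : RN * TR => z.2 : R) := @measurable_snd _ _ RN TR.
apply: measurable_fun_ifT; last exact: measurable_cst.
  apply: measurable_and; first by apply: measurable_fun_ler => //; exact: msnd.
  apply: measurable_fun_ltr; first exact: msnd.
  exact: measurableT_comp mu' (@measurable_fst _ _ RN TR).
exact: measurableT_comp mf (@measurable_fst _ _ RN TR).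
Qed.

Lemma layer_cake u f : measurable_fun setT (u : RN -> R) ->
  measurable_fun setT (f : RN -> R) -> (forall x, 0 <= u x) -> (forall x, 0 <= f x) ->
  (\int[mu]_x (u x * f x)%:E = \int[leb1]_t \int[mu]_x (levelf u f (x, t))%:E)%E.
Proof.
move=> mu' mf u0 f0.
have mF : measurable_fun setT (fun z : RN * TR => (levelf u f z)%:E : \bar R).
  by apply/measurable_EFinP; exact: measurable_levelf.
have F0 (z : RN * TR) : (0 <= (levelf u f z)%:E :> \bar R)%E.
  by rewrite lee_fin /levelf; case: ifP.
refine (etrans _ (tonelli_real mF F0)).
apply: eq_integral => x _.
transitivity (\int[leb1]_t ((f x)%:E * (\1_(`[0, u x[ : set R) t)%:E))%E.
  rewrite ge0_integral_scale//; last first.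
  - by apply/measurable_EFinP; exact: measurable_indic.
  have Lm : leb1 `[0, u x[%classic = (u x)%:E.
    rewrite lebesgue_measure_itv/= lte_fin; case: ltP => [_|ux]; first by rewrite oppr0 adde0.
    by congr EFin; apply/eqP; rewrite eq_le ux u0.
  transitivity ((f x)%:E * leb1 `[0%R, u x[%classic)%E; first by rewrite Lm -EFinM mulrC.
  by congr (_ * _)%E; rewrite integral_indic// setIT.
apply: eq_integral => t _; rewrite /levelf/= indicE.
rewrite (_ : (t \in _) = (0 <= t) && (t < u x)).
  by case: (_ && _); rewrite ?mule1 ?mule0.
by apply/idP/idP => [/set_mem|h]; [|apply/mem_set]; rewrite /= in_itv.
Qed.

Lemma measurable_level_integral u f : measurable_fun setT (u : RN -> R) ->
  measurable_fun setT (f : RN -> R) -> (forall x, 0 <= f x) ->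
  measurable_fun setT (fun t : TR => \int[mu]_x (levelf u f (x, t))%:E)%E.
Proof.
move=> mu' mf f0.
have mF : measurable_fun setT (fun z : RN * TR => (levelf u f z)%:E : \bar R).
  by apply/measurable_EFinP; exact: measurable_levelf.
have F0 (z : RN * TR) : (0 <= (levelf u f z)%:E :> \bar R)%E.
  by rewrite lee_fin /levelf; case: ifP.
exact: (@measurable_fun_fubini_tonelli_G _ _ RN TR R mu _ mF F0).
Qed.

Lemma integral_levelf1 u t : measurable_fun setT (u : RN -> R) ->
  (\int[mu]_x (levelf u (fun=> 1) (x, t))%:E =
   if (0 <= t)%R then mu [set x | (t < u x)%R] else 0)%E.
Proof.
move=> mu'; case: ifPn => t0; last first.
  rewrite (_ : (fun _ => _) = cst 0%E) ?integral0//; apply/funext => x.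
  by rewrite /levelf/= (negPf t0).
have mA : measurable [set x : RN | t < u x] by exact: measurable_lt.
transitivity (\int[mu]_x (\1_[set x : RN | t < u x] x)%:E)%E.
  apply: eq_integral => x _; rewrite /levelf/= t0/= indicE.
  rewrite (_ : (x \in _) = (t < u x)); first by case: ifP.
  by apply/idP/idP => [/set_mem|/mem_set].
by rewrite integral_indic ?setIT.
Qed.

Definition equimeasurable u v := forall t, mu [set x | t < u x] = mu [set x | t < v x].

(** [psi] acts as an inverse of [phi]: it converts the superlevel sets of phi o u into those of u,
    after which the layer-cake formula sees only the distribution function. *)
Lemma equimeasurable_integral u v (phi psi : R -> R) :
  measurable_fun setT (u : RN -> R) -> measurable_fun setT (v : RN -> R) ->
  measurable_fun setT phi -> (forall r, 0 <= r -> 0 <= phi r) ->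
  (forall t r, 0 <= t -> 0 <= r -> (t < phi r) = (psi t < r)) ->
  (forall x, 0 <= u x) -> (forall x, 0 <= v x) ->
  equimeasurable u v ->
  (\int[mu]_x (phi (u x))%:E = \int[mu]_x (phi (v x))%:E)%E.
Proof.
move=> mu' mv mphi phi0 phipsi u0 v0 uv.
have mc w : measurable_fun setT (w : RN -> R) -> measurable_fun setT (fun x : RN => phi (w x)).
  by move=> mw; exact: measurableT_comp mphi mw.
have E w : measurable_fun setT (w : RN -> R) -> (forall x, 0 <= w x) ->
  (\int[mu]_x (phi (w x))%:E =
   \int[leb1]_t (if (0 <= t)%R then mu [set x | (psi t < w x)%R] else 0))%E.
  move=> mw w0; transitivity (\int[mu]_x (phi (w x) * 1)%:E)%E.
    by apply: eq_integral => x _; rewrite mulr1.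
  have m1 : measurable_fun setT ((fun=> 1) : RN -> R) by exact: measurable_cst.
  rewrite (layer_cake (mc w mw) m1 (fun x => phi0 _ (w0 x)) (fun=> ler01)).
  apply: eq_integral => t _; rewrite integral_levelf1; last exact: mc.
  case: ifP => // t0; congr (mu _); apply/seteqP; split=> x /=; by rewrite phipsi.
by rewrite !E//; apply: eq_integral => t _; case: ifP.
Qed.

End equimeasurable.

(** * Bathtub principle and second moments *)

Section bathtub.
Context {R : realType} {N : nat}.
Notation V := 'rV[R]_N.
Notation RN := (RN R N).
Notation mu := (lebm R N).
Notation omega := (omega (R := R) (N := N)).
Hypothesis N0 : (0 < N)%N.

Lemma nint_lebm (A : set V) : measurable (A : set RN) -> nint mu (\1_A : V -> R) = fine (mu A).
Proof. by move=> mA; rewrite nint_indic. Qed.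

Lemma exprB_le (r s : R) n : 0 <= s -> s <= r -> r <= 1 -> r ^+ n - s ^+ n <= n%:R * (r - s).
Proof.
move=> s0 sr r1; elim: n => [|n IH]; first by rewrite !expr0 subrr mul0r.
have sn : s ^+ n <= 1 by rewrite exprn_ile1// (le_trans sr).
have := IH; rewrite !exprS -natr1 => {}IH.
have h : r * (r ^+ n - s ^+ n) <= n%:R * (r - s).
  apply: le_trans IH; rewrite ler_piMl// subr_ge0 lerXn2r ?nnegrE//; exact: le_trans sr.
have h2 : s ^+ n * (r - s) <= r - s by rewrite ler_piMl// subr_ge0.
lra.
Qed.

Lemma in_eball (c x : V) r : 0 < r -> (x \in eball c r) = (dot (x - c) (x - c) < r ^+ 2).
Proof.
move=> r0; rewrite -enorm_sqr ltr_pXn2r ?nnegrE ?enorm_ge0 ?(ltW r0)//.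
by apply/idP/idP => [/set_mem|/mem_set].
Qed.

Lemma measurable_dist2c (c : V) : measurable_fun setT (fun x : RN => dot ((x : V) - c) (x - c)).
Proof.
by apply: measurable_dot; (apply: mcoordB; [exact: mcoord_id|exact: mcoord_cst]).
Qed.

(** The truncation at 1 changes nothing within distance 1 of c, where the balls compared with lie,
    and bounds the contribution of remote mass by that mass. *)
Definition cdist2 (c x : V) : R := Num.min (dot (x - c) (x - c)) 1.

Lemma measurable_cdist2 c : measurable_fun setT (cdist2 c : RN -> R).
Proof. by apply: measurable_minr; [exact: measurable_dist2c|exact: measurable_cst]. Qed.

Lemma cdist2_ge0 c x : 0 <= cdist2 c x.
Proof. by rewrite le_min dot_ge0/=. Qed.

Lemma cdist2_le1 c x : cdist2 c x <= 1.
Proof. by rewrite ge_min lexx orbT. Qed.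

(** Passing from the ball to E trades the part of the ball missed by E for an equal measure of
    points whose truncated squared distance is at least r^2. At least half of the missed measure b
    lies deeper than [dl] inside the ball, and each such point gains at least dl/2. The alternative
    b = 0 gives the plain bathtub inequality for balls of any radius up to 1. *)
Lemma bathtub (E : set V) c r b : measurable (E : set RN) -> 0 < r -> r <= 1 ->
  mu E = mu (eball c r) -> 0 <= b ->
  b = 0 \/ (1 / 2 <= r ^+ N /\ b <= fine (mu (eball c r `\` E))) ->
  nint mu (fun x => \1_(eball c r) x * dot (x - c) (x - c)) + b ^+ 2 / (8 * omega * N%:R) <=
  nint mu (fun x => \1_E x * cdist2 c x).
Proof.
move=> mE r0 r1 EB b0 Hb; pose B : set V := eball c r.
have o0 := @omega_gt0 R N; have n0 : 0 < (N%:R : R) by rewrite ltr0n.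
have mB : measurable (B : set RN) by exact: eball_measurable.
have Boo : (mu B < +oo)%E by exact: mu_eball_lty.
have Eoo : (mu E < +oo)%E by rewrite EB.
have nE : nni mu (\1_E : V -> R) by exact: nni_indic.
have nB : nni mu (\1_B : V -> R) by exact: nni_indic.
have mDE : measurable (B `\` E : set RN) by exact: measurableD.
have mDB : measurable (E `\` B : set RN) by exact: measurableD.
have sub1 (S S' : set V) : measurable (S : set RN) -> S `<=` S' ->
    nni mu (\1_S' : V -> R) -> nni mu (\1_S : V -> R).
  move=> mS SS nS; apply: (nni_le nS); first exact: measurable_indic.
  move=> x; rewrite !indicE; case: (boolP (x \in S)) => [/set_mem/SS/mem_set->|_].
    by rewrite lexx ler01.
  by rewrite lexx ler0n.
have nDE : nni mu (\1_(B `\` E) : V -> R) by apply: (sub1 _ B) => // x [].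
have nDB : nni mu (\1_(E `\` B) : V -> R) by apply: (sub1 _ E) => // x [].
have nf (S : set V) : measurable (S : set RN) -> nni mu (\1_S : V -> R) ->
    nni mu (fun x => \1_S x * cdist2 c x).
  move=> mS nS; apply: (nni_le nS).
    apply: measurable_funM; [exact: measurable_indic|exact: measurable_cdist2].
  move=> x; rewrite indicE; case: (_ \in _); rewrite ?mul1r ?mul0r ?lexx//.
  by rewrite cdist2_ge0 cdist2_le1.
have e1 : nint mu (fun x => \1_E x * cdist2 c x) +
          nint mu (fun x => \1_(B `\` E) x * cdist2 c x) =
   nint mu (fun x => \1_(E `\` B) x * cdist2 c x) + nint mu (fun x => \1_B x * cdist2 c x).
  rewrite -!nintD; [|exact: nf..]; congr nint; apply/funext => x.
  by rewrite !indicE !in_setD; case: (x \in E); case: (x \in B); rewrite /=; ring.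
have e2 : r ^+ 2 * nint mu (\1_(E `\` B) : V -> R) <=
    nint mu (fun x => \1_(E `\` B) x * cdist2 c x).
  rewrite -nintZ ?sqr_ge0//; apply: nint_le; [by apply: nniZ => //; exact: sqr_ge0|exact: nf|].
  move=> x; rewrite indicE in_setD; case: (x \in E) => /=; rewrite ?mulr0 ?mul0r//.
  rewrite /B in_eball// -leNgt; case: (leP (r ^+ 2) (dot _ _)) => h; rewrite ?mulr0 ?mul0r//= mulr1 mul1r.
  by rewrite /cdist2 le_min h exprn_ile1// ltW.
have e5 : nint mu (\1_(E `\` B) : V -> R) = nint mu (\1_(B `\` E) : V -> R).
  have : nint mu (\1_E : V -> R) + nint mu (\1_(B `\` E) : V -> R) =
     nint mu (\1_(E `\` B) : V -> R) + nint mu (\1_B : V -> R).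
    rewrite -!nintD//; congr nint; apply/funext => x.
    by rewrite !indicE !in_setD; case: (x \in E); case: (x \in B); rewrite /= ?addr0 ?add0r.
  rewrite !nint_lebm// EB -/B; lra.
have e4 : nint mu (fun x => \1_B x * cdist2 c x) =
    nint mu (fun x => \1_B x * dot (x - c) (x - c)).
  congr nint; apply/funext => x; rewrite indicE; case: (boolP (x \in B)); rewrite ?mul0r//.
  rewrite /B in_eball// => h; congr (_ * _); apply/min_idPl.
  by rewrite (le_trans (ltW h))// exprn_ile1// ltW.
(* The shell between radii r - dl and r then has measure at most N dl omega = b/2. *)
pose dl := b / (2 * omega * N%:R).
have dl0 : 0 <= dl by rewrite divr_ge0// !mulr_ge0// ltW.
suff e3 : nint mu (fun x => \1_(B `\` E) x * cdist2 c x) + b ^+ 2 / (8 * omega * N%:R) <=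
    r ^+ 2 * nint mu (\1_(B `\` E) : V -> R).
  rewrite -e4; move: e1 e2 e3; rewrite e5; lra.
case: Hb => [->|[rN bm]].
  rewrite expr0n mul0r addr0 -nintZ ?sqr_ge0//.
  apply: nint_le; [exact: nf|by apply: nniZ => //; exact: sqr_ge0|].
  move=> x; rewrite indicE in_setD; case: (boolP (x \in B)); rewrite ?andbF ?mulr0 ?mul0r//.
  rewrite /B in_eball// => h; case: (x \in E) => /=; rewrite ?mulr0 ?mul0r// mul1r mulr1.
  by rewrite ge_min ltW.
have rr : r ^+ N <= r by case: N N0 => // n _; rewrite exprS ler_piMr ?(ltW r0)// exprn_ile1// ltW.
have [bz|bp] := eqVneq b 0.
  rewrite bz expr0n mul0r addr0 -nintZ ?sqr_ge0//.
  apply: nint_le; [exact: nf|by apply: nniZ => //; exact: sqr_ge0|].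
  move=> x; rewrite indicE in_setD; case: (boolP (x \in B)); rewrite ?andbF ?mulr0 ?mul0r//.
  rewrite /B in_eball// => h; case: (x \in E) => /=; rewrite ?mulr0 ?mul0r// mul1r mulr1.
  by rewrite ge_min ltW.
have bp0 : 0 < b by rewrite lt_neqAle eq_sym bp.
have dlp : 0 < dl by rewrite divr_gt0// !mulr_gt0.
have nBE : nint mu (\1_B : V -> R) = r ^+ N * omega by rewrite nint_lebm// mu_eball.
have bB : b <= nint mu (\1_B : V -> R).
  apply: (le_trans bm); rewrite -nint_lebm//; apply: nint_le => // x.
  by rewrite !indicE in_setD; case: (x \in E); case: (x \in B).
have n1 : 1 <= (N%:R : R) by rewrite ler1n.
have dlr : dl <= r / 2.
  rewrite /dl ler_pdivrMr ?mulr_gt0//; apply: (le_trans bB); rewrite nBE.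
  rewrite (_ : r / 2 * _ = r * omega * N%:R); last by field.
  apply: (@le_trans _ _ (r * omega)); first by rewrite ler_wpM2r ?(ltW o0).
  by rewrite ler_peMr// mulr_ge0 ?ltW.
have rd0 : 0 < r - dl by lra.
pose B' : set V := eball c (r - dl).
have mB' : measurable (B' : set RN) by exact: eball_measurable.
have nB' : nni mu (\1_B' : V -> R) by apply: nni_indic => //; exact: mu_eball_lty.
have nB'E : nint mu (\1_B' : V -> R) = (r - dl) ^+ N * omega by rewrite nint_lebm// mu_eball.
have mI : measurable ((B `\` E) `&` B' : set RN) by exact: measurableI.
have nI : nni mu (\1_((B `\` E) `&` B') : V -> R) by apply: (sub1 _ (B `\` E)) => // x [].
have k0 : 0 <= r ^+ 2 - (r - dl) ^+ 2.
  by rewrite subr_ge0 lerXn2r ?nnegrE ?(ltW rd0) ?(ltW r0)// gerBl.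
have sB : (r - dl) ^+ 2 <= r ^+ 2 by rewrite -subr_ge0.
have e3 : nint mu (fun x => \1_(B `\` E) x * cdist2 c x) +
    (r ^+ 2 - (r - dl) ^+ 2) * nint mu (\1_((B `\` E) `&` B') : V -> R) <=
    r ^+ 2 * nint mu (\1_(B `\` E) : V -> R).
  rewrite -nintZ// -nintZ ?sqr_ge0// -nintD; [|exact: nf|exact: nniZ].
  apply: nint_le; [by apply: nniD; [exact: nf|exact: nniZ]|by apply: nniZ => //; exact: sqr_ge0|].
  move=> x; rewrite !indicE in_setI !in_setD /B /B' !in_eball//.
  case: (x \in E) => /=; first by rewrite andbF !mulr0 mul0r addr0.
  have [h|h] := ltP (dot (x - c) (x - c)) (r ^+ 2) => /=; last by rewrite !mulr0 mul0r addr0.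
  have := ge_min (dot (x - c) (x - c)) (dot (x - c) (x - c)) 1; rewrite lexx -/(cdist2 c x) => h'.
  rewrite mul1r mulr1; case: ltP => h2; rewrite ?mulr1 ?mulr0; clear -h h' h2; lra.
have e6 : nint mu (\1_(B `\` E) : V -> R) + nint mu (\1_B' : V -> R) <=
    nint mu (\1_((B `\` E) `&` B') : V -> R) + nint mu (\1_B : V -> R).
  rewrite -!nintD//; apply: nint_le; [exact: nniD..|] => x.
  rewrite !indicE in_setI !in_setD /B /B' !in_eball//.
  have [h|h] := ltP (dot (x - c) (x - c)) ((r - dl) ^+ 2).
    by rewrite (lt_le_trans h sB) -!natrD ler_nat; case: (x \in E).
  by rewrite -!natrD ler_nat; case: (x \in E); case: (_ < _).
have m6 : b / 2 <= nint mu (\1_((B `\` E) `&` B') : V -> R).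
  move: e6 bm; rewrite nBE nB'E -nint_lebm// -/B => e6 bm.
  have dlr' : r - dl <= r by rewrite gerBl.
  have h := @exprB_le r (r - dl) N (ltW rd0) dlr' r1.
  have : (r ^+ N - (r - dl) ^+ N) * omega <= b / 2.
    apply: (@le_trans _ _ (N%:R * dl * omega)).
      by rewrite ler_wpM2r ?(ltW o0)// (le_trans h)// opprB addrC subrK.
    by rewrite le_eqVlt; apply/orP; left; apply/eqP; rewrite /dl; field; rewrite !lt0r_neq0.
  move=> gap; clear -e6 bm gap; lra.
have rh : 1 / 2 <= r := le_trans rN rr.
have kd : dl / 2 <= r ^+ 2 - (r - dl) ^+ 2.
  have -> : r ^+ 2 - (r - dl) ^+ 2 = dl * (2 * r - dl) by ring.
  by rewrite ler_wpM2l ?(ltW dl0)//; clear -rh rd0; lra.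
have dl20 : 0 <= dl / 2 by rewrite mulr_ge0// invr_ge0.
have b20 : 0 <= b / 2 by rewrite mulr_ge0// invr_ge0.
have h := ler_pM dl20 b20 kd m6.
have E8 : b ^+ 2 / (8 * omega * N%:R) = dl / 2 * (b / 2).
  by rewrite /dl; field; rewrite !lt0r_neq0.
by rewrite E8; clear -h e3; lra.
Qed.

(** The radius is the supremum of the norms on the superlevel set, and the ball is open because this
    supremum is not attained. *)
Lemma level_ball L (v : V -> R) t : 0 <= L ->
  (forall x y, `|v x - v y| <= L * enorm (x - y)) ->
  (forall x y, enorm x <= enorm y -> v y <= v x) -> 0 <= t ->
  (forall x, 1 <= enorm x -> v x = 0) ->
  [set x | t < v x] = set0 \/ exists r, [/\ 0 < r, r <= 1 & [set x | t < v x] = eball 0 r].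
Proof.
move=> L0 vL vr t0 v1.
have [|/set0P[x0 tx0]] := eqVneq [set x | t < v x] set0; [by left|right].
pose S := [set enorm x | x in [set x | t < v x]].
have S1 : ubound S 1.
  move=> _ [x /= tx <-]; rewrite leNgt; apply/negP => /ltW /v1 vx.
  by move: tx; rewrite vx ltNge t0.
have Sup : has_sup S by split; [exists (enorm x0); exists x0|exists 1].
(* By the Lipschitz bound the value stays above t after a small move outward; at the origin, which
   has no outward direction, a coordinate vector is used. *)
have ext x : t < v x -> exists2 y, t < v y & enorm x < enorm y.
  move=> tx; pose K := L + 1; have K0 : 0 < K by rewrite ltr_wpDl.
  pose dl := (v x - t) / 2 / K; have d0 : 0 < dl by rewrite !divr_gt0// subr_gt0.
  have [e e1 xe] : exists2 e : V, enorm e = 1 & enorm (x + dl *: e) = enorm x + dl.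
    have [->|xn0] := eqVneq x 0.
      pose i0 : 'I_N := Ordinal N0.
      have ee : enorm (delta_mx 0 i0 : V) = 1.
        rewrite enormE (_ : dot _ _ = 1) ?sqrtr1// /dot (bigD1 i0)//= mxE !eqxx mulr1.
        by rewrite big1 ?addr0// => j ji; rewrite mxE eqxx (negPf ji) mulr0.
      exists (delta_mx 0 i0) => //.
      by rewrite !add0r enormZ ee mulr1 gtr0_norm// enorm0 add0r.
    have xp := enorm_gt0 xn0.
    exists ((enorm x)^-1 *: x).
      by rewrite enormZ gtr0_norm ?invr_gt0// mulVf// lt0r_neq0.
    rewrite -{1}(scale1r x) scalerA -scalerDl enormZ gtr0_norm; last first.
      by rewrite addr_gt0// divr_gt0.
    by rewrite mulrDl mul1r mulfVK// lt0r_neq0.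
  exists (x + dl *: e); last by rewrite xe ltrDl.
  have := vL x (x + dl *: e); rewrite opprD addNKr enormN enormZ e1 mulr1 (gtr0_norm d0).
  have : L * dl <= (v x - t) / 2.
    rewrite [leRHS](_ : _ = K * dl); last by rewrite /dl; field; exact: lt0r_neq0.
    by rewrite /K mulrDl mul1r lerDl ltW.
  by rewrite ler_norml; lra.
exists (sup S); have x0S : S (enorm x0) by exists x0.
split.
- have [y ty xy] := ext x0 tx0.
  apply: (le_lt_trans (enorm_ge0 x0)); apply: (lt_le_trans xy).
  by apply: sup_upper_bound => //; exists y.
- by apply: ge_sup => //; exists (enorm x0).
apply/seteqP; split=> x /=; rewrite /eball/= subr0.
  move=> tx; have [y ty xy] := ext x tx; apply: (lt_le_trans xy).
  by apply: sup_upper_bound => //; exists y.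
move=> xs; have xs0 : 0 < sup S - enorm x by rewrite subr_gt0.
have [_ [y ty <-] xy'] := sup_adherent xs0 Sup.
have xy : enorm x < enorm y by lra.
by apply: lt_le_trans ty (vr _ _ (ltW xy)).
Qed.

End bathtub.

Section level_gain.
Context {R : realType} {N : nat}.
Notation V := 'rV[R]_N.
Notation RN := (RN R N).
Notation mu := (lebm R N).
Notation leb1 := (@lebesgue_measure R).
Notation TR := (measurableTypeR R).
Notation omega := (omega (R := R) (N := N)).
Implicit Types u v f : V -> R.

Lemma levelfE u f x t : 0 <= t -> levelf u f (x, t) = \1_[set x | t < u x] x * f x.
Proof.
move=> t0; rewrite /levelf/= t0 indicE /=.
rewrite (_ : (x \in _) = (t < u x)); last by apply/idP/idP => [/set_mem|/mem_set].
by case: ifP; rewrite ?mul1r ?mul0r.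
Qed.

Lemma levelf_neg u f x t : t < 0 -> levelf u f (x, t) = 0.
Proof. by move=> t0; rewrite /levelf/= leNgt t0. Qed.

Lemma integral_shift (f : RN -> \bar R) (c : V) : measurable_fun setT f ->
  (forall x, 0 <= f x)%E -> (\int[mu]_x f ((x : V) + c)%R = \int[mu]_x f x)%E.
Proof.
move=> mf f0; have := leb_map_integral (@dil_map R N 1 c (oner_neq0 R)) mf f0.
rewrite normr1 expr1n invr1 mul1e => <-.
by apply: eq_integral => x _; rewrite /dil scale1r.
Qed.

Lemma nni_dist2_ball c r : 0 < r ->
  nni mu (fun x => \1_(eball c r) x * dot (x - c) (x - c)).
Proof.
move=> r0; apply: (@nni_bounded _ _ _ c r (r ^+ 2) r0).
- apply: measurable_funM; last exact: measurable_dist2c.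
  by apply: measurable_indic; exact: eball_measurable.
- move=> x; rewrite indicE in_eball//; case: ltP => h; rewrite ?mul1r ?mul0r.
    by rewrite dot_ge0 ltW.
  by rewrite lexx sqr_ge0.
- move=> x rx; rewrite indicE in_eball// -enorm_sqr.
  by rewrite ltr_pXn2r ?nnegrE ?enorm_ge0 ?(ltW r0)// ltNge rx mul0r.
Qed.

Lemma nint_ball_moment c r : 0 < r ->
  nint mu (fun x => \1_(eball c r) x * dot (x - c) (x - c)) =
  nint mu (fun x => \1_(eball 0 r) x * dot x x).
Proof.
move=> r0; have h := nni_dist2_ball c r0.
rewrite /nint -(@integral_shift _ c); last 2 first.
- exact: nni_emeasurable h.
- by move=> x; rewrite lee_fin (nni_ge0 _ h).
congr fine; apply: eq_integral => x _.
by rewrite !indicE !in_eball// addrK subr0.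
Qed.

(** The bathtub inequality is integrated over the levels with one center c: levels below T gain b^2
    / (8 omega N), and the others only have to lose nothing. *)
Lemma level_gain L u v c b T : (0 < N)%N -> 0 <= L ->
  (forall x y, `|v x - v y| <= L * enorm (x - y)) ->
  (forall x y, enorm x <= enorm y -> v y <= v x) ->
  (forall x, 1 <= enorm x -> v x = 0) -> (forall x, 0 <= v x) ->
  (forall x, 0 <= u x) -> measurable_fun setT (u : RN -> R) ->
  nni mu (fun x => v x * dot x x) -> nni mu (fun x => u x * cdist2 c x) ->
  (forall t, mu [set x | t < v x] = mu [set x | t < u x]) ->
  0 <= b -> 0 <= T ->
  (forall t, 0 <= t -> t < T -> [set x | t < v x] !=set0 /\
    forall r, 0 < r -> r <= 1 -> [set x | t < v x] = eball 0 r ->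
      1 / 2 <= r ^+ N /\ b <= fine (mu (eball c r `\` [set x | t < u x]))) ->
  nint mu (fun x => v x * dot x x) + b ^+ 2 / (8 * omega * N%:R) * T <=
  nint mu (fun x => u x * cdist2 c x).
Proof.
move=> N0 L0 vL vr v1 v0 u0 mu' nv nu uv b0 T0 H.
have mv : measurable_fun setT (v : RN -> R) by exact: lipschitz_measurable vL.
have mdot : measurable_fun setT (fun x : RN => dot (x : V) x).
  by apply: measurable_dot; exact: mcoord_id.
have o0 := @omega_gt0 R N; have n0 : 0 < (N%:R : R) by rewrite ltr0n.
set k := b ^+ 2 / (8 * omega * N%:R).
have k0 : 0 <= k by rewrite divr_ge0 ?sqr_ge0// !mulr_ge0// ltW.
rewrite -lee_fin EFinD EFinM -!nintE//.
rewrite (layer_cake mv mdot v0) => [|x]; last exact: dot_ge0.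
rewrite (layer_cake mu' (@measurable_cdist2 R N c) u0) => [|x]; last exact: cdist2_ge0.
have mI : measurable (`[0, T[%classic : set TR) by exact: measurable_itv.
have -> : (k%:E * T%:E = \int[leb1]_t (k%:E * (\1_(`[0%R, T[%classic : set TR) t)%:E))%E.
  rewrite (@ge0_integral_scale _ _ TR leb1)//; last by apply/measurable_EFinP; exact: measurable_indic.
  have Lm : leb1 `[0, T[%classic = T%:E.
    rewrite lebesgue_measure_itv/= lte_fin; case: ltP => [_|ux]; first by rewrite oppr0 adde0.
    by congr EFin; apply/eqP; rewrite eq_le ux T0.
  by rewrite (@integral_indic _ TR R leb1)// setIT -[in LHS]Lm.
have mk : measurable_fun setT (fun t : TR => k%:E * (\1_(`[0%R, T[%classic : set TR) t)%:E : \bar R)%E.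
  by apply/measurable_EFinP; apply: measurable_funM.
rewrite -(@ge0_integral_add _ _ TR leb1)//; first last.
- by move=> t; rewrite -EFinM lee_fin mulr_ge0.
- by move=> t; apply: integral_ge0 => x _; rewrite lee_fin /levelf; case: ifP => //= _; exact: dot_ge0.
- by apply: measurable_level_integral => // x; exact: dot_ge0.
apply: (@le_ge0_integral _ _ TR leb1).
- apply: emeasurable_funD => //.
  by apply: measurable_level_integral => // x; exact: dot_ge0.
- by apply: measurable_level_integral => // [|x]; [exact: measurable_cdist2|exact: cdist2_ge0].
- move=> t; apply: adde_ge0; last by rewrite -EFinM lee_fin mulr_ge0.
  by apply: integral_ge0 => x _; rewrite lee_fin /levelf; case: ifP => //= _; exact: dot_ge0.
move=> t; have [t0|t0] := ltP (t : R) 0.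
  rewrite (_ : \1_ _ t = 0) ?mule0 ?adde0; last first.
    by rewrite indicE memNset//= in_itv/= leNgt t0.
  under eq_integral do rewrite levelf_neg//.
  rewrite integral0; apply: integral_ge0 => x _.
  by rewrite lee_fin /levelf; case: ifP => //= _; exact: cdist2_ge0.
under eq_integral do rewrite levelfE//.
under [X in (_ <= X)%E]eq_integral do rewrite levelfE//.
have mE : measurable [set x : RN | t < u x] by exact: measurable_lt.
have Ind : (\1_(`[0, T[%classic : set TR) t : R) = ((t : R) < T)%R%:R.
  rewrite indicE (_ : (t \in _) = (t < T))//.
  by apply/idP/idP => [/set_mem|h]; [|apply/mem_set]; rewrite /= in_itv/= t0.
rewrite Ind.
have [ve|[r [r0 r1 rE]]] := level_ball N0 L0 vL vr t0 v1.
  have -> : (t < T) = false.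
    by apply/negP => tT; have [] := H t t0 tT; rewrite ve => -[].
  rewrite ve mule0 adde0; under eq_integral do rewrite indic0 mul0r.
  rewrite integral0; apply: integral_ge0 => x _.
  by rewrite lee_fin mulr_ge0 ?cdist2_ge0.
have Boo := @mu_eball_lty R N 0 r r0.
have nE : nni mu (\1_[set x : RN | t < u x] : V -> R).
  have uoo : (mu [set x : RN | (t < u x)%R] < +oo)%E by rewrite -uv rE.
  by apply: nni_indic.
have nEc : nni mu (fun x => \1_[set x | t < u x] x * cdist2 c x).
  apply: (nni_le nE).
    by apply: measurable_funM; [exact: measurable_indic|exact: measurable_cdist2].
  move=> x; rewrite indicE; case: (_ \in _); rewrite ?mul1r ?mul0r ?lexx//.
  by rewrite cdist2_ge0 cdist2_le1.
have nB : nni mu (fun x => \1_[set x | t < v x] x * dot x x).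
  have := nni_dist2_ball (0 : V) r0; rewrite rE.
  by under eq_fun do rewrite subr0.
rewrite (nintE nB) (nintE nEc) -EFinM -EFinD lee_fin rE -(nint_ball_moment c r0).
have Eb : mu [set x | t < u x] = mu (eball c r) by rewrite -uv rE !mu_eball.
have [tT|tT] := ltP t T.
  have [_ /(_ r r0 r1 rE) Hr] := H t t0 tT.
  by rewrite mulr1; apply: bathtub => //; right.
rewrite mulr0.
have := @bathtub R N N0 _ c r 0 mE r0 r1 Eb (lexx _) (or_introl erefl).
by rewrite expr0n mul0r.
Qed.

End level_gain.

(** * The quadratic kernel *)

Section interaction.
Context {R : realType} {N : nat}.
Notation V := 'rV[R]_N.
Notation RN := (RN R N).
Notation mu := (lebm R N).
Notation mu2 := (@mu2 R N).
Implicit Types u v w f : V -> R.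

Definition dist2 (z : RN * RN) : R := dot ((z.1 : V) - z.2) ((z.1 : V) - z.2).

Lemma dist2_ge0 z : 0 <= dist2 z. Proof. exact: dot_ge0. Qed.

Lemma measurable_dist2' : measurable_fun setT dist2. Proof. exact: measurable_dist2. Qed.

(* Written as a function of the squared distance r, k0 is 68 - r at distances
   at most 2, so that self-interactions inside the unit ball are determined by
   mass and second moment, and it decreases to 0 at distance 6. *)
Definition k0 (r : R) : R := Num.max 0 (Num.min (68 - r) (72 - 2 * r)).

Lemma k0_ge0 r : 0 <= k0 r. Proof. by rewrite le_max lexx. Qed.

Lemma k0_le68 r : 0 <= r -> k0 r <= 68.
Proof. by move=> r0; rewrite ge_max ge_min; apply/andP; split; [lra|apply/orP; left; lra]. Qed.

Lemma k0_small r : 0 <= r -> r <= 4 -> k0 r = 68 - r.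
Proof.
by move=> r0 r4; rewrite /k0 min_l; [rewrite max_r; lra|lra].
Qed.

(** The squared distance completes [k0] to the constant 68 up to distance 2. Beyond it the doubled
    slope of [k0] leaves a surplus, worth at least 4 from distance 3 on; at distance 6 and more the
    kernel is 0 and the squared distance is no longer counted. *)
Lemma k0_le r : 0 <= r -> k0 r + (r < 36)%R%:R * r + 4 * (9 <= r)%R%:R <= 68.
Proof.
move=> r0; rewrite /k0; case: (ltP r 36) => h1; case: (leP 9 r) => h2;
  rewrite /= ?mul1r ?mul0r ?mulr1 ?mulr0; case: (leP (68 - r) _) => h3;
  case: (leP 0 _) => h4; lra.
Qed.

Lemma measurable_k0 : measurable_fun setT k0.
Proof.
apply: measurable_maxr; first exact: measurable_cst.
apply: measurable_minr; first by apply: measurable_funB => //; exact: measurable_cst.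
by apply: measurable_funB => //; exact: measurable_funM.
Qed.

Lemma measurable_k0dist : measurable_fun setT (fun z : RN * RN => k0 (dist2 z)).
Proof. exact: measurableT_comp measurable_k0 measurable_dist2'. Qed.

Lemma nni_interaction u v (h : RN * RN -> R) C : nni mu u -> nni mu v -> 0 <= C ->
  measurable_fun setT h -> (forall z, 0 <= h z) ->
  (forall z, u z.1 * v z.2 != 0 -> h z <= C) ->
  nni mu2 (fun z => u z.1 * v z.2 * h z).
Proof.
move=> nu nv C0 mh h0 hC; have [nuv _] := nni_prod nu nv.
have ge0 (z : RN * RN) : 0 <= u z.1 * v z.2 by rewrite mulr_ge0// (nni_ge0 _ nu, nni_ge0 _ nv).
apply: (nni_le (nniZ C0 nuv)) => [|z].
  by apply: measurable_funM => //; exact: nni_measurable nuv.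
rewrite mulr_ge0//=; have [->|uz] := eqVneq (u z.1 * v z.2) 0; first by rewrite mul0r mulr0.
by rewrite mulrC ler_wpM2r// hC.
Qed.

Definition J u := nint mu2 (fun z => u z.1 * u z.2 * k0 (dist2 z)).

Lemma nni_J u : nni mu u -> nni mu2 (fun z => u z.1 * u z.2 * k0 (dist2 z)).
Proof.
move=> nu; apply: (@nni_interaction _ _ _ 68) => //; first exact: measurable_k0dist.
- by move=> z; exact: k0_ge0.
- by move=> z _; exact/k0_le68/dist2_ge0.
Qed.

Lemma integral_k0_const x :
  (\int[mu]_y (k0 (dist2 (x, y)))%:E = \int[mu]_y (k0 (dot (y : V) y))%:E)%E.
Proof.
have md : measurable_fun setT (fun y : RN => dot (y : V) y).
  by apply: measurable_dot; exact: mcoord_id.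
rewrite -(@integral_shift R N (fun y : RN => (k0 (dot (y : V) y))%:E) (- x)); last 2 first.
- by apply/measurable_EFinP; exact: measurableT_comp measurable_k0 md.
- by move=> y; rewrite lee_fin k0_ge0.
by apply: eq_integral => y _; rewrite /dist2/= -opprB dotNl dotNr opprK.
Qed.

(** Expanding the square leaves two copies of the integral of u^2 times a translation-invariant
    constant, minus 2 [J u]. Functions with the same integral of u^2 thus have energies that differ
    by twice their difference in [J]. The form without subtraction is the one meaningful in the
    extended reals. *)
Lemma interaction_split u : nni mu u -> measurable_fun setT (u : RN -> R) ->
  (kernel_energy k0 u + (2 * J u)%:E =
   (\int[mu]_x (u x ^+ 2)%:E * \int[mu]_y (k0 (dot (y : V) y))%:E) +
   (\int[mu]_x (u x ^+ 2)%:E * \int[mu]_y (k0 (dot (y : V) y))%:E))%E.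
Proof.
move=> nu mu'; set ck := (\int[mu]_y (k0 (dot (y : V) y))%:E)%E.
have ck0 : (0 <= ck)%E by apply: integral_ge0 => y _; rewrite lee_fin k0_ge0.
have m1 : measurable_fun setT (fun z : RN * RN => (u z.1 ^+ 2 * k0 (dist2 z))%:E : \bar R).
  apply/measurable_EFinP; apply: measurable_funM; last exact: measurable_k0dist.
  by apply: measurable_funX; exact: measurable_fst_comp.
have m2 : measurable_fun setT (fun z : RN * RN => (u z.2 ^+ 2 * k0 (dist2 z))%:E : \bar R).
  apply/measurable_EFinP; apply: measurable_funM; last exact: measurable_k0dist.
  by apply: measurable_funX; exact: measurable_snd_comp.
have g1 (z : RN * RN) : (0 <= (u z.1 ^+ 2 * k0 (dist2 z))%:E :> \bar R)%E.
  by rewrite lee_fin mulr_ge0 ?sqr_ge0 ?k0_ge0.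
have g2 (z : RN * RN) : (0 <= (u z.2 ^+ 2 * k0 (dist2 z))%:E :> \bar R)%E.
  by rewrite lee_fin mulr_ge0 ?sqr_ge0 ?k0_ge0.
have mu2' : measurable_fun setT (fun x : RN => (u x ^+ 2)%:E : \bar R).
  by apply/measurable_EFinP; exact: measurable_funX.
have sq0 (x : RN) : (0 <= (u x ^+ 2)%:E :> \bar R)%E by rewrite lee_fin sqr_ge0.
have S (x y : V) : dist2 (x, y) = dist2 (y, x) by rewrite /dist2/= -opprB dotNl dotNr opprK.
have mk' y : measurable_fun setT (fun x : RN => (k0 (dist2 (x, y)))%:E : \bar R).
  apply/measurable_EFinP; exact: (measurableT_comp measurable_k0 (measurable_dist2c y)).
have mk x : measurable_fun setT (fun y : RN => (k0 (dist2 (x, y)))%:E : \bar R).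
  by have := mk' x; under eq_fun do rewrite S.
have slice x (a : R) : 0 <= a -> (\int[mu]_y (a * k0 (dist2 (x, y)))%:E = a%:E * ck)%E.
  move=> a0; rewrite /ck -(integral_k0_const x).
  rewrite -(@ge0_integral_scale _ _ RN mu a _ a0 (mk x)); last first.
    by move=> y; rewrite lee_fin k0_ge0.
  by apply: eq_integral.
have E1 : (\int[mu2]_z (u z.1 ^+ 2 * k0 (dist2 z))%:E = \int[mu]_x (u x ^+ 2)%:E * ck)%E.
  rewrite mu2_tonelli1//.
  transitivity (\int[mu]_x ((u x ^+ 2)%:E * ck))%E.
    by apply: eq_integral => x _; exact: (slice x _ (sqr_ge0 (u x))).
  by rewrite ge0_integralZr.
have E2 : (\int[mu2]_z (u z.2 ^+ 2 * k0 (dist2 z))%:E = \int[mu]_x (u x ^+ 2)%:E * ck)%E.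
  rewrite mu2_tonelli2//.
  transitivity (\int[mu]_x ((u x ^+ 2)%:E * ck))%E.
    apply: eq_integral => x _; rewrite -(slice x _ (sqr_ge0 (u x))).
    by apply: eq_integral => y _; rewrite S.
  by rewrite ge0_integralZr.
rewrite -{1}E1 -E2 -ge0_integral_add//.
rewrite /J -nintZ//; last exact: nni_J.
rewrite -nintE; last by apply: nniZ => //; exact: nni_J.
rewrite /kernel_energy -ge0_integral_add.
- apply: eq_integral => z _; rewrite -!EFinD; congr EFin; rewrite -/(dist2 z); ring.
- by apply: measurable_energy => //; exact: measurable_k0.
- apply/measurable_EFinP; apply: measurable_funM => //.
  exact: nni_measurable (nni_J nu).
- by move=> z; rewrite lee_fin mulr_ge0 ?sqr_ge0 ?k0_ge0.
- by move=> z; rewrite lee_fin mulr_ge0// (nni_ge0 z (nni_J nu)).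
Qed.

Lemma enorm1_dist2 (x y : V) : enorm x < 1 -> enorm y < 1 -> dist2 (x, y) <= 4.
Proof.
move=> x1 y1; rewrite /dist2/= -enorm_sqr.
have h : enorm (x - y) <= 2.
  by have := enormD x (- y); rewrite enormN; lra.
rewrite (_ : 4 = 2 ^+ 2); last by rewrite expr2; lra.
by rewrite lerXn2r ?nnegrE ?enorm_ge0//; lra.
Qed.

Lemma nni_supp1_moment v : nni mu v -> (forall x, 1 <= enorm x -> v x = 0) ->
  nni mu (fun x => v x * dot x x).
Proof.
move=> nv v1; apply: (nni_le nv) => [|x].
  apply: measurable_funM; first exact: nni_measurable nv.
  by apply: measurable_dot; exact: mcoord_id.
have vx := nni_ge0 x nv; rewrite mulr_ge0 ?dot_ge0//=.
have [h|h] := leP 1 (enorm x); first by rewrite v1// mul0r.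
by rewrite ler_piMr// -enorm_sqr exprn_ile1 ?enorm_ge0// ltW.
Qed.

(** On the unit ball [k0] is exactly 68 minus the squared distance, and evenness places the
    barycenter at the origin, so the quadratic interaction is 2 times mass times second moment. *)
Lemma J_ge v : nni mu v -> (forall x, 1 <= enorm x -> v x = 0) -> (forall x, v (- x) = v x) ->
  68 * nint mu v ^+ 2 <= J v + 2 * nint mu v * nint mu (fun x => v x * dot x x).
Proof.
move=> nv v1 ve; have nm := nni_supp1_moment nv v1.
have supp (z : RN * RN) : v z.1 * v z.2 != 0 -> enorm (z.1 : V) < 1 /\ enorm (z.2 : V) < 1.
  rewrite mulf_eq0 negb_or => /andP[a b]; split; rewrite ltNge; apply/negP => /v1 e.
    by move: a; rewrite e eqxx.
  by move: b; rewrite e eqxx.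
have nD : nni mu2 (fun z => v z.1 * v z.2 * dist2 z).
  apply: (@nni_interaction _ _ _ 4) => //; first exact: measurable_dist2'.
    by move=> z; exact: dist2_ge0.
  by case=> x y /supp[]; exact: enorm1_dist2.
(* The parallelogram identity |x-y|^2 + |x+y|^2 = 2|x|^2 + 2|y|^2 replaces the cancellation of the
   cross term, which would be a signed integral. *)
pose s2 (z : RN * RN) : R := dist2 (z.1, - (z.2 : V)).
have ms : measurable_fun setT s2.
  apply: measurable_dot; (apply: mcoordB; [exact: mcoord_fst|apply: mcoordN; exact: mcoord_snd]).
have nS : nni mu2 (fun z => v z.1 * v z.2 * s2 z).
  apply: (@nni_interaction _ _ _ 4) => //.
    by move=> z; exact: dist2_ge0.
  by case=> x y /supp[/= a b]; apply: enorm1_dist2; rewrite ?enormN.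
have N1 : (-1 : R) != 0 by rewrite oppr_eq0 oner_neq0.
have DS : nint mu2 (fun z => v z.1 * v z.2 * s2 z) = nint mu2 (fun z => v z.1 * v z.2 * dist2 z).
  have := @leb_map_integral2 R N _ _ (fun z => (v z.1 * v z.2 * dist2 z)%:E) (@dil_map R N (-1) 0 N1).
  rewrite normrN1 expr1n invr1 mul1e => h; rewrite /nint -h; last 2 first.
  - exact: nni_emeasurable nD.
  - by move=> z; rewrite lee_fin (nni_ge0 z nD).
  by congr fine; apply: eq_integral => z _; rewrite /dil/= addr0 scaleN1r ve.
have [p1 e1] := nni_prod nm nv; have [p2 e2] := nni_prod nv nm.
have sum : nint mu2 (fun z => v z.1 * v z.2 * dist2 z) + nint mu2 (fun z => v z.1 * v z.2 * s2 z) =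
   4 * nint mu v * nint mu (fun x => v x * dot x x).
  rewrite -nintD// (_ : (fun x => _) = (fun z : RN * RN =>
     2 * (v z.1 * dot (z.1 : V) z.1 * v z.2) + 2 * (v z.1 * (v z.2 * dot (z.2 : V) z.2)))).
    rewrite nintD ?nintZ ?e1 ?e2//; [ring|exact: nniZ..].
  apply/funext => -[x y]; rewrite /s2 /dist2/= opprK.
  rewrite !(dotDl, dotDr, dotNl, dotNr) (dotC y x); ring.
have [p3 e3] := nni_prod nv nv.
have Jp := nni_J nv.
have JD : J v + nint mu2 (fun z => v z.1 * v z.2 * dist2 z) = 68 * nint mu v ^+ 2.
  rewrite /J -nintD// expr2 -e3 -nintZ//; congr nint; apply/funext => z.
  have [->|/supp[a b]] := eqVneq (v z.1 * v z.2) 0; first by rewrite !mul0r addr0 mulr0.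
  rewrite k0_small ?dist2_ge0 //; first by ring.
  by case: z a b => x y /=; exact: enorm1_dist2.
by move: sum JD; rewrite DS => sum JD; clear -sum JD; lra.
Qed.

(** The variance identity, coordinate by coordinate, with c the barycenter of w. *)
Lemma barycenter w (y0 : V) : nni mu w -> (forall x, 3 <= enorm (x - y0) -> w x = 0) ->
  exists c, nni mu (fun x => w x * dot (x - c) (x - c)) /\
    2 * nint mu w * nint mu (fun x => w x * dot (x - c) (x - c)) <=
    nint mu2 (fun z => w z.1 * w z.2 * dist2 z).
Proof.
move=> nw w3; set W := nint mu w; have W0 : 0 <= W by apply: nint_ge0 => x; exact: nni_ge0 nw.
(* The shift by 3 puts the coordinates in [0, 6] on the support of w, so that first moments are
   integrals of nonnegative functions. *)
pose a i (x : V) : R := x 0 i - y0 0 i + 3.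
have ai i x : w x != 0 -> 0 <= a i x <= 6.
  move=> wx; have := coord_le_enorm (x - y0) i.
  have h : enorm (x - y0) < 3 by rewrite ltNge; apply/negP => /w3 e; move: wx; rewrite e eqxx.
  by rewrite !mxE /a => /le_lt_trans/(_ h)/ltW; rewrite ler_norml => /andP[p q]; apply/andP; split; lra.
have wx0 x : 0 <= w x by case: nw => _ + _; exact.
have mw := nni_measurable nw.
have mx i : measurable_fun setT (fun x : RN => (x : V) 0 i) by exact: coord_measurable.
have ma i : measurable_fun setT (a i : RN -> R).
  apply: measurable_funD; last exact: measurable_cst.
  by apply: measurable_funB; [exact: mx|exact: measurable_cst].
have mean f : measurable_fun setT (f : RN -> R) -> (forall x, w x != 0 -> 0 <= f x <= 144) ->
    nni mu (fun x => w x * f x).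
  move=> mf f1; apply: (nni_le (@nniZ _ _ _ mu 144 w (ler0n _ 144) nw)) => [|x].
    exact: measurable_funM mw mf.
  have [->|wx] := eqVneq (w x) 0; first by rewrite mul0r mulr0 lexx.
  by have /andP[p q] := f1 x wx; rewrite mulr_ge0//= mulrC ler_wpM2r.
have na i : nni mu (fun x => w x * a i x).
  by apply: mean => // x /(ai i)/andP[p q]; rewrite p; lra.
have na2 i : nni mu (fun x => w x * a i x ^+ 2).
  apply: mean => [|x /(ai i)/andP[p q]]; first exact: measurable_funX.
  by rewrite sqr_ge0/=; nra.
pose A i := nint mu (fun x => w x * a i x); pose g i := A i / W.
have A0 i : 0 <= A i by apply: nint_ge0 => x; exact: nni_ge0 (na i).
have g0 i : 0 <= g i by rewrite divr_ge0.
have AW i : A i <= 6 * W.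
  rewrite -nintZ//; apply: nint_le; [exact: na|exact: nniZ|move=> x].
  have [->|wx] := eqVneq (w x) 0; first by rewrite mul0r mulr0.
  by have /andP[p q] := ai i x wx; rewrite mulrC ler_wpM2r.
(* When W = 0 the quotient [g i] is 0 by convention, and [A i] is 0 as well. *)
have gW i : g i * W = A i.
  rewrite /g; have [W1|W1] := eqVneq W 0; last by rewrite divfK.
  by have := AW i; have := A0 i; rewrite W1 invr0 !mulr0; lra.
have g6 i : g i <= 6.
  have [W1|W1] := eqVneq W 0; first by rewrite /g W1 invr0 mulr0.
  by rewrite ler_pdivrMr ?AW// lt_neqAle eq_sym W1.
pose c : V := \row_i (y0 0 i - 3 + g i).
have coordE x i : (x - c) 0 i = a i x - g i by rewrite !mxE /a; ring.
have nc i : nni mu (fun x => w x * (a i x - g i) ^+ 2).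
  apply: mean => [|x /(ai i)/andP[p q]].
    by apply: measurable_funX; exact: measurable_funB.
  by rewrite sqr_ge0/=; have := g0 i; have := g6 i; nra.
have dE x : w x * dot (x - c) (x - c) = \sum_(i < N) w x * (a i x - g i) ^+ 2.
  by rewrite mulr_sumr; apply: eq_bigr => i _; rewrite !coordE expr2.
have [s1 s2] := nni_sum (index_enum 'I_N) nc.
exists c; under eq_fun do rewrite dE; split => //; rewrite s2.
pose D i (z : RN * RN) : R := w z.1 * w z.2 * (a i z.1 - a i z.2) ^+ 2.
have nD i : nni mu2 (D i).
  apply: (@nni_interaction _ _ _ 36) => //.
  - apply: measurable_funX; apply: measurable_funB.
      exact: measurable_fst_comp.
    exact: measurable_snd_comp.
  - by move=> z; exact: sqr_ge0.
  move=> z; rewrite mulf_eq0 negb_or => /andP[/(ai i)/andP[p q] /(ai i)/andP[p' q']].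
  nra.
have -> : (fun z : RN * RN => w z.1 * w z.2 * dist2 z) = (fun z => \sum_(i < N) D i z).
  apply/funext => z; rewrite /dist2 /dot mulr_sumr; apply: eq_bigr => i _.
  by rewrite /D /a expr2 !mxE; congr (_ * (_ * _)); ring.
have [_ ->] := nni_sum (index_enum 'I_N) nD.
rewrite mulr_sumr; apply: ler_sum => i _.
have [p1 e1] := nni_prod (na2 i) nw; have [p2 e2] := nni_prod nw (na2 i).
have [p3 e3] := nni_prod (na i) (na i).
have E1 : nint mu2 (D i) + 2 * A i ^+ 2 = 2 * W * nint mu (fun x => w x * a i x ^+ 2).
  rewrite expr2 -e3 -nintZ// -nintD//; last exact: nniZ.
  rewrite (_ : (fun x => _) = (fun z : RN * RN =>
    w z.1 * a i z.1 ^+ 2 * w z.2 + w z.1 * (w z.2 * a i z.2 ^+ 2))).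
    by rewrite nintD// e1 e2 -/W; ring.
  by apply/funext => z; rewrite /D; ring.
have g2 : 0 <= 2 * g i by rewrite mulr_ge0.
have E2 : nint mu (fun x => w x * (a i x - g i) ^+ 2) + 2 * g i * A i =
    nint mu (fun x => w x * a i x ^+ 2) + g i ^+ 2 * W.
  rewrite -(nintZ g2 (na i)) -[g i ^+ 2 * W](nintZ (sqr_ge0 (g i)) nw).
  rewrite -(nintD (nc i) (nniZ g2 (na i))) -(nintD (na2 i) (nniZ (sqr_ge0 (g i)) nw)).
  by congr nint; apply/funext => x; ring.
have -> : nint mu2 (D i) = 2 * W * nint mu (fun x => w x * a i x ^+ 2) - 2 * A i ^+ 2.
  by rewrite -E1 addrK.
have -> : nint mu (fun x => w x * (a i x - g i) ^+ 2) =
    nint mu (fun x => w x * a i x ^+ 2) + g i ^+ 2 * W - 2 * g i * A i.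
  by rewrite -E2 addrK.
by rewrite -gW le_eqVlt; apply/orP; left; apply/eqP; ring.
Qed.

Lemma measurable_far : measurable_fun setT (fun z : RN * RN => (9 <= dist2 z)%R%:R : R).
Proof.
have h : measurable_fun setT (fun z : RN * RN => if 9 <= dist2 z then 1 else 0 : R).
  apply: measurable_fun_ifT; [|exact: measurable_cst..].
  by apply: measurable_fun_ler; [exact: measurable_cst|exact: measurable_dist2'].
by rewrite (_ : (fun z => _) = (fun z : RN * RN => if 9 <= dist2 z then 1 else 0 : R))//;
  apply/funext => z; case: ifP.
Qed.

(* Averaging over y with weight u(y) dy: some slice is at most the mean. *)
Lemma good_center u e : nni mu u -> 0 < e ->
  exists y0 : V, nint mu u * nint mu (fun x => u x * (9 <= dot (x - y0) (x - y0))%R%:R) <=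
    nint mu2 (fun z => u z.1 * u z.2 * (9 <= dist2 z)%R%:R) + e.
Proof.
move=> nu e0; set M := nint mu u; have M0 : 0 <= M by apply: nint_ge0 => x; exact: nni_ge0 nu.
set m := nint mu2 _; pose Phi (y : V) := nint mu (fun x => u x * (9 <= dot (x - y) (x - y))%R%:R).
have nF : nni mu2 (fun z => u z.1 * u z.2 * (9 <= dist2 z)%R%:R).
  apply: (@nni_interaction _ _ _ 1) => //; first exact: measurable_far.
  by move=> z _; case: (9 <= _); rewrite ?lexx ?ler01.
have nP (y : V) : nni mu (fun x => u x * (9 <= dot (x - y) (x - y))%R%:R).
  apply: (nni_le nu) => [|x].
    apply: measurable_funM; first exact: nni_measurable nu.
    have h : measurable_fun setT (fun x : RN => if 9 <= dot ((x : V) - y) (x - y) then 1 else 0 : R).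
      apply: measurable_fun_ifT; [|exact: measurable_cst..].
      by apply: measurable_fun_ler; [exact: measurable_cst|exact: measurable_dist2c].
    by rewrite (_ : (fun x => _) = (fun x : RN => if 9 <= dot ((x : V) - y) (x - y) then 1 else 0 : R))//;
      apply/funext => x; case: ifP.
  by case: (9 <= _); rewrite ?mulr1 ?mulr0 ?lexx (nni_ge0 x nu).
have m0 : 0 <= m by apply: nint_ge0 => z; exact: nni_ge0 nF.
apply: contrapT => no; have lt y : m + e < M * Phi y.
  by rewrite ltNge; apply/negP => h; apply: no; exists y.
have M1 : 0 < M.
  rewrite lt_neqAle M0 andbT; apply/negP => /eqP M1; have := lt 0; rewrite -M1 mul0r ltNge.
  by rewrite (addr_ge0 m0 (ltW e0)).
have S (y : RN) : (\int[mu]_x (u x * u y * (9 <= dist2 (x, y))%R%:R)%:E = (u y * Phi y)%:E)%E.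
  rewrite EFinM /Phi -(nintE (nP y)) -ge0_integral_scale; last 3 first.
  - exact: nni_ge0 nu.
  - exact: nni_emeasurable (nP y).
  - by move=> x; rewrite lee_fin (nni_ge0 x (nP y)).
  by apply: eq_integral => x _; rewrite -EFinM; congr EFin; rewrite /dist2/=; ring.
have E : ((\int[mu2]_z (u z.1 * u z.2 * (9 <= dist2 z)%R%:R)%:E) =
    \int[mu]_y (u y * Phi y)%:E)%E.
  rewrite mu2_tonelli2; [|exact: nni_emeasurable nF|by move=> z; rewrite lee_fin (nni_ge0 z nF)].
  by apply: eq_integral => y _ /=; exact: S.
have mPhi : measurable_fun setT (fun y : RN => (u y * Phi y)%:E : \bar R).
  have F0 (z : RN * RN) : (0 <= (u z.1 * u z.2 * (9 <= dist2 z)%R%:R)%:E :> \bar R)%E.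
    by rewrite lee_fin (nni_ge0 z nF).
  have := tonelli_mG (nni_emeasurable nF) F0.
  by rewrite (_ : (fun y => _) = (fun y : RN => (u y * Phi y)%:E : \bar R)); last exact/funext/S.
have k0' : 0 <= (m + e) / M by rewrite divr_ge0// (addr_ge0 m0 (ltW e0)).
have : (((m + e) / M * M)%:E <= m%:E)%E.
  have nu0 (x : RN) : (0 <= (u x)%:E)%E by rewrite lee_fin (nni_ge0 x nu).
  rewrite EFinM /M -(nintE nu) -(@ge0_integral_scale _ _ RN mu _ _ k0' (nni_emeasurable nu) nu0).
  rewrite -(nintE nF) E; apply: le_ge0_integral.
  - apply/measurable_EFinP; apply: measurable_funM; first exact: measurable_cst.
    exact: nni_measurable nu.
  - exact: mPhi.
  - by move=> x; rewrite -EFinM lee_fin mulr_ge0// (nni_ge0 x nu).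
  move=> x; rewrite -EFinM lee_fin mulrC ler_wpM2l ?(nni_ge0 x nu)//.
  by rewrite ler_pdivrMr// mulrC ltW.
by rewrite lee_fin divfK ?lt0r_neq0// -subr_ge0 opprD addNKr oppr_ge0 leNgt e0.
Qed.

(** With c the barycenter of u restricted to the ball of radius 3 about [y0], the near part is
    handled by the variance identity. The far mass F enters the truncated moment directly and
    through the cross term with the near part, each time costing at most 2MF. The total 4MF is paid
    by the surplus 4 that [k0_le] grants to pairs at distance at least 3, because [good_center]
    makes MF at most the mass of such pairs, up to e. *)
Lemma J_le u e : nni mu u -> 0 < e ->
  exists c, J u + 2 * nint mu u * nint mu (fun x => u x * cdist2 c x) <=
    68 * nint mu u ^+ 2 + 4 * e.
Proof.
move=> nu e0; have [y0 Hy] := good_center nu e0.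
have mu' := nni_measurable nu.
have u0 x : 0 <= u x by case: nu => _ + _; exact.
set M := nint mu u in Hy *; have M0 : 0 <= M by apply: nint_ge0.
pose w x := \1_(eball y0 3) x * u x.
have i3 x : (x \in eball y0 3) = (dot (x - y0) (x - y0) < 9).
  by rewrite in_eball// (_ : 3 ^+ 2 = 9)// -natrX.
have nw : nni mu w by apply: nniM_indic => //; exact: eball_measurable.
have w0 x : 0 <= w x by case: nw => _ + _; exact.
have w3 x : 3 <= enorm (x - y0) -> w x = 0.
  move=> h; rewrite /w indicE i3 -enorm_sqr ltNge (_ : 9 = 3 ^+ 2); last by rewrite -natrX.
  by rewrite lerXn2r ?nnegrE ?enorm_ge0// mul0r.
have [c [nwc Hc]] := barycenter nw w3; exists c.
pose far x := u x * (9 <= dot (x - y0) (x - y0))%R%:R.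
have uE x : u x = w x + far x.
  by rewrite /w /far indicE i3; case: leP => _; rewrite ?mul1r ?mul0r ?mulr1 ?mulr0 ?add0r ?addr0.
have nfar : nni mu far.
  apply: (nni_le nu) => [|x].
    rewrite (_ : far = fun x => u x - w x); last by apply/funext => x; rewrite uE addrAC subrr add0r.
    exact: measurable_funB mu' (nni_measurable nw).
  by rewrite [u x]uE lerDr w0 andbT /far mulr_ge0.
have far0 x : 0 <= far x by case: nfar => _ + _; exact.
have ME : M = nint mu w + nint mu far.
  by rewrite -(nintD nw nfar); congr nint; apply/funext => x; exact: uE.
have mcd := @measurable_cdist2 R N c.
have cd (f : V -> R) : nni mu f -> nni mu (fun x => f x * cdist2 c x).
  move=> nf; have f0 x : 0 <= f x by case: nf => _ + _; exact.
  apply: (nni_le nf) => [|x]; first exact: measurable_funM (nni_measurable nf) mcd.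
  by rewrite mulr_ge0 ?cdist2_ge0//= ler_piMr ?cdist2_le1.
have I1 : nint mu (fun x => u x * cdist2 c x) <= nint mu (fun x => w x * cdist2 c x) + nint mu far.
  rewrite -(nintD (cd w nw) nfar); apply: nint_le; [exact: cd|exact: nniD (cd w nw) nfar|] => x.
  by rewrite uE mulrDl lerD2l ler_piMr ?cdist2_le1.
have I2 : nint mu (fun x => w x * cdist2 c x) <= nint mu w.
  by apply: nint_le => [||x]; [exact: cd|exact: nw|rewrite ler_piMr ?cdist2_le1].
have I3 : nint mu (fun x => w x * cdist2 c x) <= nint mu (fun x => w x * dot (x - c) (x - c)).
  apply: nint_le => [||x]; [exact: cd|exact: nwc|rewrite ler_wpM2l//].
  by rewrite /cdist2 ge_min lexx.
have P0 : 0 <= nint mu (fun x => w x * cdist2 c x).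
  by apply: nint_ge0 => x; rewrite mulr_ge0 ?cdist2_ge0.
have W0 : 0 <= nint mu w by apply: nint_ge0.
have d0 : 0 <= nint mu far by apply: nint_ge0.
have [nuu euu] := nni_prod nu nu.
have nF : nni mu2 (fun z => u z.1 * u z.2 * (9 <= dist2 z)%R%:R).
  apply: (@nni_interaction _ _ _ 1) => //; first exact: measurable_far.
  by move=> z _; case: (9 <= _); rewrite ?lexx ?ler01.
(* Two points within 3 of [y0] are at distance below 6, so [k0_le] counts their squared distance in
   full. *)
have d36 (z : RN * RN) : w z.1 * w z.2 != 0 -> dist2 z < 36.
  rewrite mulf_eq0 negb_or => /andP[a b]; rewrite /dist2 -enorm_sqr.
  rewrite (_ : 36 = 6 ^+ 2); last by rewrite -natrX.
  have h x : w x != 0 -> enorm (x - y0) < 3.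
    by move=> wx; rewrite ltNge; apply/negP => /w3 wz; move: wx; rewrite wz eqxx.
  rewrite ltr_pXn2r ?nnegrE ?enorm_ge0//.
  apply: (le_lt_trans (enormB (z.1 : V) y0 z.2)); rewrite (enormBC y0).
  by rewrite (_ : 6 = 3 + 3) ?(ltrD (h _ a) (h _ b))// -natrD.
have nD : nni mu2 (fun z => w z.1 * w z.2 * dist2 z).
  apply: (@nni_interaction _ _ _ 36) => //; first exact: measurable_dist2'.
    by move=> z; exact: dist2_ge0.
  by move=> z /d36/ltW.
have key : J u + nint mu2 (fun z => w z.1 * w z.2 * dist2 z) +
   4 * nint mu2 (fun z => u z.1 * u z.2 * (9 <= dist2 z)%R%:R) <= 68 * M ^+ 2.
  rewrite /J expr2 -euu -(nintZ (ler0n _ 68) nuu) -(nintZ (ler0n _ 4) nF).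
  have nA := nniD (nni_J nu) nD; have n4 := nniZ (ler0n R 4) nF.
  rewrite -(nintD (nni_J nu) nD) -(nintD nA n4).
  apply: nint_le; [exact: nniD nA n4|exact: nniZ (ler0n R 68) nuu|] => z.
  have uu : 0 <= u z.1 * u z.2 by rewrite mulr_ge0.
  have h := ler_wpM2l uu (k0_le (dist2_ge0 z)).
  have ww : w z.1 * w z.2 * dist2 z <= u z.1 * u z.2 * ((dist2 z < 36)%R%:R * dist2 z).
    have [->|hw] := eqVneq (w z.1 * w z.2) 0.
      by rewrite mul0r mulr_ge0// mulr_ge0 ?dist2_ge0.
    rewrite d36// mul1r ler_wpM2r ?dist2_ge0// ler_pM// [leRHS]uE lerDl//.
  have arith (a k d f W : R) : a * (k + d + 4 * f) <= a * 68 -> W <= a * d ->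
    a * k + W + 4 * (a * f) <= 68 * a by clear; lra.
  exact: arith h ww.
have h1 : nint mu w * nint mu (fun x => w x * cdist2 c x) <=
  nint mu w * nint mu (fun x => w x * dot (x - c) (x - c)) by rewrite ler_wpM2l.
have h2 : nint mu far * nint mu (fun x => w x * cdist2 c x) <= nint mu far * nint mu w.
  by rewrite ler_wpM2l.
have h3 : 2 * M * nint mu (fun x => u x * cdist2 c x) <=
   2 * M * (nint mu (fun x => w x * cdist2 c x) + nint mu far).
  by rewrite ler_wpM2l// mulr_ge0.
move: Hy; rewrite -/far => Hy.
have h4 : nint mu far * nint mu w <= M * nint mu far.
  by rewrite mulrC ler_wpM2r// ME lerDl.
have h5 : 2 * M * (nint mu (fun x => w x * cdist2 c x) + nint mu far) =
  2 * (nint mu w * nint mu (fun x => w x * cdist2 c x)) +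
  2 * (nint mu far * nint mu (fun x => w x * cdist2 c x)) + 2 * (M * nint mu far).
  by rewrite {1}ME ME; ring.
move: Hc; rewrite -mulrA => Hc.
rewrite h5 in h3.
have arith (ju MI WP' WP FP' FW MF D m : R) : ju + D + 4 * m <= 68 * M ^+ 2 -> WP' <= WP ->
  FP' <= FW -> 2 * MI <= 2 * WP' + 2 * FP' + 2 * MF -> FW <= MF -> MF <= m + e ->
  2 * WP <= D -> ju + 2 * MI <= 68 * M ^+ 2 + 4 * e by clear; lra.
rewrite -mulrA; rewrite -mulrA in h3; exact: arith key h1 h2 h3 h4 Hy Hc.
Qed.

(** The energies differ by twice the difference of the interactions, and a gap G in the second
    moments makes a gap of 2 M G in the interactions, M being the common mass. The hypothesis ranges
    over all centers because the one given by [J_le] depends on u. *)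
Lemma k0_gain u v G : nni mu u -> nni mu v ->
  (\int[mu]_x (u x ^+ 2)%:E = \int[mu]_x (v x ^+ 2)%:E)%E -> nint mu u = nint mu v ->
  (forall x, 1 <= enorm x -> v x = 0) -> (forall x, v (- x) = v x) ->
  (forall c, nint mu (fun x => v x * dot x x) + G <= nint mu (fun x => u x * cdist2 c x)) ->
  (kernel_energy k0 v + (4 * nint mu u * G)%:E <= kernel_energy k0 u)%E.
Proof.
move=> nu nv uv2 uv1 v1 ve H.
have := interaction_split nu (nni_measurable nu); rewrite uv2.
rewrite -(interaction_split nv (nni_measurable nv)).
have Q0 f : (0 <= kernel_energy k0 f)%E.
  by apply: integral_ge0 => z _; rewrite lee_fin mulr_ge0 ?sqr_ge0 ?k0_ge0.
move: (Q0 u) (Q0 v); case: (kernel_energy k0 u) => [a| |]//; case: (kernel_energy k0 v) => [b| |]// _ _;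
  rewrite ?leey// -?EFinD => -[E].
rewrite lee_fin; apply/ler_addgt0Pr => e e0.
(* The error 4 (e / 8) in the interaction is doubled in the energy, giving e. *)
have [|c Hc] := @J_le u (e / 8) nu; first by rewrite divr_gt0.
have Jv := J_ge nv v1 ve; have M0 : 0 <= nint mu u by apply: nint_ge0 => x; exact: nni_ge0 nu.
rewrite -uv1 in Jv.
have h : 2 * nint mu u * (nint mu (fun x => v x * dot x x) + G) <=
  2 * nint mu u * nint mu (fun x => u x * cdist2 c x) by rewrite ler_wpM2l// mulr_ge0.
rewrite mulrDr in h.
have -> : 4 * nint mu u * G = 2 * (2 * nint mu u * G) by ring.
have arith (ju jv M Y X : R) : a + 2 * ju = b + 2 * jv ->
  ju + 2 * M * X <= 68 * M ^+ 2 + 4 * (e / 8) -> 68 * M ^+ 2 <= jv + 2 * M * Y ->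
  2 * M * Y + 2 * M * G <= 2 * M * X -> b + 2 * (2 * M * G) <= a + e.
  by clear; lra.
exact: arith E Hc Jv h.
Qed.

End interaction.

(** * The fractional kernel *)

Section fractional_kernel.
Context {R : realType} {N : nat}.
Notation V := 'rV[R]_N.
Notation RN := (RN R N).
Notation mu := (lebm R N).
Notation omega := (omega (R := R) (N := N)).
Variable s : R.
Hypotheses (N2 : (2 <= N)%N) (s0 : 0 < s).
Implicit Types u v w f : V -> R.

Definition Kf (r : R) : R := ((Num.sqrt r) `^ (N%:R + 2 * s))^-1.

Lemma KfE r : Kf r = ((Num.sqrt r) `^ (N%:R + 2 * s))^-1.
Proof. by []. Qed.

Lemma Kf_ge0 r : 0 <= Kf r. Proof. by rewrite invr_ge0 powR_ge0. Qed.

Lemma Kf_gt0 r : 0 < r -> 0 < Kf r.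
Proof. by move=> r0; rewrite invr_gt0 powR_gt0// sqrtr_gt0. Qed.

Lemma measurable_Kf : measurable_fun setT Kf.
Proof.
rewrite (_ : Kf = (fun r => Num.sqrt r `^ (- (N%:R + 2 * s)))).
  have ms : measurable_fun setT (fun r : R => Num.sqrt r).
    by apply: measurable_sqrt; exact: measurable_id.
  exact: (measurableT_comp (@measurable_powR R (- (N%:R + 2 * s))) ms).
by apply/funext => r; rewrite powRN.
Qed.

Lemma exponent_ge2 : 2 <= N%:R + 2 * s.
Proof.
have : 2 <= (N%:R : R) by rewrite ler_nat.
by move=> h; rewrite (le_trans h)// lerDl mulr_ge0// ltW.
Qed.

(** The product r [Kf] r is nonincreasing because the exponent N + 2s is at least 2. This is the
    strict decrease out of which a multiple of [k0] is taken. *)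
Lemma Kf_decr r r' : 0 < r -> r <= r' -> Kf r' <= r / r' * Kf r.
Proof.
move=> r0 rr'; have r'0 := lt_le_trans r0 rr'.
rewrite /Kf; set P := _ + _; have P2 : 2 <= P := exponent_ge2.
set a := Num.sqrt r; set b := Num.sqrt r'.
have a0 : 0 < a by rewrite sqrtr_gt0.
have b0 : 0 < b by rewrite sqrtr_gt0.
have ab : a <= b by rewrite ler_sqrt// ltW.
have -> : r / r' = (a / b) ^+ 2 by rewrite expr_div_n !sqr_sqrtr ?ltW.
have t0 : 0 < a / b by rewrite divr_gt0.
have t1 : a / b <= 1 by rewrite ler_pdivrMr// mul1r.
have e : a `^ P = (a / b) `^ P * b `^ P by rewrite -powRM ?divfK ?ltW ?lt0r_neq0.
have h : (a / b) `^ P <= (a / b) ^+ 2.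
  by rewrite -powR_mulrn ?(ltW t0)// ger_powR// t0.
rewrite ler_pdivlMr ?powR_gt0// e mulrCA mulVf ?mulr1//.
by rewrite lt0r_neq0// powR_gt0.
Qed.

Lemma Kf_nincr r r' : 0 < r -> r <= r' -> Kf r' <= Kf r.
Proof.
move=> r0 rr'; apply: le_trans (Kf_decr r0 rr') _.
by rewrite ler_piMl ?Kf_ge0// ler_pdivrMr ?mul1r// (lt_le_trans r0).
Qed.

Lemma seminorm2E u : seminorm2 s u = kernel_energy Kf u.
Proof.
have E : (fun z : RN * RN => (`|u z.1 - u z.2| ^+ 2 / enorm ((z.1 : V) - z.2) `^ (N%:R + 2 * s))%:E) =
    (fun z : RN * RN => ((u z.1 - u z.2) ^+ 2 * Kf (dot ((z.1 : V) - z.2) ((z.1 : V) - z.2)))%:E).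
  by apply/funext => z; rewrite real_normK ?num_real// /Kf enormE.
by rewrite /seminorm2 E.
Qed.

(** For t < t' up to 36, [Kf_decr] makes [Kf] drop by at least Kf 36 (t' - t) / 36, while [k0] drops
    by at most 2 (t' - t); hence 72 = 36 * 2. *)
Definition eta : R := Kf 36 / 72.

Lemma eta_gt0 : 0 < eta. Proof. by rewrite divr_gt0// Kf_gt0. Qed.

(* eta is small enough for the remainder to be a decreasing kernel as well, so
   that symmetrization does not increase its energy either. *)
Definition K1 (r : R) : R := if r <= 0 then 0 else Kf r - eta * k0 r.

Lemma k0_far (r : R) : 36 <= r -> k0 r = 0.
Proof. by move=> h; rewrite /k0 max_l// ge_min; apply/orP; right; lra. Qed.

Lemma k0_slope (r r' : R) : 0 <= r -> r <= r' -> k0 r - k0 r' <= 2 * (r' - r).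
Proof.
move=> r0 rr'; rewrite /k0.
case: (leP (68 - r) (72 - 2 * r)) => h1; case: (leP (68 - r') (72 - 2 * r')) => h2;
case: (leP 0 _) => h3; case: (leP 0 _) => h4; lra.
Qed.

Lemma K1_decreasing : decreasing_kernel K1.
Proof.
have K36 : 0 < Kf 36 by rewrite Kf_gt0.
split.
- apply: measurable_fun_ifT.
  + by apply: measurable_fun_ler; [exact: measurable_id|exact: measurable_cst].
  + exact: measurable_cst.
  + apply: measurable_funB; first exact: measurable_Kf.
    by apply: measurable_funM; [exact: measurable_cst|exact: measurable_k0].
- move=> r; rewrite /K1; case: (leP r 0) => // r0; rewrite subr_ge0.
  have [h|h] := leP 36 r; first by rewrite k0_far// mulr0 Kf_ge0.
  apply: (@le_trans _ _ (eta * 68)).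
    by rewrite ler_wpM2l ?(ltW eta_gt0)// k0_le68 ?ltW.
  apply: le_trans (Kf_nincr r0 (ltW h)); rewrite /eta; lra.
move=> r r' r0 rr'; have r'0 := lt_le_trans r0 rr'.
have near (t t' : R) : 0 < t -> t <= t' -> t' <= 36 -> Kf t' - eta * k0 t' <= Kf t - eta * k0 t.
  move=> t0 tt' t36; have t'0 := lt_le_trans t0 tt'.
  have h := k0_slope (ltW t0) tt'; have d := Kf_decr t0 tt'.
  have k : Kf 36 <= Kf t by apply: Kf_nincr => //; exact: le_trans t36.
  have : eta * (k0 t - k0 t') <= eta * (2 * (t' - t)) by rewrite ler_wpM2l ?(ltW eta_gt0).
  have : eta * (2 * (t' - t)) <= Kf t - Kf t'.
    apply: (@le_trans _ _ (Kf t * ((t' - t) / t'))).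
      rewrite (_ : eta * (2 * (t' - t)) = Kf 36 * ((t' - t) / 36)); last by rewrite /eta; field.
      rewrite ler_pM ?Kf_ge0 ?divr_ge0 ?subr_ge0//.
      by rewrite ler_wpM2l ?subr_ge0// lef_pV2 ?posrE.
    have -> : Kf t * ((t' - t) / t') = Kf t - t / t' * Kf t by field; exact: lt0r_neq0.
    by rewrite lerD2l lerN2.
  by move=> e2 e1; clear -e1 e2; lra.
rewrite /K1 (leNgt r) (leNgt r') r0 r'0/=.
have [h|h] := leP r' 36; first exact: near.
have [h'|h'] := leP 36 r.
  by rewrite !k0_far ?(ltW h)// !mulr0 !subr0 Kf_nincr.
apply: (@le_trans _ _ (Kf 36 - eta * k0 36)); last by apply: near => //; exact: ltW.
by rewrite !k0_far ?(ltW h)// !mulr0 !subr0 Kf_nincr ?(ltW h).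
Qed.

Lemma energy_split u : measurable_fun setT (u : RN -> R) ->
  (kernel_energy Kf u = kernel_energy K1 u + eta%:E * kernel_energy (@k0 R) u)%E.
Proof.
move=> mu'; have [mK1 K10 _] := K1_decreasing.
rewrite /kernel_energy -ge0_integral_scale ?(ltW eta_gt0)//; last 2 first.
- by apply: measurable_energy => //; exact: measurable_k0.
- by move=> z; rewrite lee_fin mulr_ge0 ?sqr_ge0 ?k0_ge0.
rewrite -ge0_integral_add.
- apply: eq_integral => z _; rewrite -EFinM -EFinD; congr EFin.
  (* The modified value of [K1] at 0 concerns the diagonal only, where the difference of values is
     0. *)
  rewrite /K1; case: leP => h; last by ring.
  have -> : z.1 = z.2.
    apply/eqP; rewrite -subr_eq0; apply/eqP; apply: dot_eq0.
    by apply/eqP; rewrite eq_le h dot_ge0.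
  by rewrite subrr expr0n !mul0r mulr0 addr0.
- exact: measurable_energy.
- apply/measurable_EFinP; apply: measurable_funM => //; apply/measurable_EFinP.
  by apply: measurable_energy => //; exact: measurable_k0.
- by move=> z; rewrite lee_fin mulr_ge0 ?sqr_ge0.
- by move=> z; rewrite -EFinM lee_fin mulr_ge0 ?(ltW eta_gt0)// mulr_ge0 ?sqr_ge0 ?k0_ge0.
Qed.

(** A positive value at norm at least 1 would persist slightly farther out, and by monotonicity v
    would be positive on a ball of volume above [omega]. *)
Lemma radial_supp L v : (forall x y, `|v x - v y| <= L * enorm (x - y)) -> 0 <= L ->
  (forall x, 0 <= v x) ->
  (forall x y, enorm x <= enorm y -> v y <= v x) ->
  (mu [set x | (0 < v x)%R] <= omega%:E)%E -> forall x, 1 <= enorm x -> v x = 0.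
Proof.
move=> vL L0 v0 vr vo x x1; apply/eqP; rewrite eq_le v0 andbT leNgt; apply/negP => vx.
have xp : 0 < enorm x by exact: lt_le_trans x1.
pose dl := v x / (L + 1) / enorm x; have L1 : 0 < L + 1 by rewrite ltr_wpDl.
have d0 : 0 < dl by rewrite !divr_gt0.
have sub : eball 0 (1 + dl) `<=` [set y | 0 < v y].
  move=> y; rewrite /eball/= subr0 => y1.
  apply: (@lt_le_trans _ _ (v ((1 + dl) *: x))); last first.
    apply: vr; rewrite enormZ gtr0_norm ?addr_gt0//.
    by apply: (le_trans (ltW y1)); rewrite ler_peMr// ltW// addr_gt0.
  have := vL x ((1 + dl) *: x); rewrite scalerDl scale1r opprD addNKr enormN enormZ (gtr0_norm d0).
  have : L * (dl * enorm x) < v x.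
    rewrite /dl divfK ?lt0r_neq0// mulrC mulrAC ltr_pdivrMr//; nra.
  by rewrite ler_norml => h /andP[_ h2]; lra.
have mv : measurable [set y : RN | 0 < v y].
  by apply: measurable_lt; [exact: measurable_cst|exact: lipschitz_measurable vL].
have : (mu (eball 0 (1 + dl)) <= omega%:E)%E.
  apply: le_trans vo; apply: le_measure; rewrite ?inE//; exact: eball_measurable.
rewrite mu_eball ?addr_gt0// lee_fin leNgt => /negP; apply.
rewrite -[ltLHS]mul1r ltr_pM2r ?omega_gt0// exprn_egt1 ?ltrDl//.
by rewrite -lt0n (leq_trans _ N2).
Qed.

Lemma nni_admissible L rho M u : 0 < rho -> admissible L rho M u -> nni mu u.
Proof.
move=> r0 au; apply: (@nni_bounded R N u 0 rho M) => //; first exact: adm_measurable au.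
  by move=> x; rewrite (adm_ge0 au) (adm_le au).
by move=> x; rewrite subr0 => h; exact: (adm_supp au h).
Qed.

(** Symmetrizing with the remainder [K1] loses nothing there, and the [k0] part of weight [eta]
    yields the gain. [G] is quantified after v, since the gain available is read off from the levels
    of v. *)
Theorem symmetrization_gain L rho M u : 0 < rho -> 0 <= L -> admissible L rho M u ->
  (mu [set x | (0 < u x)%R] <= omega%:E)%E ->
  exists v, [/\ admissible L 1 M v,
    forall t, mu [set x | t < v x] = mu [set x | t < u x],
    forall x y, enorm x <= enorm y -> v y <= v x &
    forall G, 0 <= G ->
     (forall c, nint mu (fun x => v x * dot x x) + G <= nint mu (fun x => u x * cdist2 c x)) ->
     (kernel_energy Kf v + (4 * eta * nint mu u * G)%:E <= kernel_energy Kf u)%E].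
Proof.
move=> r0 L0 au uo; have [v [av uv K1v vr]] := symmetrization K1_decreasing r0 L0 au.
have v1 : forall x, 1 <= enorm x -> v x = 0.
  apply: (@radial_supp L) => //; [exact: adm_lip av|exact: adm_ge0 av|by rewrite uv].
have av1 : admissible L 1 M v.
  by split=> //; [exact: adm_lip av|exact: adm_ge0 av|exact: adm_le av].
exists v; split=> // G G0 HG.
have mu' := adm_measurable au; have mv := adm_measurable av.
have nu := nni_admissible r0 au; have nv := nni_admissible ltr01 av1.
have u0 := adm_ge0 au; have v0 := adm_ge0 av.
have vu : equimeasurable u v by move=> t; rewrite uv.
have sq : (\int[mu]_x (u x ^+ 2)%:E = \int[mu]_x (v x ^+ 2)%:E)%E.
  apply: (@equimeasurable_integral R N u v (fun r => r ^+ 2) Num.sqrt) => //.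
  - by move=> r _; exact: sqr_ge0.
  - move=> t r t0 r0'; rewrite -[X in _ = (X < _)]/(Num.sqrt t).
    by rewrite -{1}(sqr_sqrtr t0) ltr_pXn2r ?nnegrE ?sqrtr_ge0.
have one : nint mu u = nint mu v.
  by congr fine; apply: (@equimeasurable_integral R N u v id id).
have kg := k0_gain nu nv sq one v1 _ HG.
have {kg} : (kernel_energy (@k0 R) v + (4 * nint mu u * G)%:E <= kernel_energy (@k0 R) u)%E.
  by apply: kg => x; apply/eqP; rewrite eq_le !vr ?enormN.
move=> kg; rewrite !energy_split// (_ : 4 * eta * nint mu u * G = eta * (4 * nint mu u * G)); last by ring.
have e0 : (0 <= eta%:E :> \bar R)%E by rewrite lee_fin ltW// eta_gt0.
have Q0 f : (0 <= kernel_energy (@k0 R) f)%E.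
  by apply: integral_ge0 => z _; rewrite lee_fin mulr_ge0 ?sqr_ge0 ?k0_ge0.
have M0 : 0 <= nint mu u by apply: nint_ge0 => x; exact: u0.
have g0 : (0 <= (4 * nint mu u * G)%:E :> \bar R)%E by rewrite lee_fin !mulr_ge0.
rewrite -addeA EFinM -(@ge0_muleDr _ _ _ _ (Q0 v) g0).
by apply: leeD => //; exact: lee_wpmul2l.
Qed.

End fractional_kernel.

(** * Elementary inequalities for real powers *)

Section real_powers.
Context {R : realType}.
Implicit Types x p q v t : R.

Lemma bernoulli_sub x n : 0 <= x -> x <= 1 -> 1 - n%:R * x <= (1 - x) ^+ n.
Proof.
move=> x0 x1; elim: n => [|n IH]; first by rewrite mul0r subr0 expr0.
have y0 : 0 <= 1 - x by rewrite subr_ge0.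
have := ler_wpM2l y0 IH; rewrite -exprS => h; apply: le_trans h.
have : 0 <= n%:R * x * x by rewrite !mulr_ge0.
rewrite -natr1; lra.
Qed.

Lemma powR_pred_le q v : 1 <= q -> 0 < v -> v `^ (q - 1) <= 1 + v `^ q.
Proof.
move=> q1 v0; have [v1|v1] := leP v 1.
  rewrite (@le_trans _ _ 1)// ?lerDl ?powR_ge0//.
  by rewrite -[leRHS](powRr0 v) ger_powR ?v0// subr_ge0.
rewrite (@le_trans _ _ (v `^ q))// ?lerDr//.
by apply: ler_powR; [exact: ltW|rewrite gerBl].
Qed.

Lemma powR_pred q v : 0 < v -> v `^ q = v * v `^ (q - 1).
Proof.
by move=> v0; rewrite -{2}[v]powRr1 ?ltW// -powRD ?(addrC 1) ?subrK//; apply/implyP => _; rewrite lt0r_neq0.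
Qed.

(** Truncation at height t costs at most linearly in t. With x = t/v, Bernoulli is applied to the
    integer exponent k, and (1 - x)^k <= (1 - x)^q since q <= k. *)
Lemma powR_trunc_ge q t v k : 1 <= q -> q <= k%:R -> 0 <= t -> 0 <= v ->
  v `^ q - k%:R * t * (1 + v `^ q) <= (Num.max 0 (v - t)) `^ q.
Proof.
move=> q1 qk t0 v0; have q0 : 0 < q by exact: lt_le_trans q1.
have k1 : 1 <= (k%:R : R) by exact: le_trans qk.
have vq0 : 0 <= v `^ q := powR_ge0 _ _.
have pos : 0 <= k%:R * t * (1 + v `^ q) by rewrite !mulr_ge0// addr_ge0.
have [/eqP->|vn0] := boolP (v == 0).
  by rewrite powR0 ?lt0r_neq0// addr0 mulr1 sub0r (le_trans _ (powR_ge0 _ _))// oppr_le0 mulr_ge0.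
have vp : 0 < v by rewrite lt_neqAle eq_sym vn0.
have h := powR_pred_le q1 vp; have e := powR_pred q vp.
have [vt|tv] := leP v t.
  rewrite max_l ?subr_le0// powR0 ?lt0r_neq0// subr_le0 e.
  apply: (@le_trans _ _ (t * (1 + v `^ q))).
    by rewrite ler_pM ?powR_ge0// ltW.
  by rewrite -e -mulrA ler_peMl// mulr_ge0// addr_ge0.
rewrite max_r ?subr_ge0 ?(ltW tv)//.
pose x := t / v; have x0 : 0 <= x by rewrite divr_ge0.
have x1 : x <= 1 by rewrite ler_pdivrMr// mul1r ltW.
have -> : v - t = v * (1 - x) by rewrite /x; field; exact: lt0r_neq0.
have y0 : 0 <= 1 - x by rewrite subr_ge0.
rewrite powRM//.
apply: (@le_trans _ _ (v `^ q * (1 - k%:R * x))).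
  rewrite mulrBr mulr1 lerD2l lerN2.
  have -> : v `^ q * (k%:R * x) = k%:R * t * v `^ (q - 1).
    by rewrite e /x; field; exact: lt0r_neq0.
  by rewrite ler_wpM2l// mulr_ge0.
rewrite ler_wpM2l//; apply: le_trans (bernoulli_sub k x0 x1) _.
have [/eqP y1|yn] := boolP (1 - x == 0).
  rewrite y1 (powR0 (lt0r_neq0 q0)) expr0n; case: (k) k1 => // ; by rewrite ler10.
rewrite -powR_mulrn// ger_powR// lt_neqAle eq_sym yn y0 /=; lra.
Qed.

(** The tangent at 1 of the convex function x^(-p). *)
Lemma powR_neg_ge x p : 0 < x -> 0 <= p -> 1 + p * (1 - x) <= x `^ (- p).
Proof.
move=> x0 p0; rewrite /powR gt_eqF//; apply: le_trans (expR_ge1Dx _).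
rewrite lerD2l mulNr -mulrN ler_wpM2l//.
have h : -1 < x - 1 by lra.
have := le_ln1Dx h; rewrite (_ : 1 + (x - 1) = x); [lra|ring].
Qed.

End real_powers.

(** * Scaling of the energy and of the q-integral *)

Section energy_scaling.
Context {R : realType} {N : nat}.
Notation V := 'rV[R]_N.
Notation RN := (RN R N).
Notation mu := (lebm R N).
Notation mu2 := (@mu2 R N).
Notation omega := (omega (R := R) (N := N)).
Variable s : R.
Notation Kf := (@Kf R N s).
Implicit Types u v w f : V -> R.

Definition energy u : \bar R := kernel_energy Kf u.

Lemma energyE u : energy u = kernel_energy Kf u.
Proof. by []. Qed.

Lemma energy_ge0 u : (0 <= energy u)%E.
Proof. by apply: integral_ge0 => z _; rewrite lee_fin mulr_ge0 ?sqr_ge0 ?Kf_ge0. Qed.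

Lemma measurable_Kenergy u : measurable_fun setT (u : RN -> R) ->
  measurable_fun setT (fun z : RN * RN => ((u z.1 - u z.2) ^+ 2 * Kf (dist2 z))%:E : \bar R).
Proof. by move=> mu'; apply: measurable_energy => //; exact: measurable_Kf. Qed.

Lemma energy_le u v : measurable_fun setT (u : RN -> R) -> measurable_fun setT (v : RN -> R) ->
  (forall x y, `|u x - u y| <= `|v x - v y|) -> (energy u <= energy v)%E.
Proof.
move=> mu' mv uv; apply: le_ge0_integral; [exact: measurable_Kenergy..| |] => z.
  by rewrite lee_fin mulr_ge0 ?sqr_ge0 ?Kf_ge0.
by rewrite lee_fin ler_wpM2r ?Kf_ge0// -(real_normK (num_real (u _ - _))) -(real_normK (num_real (v _ - _)))
  lerXn2r ?nnegrE.
Qed.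

Lemma energyZ u a : measurable_fun setT (u : RN -> R) ->
  (energy (fun x => a * u x)%R = (a ^+ 2)%:E * energy u)%E.
Proof.
move=> mu'; rewrite /energy /kernel_energy -ge0_integral_scale ?sqr_ge0//; last 2 first.
- exact: measurable_Kenergy.
- by move=> z; rewrite lee_fin mulr_ge0 ?sqr_ge0 ?Kf_ge0.
by apply: eq_integral => z _; rewrite -EFinM; congr EFin; ring.
Qed.

Lemma Kf_scale t r : 0 < t -> Kf (t ^+ 2 * r) = t `^ (- (N%:R + 2 * s)) * Kf r.
Proof.
move=> t0; rewrite !KfE sqrtrM ?sqr_ge0// sqrtr_sqr gtr0_norm// powRM ?sqrtr_ge0 ?(ltW t0)//.
by rewrite powRN invfM.
Qed.

(** Each of the two variables contributes t^(-N), and the kernel t^(N + 2s). *)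
Lemma energy_dil u t a : 0 < t -> measurable_fun setT (u : RN -> R) ->
  (energy (fun x => u (t *: x + a))%R = (t `^ (2 * s - N%:R))%:E * energy u)%E.
Proof.
move=> t0 mu'; have dm := @dil_map R N t a (lt0r_neq0 t0).
rewrite gtr0_norm// in dm.
have mF := measurable_Kenergy mu'; set F : RN * RN -> \bar R := fun z => _ in mF.
have F0 z : (0 <= F z)%E by rewrite lee_fin mulr_ge0 ?sqr_ge0 ?Kf_ge0.
have h1 := leb_map_integral1 dm mF F0.
have mF1 := measurable_map1 dm mF.
have h2 := leb_map_integral2 dm mF1 (fun z => F0 _).
have md : measurable_fun setT (fun x : RN => u (t *: (x : V) + a)).
  exact: measurableT_comp mu' (leb_map_measurable dm).
have E : (energy u * (t ^- N * t ^- N)%:E =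
   (t `^ (- (N%:R + 2 * s)))%:E * energy (fun x => u (t *: x + a))%R)%E.
  rewrite /energy /kernel_energy -(@ge0_integral_scale _ _ (RN * RN)%type mu2); last 3 first.
  - exact: powR_ge0.
  - exact: (measurable_Kenergy md).
  - by move=> z; rewrite lee_fin mulr_ge0 ?sqr_ge0 ?Kf_ge0.
  rewrite muleC EFinM -muleA -h1 -h2; apply: eq_integral => z _.
  rewrite /F -EFinM; congr EFin; rewrite /dil /dist2/= opprD addrACA subrr addr0 -scalerBr.
  by rewrite dotZl dotZr mulrA -expr2 Kf_scale//; ring.
have e1 : t `^ (2 * s - N%:R) = (t ^- N * t ^- N) * t `^ (N%:R + 2 * s).
  rewrite -powR_mulrn ?(ltW t0)// -powRN -!powRD; [|by rewrite lt0r_neq0// implybT..].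
  congr powR; ring.
have p1 : t `^ (N%:R + 2 * s) * t `^ (- (N%:R + 2 * s)) = 1.
  by rewrite powRN divff// lt0r_neq0// powR_gt0.
rewrite e1 mulrC EFinM -muleA [X in (_ * X)%E]muleC E muleA -EFinM p1.
by rewrite mul1e.
Qed.

Section pint.
Variable q : R.
Hypothesis q1 : 1 <= q.
Let q0 : 0 < q. Proof. exact: lt_le_trans q1. Qed.

Definition pint u : R := nint mu (fun x => u x `^ q).

Lemma pintE u : pint u = nint mu (fun x => u x `^ q).
Proof. by []. Qed.

Lemma pint_ge0 u : 0 <= pint u.
Proof. by apply: nint_ge0 => x; exact: powR_ge0. Qed.

Lemma nni_pow L rho M u : 0 < rho -> admissible L rho M u -> nni mu (fun x => u x `^ q).
Proof.
move=> r0 au; have M0 : 0 <= M := le_trans (adm_ge0 au 0) (adm_le au 0).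
apply: (@nni_bounded R N _ 0 rho (M `^ q) r0).
- exact: measurableT_comp (@measurable_powR R q) (adm_measurable au).
- move=> x; rewrite powR_ge0/= ge0_ler_powR ?nnegrE ?(ltW q0)//.
    exact: adm_ge0 au x.
  exact: adm_le au x.
- by move=> x; rewrite subr0 => h; rewrite (adm_supp au h) powR0// lt0r_neq0.
Qed.

Lemma pintZ u a : nni mu (fun x => u x `^ q) -> 0 <= a -> (forall x, 0 <= u x) ->
  pint (fun x => a * u x) = a `^ q * pint u.
Proof.
move=> nu a0 u0; rewrite /pint -(nintZ (powR_ge0 a q) nu); congr nint.
by apply/funext => x; rewrite powRM.
Qed.

Lemma pint_dil u t a : 0 < t -> nni mu (fun x => u x `^ q) ->
  pint (fun x => u (t *: x + a)) = t ^- N * pint u.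
Proof.
move=> t0 nu; have dm := @dil_map R N t a (lt0r_neq0 t0).
rewrite gtr0_norm// in dm.
have h := leb_map_integral dm (nni_emeasurable nu).
rewrite /pint /nint; have -> : (\int[mu]_x (u (t *: (x : V) + a) `^ q)%:E =
   (t ^- N)%:E * \int[mu]_x (u x `^ q)%:E)%E.
  by rewrite -h => // x; rewrite lee_fin powR_ge0.
by rewrite (nintE nu).
Qed.

Lemma pint_equimeasurable u v : measurable_fun setT (u : RN -> R) ->
  measurable_fun setT (v : RN -> R) -> (forall x, 0 <= u x) -> (forall x, 0 <= v x) ->
  equimeasurable u v -> pint u = pint v.
Proof.
move=> mu' mv u0 v0 uv; congr fine.
apply: (@equimeasurable_integral R N u v (fun r => r `^ q) (fun t => t `^ q^-1)) => //.
- by move=> r _; exact: powR_ge0.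
- move=> t r t0 r0; have e : t = (t `^ q^-1) `^ q by rewrite -powRrM mulVf ?lt0r_neq0// powRr1.
  apply/idP/idP => h.
    rewrite ltNge; apply/negP => h'; move: h; rewrite e ltNge ge0_ler_powR ?nnegrE ?powR_ge0//.
    exact: ltW.
  by rewrite {1}e gt0_ltr_powR ?nnegrE ?powR_ge0.
Qed.

End pint.

End energy_scaling.

(** * Quantitative inequality in the unit ball *)

Lemma trunc_lip (R : realDomainType) (a b t : R) :
  `|Num.max 0 (a - t) - Num.max 0 (b - t)| <= `|a - b|.
Proof.
have h1 := ler_norm (a - b); have := ler_norm (- (a - b)); rewrite normrN => h2.
by rewrite ler_norml; case: (leP 0 (a - t)) => ?; case: (leP 0 (b - t)) => ?; apply/andP; split; lra.
Qed.

Section arithmetic.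
Variable R : realFieldType.
Implicit Types b o r x z : R.

Lemma half_gap b o : b <= o -> o / 2 <= o - b / 2.
Proof. lra. Qed.

Lemma split_gap b o r x : b <= x + (o - r) -> o - b / 2 < r -> b / 2 <= x.
Proof. lra. Qed.

Lemma quad_gap z : 0 <= z -> z <= 1 -> 1 + z / 2 <= (1 + z) * (1 - z / 8) ^+ 2.
Proof. nra. Qed.

End arithmetic.

Section core.
Context {R : realType} {N : nat}.
Notation V := 'rV[R]_N.
Notation RN := (RN R N).
Notation mu := (lebm R N).
Notation omega := (omega (R := R) (N := N)).
Variables s q : R.
Hypotheses (N2 : (2 <= N)%N) (s0 : 0 < s) (s1 : s < 1) (q1 : 1 <= q) (q2 : q < crit_exp N s).
Notation energy := (@energy R N s).
Notation pint := (@pint R N q).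
Implicit Types u v w f : V -> R.

Let q0 : 0 < q. Proof. exact: lt_le_trans q1. Qed.
Let N0 : (0 < N)%N. Proof. exact: leq_trans N2. Qed.
Let Np : 0 < (N%:R : R). Proof. by rewrite ltr0n. Qed.
Let Nge2 : 2 <= (N%:R : R). Proof. by rewrite ler_nat. Qed.
Let o0 := @omega_gt0 R N.

(** The power of the volume that makes its product with the eigenvalue scale-invariant; it is
    positive because q is subcritical. *)
Definition scale_exp : R := 2 / q - 1 + 2 * s / N%:R.

Notation p := scale_exp.

Lemma scale_exp_gt0 : 0 < p.
Proof.
have d : 0 < N%:R - 2 * s.
  by rewrite subr_gt0 (lt_le_trans _ Nge2)// -[ltRHS]mulr1 ltr_pM2l.
have h : N%:R - 2 * s < 2 * N%:R / q.
  by rewrite ltr_pdivlMr// mulrC -ltr_pdivlMr.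
rewrite /scale_exp (_ : _ + _ = (2 * N%:R / q - (N%:R - 2 * s)) / N%:R); last first.
  by field; rewrite !lt0r_neq0.
by rewrite divr_gt0// subr_gt0.
Qed.

Lemma scale_exp_le2 : p <= 2.
Proof.
have a : 2 / q <= 2 by rewrite ler_pdivrMr// ler_peMr.
have b : 2 * s / N%:R <= 1.
  by rewrite ler_pdivrMr// mul1r (le_trans _ Nge2)// ger_pMr// ltW.
rewrite /scale_exp; lra.
Qed.

Definition radial_dec v := forall x y, enorm x <= enorm y -> v y <= v x.

(** These functions represent the unit ball: symmetrization leads into this class, and [Lam] below
    will be the best constant on it. *)
Definition nice w := exists L M, [/\ 0 <= L, admissible L 1 M w & radial_dec w].

Variable Lam : R.
Hypotheses (Lam0 : 0 < Lam)
  (HLam : forall w, nice w -> ((Lam * pint w `^ (2 / q))%:E <= energy w)%E).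

Lemma nice_trunc v r t : nice v -> 0 < r -> 0 <= t -> (forall x, r <= enorm x -> v x <= t) ->
  nice (fun x => Num.max 0 (v (r *: x) - t)).
Proof.
move=> [L [M [L0 av rv]]] r0 t0 vt; exists (L * r), M; split; first by rewrite mulr_ge0// ltW.
  split=> [x y|x|x|x x1].
  - apply: (le_trans (trunc_lip _ _ _)); apply: (le_trans (adm_lip av _ _)).
    by rewrite -scalerBr enormZ gtr0_norm// mulrA.
  - by rewrite le_max lexx.
  - have M0 := le_trans (adm_ge0 av 0) (adm_le av 0).
    by rewrite ge_max M0/= lerBlDr (le_trans (adm_le av _))// lerDl.
  - rewrite max_l// subr_le0; apply: vt.
    by rewrite enormZ gtr0_norm// ler_peMr// ltW.
move=> x y xy; rewrite ge_max le_max lexx/= le_max; apply/orP; right.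
by rewrite lerD2r rv// !enormZ ler_wpM2l.
Qed.

(* If a low superlevel set of v is noticeably smaller than the unit ball, cutting
   v at that level and dilating the result back to the unit ball gains. *)
Lemma small_levels : exists2 th, 0 < th & forall b v, 0 < b -> b <= omega -> nice v -> pint v = 1 ->
  (mu [set x | (th * b < v x)%R] <= (omega - b / 2)%:E)%E ->
  ((Lam * (1 + p * b / (4 * omega)))%:E <= energy v)%E.
Proof.
have p0 := scale_exp_gt0; have p2 := scale_exp_le2.
have [k qk] : exists k : nat, q <= k%:R by exists (Num.truncn q).+1; exact: ltW (truncnS_gt q).
have k1 : 1 <= (k%:R : R) := le_trans q1 qk.
have kp : 0 < (k%:R : R) by exact: lt_le_trans k1.
have o1 : 0 < 1 + omega by rewrite addr_gt0.
(* With z = p b / (2 omega), truncation at height th b loses at most y = z/8 of the q-integral,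
   while the dilation gains a factor at least 1 + z; [quad_gap] leaves 1 + z/2. *)
pose th := p / (16 * omega * k%:R * (1 + omega)).
have th0 : 0 < th by rewrite divr_gt0// !mulr_gt0.
exists th => // b v b0 bo nv pv mv.
have [L [M [L0 av rv]]] := nv.
pose t := th * b; have t0 : 0 <= t by rewrite mulr_ge0// ltW.
pose w x := Num.max 0 (v x - t).
have v0 := adm_ge0 av.
have npv := nni_pow q1 ltr01 av.
have ballm := @eball_measurable R N 0 1.
have n1 : nni mu (\1_(eball 0 1 : set RN) : V -> R).
  by apply: nni_indic => //; exact: mu_eball_lty.
have aw1 : admissible L 1 M w.
  have := @nice_trunc v 1 t nv ltr01 t0; have M0 := le_trans (v0 0) (adm_le av 0).
  split=> [x y|x|x|x x1].
  - exact: le_trans (trunc_lip _ _ _) (adm_lip av _ _).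
  - by rewrite le_max lexx.
  - by rewrite ge_max M0/= lerBlDr (le_trans (adm_le av _))// lerDl.
  - by rewrite /w (adm_supp av x1) max_l// sub0r oppr_le0.
have mw := adm_measurable aw1; have mv' := adm_measurable av.
have npw := nni_pow q1 ltr01 aw1.
pose y := k%:R * t * (1 + omega).
have yE : y = p * (b / (2 * omega)) / 8.
  by rewrite /y /t /th; field; rewrite !lt0r_neq0.
have z0 : 0 <= p * (b / (2 * omega)) by rewrite mulr_ge0 ?divr_ge0 ?mulr_ge0// ltW.
have z1 : p * (b / (2 * omega)) <= 1.
  rewrite (_ : 1 = 2 * (1 / 2)); last by field.
  apply: ler_pM => //; [exact: ltW|by rewrite divr_ge0// ?mulr_ge0 ?ltW|].
  rewrite ler_pdivrMr ?mulr_gt0//; lra.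
have P1 : 1 - y <= pint w.
  have kt0 : 0 <= k%:R * t by rewrite mulr_ge0.
  have nS := nniD n1 npv; have nK := nniZ kt0 nS.
  have : pint v <= pint w + k%:R * t * (omega + pint v).
    rewrite !pintE.
    have -> : omega + nint mu (fun x => v x `^ q) = nint mu (fun x => \1_(eball 0 1) x + v x `^ q).
      by rewrite (nintD n1 npv) nint_lebm// mu_eball//= expr1n mul1r.
    rewrite -(nintZ kt0 nS) -(nintD npw nK); apply: nint_le; [exact: npv|exact: nniD|] => x.
    have [x1|x1] := ltP (enorm x) 1.
      have -> : \1_(eball 0 1) x = 1 :> R.
        by rewrite indicE mem_set//= /eball/= subr0.
      by rewrite -lerBlDr; apply: powR_trunc_ge.
    rewrite (adm_supp av x1) powR0 ?lt0r_neq0// addr_ge0 ?powR_ge0// mulr_ge0//.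

  by rewrite pv (addrC omega) -/y lerBlDr.
have y1 : 0 < 1 - y by rewrite yE subr_gt0 ltr_pdivrMr// mul1r (le_lt_trans z1)// ltr1n.
have [ve|[r [r0 r1 rE]]] := level_ball N0 L0 (adm_lip av) rv t0 (adm_supp av).
  exfalso; have : pint w = 0.
    rewrite !pintE (_ : (fun x => _) = fun=> 0) ?nint0//; apply/funext => x.
    rewrite /w max_l ?powR0 ?lt0r_neq0// subr_le0 leNgt; apply/negP => tv.
    by have : [set x | t < v x] x := tv; rewrite ve.
  by move=> e; move: P1; rewrite e leNgt y1.
have vt x : r <= enorm x -> v x <= t.
  move=> rx; rewrite leNgt; apply/negP => tv; have : [set x | t < v x] x := tv.
  by rewrite rE /eball/= subr0 ltNge rx.
have nw := nice_trunc nv r0 t0 vt.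
apply: (@le_trans _ _ (energy w)); last first.
  by apply: energy_le => // x x'; exact: trunc_lip.
have := HLam nw.
have -> : (fun x => Num.max 0 (v (r *: x) - t)) = (fun x => w (r *: x + 0)).
  by apply/funext => x; rewrite addr0.
rewrite energy_dil// pint_dil//.
have := energy_ge0 s w; case: (energy w) => [e| |]//; last by move=> _ _; rewrite leey.
rewrite -EFinM !lee_fin => e0 H.
have rN : r ^+ N <= 1 - b / (2 * omega).
  move: mv; rewrite -/t rE mu_eball// lee_fin => h.
  rewrite -(ler_pM2r o0); apply: (le_trans h).
  by rewrite le_eqVlt; apply/orP; left; apply/eqP; field; rewrite lt0r_neq0.
have rN0 : 0 < r ^+ N by rewrite exprn_gt0.
(* The superlevel set is the ball of radius r, so w dilated by r lives in the unit ball and [Lam]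
   applies to it; undoing the dilation produces the power -p of r^N. *)
have key : Lam * ((r ^+ N) `^ (- p) * pint w `^ (2 / q)) <= e.
  have m : 0 <= r `^ (N%:R - 2 * s) := powR_ge0 _ _.
  have := ler_wpM2l m H; rewrite mulrA -powRD; last by rewrite (lt0r_neq0 r0) implybT.
  rewrite addrA subrK subrr powRr0 mul1r => h; apply: le_trans h.
  rewrite powRM ?invr_ge0 ?(ltW rN0) ?pint_ge0// [leRHS]mulrCA ler_wpM2l ?(ltW Lam0)//.
  rewrite [leRHS]mulrA ler_wpM2r ?powR_ge0// -powR_mulrn ?(ltW r0)// -powRN -!powRrM -powRD; last first.
    by rewrite (lt0r_neq0 r0) implybT.
  rewrite le_eqVlt; apply/orP; left; apply/eqP; congr powR; rewrite /scale_exp; field.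
  by rewrite !lt0r_neq0.
apply: le_trans key; rewrite ler_pM2l//.
have h1 := powR_neg_ge rN0 (ltW p0).
have h2 : (1 - y) ^+ 2 <= pint w `^ (2 / q).
  apply: (@le_trans _ _ ((1 - y) `^ (2 / q))).
    rewrite -powR_mulrn ?(ltW y1)// ger_powR// ?y1/=; last by rewrite ler_pdivrMr// ler_peMr.
    by rewrite gerBl /y mulr_ge0 ?(ltW o1)// mulr_ge0// ltW.
  by rewrite ge0_ler_powR ?nnegrE ?pint_ge0 ?(ltW y1)// divr_ge0// ltW.
apply: (@le_trans _ _ ((1 + p * (b / (2 * omega))) * (1 - y) ^+ 2)); last first.
  apply: ler_pM => //; [by rewrite addr_ge0|exact: sqr_ge0|].
  by apply: le_trans h1; rewrite lerD2l ler_wpM2l ?(ltW p0)// lerBrDl -lerBrDr.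
have -> : p * b / (4 * omega) = p * (b / (2 * omega)) / 2 by field; rewrite lt0r_neq0.
by rewrite yE; exact: quad_gap.
Qed.

Notation eta := (@eta R N s).

Lemma mu_diff (A B : set RN) : measurable A -> measurable B -> (mu A < +oo)%E -> B `<=` A ->
  (mu (A `\` B) = mu A - mu B)%E.
Proof. by move=> mA mB Aoo BA; rewrite measureD// setIidr. Qed.

(** Three cases according to the levels of the rearrangement v: a low level smaller than the unit
    ball by b/2, a level of height th omega of less than half the volume, or neither. The first two
    gain through [small_levels], the third through the second moments. *)
Lemma core_normalized : exists2 C, 0 < C & forall b L rho M u (O : set V),
  0 < rho -> 0 <= L -> admissible L rho M u -> (forall x, 0 < u x -> O x) ->
  measurable (O : set RN) -> (mu O <= omega%:E)%E -> 0 <= b -> b <= omega ->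
  (forall c, (b%:E <= mu (eball c 1 `\` O))%E) -> pint u = 1 ->
  ((Lam + C * b ^+ 3)%:E <= energy u)%E.
Proof.
have p0 := scale_exp_gt0; have [th th0 Hth] := small_levels; have eta0 := @eta_gt0 R N s.
pose c1 := Lam * p / (4 * omega ^+ 3).
pose c2 := 4 * eta * (th * omega * (omega / 2)) * ((1 / 2) ^+ 2 / (8 * omega * N%:R) * th).
have c10 : 0 < c1 by rewrite divr_gt0 ?mulr_gt0// exprn_gt0.
have c20 : 0 < c2.
  have a1 : 0 < 4 * eta * (th * omega * (omega / 2)) by rewrite !mulr_gt0// invr_gt0.
  have a2 : 0 < (1 / 2) ^+ 2 / (8 * omega * N%:R) :> R.
    by rewrite divr_gt0 ?exprn_gt0 ?divr_gt0// !mulr_gt0.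
  by rewrite /c2 mulr_gt0// mulr_gt0.
exists (Num.min c1 c2); first by rewrite lt_min c10.
move=> b L rho M u O r0 L0 au uO mO Oo b0 bo bO pu.
have mu' := adm_measurable au.
have muO : (mu [set x | (0 < u x)%R] <= omega%:E)%E.
  apply: le_trans Oo; apply: le_measure; rewrite ?inE//.
  by apply: measurable_lt => //; exact: measurable_cst.
have [v [av uv rv gain]] := symmetrization_gain N2 s0 r0 L0 au muO.
have v0 := adm_ge0 av; have u0 := adm_ge0 au; have mv := adm_measurable av.
have nv : nice v by exists L, M.
have pv : pint v = 1 by rewrite -pu; apply: pint_equimeasurable.
have Ev : (Lam%:E <= energy v)%E by have := HLam nv; rewrite pv powR1 mulr1.
have nu := nni_admissible r0 au; have nnv := nni_admissible ltr01 av.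
have nmv := nni_supp1_moment nnv (adm_supp av).
have ncu c : nni mu (fun x => u x * cdist2 c x).
  apply: (nni_le nu) => [|x].
    by apply: measurable_funM => //; exact: measurable_cdist2.
  by rewrite mulr_ge0 ?cdist2_ge0//= ler_piMr ?cdist2_le1.
have gain0 : (energy v <= energy u)%E.
  have := gain 0 (lexx _); rewrite mulr0 adde0; apply => c; rewrite addr0.
  have := level_gain (b := 0) (T := 0) N0 L0 (adm_lip av) rv (adm_supp av) v0 u0 mu' nmv (ncu c)
    uv (lexx _) (lexx _) _.
  by rewrite mulr0 addr0; apply => t t0; rewrite ltNge t0.
have b3 : b ^+ 3 <= b * omega ^+ 2.
  by rewrite exprS ler_wpM2l// lerXn2r ?nnegrE ?(ltW o0).
have [bz|bn] := eqVneq b 0.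
  by rewrite bz expr0n mulr0 addr0 (le_trans Ev).
have bp : 0 < b by rewrite lt_neqAle eq_sym bn.
have mC1 : Num.min c1 c2 <= c1 by rewrite ge_min lexx.
have mC2 : Num.min c1 c2 <= c2 by rewrite ge_min lexx orbT.
have [h|h] := leP (mu [set x | (th * b < v x)%R]) (omega - b / 2)%:E.
  apply: (le_trans _ gain0); apply: (le_trans _ (Hth b v bp bo nv pv h)).
  rewrite lee_fin mulrDr mulr1 lerD2l.
  apply: (@le_trans _ _ (c1 * (b * omega ^+ 2))).
    by apply: ler_pM => //; rewrite ?exprn_ge0// le_min !ltW.
  by rewrite le_eqVlt /c1; apply/orP; left; apply/eqP; field; rewrite lt0r_neq0.
(* [small_levels] is used again with omega in place of b. If it does not conclude, v exceeds th
   omega on more than half the volume, which bounds its mass from below; the gain of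
   [symmetrization_gain] is proportional to the mass. *)
have [h2|h2] := leP (mu [set x | (th * omega < v x)%R]) (omega - omega / 2)%:E.
  apply: (le_trans _ gain0); apply: (le_trans _ (Hth omega v o0 (lexx _) nv pv h2)).
  rewrite lee_fin mulrDr mulr1 lerD2l.
  apply: (@le_trans _ _ (c1 * omega ^+ 3)).
    by apply: ler_pM => //; rewrite ?exprn_ge0 ?le_min ?(ltW c10) ?(ltW c20)// lerXn2r ?nnegrE ?(ltW o0).
  by rewrite le_eqVlt /c1; apply/orP; left; apply/eqP; field; rewrite lt0r_neq0.
pose T := th * b; have T0 : 0 <= T by rewrite mulr_ge0// ltW.
pose G := (b / 2) ^+ 2 / (8 * omega * N%:R) * T.
have G0 : 0 <= G by rewrite /G mulr_ge0// divr_ge0 ?sqr_ge0// !mulr_ge0// ltW.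
have Mlow : th * omega * (omega / 2) <= nint mu u.
  have mS : measurable [set x : RN | th * omega < u x].
    by apply: measurable_lt => //; exact: measurable_cst.
  have Soo : (mu [set x : RN | (th * omega < u x)%R] < +oo)%E.
    apply: (@le_lt_trans _ _ (omega%:E)%E); last exact: ltry.
    apply: le_trans muO; apply: le_measure; rewrite ?inE//.
      by apply: measurable_lt => //; exact: measurable_cst.
    by move=> x /=; apply: lt_trans; rewrite mulr_gt0.
  have nS : nni mu (\1_[set x : RN | th * omega < u x] : V -> R) by apply: nni_indic.
  have k0' : 0 <= th * omega by rewrite mulr_ge0 ?ltW.
  apply: (@le_trans _ _ (nint mu (fun x => th * omega * \1_[set x : RN | th * omega < u x] x))).
    rewrite (nintZ k0' nS) nint_lebm// ler_wpM2l//.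
    have fm : mu [set x : RN | (th * omega < u x)%R] \is a fin_num by rewrite ge0_fin_numE.
    rewrite -lee_fin fineK// -uv; apply: ltW; apply: le_lt_trans h2.
    by rewrite lee_fin half_gap.
  apply: nint_le; [exact: nniZ k0' nS|exact: nu|] => x.
  rewrite indicE; case: (boolP (x \in _)) => [/set_mem/ltW|_]; first by rewrite mulr1.
  by rewrite mulr0.
have GI c : nint mu (fun x => v x * dot x x) + G <= nint mu (fun x => u x * cdist2 c x).
  have b20 : 0 <= b / 2 by rewrite divr_ge0.
  apply: (level_gain N0 L0 (adm_lip av) rv (adm_supp av) v0 u0 mu' nmv (ncu c) uv b20 T0) => t t0 tT.
  (* Below height T the level ball differs from the unit ball by less than b/2 in volume. Of the
     measure b missed by [O] in the unit ball about c, at least b/2 therefore lies in the level ball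
     about c. *)
  have lv : ((omega - b / 2)%:E < mu [set x | (t < v x)%R])%E.
    apply: (lt_le_trans h); apply: le_measure; rewrite ?inE.
    - by apply: measurable_lt => //; exact: measurable_cst.
    - by apply: measurable_lt => //; exact: measurable_cst.
    - by move=> x /=; apply: lt_trans.
  have ob : 0 <= omega - b / 2 by rewrite (le_trans _ (half_gap bo))// divr_ge0// ltW.
  split.
    apply/set0P/negP => /eqP e; move: lv; rewrite e measure0 lte_fin ltNge ob //.
  move=> r rp r1 rE; move: lv; rewrite rE mu_eball// lte_fin => lv; split.
    by rewrite -(ler_pM2r o0) ltW// (le_lt_trans _ lv)// mulrAC mul1r half_gap.
  have mB1 := @eball_measurable R N c 1; have mBr := @eball_measurable R N c r.
  have mE : measurable [set x : RN | t < u x] by apply: measurable_lt => //; exact: measurable_cst.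
  have mX : measurable (eball c r `\` [set x | t < u x] : set RN) by exact: measurableD.
  have mY : measurable (eball c 1 `\` eball c r : set RN) by exact: measurableD.
  have rsub : eball c r `<=` eball c 1 by move=> x /lt_le_trans; exact.
  have mYE : mu (eball c 1 `\` eball c r) = (omega - r ^+ N * omega)%:E.
    by rewrite (mu_diff mB1 mBr (mu_eball_lty c ltr01) rsub) !mu_eball// expr1n mul1r.
  have : (b%:E <= mu (eball c r `\` [set x | (t < u x)%R]) + mu (eball c 1 `\` eball c r))%E.
    apply: (le_trans (bO c)).
    apply: (@le_trans _ _ (mu ((eball c r `\` [set x | (t < u x)%R]) `|` (eball c 1 `\` eball c r)))); last first.
      by apply: measureU2.
    apply: le_measure; rewrite ?inE; [exact: measurableD|exact: measurableU|].
    move=> x [x1 xO]; have [xr|xr] := pselect (eball c r x); [left|by right].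
    by split=> //= tu; apply: xO; apply: uO; exact: le_lt_trans tu.
  have fX : mu (eball c r `\` [set x | (t < u x)%R]) \is a fin_num.
    rewrite ge0_fin_numE//; apply: (@le_lt_trans _ _ (mu (eball c r))); last exact: mu_eball_lty.
    by apply: le_measure; rewrite ?inE// => x [].
  by rewrite mYE -(fineK fX) -EFinD lee_fin => /split_gap; exact.
have Gn := gain G G0 GI.
apply: le_trans Gn; rewrite EFinD; apply: leeD => //.
rewrite lee_fin; apply: (@le_trans _ _ (c2 * b ^+ 3)).
  by rewrite ler_wpM2r// exprn_ge0.
have -> : c2 * b ^+ 3 = 4 * eta * (th * omega * (omega / 2)) * G.
  by rewrite /c2 /G /T; field; rewrite !lt0r_neq0.
by rewrite ler_wpM2r// ler_wpM2l// mulr_ge0// ltW.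
Qed.

(** Both sides are homogeneous of degree 2, so u is normalized by the factor [pint u] to the power
    -1/q; a vanishing q-integral makes the bound trivial. *)
Theorem core_stability : exists2 C, 0 < C & forall b L rho M u (O : set V),
  0 < rho -> 0 <= L -> admissible L rho M u -> (forall x, 0 < u x -> O x) ->
  measurable (O : set RN) -> (mu O <= omega%:E)%E -> 0 <= b -> b <= omega ->
  (forall c, (b%:E <= mu (eball c 1 `\` O))%E) ->
  (((Lam + C * b ^+ 3) * pint u `^ (2 / q))%:E <= energy u)%E.
Proof.
have [C C0 H] := core_normalized; exists C => // b L rho M u O r0 L0 au uO mO Oo b0 bo bO.
have [z|nz] := eqVneq (pint u) 0.
  by rewrite z powR0 ?mulr0 ?energy_ge0// mulf_neq0// ?invr_neq0 ?lt0r_neq0.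
have P0 : 0 < pint u by rewrite lt_neqAle eq_sym nz pint_ge0.
pose a := (pint u) `^ (- q^-1); have a0 : 0 < a by rewrite powR_gt0.
have M0 := le_trans (adm_ge0 au 0) (adm_le au 0).
have au' : admissible (a * L) rho (a * M) (fun x => a * u x).
  split=> [x y|x|x|x rx].
  - by rewrite -mulrBr normrM gtr0_norm// -mulrA ler_wpM2l ?(ltW a0)// (adm_lip au).
  - by rewrite mulr_ge0 ?(ltW a0)// (adm_ge0 au).
  - by rewrite ler_wpM2l ?(ltW a0)// (adm_le au).
  - by rewrite (adm_supp au rx) mulr0.
have nu := nni_pow q1 r0 au.
have pa : a `^ q = (pint u)^-1.
  by rewrite /a -powRrM mulNr mulVf ?lt0r_neq0// powR_inv1// pint_ge0.
have p1 : pint (fun x => a * u x) = 1.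
  by rewrite pintZ ?(ltW a0)//; [rewrite pa mulVf|exact: adm_ge0 au].
have aL : 0 <= a * L by rewrite mulr_ge0// ltW.
have := H b _ _ _ _ O r0 aL au' _ mO Oo b0 bo bO p1.
have pos x : 0 < a * u x -> O x by rewrite pmulr_rgt0//; exact: uO.
move=> /(_ pos); rewrite energyZ; last exact: adm_measurable au.
have := energy_ge0 s u; case: (energy u) => [e| |]//; last by move=> _ _; rewrite leey.
rewrite -EFinM !lee_fin => e0 h.
have e1 : pint u `^ (2 / q) * a ^+ 2 = 1.
  rewrite -powR_mulrn ?(ltW a0)// /a -powRrM -powRD ?nz ?implybT//.
  by rewrite (_ : _ + _ = 0) ?powRr0//; ring.
have := ler_wpM2l (powR_ge0 (pint u) (2 / q)) h.
by rewrite mulrA e1 mul1r mulrC.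
Qed.

End core.

(** * The optimal constant of the ball *)

Section shells.
Context {R : realType} {N : nat}.
Notation V := 'rV[R]_N.
Notation RN := (RN R N).
Notation mu := (lebm R N).
Notation mu2 := (@mu2 R N).
Notation omega := (omega (R := R) (N := N)).
Implicit Types f : V -> R.

Lemma geometric_le (z : R) n : 0 <= z -> z < 1 -> \sum_(0 <= k < n) z ^+ k <= (1 - z)^-1.
Proof.
move=> z0 z1; have d : 0 < 1 - z by rewrite subr_gt0.
rewrite -[leRHS]mul1r ler_pdivlMr// mulrC.
have -> : (1 - z) * \sum_(0 <= k < n) z ^+ k = 1 - z ^+ n.
  elim: n => [|n IH]; first by rewrite big_geq// mulr0 expr0 subrr.
  by rewrite big_nat_recr//= mulrDr IH exprS; ring.
by rewrite gerBl exprn_ge0.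
Qed.

(** Balls of geometric radii take the place of polar coordinates: f is at most the sum of the a_k on
    the balls of radius r_k, whose integrals form a geometric series. *)
Lemma nni_shells f (a r : nat -> R) (A z : R) : measurable_fun setT (f : RN -> R) ->
  (forall x, 0 <= f x) -> (forall k, 0 <= a k) -> (forall k, 0 < r k) -> 0 <= A -> 0 <= z -> z < 1 ->
  (forall k, a k * r k ^+ N <= A * z ^+ k) ->
  (forall x, f x = 0 \/ exists2 k, eball 0 (r k) x & f x <= a k) -> nni mu f.
Proof.
move=> mf f0 a0 r0 A0 z0 z1 arz fa; split=> //.
pose F k : RN -> \bar R := fun x => (a k * \1_(eball 0 (r k)) x)%:E.
have F0 k x : (0 <= F k x)%E by rewrite lee_fin mulr_ge0.
have mB k := @eball_measurable R N 0 (r k).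
have nB k : nni mu (\1_(eball 0 (r k) : set RN) : V -> R).
  by apply: nni_indic => //; exact: mu_eball_lty.
have mF k : measurable_fun setT (F k) by exact: nni_emeasurable (nniZ (a0 k) (nB k)).
apply: (@le_lt_trans _ _ (\int[mu]_x (\sum_(k <oo) F k x))%E).
  apply: le_ge0_integral.
  - exact/measurable_EFinP.
  - by apply: ge0_emeasurable_sum.
  - by move=> x; rewrite lee_fin.
  move=> x; case: (fa x) => [->|[k kx fk]]; first by apply: nneseries_ge0.
  apply: (@le_trans _ _ (F k x)).
    by rewrite lee_fin indicE mem_set// mulr1.
  by apply: (@nneseries_ge_term _ (fun k => F k x)).
rewrite (@integral_nneseries _ RN R mu)//.
apply: (@le_lt_trans _ _ (A * omega * (1 - z)^-1)%:E); last exact: ltry.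
apply: lime_le; first by apply: is_cvg_nneseries => k _ _; apply: integral_ge0.
apply: nearW => n; apply: (@le_trans _ _ (\sum_(0 <= k < n) (A * omega * z ^+ k)%:E)%E).
  apply: lee_sum => k _; rewrite (nintE (nniZ (a0 k) (nB k))) (nintZ (a0 k) (nB k)) nint_lebm// mu_eball//= lee_fin.
  by rewrite mulrA [leRHS]mulrAC ler_wpM2r// ltW// omega_gt0.
rewrite sumEFin lee_fin -mulr_sumr ler_wpM2l ?geometric_le// mulr_ge0//.
by rewrite ltW// omega_gt0.
Qed.

Lemma dyadic_small (t : R) : 0 < t -> t < 1 -> exists k, 2^-1 ^+ k.+1 <= t < 2^-1 ^+ k.
Proof.
move=> t0 t1; have ex : exists k, 2^-1 ^+ k.+1 <= t.
  exists (Num.truncn t^-1); rewrite exprVn -[leRHS]invrK lef_pV2 ?posrE ?exprn_gt0 ?invr_gt0//.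
  apply: (le_trans (ltW (truncnS_gt _))); rewrite -natrX ler_nat.
  exact: ltnW (ltn_expl _ (ltnSn 1)).
case: (ex_minnP ex) => k kt kmin; exists k; rewrite kt/=.
case: k kt kmin => [|k] kt kmin; first by rewrite expr0.
by rewrite ltNge; apply/negP => /kmin; rewrite ltnn.
Qed.

Lemma dyadic_large (t : R) : 1 <= t -> exists k, 2 ^+ k <= t < 2 ^+ k.+1.
Proof.
move=> t1; have ex : exists k, t < 2 ^+ k.+1.
  exists (Num.truncn t); apply: (lt_le_trans (truncnS_gt _)); rewrite -natrX ler_nat.
  exact: ltnW (ltn_expl _ (ltnSn 1)).
case: (ex_minnP ex) => k kt kmin; exists k; rewrite kt andbT.
case: k kt kmin => [|k] kt kmin; first by rewrite expr0.
by rewrite leNgt; apply/negP => /kmin; rewrite ltnn.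
Qed.

Lemma measurable_enorm_pow (b : R) : measurable_fun setT (fun x : RN => enorm (x : V) `^ b).
Proof.
apply: (measurableT_comp (@measurable_powR R b)).
by apply: measurable_enorm; exact: mcoord_id.
Qed.

Lemma powR_exprn (x b : R) n : 0 <= x -> (x ^+ n) `^ b = (x `^ b) ^+ n.
Proof. by move=> x0; rewrite -(powR_mulrn n x0) -powRrM mulrC powRrM powR_mulrn// powR_ge0. Qed.

Lemma powR_lt1 (x b : R) : 0 <= x -> x < 1 -> 0 < b -> x `^ b < 1.
Proof.
move=> x0 x1 b0; have -> : 1 = 1 `^ b :> R by rewrite powR1.
by rewrite gt0_ltr_powR ?nnegrE.
Qed.

Lemma powR_gt1 (x b : R) : 1 < x -> 0 < b -> 1 < x `^ b.
Proof.
move=> x1 b0; have e : 1 = 1 `^ b :> R by rewrite powR1.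
by rewrite [ltLHS]e gt0_ltr_powR ?nnegrE// (le_trans ler01)// ltW.
Qed.

Lemma powR_le1 (x b : R) : 0 <= x -> x <= 1 -> 0 <= b -> x `^ b <= 1.
Proof.
move=> x0 x1 b0; have -> : 1 = 1 `^ b :> R by rewrite powR1.
by rewrite ge0_ler_powR ?nnegrE.
Qed.

Lemma nni_near_pow (b : R) : 0 <= b -> b < N%:R ->
  nni mu (fun x => \1_(eball 0 1) x * enorm x `^ (- b)).
Proof.
move=> b0 bN; have h0 : 0 <= 2^-1 :> R by rewrite invr_ge0.
have hp : 0 < 2^-1 :> R by rewrite invr_gt0.
apply: (@nni_shells _ (fun k => (2^-1 ^+ k.+1) `^ (- b)) (fun k => 2^-1 ^+ k) (2 `^ b) (2^-1 `^ (N%:R - b))).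
- apply: measurable_funM; last exact: measurable_enorm_pow.
  by apply: measurable_indic; exact: eball_measurable.
- by move=> x; rewrite mulr_ge0 ?powR_ge0.
- by move=> k; exact: powR_ge0.
- by move=> k; rewrite exprn_gt0.
- exact: powR_ge0.
- exact: powR_ge0.
- by apply: powR_lt1; rewrite ?subr_gt0// invf_lt1// ltr1n.
- move=> k; rewrite le_eqVlt; apply/orP; left; apply/eqP.
  have e1 : 2 `^ b = 2^-1 `^ (- b) :> R by rewrite -powR_inv1// -powRrM mulrNN mul1r.
  have e2 : 2^-1 `^ (N%:R - b) = 2^-1 ^+ N * 2^-1 `^ (- b) :> R.
    by rewrite powRD ?powR_mulrn// (lt0r_neq0 hp) implybT.
  by rewrite powR_exprn// exprS -exprM mulnC exprM e1 e2 exprMn; ring.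
move=> x; rewrite indicE in_eball// subr0 -enorm_sqr expr1n.
have [x1|x1] := ltP (enorm x ^+ 2) 1; last by left; rewrite mul0r.
have {}x1 : enorm x < 1 by rewrite -(@ltr_pXn2r _ 2) ?nnegrE ?enorm_ge0// expr1n.
(* At the origin the negative power is 0 or 1 by convention, and the first ball accommodates it. *)
right; rewrite mul1r; have [xz|xn] := eqVneq (enorm x) 0.
  exists 0%N; first by rewrite expr0 /eball/= subr0.
  rewrite xz expr1 powRN; apply: (@le_trans _ _ 1); first by rewrite /powR eqxx; case: (_ == 0); rewrite ?invr1 ?invr0.
  by rewrite powRN invf_ge1 ?powR_gt0// powR_le1// invf_le1// ler1n.
have xp : 0 < enorm x by rewrite lt_neqAle eq_sym xn enorm_ge0.
have [k /andP[k1 k2]] := dyadic_small xp x1.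
exists k; first by rewrite /eball/= subr0.
rewrite !powRN lef_pV2 ?posrE ?powR_gt0 ?exprn_gt0//.
by rewrite ge0_ler_powR ?nnegrE ?enorm_ge0 ?exprn_ge0.
Qed.

Lemma nni_far_pow (b : R) : N%:R < b ->
  nni mu (fun x => \1_(~` eball 0 1) x * enorm x `^ (- b)).
Proof.
move=> bN; have b0 : 0 <= b by rewrite (le_trans _ (ltW bN)).
have two : 0 <= 2 :> R by [].
apply: (@nni_shells _ (fun k => (2 ^+ k) `^ (- b)) (fun k => 2 ^+ k.+1) (2 ^+ N) (2 `^ (N%:R - b))).
- apply: measurable_funM; last exact: measurable_enorm_pow.
  by apply: measurable_indic; apply: measurableC; exact: eball_measurable.
- by move=> x; rewrite mulr_ge0 ?powR_ge0.
- by move=> k; exact: powR_ge0.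
- by move=> k; rewrite exprn_gt0.
- exact: exprn_ge0.
- exact: powR_ge0.
- rewrite -opprB powRN invf_lt1 ?powR_gt0//.
  by apply: powR_gt1; rewrite ?ltr1n ?subr_gt0.
- move=> k; rewrite le_eqVlt; apply/orP; left; apply/eqP.
  have e2 : 2 `^ (N%:R - b) = 2 ^+ N * 2 `^ (- b) :> R.
    by rewrite powRD ?powR_mulrn// pnatr_eq0 implybT.
  by rewrite powR_exprn// -exprM mulnC exprM exprS e2 exprMn; ring.
move=> x; rewrite indicE in_setC in_eball// subr0 -enorm_sqr expr1n -leNgt.
have [x1|x1] := leP 1 (enorm x ^+ 2); last by left; rewrite mul0r.
have {}x1 : 1 <= enorm x by rewrite -(@ler_pXn2r _ 2) ?nnegrE ?enorm_ge0// expr1n.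
right; rewrite mul1r; have [k /andP[k1 k2]] := dyadic_large x1.
exists k; first by rewrite /eball/= subr0.
rewrite !powRN lef_pV2 ?posrE ?powR_gt0 ?exprn_gt0//; last exact: lt_le_trans x1.
by rewrite ge0_ler_powR ?nnegrE ?enorm_ge0 ?exprn_ge0.
Qed.

End shells.

(** * Finiteness of the energy of Lipschitz functions *)

Section finite_energy.
Context {R : realType} {N : nat}.
Notation V := 'rV[R]_N.
Notation RN := (RN R N).
Notation mu := (lebm R N).
Notation mu2 := (@mu2 R N).
Notation omega := (omega (R := R) (N := N)).
Variable s : R.
Hypotheses (N2 : (2 <= N)%N) (s0 : 0 < s) (s1 : s < 1).
Notation Kf := (@Kf R N s).
Notation energy := (@energy R N s).
Notation P := (N%:R + 2 * s).
Implicit Types u v w f : V -> R.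

Let N0 : (0 < N)%N. Proof. exact: leq_trans N2. Qed.

Lemma nni_conv f (h : R -> R) : nni mu f -> measurable_fun setT h -> (forall r, 0 <= h r) ->
  nni mu (fun y => h (dot y y)) ->
  nni mu2 (fun z => f z.1 * h (dist2 z)) /\ nni mu2 (fun z => f z.2 * h (dist2 z)).
Proof.
move=> nf mh h0 nh.
have f0 x : 0 <= f x by case: nf => _ + _; exact.
have S (x y : V) : dist2 (x, y) = dist2 (y, x) by rewrite /dist2/= -opprB dotNl dotNr opprK.
have mhd : measurable_fun setT (fun z : RN * RN => h (dist2 z)).
  exact: measurableT_comp mh (@measurable_dist2' R N).
have mk' y : measurable_fun setT (fun x : RN => (h (dist2 (x, y)))%:E : \bar R).
  apply/measurable_EFinP; exact: (measurableT_comp mh (measurable_dist2c y)).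
have mk x : measurable_fun setT (fun y : RN => (h (dist2 (x, y)))%:E : \bar R).
  by have := mk' x; under eq_fun do rewrite S.
have shift x : (\int[mu]_y (h (dist2 (x, y)))%:E = \int[mu]_y (h (dot (y : V) y))%:E)%E.
  rewrite -(@integral_shift R N (fun y : RN => (h (dot (y : V) y))%:E) (- x)).
  - by apply: eq_integral => y _; rewrite S.
  - exact: nni_emeasurable nh.
  - by move=> y; rewrite lee_fin h0.
have slice x (a : R) : 0 <= a -> (\int[mu]_y (a * h (dist2 (x, y)))%:E =
    a%:E * \int[mu]_y (h (dot (y : V) y))%:E)%E.
  move=> a0; rewrite -(shift x).
  rewrite -(@ge0_integral_scale _ _ RN mu a _ a0 (mk x)); last by move=> y; rewrite lee_fin h0.
  by apply: eq_integral.
have fin : (\int[mu]_x ((f x)%:E * \int[mu]_y (h (dot (y : V) y))%:E) < +oo)%E.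
  rewrite ge0_integralZr; [|exact: measurableT|exact: nni_emeasurable nf| |]; last 2 first.
  - by move=> x _; rewrite lee_fin.
  - by apply: integral_ge0 => y _; rewrite lee_fin.
  by rewrite (nintE nf) (nintE nh) -EFinM ltry.
have m1 : measurable_fun setT (fun z : RN * RN => f z.1 * h (dist2 z)).
  by apply: measurable_funM => //; apply: measurable_fst_comp; exact: nni_measurable nf.
have m2 : measurable_fun setT (fun z : RN * RN => f z.2 * h (dist2 z)).
  by apply: measurable_funM => //; apply: measurable_snd_comp; exact: nni_measurable nf.
split; (split; [by []|by move=> z; rewrite mulr_ge0|]).
- rewrite mu2_tonelli1; [|exact/measurable_EFinP|by move=> z; rewrite lee_fin mulr_ge0].
  apply: le_lt_trans fin; rewrite le_eqVlt; apply/orP; left; apply/eqP.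
  by apply: eq_integral => x _; exact: (slice x _ (f0 x)).
- rewrite mu2_tonelli2; [|exact/measurable_EFinP|by move=> z; rewrite lee_fin mulr_ge0].
  apply: le_lt_trans fin; rewrite le_eqVlt; apply/orP; left; apply/eqP.
  apply: eq_integral => x _; rewrite -(slice x _ (f0 x)).
  by apply: eq_integral => y _; rewrite S.
Qed.

(** For a bounded Lipschitz function the squared difference is at most a constant times min(|x-y|^2,
    1). The resulting kernel is integrable near 0 because s < 1 and at infinity because s > 0. *)
Definition gk (r : R) : R := Num.min r 1 * Kf r.

Lemma gk_ge0 r : 0 <= r -> 0 <= gk r.
Proof. by move=> r0; rewrite mulr_ge0 ?Kf_ge0// le_min r0 ler01. Qed.

Lemma measurable_gk : measurable_fun setT gk.
Proof.
apply: measurable_funM; last exact: measurable_Kf.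
by apply: measurable_minr; [exact: measurable_id|exact: measurable_cst].
Qed.

Lemma nni_gk : nni mu (fun z => gk (dot z z)).
Proof.
have n2 : 2 <= (N%:R : R) by rewrite ler_nat.
have b0 : 0 <= P - 2 by rewrite subr_ge0 exponent_ge2.
have bN : P - 2 < N%:R.
  by rewrite -addrA gtrDl subr_lt0 -[ltRHS]mulr1 ltr_pM2l.
have bN' : N%:R < P by rewrite ltrDl mulr_gt0.
have n1 := nni_near_pow b0 bN; have n3 := nni_far_pow bN'.
apply: (nni_le (nniD n1 n3)) => [|x].
  apply: (measurableT_comp measurable_gk).
  by apply: measurable_dot; exact: mcoord_id.
rewrite gk_ge0 ?dot_ge0//= !indicE in_setC in_eball// subr0 expr1n /gk !KfE -enormE.
have [x1|x1] := ltP (dot x x) 1; rewrite /= ?mul1r ?mul0r ?addr0 ?add0r.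
- have [xz|xn] := eqVneq (enorm x) 0.
    by rewrite -enorm_sqr xz expr0n mul0r powR_ge0.
  have xp : 0 < enorm x by rewrite lt_neqAle eq_sym xn enorm_ge0.
  rewrite -enorm_sqr -powR_mulrn ?enorm_ge0// -powRN -powRD ?xn ?implybT//.
  by rewrite opprB addrC.
- by rewrite powRN.
Qed.

(** The energy density of a function supported in the unit ball vanishes unless one of the points is
    in it, so this integrable function dominates it up to a constant depending on L and M only. *)
Definition domin (z : RN * RN) : R :=
  \1_(eball 0 1) (z.1 : V) * gk (dist2 z) + \1_(eball 0 1) (z.2 : V) * gk (dist2 z).

Lemma nni_domin : nni mu2 domin.
Proof.
have nB : nni mu (\1_(eball 0 1 : set RN) : V -> R).
  by apply: nni_indic; [exact: eball_measurable|exact: mu_eball_lty].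
(* [nni_conv] asks for a kernel nonnegative on all reals, whereas [gk] is only known to be so for
   nonnegative arguments. *)
pose h r : R := if 0 <= r then gk r else 0.
have mh : measurable_fun setT h.
  apply: measurable_fun_ifT; [|exact: measurable_gk|exact: measurable_cst].
  by apply: measurable_fun_ler; [exact: measurable_cst|exact: measurable_id].
have h0 r : 0 <= h r by rewrite /h; case: (leP 0 r) => // r0; exact: gk_ge0.
have hg z : gk (dist2 z) = h (dist2 z) by rewrite /h dist2_ge0.
have nh : nni mu (fun z => h (dot z z)).
  by have := nni_gk; rewrite (_ : (fun z => gk _) = (fun z => h (dot z z)))//; apply/funext => z; rewrite /h dot_ge0.
have [a b] := nni_conv nB mh h0 nh; have := nniD a b.
rewrite (_ : (fun x => _) = domin)//.
by apply/funext => z; rewrite /domin !hg.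
Qed.

Lemma energy_domin L M w z : admissible L 1 M w ->
  (w z.1 - w z.2) ^+ 2 * Kf (dist2 z) <= (L ^+ 2 + M ^+ 2) * domin z.
Proof.
move=> aw; have L2 := sqr_ge0 L; have M2 := sqr_ge0 M.
have g0 : 0 <= gk (dist2 z) := gk_ge0 (dist2_ge0 z).
have b1 : (w z.1 - w z.2) ^+ 2 <= L ^+ 2 * dist2 z.
  rewrite /dist2 -enorm_sqr -exprMn -(real_normK (num_real (w _ - _))).
  rewrite lerXn2r ?nnegrE//; last exact: adm_lip aw _ _.
  exact: le_trans (normr_ge0 _) (adm_lip aw _ _).
have b2 : (w z.1 - w z.2) ^+ 2 <= M ^+ 2.
  have := adm_ge0 aw z.1; have := adm_ge0 aw z.2; have := adm_le aw z.1; have := adm_le aw z.2; nra.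
have b3 : (w z.1 - w z.2) ^+ 2 * Kf (dist2 z) <= (L ^+ 2 + M ^+ 2) * gk (dist2 z).
  rewrite /gk mulrA ler_wpM2r ?Kf_ge0//; case: (leP (dist2 z) 1) => h.
    by apply: (le_trans b1); rewrite ler_wpM2r ?dist2_ge0// lerDl.
  by rewrite mulr1; apply: (le_trans b2); rewrite lerDr.
have LM0 : 0 <= L ^+ 2 + M ^+ 2 by rewrite addr_ge0.
rewrite /domin; have [x1|x1] := ltP (enorm (z.1 : V)) 1.
  rewrite indicE mem_set /eball/= ?subr0// mul1r mulrDr (le_trans b3)// lerDl.
  by rewrite mulr_ge0// mulr_ge0.
have [y1|y1] := ltP (enorm (z.2 : V)) 1.
  rewrite [\1_ _ (z.2 : V)]indicE mem_set /eball/= ?subr0// mul1r mulrDr (le_trans b3)// lerDr.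
  by rewrite mulr_ge0// mulr_ge0.
rewrite !(adm_supp aw)// subrr expr0n mul0r mulr_ge0// addr_ge0// mulr_ge0//.
Qed.

Lemma energy_lty L M w : admissible L 1 M w -> (energy w < +oo)%E.
Proof.
move=> aw; have LM0 : 0 <= L ^+ 2 + M ^+ 2 by rewrite addr_ge0 ?sqr_ge0.
have [_ _] := nniZ LM0 nni_domin; apply: le_lt_trans.
apply: le_ge0_integral.
- by apply: measurable_Kenergy; exact: adm_measurable aw.
- exact: nni_emeasurable (nniZ LM0 nni_domin).
- by move=> z; rewrite lee_fin mulr_ge0 ?sqr_ge0 ?Kf_ge0.
- by move=> z; rewrite lee_fin; exact: energy_domin aw.
Qed.

Lemma unit_vector : exists e : V, enorm e = 1.
Proof.
pose i0 : 'I_N := Ordinal N0; exists (delta_mx 0 i0).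
rewrite enormE (_ : dot _ _ = 1) ?sqrtr1// /dot (bigD1 i0)//= mxE !eqxx mulr1.
by rewrite big1 ?addr0// => j ji; rewrite mxE eqxx (negPf ji) mulr0.
Qed.

(* Only the pairs in the ball of radius r times the annulus 2r <= |y| < 3r are kept. *)
Lemma energy_ring w L M (e1 : V) r : admissible L 1 M w -> radial_dec w -> enorm e1 = 1 -> 0 < r ->
  (((w (r *: e1) - w ((2 * r) *: e1)) ^+ 2 * Kf (16 * r ^+ 2) * (r ^+ N * omega) ^+ 2)%:E <= energy w)%E.
Proof.
move=> aw rw e11 r0; set d := w (r *: e1) - _.
have o0 := ltW (@omega_gt0 R N).
have r20 : 0 < 2 * r by rewrite mulr_gt0.
have r30 : 0 < 3 * r by rewrite mulr_gt0.
have en t : 0 < t -> enorm (t *: e1) = t by move=> t0; rewrite enormZ e11 mulr1 gtr0_norm.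
have d0 : 0 <= d by rewrite subr_ge0 rw// !en//; lra.
pose A : set RN := eball 0 r; pose B : set RN := eball 0 (3 * r) `\` eball 0 (2 * r).
have mA : measurable A := @eball_measurable R N 0 r.
have mB3 := @eball_measurable R N 0 (3 * r); have mB2 := @eball_measurable R N 0 (2 * r).
have mB : measurable B by exact: measurableD.
have sub : (eball 0 (2 * r) : set V) `<=` eball 0 (3 * r).
  by move=> x /lt_le_trans; apply; lra.
have muB : mu B = ((3 ^+ N - 2 ^+ N) * (r ^+ N * omega))%:E.
  by rewrite (mu_diff mB3 mB2 (mu_eball_lty 0 r30) sub) !mu_eball// !exprMn -EFinB; congr EFin; ring.
have nA : nni mu (\1_A : V -> R) by apply: nni_indic => //; exact: mu_eball_lty.
have Boo : (mu B < +oo)%E by rewrite muB ltry.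
have nB : nni mu (\1_B : V -> R) by apply: nni_indic.
have [nAB eAB] := nni_prod nA nB.
have k0' : 0 <= d ^+ 2 * Kf (16 * r ^+ 2) by rewrite mulr_ge0 ?sqr_ge0 ?Kf_ge0.
have IB : r ^+ N * omega <= nint mu (\1_B : V -> R).
  rewrite nint_lebm// muB/= ler_peMl ?mulr_ge0 ?exprn_ge0 ?(ltW r0) ?o0//.
  rewrite -!natrX -natrB ?leq_exp2r// ler1n subn_gt0 ltn_exp2r//.
apply: (@le_trans _ _ (d ^+ 2 * Kf (16 * r ^+ 2) * nint mu2 (fun z => \1_A z.1 * \1_B z.2))%:E).
  have rN0 : 0 <= r ^+ N * omega by rewrite mulr_ge0 ?exprn_ge0 ?(ltW r0).
  rewrite lee_fin ler_wpM2l// eAB [leLHS]expr2 ler_pM//.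
  by rewrite nint_lebm// mu_eball.
rewrite -(nintZ k0' nAB) -(nintE (nniZ k0' nAB)).
apply: le_ge0_integral.
- exact: nni_emeasurable (nniZ k0' nAB).
- by apply: measurable_Kenergy; exact: adm_measurable aw.
- by move=> z; rewrite lee_fin mulr_ge0// mulr_ge0.
move=> [x y]; rewrite lee_fin /= -/(dist2 (x, y)) !indicE.
have [/set_mem xA|_] := boolP (x \in A); last by rewrite mul0r mulr0 mulr_ge0 ?sqr_ge0 ?Kf_ge0.
have [/set_mem yB|_] := boolP (y \in B); last by rewrite !mulr0 mulr_ge0 ?sqr_ge0 ?Kf_ge0.
rewrite !mulr1; move: xA yB; rewrite /A /B /eball/= !subr0 => xr [y3 /negP]; rewrite -leNgt => y2.
have xy : 0 < dist2 (x, y).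
  rewrite lt_neqAle dist2_ge0 andbT eq_sym; apply/negP => /eqP/dot_eq0/eqP; rewrite subr_eq0/= => /eqP exy.
  by move: y2; rewrite -exy leNgt => /negP; apply; apply: (lt_trans xr); lra.
(* Monotonicity bounds the difference of values below by that of the radii r and 2r, and the points
   are at distance at most 4r, whence the argument 16 r^2. *)
apply: ler_pM; rewrite ?sqr_ge0 ?Kf_ge0//.
  have h1 : w (r *: e1) <= w x by apply: rw; rewrite en// ltW.
  have h2 : w y <= w ((2 * r) *: e1) by apply: rw; rewrite en.
  rewrite lerXn2r ?nnegrE//; last by rewrite lerB.
  by apply: (le_trans d0); rewrite lerB.
apply: Kf_nincr => //; rewrite /dist2/= -enorm_sqr.
have h : enorm (x - y) <= 4 * r by have := enormD x (- y); rewrite enormN; lra.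
rewrite (_ : 16 * r ^+ 2 = (4 * r) ^+ 2); last by ring.
by rewrite lerXn2r ?nnegrE ?enorm_ge0// mulr_ge0// ltW.
Qed.

End finite_energy.

(** * Radial decay and the best constant *)

Section sharp_constant.
Context {R : realType} {N : nat}.
Notation V := 'rV[R]_N.
Notation RN := (RN R N).
Notation mu := (lebm R N).
Notation mu2 := (@mu2 R N).
Notation omega := (omega (R := R) (N := N)).
Variables s q : R.
Hypotheses (N2 : (2 <= N)%N) (s0 : 0 < s) (s1 : s < 1) (q1 : 1 <= q) (q2 : q < crit_exp N s).
Notation Kf := (@Kf R N s).
Notation energy := (@energy R N s).
Notation pint := (@pint R N q).
Notation P := (N%:R + 2 * s).
Implicit Types u v w f : V -> R.

Let N0 : (0 < N)%N. Proof. exact: leq_trans N2. Qed.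
Let q0 : 0 < q. Proof. exact: lt_le_trans q1. Qed.
Let o0 : 0 < omega. Proof. exact: omega_gt0. Qed.
Let N2s : 0 < N%:R - 2 * s.
Proof.
have h : 2 <= (N%:R : R) by rewrite ler_nat.
by rewrite subr_gt0 (lt_le_trans _ h)// -[ltRHS]mulr1 ltr_pM2l.
Qed.

(** The rate fixed by scaling: a drop d between radii r and 2r costs energy of order d^2 r^(N -
    2s). *)
Definition decay : R := (N%:R - 2 * s) / 2.

Let decay_gt0 : 0 < decay. Proof. by rewrite divr_gt0. Qed.

Lemma radial_step : exists2 D0, 0 < D0 & forall w L M e (e1 : V) r,
  admissible L 1 M w -> radial_dec w -> energy w = e%:E -> enorm e1 = 1 -> 0 < r ->
  w (r *: e1) - w ((2 * r) *: e1) <= D0 * Num.sqrt e * r `^ (- decay).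
Proof.
exists (4 `^ (P / 2) / omega); first by rewrite divr_gt0// powR_gt0.
move=> w L M e e1 r aw rw we e11 r0.
have := energy_ring N2 s0 aw rw e11 r0; rewrite we lee_fin; set d := _ - _ => h.
have e0 : 0 <= e by rewrite -lee_fin -we energy_ge0.
have X0 : 0 <= 4 `^ (P / 2) / omega * Num.sqrt e * r `^ (- decay).
  by rewrite !mulr_ge0 ?powR_ge0 ?sqrtr_ge0 ?invr_ge0// ltW.
have r4 : 0 < 4 * r by rewrite mulr_gt0.
have K16 : Kf (16 * r ^+ 2) = 4 `^ (- P) * r `^ (- P).
  rewrite (_ : 16 * r ^+ 2 = (4 * r) ^+ 2 * 1); last by ring.
  rewrite Kf_scale// !KfE sqrtr1 powR1 invr1 mulr1 powRM//.
  exact: ltW.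
suff : d ^+ 2 <= (4 `^ (P / 2) / omega * Num.sqrt e * r `^ (- decay)) ^+ 2.
  have [d0|d0] := leP 0 d; last by move=> _; apply: le_trans (ltW d0) X0.
  by rewrite ler_pXn2r ?nnegrE.
have Z : 0 < 4 `^ P * r `^ (- (decay * 2)) / omega ^+ 2.
  by rewrite divr_gt0 ?exprn_gt0// mulr_gt0// powR_gt0.
have -> : (4 `^ (P / 2) / omega * Num.sqrt e * r `^ (- decay)) ^+ 2 =
    e * (4 `^ P * r `^ (- (decay * 2)) / omega ^+ 2).
  rewrite !exprMn sqr_sqrtr// exprVn -![(_ `^ _) ^+ 2]powR_mulrn ?powR_ge0// -!powRrM.
  by rewrite divfK// mulNr; ring.
apply: le_trans (ler_wpM2r (ltW Z) h).
rewrite le_eqVlt; apply/orP; left; apply/eqP; rewrite K16.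
have e4 : 4 `^ (- P) * 4 `^ P = 1 :> R by rewrite powRN mulVf// lt0r_neq0// powR_gt0.
have er : r `^ (- P) * r `^ (- (decay * 2)) * (r ^+ N) ^+ 2 = 1.
  rewrite -exprM -powR_mulrn ?(ltW r0)// -!powRD ?(lt0r_neq0 r0) ?implybT//.
  have -> : - P - decay * 2 + (N * 2)%:R = 0 by rewrite natrM /decay; field.
  by rewrite powRr0.
transitivity (d ^+ 2 * (4 `^ (- P) * 4 `^ P) * (r `^ (- P) * r `^ (- (decay * 2)) * (r ^+ N) ^+ 2)).
  by rewrite e4 er !mulr1.
by field; exact: lt0r_neq0.
Qed.

(** The drops over successive octaves are summed from the outside inward, starting beyond radius 1
    where w is 0; they form a geometric series of ratio h = 2^(-decay). *)
Lemma radial_bound : exists2 D, 0 < D & forall w e, nice w -> energy w = e%:E ->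
  forall x, x != 0 -> w x <= D * Num.sqrt e * enorm x `^ (- decay).
Proof.
have [D0 D00 step] := radial_step.
have [e1 e11] := @unit_vector R N N2.
pose h : R := 2 `^ (- decay).
have h1 : h < 1 by rewrite /h powRN invf_lt1 ?powR_gt0// powR_gt1// ltr1n.
pose D := D0 / (1 - h); have h10 : 0 < 1 - h by rewrite subr_gt0.
have Dp : 0 < D by rewrite divr_gt0.
exists D => // w e [L [M [L0 aw rw]]] we.
have se0 : 0 <= Num.sqrt e := sqrtr_ge0 _.
have main k r : 0 < r -> 1 <= 2 ^+ k * r -> w (r *: e1) <= D * Num.sqrt e * r `^ (- decay).
  elim: k r => [|k IH] r r0 hr.
    have x1 : 1 <= enorm (r *: e1).
      by rewrite enormZ e11 mulr1 gtr0_norm//; move: hr; rewrite expr0 mul1r.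
    by rewrite (adm_supp aw x1) mulr_ge0 ?powR_ge0// mulr_ge0// ltW.
  have r20 : 0 < 2 * r by rewrite mulr_gt0.
  have := IH (2 * r) r20; rewrite mulrA -exprSr => /(_ hr).
  rewrite powRM ?(ltW r0)// -/h => IH'.
  have := step _ _ _ _ _ _ aw rw we e11 r0 => st.
  have eD : D0 = D * (1 - h) by rewrite /D divfK// lt0r_neq0.
  rewrite eD in st.
  have -> : D * Num.sqrt e * r `^ (- decay) = D * Num.sqrt e * (h * r `^ (- decay)) +
     D * (1 - h) * Num.sqrt e * r `^ (- decay) by ring.
  lra.
move=> x xn; have xp := enorm_gt0 xn.
have [k hk] : exists k, 1 <= 2 ^+ k * enorm x.
  exists (Num.truncn (enorm x)^-1).+1.
  rewrite -ler_pdivrMr// div1r (le_trans (ltW (truncnS_gt _)))// -natrX ler_nat.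
  exact: ltnW (ltn_expl _ (ltnSn 1)).
apply: le_trans (main k _ xp hk).
by apply: rw; rewrite enormZ e11 mulr1 gtr0_norm.
Qed.

(** The pointwise decay bounds w^q by a multiple of |x|^(-decay q), which is integrable on the unit
    ball exactly because q is below the critical exponent. *)
Lemma poincare : exists2 c, 0 < c & forall w, nice w -> ((c * pint w `^ (2 / q))%:E <= energy w)%E.
Proof.
have [D D0 HD] := radial_bound.
have bN : decay * q < N%:R.
  by rewrite /decay mulrAC ltr_pdivrMr// mulrC -ltr_pdivlMr// (mulrC N%:R).
have b0 : 0 <= decay * q by rewrite mulr_ge0 ?ltW.
have nh := nni_near_pow b0 bN; set hh := (fun x => _) in nh.
pose H := nint mu hh + 1; have H0 : 0 < H.
  by rewrite ltr_wpDl// nint_ge0// => x; case: nh => _ + _; exact.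
pose c := (D ^+ 2 * H `^ (2 / q))^-1.
have c0 : 0 < c by rewrite invr_gt0 mulr_gt0 ?exprn_gt0 ?powR_gt0.
exists c => // w nw; have [L [M [L0 aw rw]]] := nw.
have w0 := adm_ge0 aw; have npw := nni_pow q1 ltr01 aw.
have := energy_ge0 s w; case we : (energy w) => [e| |]//; last by move=> *; rewrite leey.
rewrite !lee_fin => e0.
pose X := (D * Num.sqrt e) `^ q; have X0 : 0 <= X := powR_ge0 _ _.
have DS0 : 0 <= D * Num.sqrt e by rewrite mulr_ge0 ?sqrtr_ge0 ?ltW.
have pw : pint w <= X * H.
  apply: (@le_trans _ _ (X * nint mu hh)); last by rewrite ler_wpM2l// lerDl.
  apply/ler_addgt0Pr => eps eps0.
  (* The decay bound excludes the origin; a ball of radius r, on which w(0)^q integrates to at most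
     eps, takes care of that point. *)
  pose r := Num.min 1 (eps / (w 0 `^ q + 1) / omega).
  have wq0 : 0 < w 0 `^ q + 1 by rewrite ltr_wpDl ?powR_ge0.
  have r0 : 0 < r by rewrite lt_min ltr01 !divr_gt0.
  have r1 : r <= 1 by rewrite ge_min lexx.
  have nB : nni mu (\1_(eball 0 r : set RN) : V -> R).
    by apply: nni_indic; [exact: eball_measurable|exact: mu_eball_lty].
  have nZ := nniZ (powR_ge0 (w 0) q) nB; have nXh := nniZ X0 nh.
  apply: (@le_trans _ _ (nint mu (fun x => X * hh x) + nint mu (fun x => w 0 `^ q * \1_(eball 0 r) x))).
    rewrite -(nintD nXh nZ); apply: nint_le; [exact: npw|exact: nniD|] => x.
    have [->|xn] := eqVneq x 0.
      rewrite [\1_(eball 0 r) _]indicE mem_set ?mulr1 /eball/= ?subr0 ?enorm0// lerDr.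
      by rewrite mulr_ge0// mulr_ge0 ?powR_ge0.
    rewrite (@le_trans _ _ (X * hh x))//; last by rewrite lerDl mulr_ge0 ?powR_ge0.
    rewrite /hh; have [x1|x1] := ltP (enorm x) 1; last first.
      by rewrite (adm_supp aw x1) powR0 ?lt0r_neq0// mulr_ge0// mulr_ge0 ?powR_ge0.
    rewrite indicE mem_set /eball/= ?subr0// mul1r.
    rewrite -mulNr powRrM /X -powRM ?powR_ge0//.
    rewrite ge0_ler_powR ?nnegrE ?(ltW q0)//; last exact: HD.
    by rewrite mulr_ge0 ?powR_ge0.
  rewrite (nintZ X0 nh) (nintZ (powR_ge0 _ _) nB) lerD2l nint_lebm; last exact: eball_measurable.
  rewrite mu_eball//=.
  have rN : r ^+ N <= r by case: (N) N0 => // n _; rewrite exprS ler_piMr ?(ltW r0)// exprn_ile1// ltW.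
  apply: (@le_trans _ _ ((w 0 `^ q + 1) * (r * omega))).
    by apply: ler_pM; rewrite ?powR_ge0 ?mulr_ge0 ?exprn_ge0 ?(ltW r0) ?(ltW o0)// ?lerDl// ler_wpM2r// ltW.
  rewrite mulrC -ler_pdivlMr// -ler_pdivlMr//; by rewrite /r ge_min lexx orbT.
have XE : X `^ (2 / q) = D ^+ 2 * e.
  rewrite /X -powRrM mulrCA divff ?lt0r_neq0// mulr1 -[2]/(2%:R) powR_mulrn//.
  by rewrite exprMn sqr_sqrtr.
have : pint w `^ (2 / q) <= D ^+ 2 * H `^ (2 / q) * e.
  apply: (@le_trans _ _ ((X * H) `^ (2 / q))).
    by rewrite ge0_ler_powR ?nnegrE ?pint_ge0 ?divr_ge0 ?(ltW q0)// mulr_ge0// ltW.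
  by rewrite powRM ?(ltW H0)// XE mulrAC.
by move=> hX; rewrite /c ler_pdivrMl ?mulr_gt0 ?exprn_gt0 ?powR_gt0.
Qed.

(** A competitor with finite energy and positive q-integral, so that the constants of the inequality
    are bounded above. *)
Definition cone (x : V) : R := Num.max 0 (1 - enorm x).

Lemma nice_cone : nice cone.
Proof.
exists 1, 1; split=> //; last by move=> x y xy; rewrite ge_max !le_max lexx/= lerB ?orbT.
split=> [x y|x|x|x x1].
- rewrite mul1r (le_trans _ (enorm_lip x y))//; have := trunc_lip (- enorm x) (- enorm y) (-1).
  rewrite !opprK ![_ + 1]addrC; have -> : - enorm x + enorm y = - (enorm x - enorm y) by ring.
  by rewrite normrN.
- by rewrite le_max lexx.
- by rewrite ge_max ler01 gerBl enorm_ge0.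
- by rewrite /cone max_l// subr_le0.
Qed.

Lemma pint_cone_gt0 : 0 < pint cone.
Proof.
have [L [M [L0 ac _]]] := nice_cone; have nc := nni_pow q1 ltr01 ac.
have r0 : 0 < 2^-1 :> R by rewrite invr_gt0.
have nB : nni mu (\1_(eball 0 2^-1 : set RN) : V -> R).
  by apply: nni_indic; [exact: eball_measurable|exact: mu_eball_lty].
have k0' : 0 <= 2^-1 `^ q :> R := powR_ge0 _ _.
apply: (@lt_le_trans _ _ (nint mu (fun x => 2^-1 `^ q * \1_(eball 0 2^-1) x))).
  rewrite (nintZ k0' nB) nint_lebm; last exact: eball_measurable.
  by rewrite mu_eball//= !mulr_gt0 ?powR_gt0 ?exprn_gt0.
apply: nint_le; [exact: nniZ|exact: nc|] => x.
rewrite indicE; case: (boolP (x \in _)) => [/set_mem|_]; last by rewrite mulr0 powR_ge0.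
rewrite /eball/= subr0 mulr1 => x2; rewrite ge0_ler_powR ?nnegrE ?(ltW q0) ?(ltW r0)//.
  by rewrite le_max lexx.
by rewrite le_max; apply/orP; right; lra.
Qed.

Lemma admissibleZ L rho M u a : 0 <= a -> admissible L rho M u ->
  admissible (a * L) rho (a * M) (fun x => a * u x).
Proof.
move=> a0 au; split=> [x y|x|x|x rx].
- by rewrite -mulrBr normrM ger0_norm// -mulrA ler_wpM2l// (adm_lip au).
- by rewrite mulr_ge0// (adm_ge0 au).
- by rewrite ler_wpM2l// (adm_le au).
- by rewrite (adm_supp au rx) mulr0.
Qed.

Lemma niceZ w a : 0 <= a -> nice w -> nice (fun x => a * w x).
Proof.
move=> a0 [L [M [L0 aw rw]]]; exists (a * L), (a * M); split.
- exact: mulr_ge0.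
- exact: admissibleZ.
- by move=> x y xy; rewrite ler_wpM2l// rw.
Qed.

(** [Lam] is the supremum of the valid constants: positive by [poincare], finite by [cone]. That no
    larger constant is valid provides almost extremal functions, which homogeneity normalizes. *)
Theorem sharp_constant : exists2 Lam, 0 < Lam &
  (forall w, nice w -> ((Lam * pint w `^ (2 / q))%:E <= energy w)%E) /\
  (forall e, 0 < e -> exists w, [/\ nice w, pint w = 1 & (energy w < (Lam + e)%:E)%E]).
Proof.
have [c c0 Hc] := poincare.
pose S := [set k : R | forall w, nice w -> ((k * pint w `^ (2 / q))%:E <= energy w)%E].
have Sc : S c by [].
have nc := nice_cone; have pc := pint_cone_gt0.
have [L [M [L0 ac rc]]] := nc; have ec := energy_lty N2 s0 s1 ac.
have pq : 0 < pint cone `^ (2 / q) by rewrite powR_gt0.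
have q20 : 2 / q != 0 by rewrite lt0r_neq0// divr_gt0.
have fe : energy cone \is a fin_num by rewrite ge0_fin_numE// energy_ge0.
have Sub : ubound S (fine (energy cone) / pint cone `^ (2 / q)).
  by move=> k /(_ _ nc); rewrite -(fineK fe) lee_fin ler_pdivlMr.
have hS : has_sup S by split; [exists c|eexists; exact: Sub].
exists (sup S); first by apply: lt_le_trans c0 _; exact: sup_upper_bound.
split.
  move=> w nw; have [E|E] := leP (energy w) 0%E; last first.
    apply/lee_addgt0Pr => e e0; have [/eqP z|pn] := boolP (pint w == 0).
      by rewrite z powR0// mulr0 adde_ge0// ?lee_fin ltW.
    have pp0 : 0 < pint w by rewrite lt_neqAle eq_sym pn pint_ge0.
    have pp : 0 < pint w `^ (2 / q) by rewrite powR_gt0.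
    have d0 : 0 < e / pint w `^ (2 / q) by rewrite divr_gt0.
    have [k Sk kS] := sup_adherent d0 hS.
    apply: (@le_trans _ _ ((k * pint w `^ (2 / q)) + e)%:E).
      move: pp kS; rewrite lee_fin; generalize (pint w `^ (2 / q)) => Z Z0 /ltW.
      by rewrite lerBlDr => /(ler_wpM2r (ltW Z0)); rewrite mulrDl divfK// lt0r_neq0.
    by rewrite EFinD leeD2r// Sk.
  have := Hc _ nw => h; have pz : pint w `^ (2 / q) <= 0.
    by have := le_trans h E; rewrite lee_fin pmulr_rle0.
  apply: le_trans (energy_ge0 s w); rewrite lee_fin pmulr_rle0//.
  by apply: lt_le_trans c0 _; exact: sup_upper_bound.
move=> e e0; have : ~ S (sup S + e).
  by move=> /(sup_upper_bound hS); rewrite leNgt ltrDl e0.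
move=> /existsNP[w] /not_implyP[nw] /negP; rewrite -ltNge => h.
have [Lw [Mw [Lw0 aw rw]]] := nw.
have [/eqP z|pn] := boolP (pint w == 0).
  move: h; rewrite z powR0// mulr0 => h.
  by have := energy_ge0 s w; rewrite leNgt h.
have pp : 0 < pint w by rewrite lt_neqAle eq_sym pn pint_ge0.
pose a := (pint w) `^ (- q^-1); have a0 : 0 < a by rewrite powR_gt0.
have nw' := nni_pow q1 ltr01 aw.
exists (fun x => a * w x); split.
- exact: niceZ (ltW a0) nw.
- rewrite pintZ ?(ltW a0)//; last exact: adm_ge0 aw.
  by rewrite /a -powRrM mulNr mulVf ?lt0r_neq0// powR_inv1 ?pint_ge0// mulVf.
rewrite energyZ; last exact: adm_measurable aw.
have fw : energy w \is a fin_num.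
  by rewrite ge0_fin_numE ?energy_ge0// (energy_lty N2 s0 s1 aw).
rewrite -(fineK fw) in h *; rewrite lte_fin in h; rewrite -EFinM lte_fin.
have e1 : pint w `^ (2 / q) * a ^+ 2 = 1.
  rewrite -powR_mulrn ?(ltW a0)// /a -powRrM -powRD ?pn ?implybT//.
  by rewrite (_ : _ + _ = 0) ?powRr0//; ring.
rewrite -[ltRHS]mulr1 -e1 mulrA mulrC ltr_pM2r// exprn_gt0//.
Qed.

End sharp_constant.

(** * Smooth approximation *)

Section smooth_functions.
Context {R : realType}.

(* The functions t^-k exp(-1/t), extended by 0, are closed under derivation. *)
Definition flat k (t : R) : R := if t <= 0 then 0 else t ^- k * expR (- t^-1).

Lemma flat_ge0 k t : 0 <= flat k t.
Proof.
rewrite /flat; case: (leP t 0) => // t0.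
by rewrite mulr_ge0 ?expR_ge0// invr_ge0 exprn_ge0// ltW.
Qed.

(** One term of the exponential series suffices: exp(1/t) is at least t^(-k-1) / (k+1)!. *)
Lemma flat_le k t : flat k t <= k.+1`!%:R * Num.max 0 t.
Proof.
rewrite /flat; case: (leP t 0) => t0; first by rewrite mulr_ge0// le_max lexx.
have ti : 0 < t^-1 by rewrite invr_gt0.
have h : t^-1 ^+ k.+1 / k.+1`!%:R <= expR t^-1.
  by apply: le_trans (expR_ge1Dxn k (ltW ti)); rewrite lerDr.
have f0 : 0 < k.+1`!%:R :> R by rewrite ltr0n fact_gt0.
rewrite expRN ler_pdivrMr ?expR_gt0//.
apply: le_trans (ler_wpM2l (mulr_ge0 (ltW f0) (ltW t0)) h).
rewrite le_eqVlt; apply/orP; left; apply/eqP.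
rewrite exprVn exprS; field.
by rewrite expf_neq0 ?lt0r_neq0.
Qed.

Lemma is_derive_flat k (t : R) : is_derive t 1 (flat k) (flat k.+2 t - k%:R * flat k.+1 t).
Proof.
have [t0|t0|t0] := ltgtP t 0.
- apply: (@near_eq_is_derive _ _ _ (fun=> 0)).
    near=> x; rewrite /flat ifT//; apply: ltW; near: x; exact: lt_nbhsl.
  by rewrite /flat !(ltW t0) mulr0 subr0; exact: is_derive_cst.
- suff dG : is_derive t 1 (fun x : R => x ^- k * expR (- x^-1)) (flat k.+2 t - k%:R * flat k.+1 t).
    apply: near_eq_is_derive dG.
    near=> x; rewrite /flat ifF//; apply/negP; rewrite leNgt => /negP; apply.
    by near: x; exact: lt_nbhsr.
  have dV : is_derive t 1 (fun x : R => x^-1) (- t ^- 2 *: 1).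
    by apply: is_deriveV => //; rewrite lt0r_neq0.
  have dN := is_deriveN dV.
  have dE := @is_derive1_comp R expR (fun x => - x^-1) t _ _ (is_derive_expR (- t^-1)) dN.
  have dX : is_derive t 1 (fun x : R => x ^+ k) ((k%:R * t ^+ k.-1) *: 1).
    by split; [exact: exprn_derivable|exact: exp_derive].
  have dXV := @is_deriveV R (fun x => x ^+ k) t _ 1 (lt0r_neq0 (exprn_gt0 k t0)) dX.
  have dM := is_deriveM dXV dE; apply: is_derive_eq.
  rewrite /flat !leNgt t0/= /GRing.scale/= !mulr1.
  have tn := lt0r_neq0 t0; move: (expR _) => E.
  case: k {dX dXV dM} => [|k]; first by rewrite expr0 expr1; field.
  have := expf_neq0 k tn; rewrite [k.+1.-1]/= !exprS; move: (t ^+ k) => T Tn.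
  by field; rewrite tn Tn.
have z j : flat j 0 = 0 by rewrite /flat lexx.
rewrite t0 !z mulr0 subr0.
(* At 0 the difference quotient of [flat k] is [flat k.+1] itself, which tends to 0 by [flat_le]. *)
have E : (fun h : R => h^-1 *: ((flat k \o shift 0) (h *: 1) - flat k 0)) = flat k.+1.
  apply/funext => h; rewrite /= addr0 z subr0 /GRing.scale/= mulr1 /flat.
  by case: (leP h 0) => h0; rewrite ?mulr0// mulrA exprS invfM.
have cv : h^-1 *: ((flat k \o shift 0) (h *: 1) - flat k 0) @[h --> 0^'] --> (0 : R).
  rewrite E; apply/cvgrPdist_lt => e e0.
  have C0 : 0 < k.+2`!%:R :> R by rewrite ltr0n fact_gt0.
  near=> h; rewrite sub0r normrN ger0_norm ?flat_ge0//.
  apply: (le_lt_trans (flat_le _ _)); rewrite mulrC -ltr_pdivlMr//.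
  have : `|h| < e / k.+2`!%:R.
    near: h; apply: dnbhs0_lt; exact: divr_gt0.
  apply: le_lt_trans; rewrite ge_max normr_ge0 ler_norm//.
split; first by apply/cvg_ex; exists 0.
exact: cvg_lim cv.
Unshelve. all: end_near.
Qed.

Lemma derive_line (V W : normedModType R) (f : V -> W) x v df :
  is_derive x v f df <-> is_derive (0 : R) 1 (fun h => f (h *: v + x)) df.
Proof.
have E : (fun h : R => h^-1 *: ((f \o shift x) (h *: v) - f x)) =
  (fun h : R => h^-1 *: (((fun h => f (h *: v + x)) \o shift 0) (h *: 1) - f (0 *: v + x))).
  by apply/funext => h; rewrite /= addr0 scale0r add0r /GRing.scale/= mulr1.
split=> -[d <-]; split.
- by move: d; rewrite /derivable E.
- by rewrite /derive -E.
- by move: d; rewrite /derivable -E.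
- by rewrite /derive E.
Qed.

End smooth_functions.

Section smooth_class.
Context {R : realType} {N : nat}.
Notation V := 'rV[R]_N.

(** A syntactic class closed under partial derivatives, so that all orders of differentiability
    follow by one induction. *)
Inductive smooth : (V -> R) -> Prop :=
| smooth_cst c : smooth (fun=> c)
| smooth_coord i : smooth (fun x => x 0 i)
| smoothD f g : smooth f -> smooth g -> smooth (fun x => f x + g x)
| smoothM f g : smooth f -> smooth g -> smooth (fun x => f x * g x)
| smooth_flat k f : smooth f -> smooth (fun x => flat k (f x)).

Lemma is_derive_coord (x : V) i j :
  is_derive x (delta_mx 0 i) (fun y : V => y 0 j) ((i == j)%:R : R).
Proof.
apply/derive_line.
have E : (fun h : R => (h *: (delta_mx 0 i : V) + x) 0 j) = (fun h => (i == j)%:R * h + x 0 j).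
  by apply/funext => h; rewrite !mxE eqxx/= eq_sym mulrC.
rewrite E; apply: is_derive_eq.
by rewrite addr0 /GRing.scale/= mulr1.
Qed.

Lemma smooth_partial f : smooth f -> forall i, exists2 g, smooth g &
  forall x : V, is_derive x (delta_mx 0 i) f (g x).
Proof.
move=> sf i; elim: sf => {f}.
- by move=> c; exists (fun=> 0); [exact: smooth_cst|move=> x; exact: is_derive_cst].
- by move=> j; exists (fun=> (i == j)%:R); [exact: smooth_cst|move=> x; exact: is_derive_coord].
- move=> f g sf [f' sf' df] sg [g' sg' dg]; exists (fun x => f' x + g' x); first exact: smoothD.
  by move=> x; exact: is_deriveD.
- move=> f g sf [f' sf' df] sg [g' sg' dg]; exists (fun x => f x * g' x + g x * f' x).
    by apply: smoothD; exact: smoothM.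
  by move=> x; exact: is_deriveM.
move=> k f sf [f' sf' df].
exists (fun x => (flat k.+2 (f x) + (- k%:R) * flat k.+1 (f x)) * f' x).
  apply: smoothM => //; apply: smoothD; first exact: smooth_flat.
  by apply: smoothM; [exact: smooth_cst|exact: smooth_flat].
move=> x; apply/derive_line.
have := df x; rewrite derive_line => d1.
have d2 := is_derive_flat k (f (0 *: (delta_mx 0 i : V) + x)).
have := is_derive1_comp d2 d1; rewrite scale0r add0r mulNr.
exact.
Qed.

Lemma smooth_continuous f : smooth f -> continuous f.
Proof.
elim=> {f}.
- by move=> c; exact: cst_continuous.
- by move=> i x; exact: coord_continuous.
- by move=> f g _ cf _ cg x; exact: (cvgD (cf x) (cg x)).
- by move=> f g _ cf _ cg x; exact: (cvgM (cf x) (cg x)).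
move=> k f _ cf x; apply: continuous_comp; first exact: cf.
by apply: differentiable_continuous; apply/derivable1_diffP; by case: (is_derive_flat k (f x)).
Qed.

Lemma smooth_Ck k f : smooth f -> Ck k f.
Proof.
elim: k f => [|k IH] f sf; split=> //; try exact: smooth_continuous.
move=> i; have [g sg dg] := smooth_partial sf i; split.
  by move=> x; case: (dg x).
rewrite (_ : (fun x => _) = g); first exact: IH.
by apply/funext => x; case: (dg x).
Qed.

Lemma smooth_sum (I : Type) (r : seq I) (F : I -> V -> R) : (forall i, smooth (F i)) ->
  smooth (fun x => \sum_(i <- r) F i x).
Proof.
move=> sF; elim: r => [|i r IH]; first by under eq_fun do rewrite big_nil; exact: smooth_cst.
by under eq_fun do rewrite big_cons; exact: smoothD.
Qed.

Lemma smooth_dot (x0 : V) : smooth (fun x => dot (x - x0) (x - x0)).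
Proof.
apply: smooth_sum => i; have h : smooth (fun x => (x - x0) 0 i).
  under eq_fun do rewrite !mxE.
  by apply: smoothD; [exact: smooth_coord|exact: smooth_cst].
exact: smoothM.
Qed.

End smooth_class.

Section step.
Context {R : realType}.
Implicit Types t r : R.

Lemma flat_mono t t' : t <= t' -> flat 0 t <= flat 0 t'.
Proof.
move=> tt'; rewrite /flat !expr0 invr1 !mul1r.
case: (leP t 0) => t0; case: (leP t' 0) => t'0; rewrite ?expR_ge0//.
  by move: (le_lt_trans t'0 t0); rewrite ltNge tt'.
by rewrite ler_expR lerN2 lef_pV2.
Qed.

Definition step_top : R := flat 0 1.

Lemma step_top_gt0 : 0 < step_top.
Proof. by rewrite /step_top /flat ler10 mulr_gt0 ?expR_gt0// invr_gt0 exprn_gt0. Qed.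

Lemma step_top_le1 : step_top <= 1.
Proof. by have := @flat_le R 0 1; rewrite max_r// mulr1. Qed.

(** A smooth descent from 1 to 0 over [0, 1]. The denominator is constant, so composing with a
    [smooth] function stays in that class, which has no quotients. *)
Definition step t : R := flat 0 (step_top - flat 0 t) / flat 0 step_top.

Let den_gt0 : 0 < flat 0 step_top.
Proof. by rewrite /flat leNgt step_top_gt0/= expr0 invr1 mul1r expR_gt0. Qed.

Lemma step_ge0 t : 0 <= step t.
Proof. by rewrite /step divr_ge0 ?flat_ge0. Qed.

Lemma step_le1 t : step t <= 1.
Proof. by rewrite /step ler_pdivrMr// mul1r flat_mono// gerBl flat_ge0. Qed.

Lemma step_left t : t <= 0 -> step t = 1.
Proof. by move=> t0; rewrite /step [flat 0 t]/flat t0 subr0 divff// lt0r_neq0. Qed.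

Lemma step_right t : 1 <= t -> step t = 0.
Proof.
by move=> t1; rewrite /step [flat 0 (_ - _)]/flat subr_le0 flat_mono// mul0r.
Qed.

Definition dstep t : R := - (flat 2 (step_top - flat 0 t) * flat 2 t) / flat 0 step_top.

Lemma is_derive_step t : is_derive t 1 step (dstep t).
Proof.
have d0 := is_derive_flat 0 t.
have d1 : is_derive t 1 (fun t : R => step_top - flat 0 t) (- (flat 2 t - 0%:R * flat 1 t)).
  have := is_deriveB (is_derive_cst step_top t 1) d0; rewrite sub0r; exact.
have d2 := is_derive_flat 0 (step_top - flat 0 t).
have d3 := @is_derive1_comp R (flat 0) _ t _ _ d2 d1.
have d4 := is_deriveZ (flat 0 step_top)^-1 d3.
have E : step = (flat 0 step_top)^-1 \*: (flat 0 \o (fun t : R => step_top - flat 0 t)).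
  by apply/funext => x; rewrite /step /= /GRing.scale/= mulrC.
rewrite E; apply: is_derive_eq.
by rewrite /dstep /GRing.scale/= !mul0r !subr0; ring.
Qed.

(** 36 is 6 * 6: by [flat_le] each of the two factors [flat 2] in the derivative is at most 3! on
    arguments up to 1. *)
Definition step_lip : R := 36 / flat 0 step_top.

Lemma step_lip_gt0 : 0 < step_lip. Proof. by rewrite divr_gt0. Qed.

Lemma dstep_out t : t <= 0 \/ 1 <= t -> dstep t = 0.
Proof.
by rewrite /dstep => -[h|h]; [rewrite [flat 2 t]/flat h|rewrite [flat 2 (_ - _)]/flat subr_le0 flat_mono//];
  rewrite ?mulr0 ?mul0r oppr0 mul0r.
Qed.

Lemma dstep_le t : `|dstep t| <= step_lip.
Proof.
have [h|h] := leP 1 t; first by rewrite dstep_out ?normr0 ?(ltW step_lip_gt0)//; right.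
rewrite /dstep normrM normrN normfV (gtr0_norm den_gt0) ler_wpM2r ?invr_ge0 ?(ltW den_gt0)//.
rewrite ger0_norm ?mulr_ge0 ?flat_ge0// (_ : 36 = 6 * 6); last by ring.
have f6 u : u <= 1 -> flat 2 u <= 6.
  move=> u1; apply: (le_trans (flat_le _ _)); rewrite (_ : 3`! = 6)%N//.
  by rewrite -[leRHS]mulr1 ler_wpM2l// ge_max u1 ler01.
apply: ler_pM; rewrite ?flat_ge0//; apply: f6; last exact: ltW.
by rewrite (le_trans _ step_top_le1)// gerBl flat_ge0.
Qed.

End step.

(** * Smoothing a radial profile from below *)

Section profile.
Context {R : realType}.
Variables (W : R -> R) (L : R) (m : nat).
Hypotheses (L0 : 0 <= L)
  (Wlip : forall r r', 0 <= r -> 0 <= r' -> `|W r - W r'| <= L * `|r - r'|)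
  (Wdec : forall r r', 0 <= r -> r <= r' -> W r' <= W r)
  (W1 : forall r, 1 <= r -> W r = 0).
Implicit Types r rho : R.

Notation n := (m.+1%:R : R).

(** The value at the outer end of the i-th interval keeps the staircase below W. With n = m + 1 the
    level of index m is W(1) = 0, and the sum over i < m ends at radius m/n, strictly inside the
    unit ball. *)
Definition level (i : nat) : R := W (i.+1%:R / n).
(** The affine change of variable taking the squared radii (i/n)^2 and ((i+1)/n)^2 to 0 and 1.
    Squared radii make the staircase smooth at the origin. *)
Definition node (i : nat) rho : R := (rho * n ^+ 2 - i%:R ^+ 2) / (2 * i%:R + 1).
(* Smoothed staircase in the squared radius: the i-th step is located between
   the radii i / n and (i + 1) / n. *)
Definition prof rho : R := \sum_(i < m) (level i - level i.+1) * step (node i rho).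

Let n0 : 0 < n. Proof. by rewrite ltr0n. Qed.
Let di0 i : 0 < 2 * i%:R + 1 :> R. Proof. by rewrite ltr_wpDl// mulr_ge0. Qed.

Lemma level_dec i : 0 <= level i - level i.+1.
Proof.
by rewrite subr_ge0; apply: Wdec; rewrite ?divr_ge0// ler_wpM2r ?invr_ge0// ler_nat.
Qed.

Lemma level_drop i : level i - level i.+1 <= L / n.
Proof.
apply: (le_trans (ler_norm _)); apply: (le_trans (Wlip _ _)); rewrite ?divr_ge0//.
rewrite ler_wpM2l// -mulrBl normrM normfV (gtr0_norm n0) ler_piMl ?invr_ge0//.
by rewrite -[i.+2%:R]natr1 opprD addNKr normrN normr1.
Qed.

Lemma level_last : level m = 0. Proof. by rewrite /level divff ?W1// lt0r_neq0. Qed.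

Lemma W_ge0 r : 0 <= r -> 0 <= W r.
Proof.
move=> r0; rewrite -(@W1 (Num.max 1 r)) ?le_max ?lexx//; apply: Wdec => //.
by rewrite le_max lexx orbT.
Qed.

Lemma telescope_from (j k : nat) :
  \sum_(i < k) (level i - level i.+1) * (j <= i)%N%:R = level (minn j k) - level k.
Proof.
elim: k => [|k IH]; first by rewrite big_ord0 minn0 subrr.
rewrite big_ord_recr/= IH; case: (leqP j k) => jk.
  by rewrite (minn_idPl (leqW jk)) mulr1; ring.
by rewrite (minn_idPr jk) mulr0; ring.
Qed.

Lemma node_left i r : 0 <= r -> r * n <= i%:R -> step (node i (r ^+ 2)) = 1.
Proof.
move=> r0 h; apply: step_left; rewrite /node pmulr_lle0 ?invr_gt0// subr_le0 -exprMn.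
by rewrite lerXn2r ?nnegrE ?mulr_ge0// ltW.
Qed.

Lemma node_gap i : i.+1%:R ^+ 2 - i%:R ^+ 2 = 2 * i%:R + 1 :> R.
Proof. by rewrite -natr1; ring. Qed.

Lemma node_right i r : 0 <= r -> i.+1%:R <= r * n -> 1 <= node i (r ^+ 2).
Proof.
move=> r0 h; rewrite /node ler_pdivlMr// mul1r -node_gap lerD2r -exprMn.
by rewrite lerXn2r ?nnegrE ?mulr_ge0// ltW.
Qed.

Lemma prof_ge0 rho : 0 <= prof rho.
Proof. by apply: sumr_ge0 => i _; rewrite mulr_ge0 ?level_dec ?step_ge0. Qed.

Lemma prof_upper r : 0 <= r -> prof (r ^+ 2) <= W r.
Proof.
move=> r0; have rn0 : 0 <= r * n by rewrite mulr_ge0// ltW.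
pose t := Num.truncn (r * n).
apply: (@le_trans _ _ (\sum_(i < m) (level i - level i.+1) * (t <= i)%N%:R)).
  apply: ler_sum => i _; rewrite ler_wpM2l ?level_dec//.
  case: (leqP t i) => ti; first exact: step_le1.
  rewrite step_right// node_right//; apply: (@le_trans _ _ t%:R); first by rewrite ler_nat.
  by rewrite truncn_le.
rewrite telescope_from level_last subr0 /level.
case: (leqP t m) => tm.
  apply: Wdec => //; rewrite ler_pdivlMr//.
  exact: ltW (truncnS_gt _).
by rewrite divff ?lt0r_neq0// W1// W_ge0.
Qed.

Lemma prof_lower r : 0 <= r -> W r - 2 * L / n <= prof (r ^+ 2).
Proof.
move=> r0; have rn0 : 0 <= r * n by rewrite mulr_ge0// ltW.
pose t := (Num.truncn (r * n)).+1.
apply: (@le_trans _ _ (\sum_(i < m) (level i - level i.+1) * (t <= i)%N%:R)); last first.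
  apply: ler_sum => i _; rewrite ler_wpM2l ?level_dec//.
  case: (leqP t i) => ti; last exact: step_ge0.
  rewrite node_left//; apply: (le_trans (ltW (truncnS_gt _))); by rewrite ler_nat.
rewrite telescope_from level_last subr0 /level.
have r2 : 0 <= r + 2 / n by rewrite addr_ge0// divr_ge0// ltW.
apply: (@le_trans _ _ (W (r + 2 / n))).
  have := Wlip r0 r2; rewrite opprD addNKr normrN (ger0_norm (divr_ge0 (ler0n _ 2) (ltW n0))).
  rewrite (_ : L * (2 / n) = 2 * L / n); last by ring.
  by move=> /(le_trans (ler_norm _)); rewrite !lerBlDr addrC.
apply: Wdec; first by rewrite divr_ge0// ltW.
rewrite ler_pdivrMr// mulrDl divfK ?lt0r_neq0//.
apply: (@le_trans _ _ t.+1%:R); first by rewrite ler_nat ltnS geq_minl.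
rewrite /t -natr1 -natr1 -addrA (_ : 1 + 1 = 2)// lerD2r truncn_le//.
Qed.

Lemma prof_supp r : 0 <= r -> m%:R / n <= r -> prof (r ^+ 2) = 0.
Proof.
move=> r0; rewrite ler_pdivrMr// => h; apply: big1 => i _.
rewrite step_right ?mulr0// node_right//; apply: le_trans h.
by rewrite ler_nat.
Qed.

Definition dprof r : R := \sum_(i < m)
  (level i - level i.+1) * (dstep (node i (r ^+ 2)) * (2 * r * n ^+ 2 / (2 * i%:R + 1))).

Lemma is_derive_prof r : is_derive r 1 (fun r => prof (r ^+ 2)) (dprof r).
Proof.
have E : (fun r => prof (r ^+ 2)) =
  \sum_(i < m) ((level i - level i.+1) \*: (step \o (fun r => node i (r ^+ 2)))).
  by apply/funext => x; rewrite /prof fct_sumE.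
rewrite E; apply: is_derive_sum => i.
apply: is_deriveZ; apply: is_derive1_comp; first exact: is_derive_step.
have E2 : (fun r : R => node i (r ^+ 2)) = (fun r => (n ^+ 2 / (2 * i%:R + 1)) * (r * r) + (- i%:R ^+ 2 / (2 * i%:R + 1))).
  by apply/funext => x; rewrite /node; ring.
rewrite E2; apply: is_derive_eq.
by rewrite /GRing.scale/= addr0 !mulr1; ring.
Qed.

(** At a given radius only the step of index [t] is not locally constant. Its height is at most L/n
    and its slope at most [step_lip] times 2n, so the bound does not depend on m. *)
Lemma dprof_le r : 0 <= r -> `|dprof r| <= 2 * L * step_lip.
Proof.
move=> r0; have rn0 : 0 <= r * n by rewrite mulr_ge0// ltW.
have C0 : 0 <= 2 * L * step_lip :> R by apply: mulr_ge0; [exact: mulr_ge0|exact: ltW step_lip_gt0].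
pose t := Num.truncn (r * n).
apply: (le_trans (ler_norm_sum _ _ _)).
apply: (@le_trans _ _ (\sum_(i < m) 2 * L * step_lip * (i == t :> nat)%:R)).
  apply: ler_sum => i _.
  have [h|h] := leP (r * n) i%:R.
    rewrite dstep_out ?mul0r ?mulr0 ?normr0; first by rewrite mulr_ge0.
    left; rewrite /node pmulr_lle0 ?invr_gt0// subr_le0 -exprMn.
    by rewrite lerXn2r ?nnegrE.
  have [h'|h'] := leP i.+1%:R (r * n).
    rewrite dstep_out ?mul0r ?mulr0 ?normr0; first by rewrite mulr_ge0.
    by right; exact: node_right.
  have -> : (i == t :> nat) by apply/eqP/esym; apply/eqP; rewrite truncn_eq// (ltW h).
  rewrite mulr1 normrM (ger0_norm (level_dec i)) normrM.
  have p0 : 0 <= 2 * r * n ^+ 2 / (2 * i%:R + 1).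
    by rewrite divr_ge0 ?(ltW (di0 i))// !mulr_ge0// exprn_ge0// ltW.
  rewrite (ger0_norm p0).
  have h2 : 2 * r * n ^+ 2 / (2 * i%:R + 1) <= 2 * n.
    rewrite ler_pdivrMr// (_ : 2 * r * n ^+ 2 = 2 * n * (r * n)); last by ring.
    rewrite ler_wpM2l ?mulr_ge0 ?(ltW n0)//; apply: (le_trans (ltW h')).
    by rewrite -natr1 lerD2r ler_peMl// ler1n.
  apply: (@le_trans _ _ (L / n * (step_lip * (2 * n)))).
    apply: ler_pM => //; [exact: level_dec|by rewrite mulr_ge0|exact: level_drop|].
    by apply: ler_pM => //; exact: dstep_le.
  by rewrite le_eqVlt; apply/orP; left; apply/eqP; field; rewrite lt0r_neq0.
rewrite -mulr_sumr ler_piMr//.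
have -> : \sum_(i < m) (i == t :> nat)%:R = (t < m)%N%:R :> R.
  elim: (m) => [|k IH]; first by rewrite big_ord0.
  rewrite big_ord_recr/= IH; case: (ltngtP t k) => [tk|tk|->].
  - by rewrite (ltn_trans tk)// addr0.
  - by rewrite ltnS leqNgt tk addr0.
  - by rewrite ltnSn add0r.
by case: (_ < _)%N; rewrite ?ler01 ?lexx.
Qed.

Lemma prof_lip r r' : 0 <= r -> 0 <= r' ->
  `|prof (r ^+ 2) - prof (r' ^+ 2)| <= 2 * L * step_lip * `|r - r'|.
Proof.
wlog rr' : r r' / r <= r'.
  move=> H r0 r'0; have [h|h] := leP r r'; first exact: H.
  by rewrite distrC (distrC r); apply: H => //; exact: ltW.
move=> r0 r'0; rewrite distrC (distrC r).
have [x xr ->] := @MVT_segment R (fun r => prof (r ^+ 2)) dprof r r' rr'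
  (fun x _ => is_derive_prof x)
  (continuous_subspaceT (fun x => differentiable_continuous
     (iffLR (derivable1_diffP _ _) (@ex_derive _ _ _ _ _ _ _ (is_derive_prof x))))).
rewrite normrM ler_wpM2r// dprof_le//.
by move: xr; rewrite in_itv/= => /andP[+ _]; exact: le_trans.
Qed.

End profile.

Section approximation.
Context {R : realType} {N : nat}.
Notation V := 'rV[R]_N.
Notation RN := (RN R N).
Notation mu := (lebm R N).
Notation mu2 := (@mu2 R N).
Variables s q : R.
Hypotheses (N2 : (2 <= N)%N) (s0 : 0 < s) (s1 : s < 1) (q1 : 1 <= q).
Notation Kf := (@Kf R N s).
Notation energy := (@energy R N s).
Notation pint := (@pint R N q).
Implicit Types u v w f : V -> R.

Let q0 : 0 < q. Proof. exact: lt_le_trans q1. Qed.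

Lemma dominated_cvg d (T : measurableType d) (m : {measure set T -> \bar R})
    (f_ : nat -> T -> R) (f g : T -> R) :
  (forall k, measurable_fun setT (f_ k)) -> measurable_fun setT f -> nni m g ->
  (forall x, f_ k x @[k --> \oo] --> f x) -> (forall k x, 0 <= f_ k x <= g x) ->
  (\int[m]_x (f_ k x)%:E @[k --> \oo] --> \int[m]_x (f x)%:E)%E.
Proof.
move=> mf_ mf ng cf fg.
have [|||||_ _] := @dominated_convergence _ T R m setT measurableT (fun k x => (f_ k x)%:E)
  (fun x => (f x)%:E) (fun x => (g x)%:E); last exact.
- by move=> k; exact/measurable_EFinP.
- exact/measurable_EFinP.
- by apply: aeW => x _; apply/fine_cvgP; split; [exact: nearW|exact: cf].
- have [mg g0 goo] := ng; apply/integrableP; split; first exact/measurable_EFinP.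
  by under eq_integral do rewrite gee0_abs ?lee_fin//.
- apply: aeW => x k _; have /andP[a b] := fg k x.
  by rewrite gee0_abs lee_fin.
Qed.

Lemma powR_lip (M a b : R) k : q <= k%:R -> 0 <= a <= M -> 0 <= b <= M ->
  `|a `^ q - b `^ q| <= k%:R * (1 + M `^ q) * `|a - b|.
Proof.
move=> qk; wlog ab : a b / b <= a.
  move=> H ha hb; have [h|h] := leP b a; first exact: H.
  by rewrite distrC (distrC a); apply: H => //; exact: ltW.
move=> /andP[a0 aM] /andP[b0 bM].
have d0 : 0 <= a - b by rewrite subr_ge0.
have := powR_trunc_ge q1 qk d0 a0; rewrite (_ : a - (a - b) = b) ?(max_r b0); last by ring.
move=> h.
have pab : b `^ q <= a `^ q by rewrite ge0_ler_powR ?nnegrE ?(ltW q0).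
have paM : a `^ q <= M `^ q by rewrite ge0_ler_powR ?nnegrE ?(ltW q0)// (le_trans a0).
rewrite !ger0_norm ?subr_ge0//.
have : k%:R * (a - b) * (1 + a `^ q) <= k%:R * (a - b) * (1 + M `^ q).
  by rewrite ler_wpM2l ?mulr_ge0// lerD2l.
rewrite [X in _ -> _ <= X]mulrAC; lra.
Qed.

(** The Lipschitz constant of the approximants is independent of m, so [domin] dominates all their
    energies and both integrals converge. Smoothness is given for rescaled copies, since these
    become test functions of arbitrary balls; [dl < 1] keeps their support compact inside the
    ball. *)
Lemma approx_nice w e : nice w -> 0 < e -> exists (F : V -> R) (L M dl : R),
  [/\ admissible L 1 M F, dl < 1 /\ (forall x, dl <= enorm x -> F x = 0),
      forall (x0 : V) (k : R), smooth (fun x => F (k *: (x - x0))),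
      (energy F <= energy w + e%:E)%E & pint w - e <= pint F].
Proof.
move=> nw e0; have [L [M [L0 aw rw]]] := nw.
have [e1 e11] := @unit_vector R N N2.
pose W r := w (r *: e1).
have en r : 0 <= r -> enorm (r *: e1) = r by move=> r0; rewrite enormZ e11 mulr1 ger0_norm.
have Wlip r r' : 0 <= r -> 0 <= r' -> `|W r - W r'| <= L * `|r - r'|.
  move=> r0 r'0; apply: (le_trans (adm_lip aw _ _)).
  by rewrite -scalerBl enormZ e11 mulr1.
have Wdec r r' : 0 <= r -> r <= r' -> W r' <= W r.
  by move=> r0 rr'; apply: rw; rewrite !en//; exact: le_trans rr'.
have W1 r : 1 <= r -> W r = 0.
  by move=> r1; rewrite /W (adm_supp aw)// en// (le_trans _ r1).
have wW x : w x = W (enorm x).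
  by apply/eqP; rewrite /W eq_le !rw ?en ?enorm_ge0.
pose F m (x : V) := prof W m (dot x x).
have FE m x : F m x = prof W m (enorm x ^+ 2) by rewrite /F enorm_sqr.
have M0 : 0 <= M := le_trans (adm_ge0 aw 0) (adm_le aw 0).
pose L' := 2 * L * @step_lip R.
have L'0 : 0 <= L' by apply: mulr_ge0; [exact: mulr_ge0|exact: ltW step_lip_gt0].
have aF m : admissible L' 1 M (F m).
  split=> [x y|x|x|x x1].
  - rewrite !FE; apply: (le_trans (prof_lip m L0 Wlip Wdec _ _)); rewrite ?enorm_ge0//.
    by rewrite ler_wpM2l ?enorm_lip.
  - by rewrite FE prof_ge0.
  - rewrite FE (le_trans (prof_upper m Wdec W1 (enorm_ge0 x)))// -wW.
    exact: adm_le aw x.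
  - rewrite FE prof_supp ?enorm_ge0//; apply: le_trans x1.
    by rewrite ler_pdivrMr ?ltr0n// mul1r ler_nat.
have cF x : F m x @[m --> \oo] --> w x.
  apply/cvgrPdist_le => eps eps0; near=> m.
  rewrite FE wW; have up := prof_upper m Wdec W1 (enorm_ge0 x).
  have lo := prof_lower m Wlip Wdec W1 (enorm_ge0 x).
  rewrite ger0_norm ?subr_ge0// lerBlDr -lerBlDl; apply: le_trans lo.
  rewrite lerD2l lerN2 ler_pdivrMr ?ltr0n// -ler_pdivrMl// mulrC.
  near: m; exists (Num.truncn (2 * L / eps)) => // m /= hm.
  apply: (le_trans (ltW (truncnS_gt _))); by rewrite ler_nat ltnS.
have mF m := adm_measurable (aF m); have mw := adm_measurable aw.
have LM0 : 0 <= L' ^+ 2 + M ^+ 2 by rewrite addr_ge0 ?sqr_ge0.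
have cE : (energy (F m) @[m --> \oo] --> energy w)%E.
  apply: (@dominated_cvg _ _ mu2 _ _ (fun z => (L' ^+ 2 + M ^+ 2) * domin s z)).
  - by move=> m; apply/measurable_EFinP; exact: measurable_Kenergy.
  - by apply/measurable_EFinP; exact: measurable_Kenergy.
  - by apply: nniZ => //; exact: nni_domin.
  - by move=> z; apply: cvgMl; rewrite expr2; under eq_cvg do rewrite expr2;
      apply: cvgM; apply: cvgB; exact: cF.
  - move=> m z; rewrite mulr_ge0 ?sqr_ge0 ?Kf_ge0//=; exact: energy_domin (aF m).
have nB : nni mu (\1_(eball 0 1 : set RN) : V -> R).
  by apply: nni_indic; [exact: eball_measurable|exact: mu_eball_lty].
have cP : (\int[mu]_x (F m x `^ q)%:E @[m --> \oo] --> \int[mu]_x (w x `^ q)%:E)%E.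
  apply: (@dominated_cvg _ _ mu _ _ (fun x => M `^ q * \1_(eball 0 1) x)).
  - by move=> m; exact: measurableT_comp (@measurable_powR R q) (mF m).
  - exact: measurableT_comp (@measurable_powR R q) mw.
  - by apply: nniZ => //; exact: powR_ge0.
  - move=> x; apply/cvgrPdist_le => eps eps0.
    have [k qk] : exists k : nat, q <= k%:R by exists (Num.truncn q).+1; exact: ltW (truncnS_gt q).
    have C0 : 0 < k%:R * (1 + M `^ q).
      have k0' : 0 < (k%:R : R) := lt_le_trans q0 qk.
      by apply: mulr_gt0 k0' _; apply: ltr_wpDr => //; exact: powR_ge0.
    have eC : 0 < eps / (k%:R * (1 + M `^ q)) by rewrite divr_gt0.
    have := cF x; move/cvgrPdist_le => /(_ _ eC) H; near=> m.
    have b1 : 0 <= w x <= M by rewrite (adm_ge0 aw) (adm_le aw).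
    have b2 : 0 <= F m x <= M by rewrite (adm_ge0 (aF m)) (adm_le (aF m)).
    apply: (le_trans (powR_lip qk b1 b2)).
    rewrite mulrC -ler_pdivlMr//; near: m; exact: H.
  - move=> m x; rewrite powR_ge0/= indicE; have [x1|x1] := ltP (enorm x) 1.
      rewrite mem_set /eball/= ?subr0// mulr1 ge0_ler_powR ?nnegrE ?(ltW q0)//.
        exact: adm_ge0 (aF m) x.
      exact: adm_le (aF m) x.
    by rewrite (adm_supp (aF m) x1) powR0 ?lt0r_neq0// mulr_ge0 ?powR_ge0.
have few : energy w \is a fin_num.
  by rewrite ge0_fin_numE ?energy_ge0// (energy_lty N2 s0 s1 aw).
have lt_e : fine (energy w) < fine (energy w) + e by rewrite ltrDl.
have lt_p : pint w - e < pint w by rewrite gtrBl.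
have /fine_cvgP[_ cE'] : (energy (F m) @[m --> \oo] --> (fine (energy w))%:E)%E by rewrite fineK.
have npw := nni_pow q1 ltr01 aw.
have /fine_cvgP[_ cP'] : (\int[mu]_x (F m x `^ q)%:E @[m --> \oo] --> (pint w)%:E)%E.
  by rewrite -(nintE npw).
have near1 : \forall m \near \oo, fine (energy (F m)) < fine (energy w) + e .
  by apply: (cvgr_lt (fine (energy w))) lt_e; exact: cE'.
have near2 : \forall m \near \oo, pint w - e < pint (F m) .
  by apply: (cvgr_gt (pint w)) lt_p; exact: cP'.
have [m [h1 h2]] := filter_ex (filterI near1 near2).
exists (F m), L', M, (m%:R / m.+1%:R); split.
- exact: aF.
- split; first by rewrite ltr_pdivrMr ?ltr0n// mul1r ltr_nat.
  by move=> x x1; rewrite FE prof_supp ?enorm_ge0.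
- move=> x0 k; have sd := smooth_dot x0.
  rewrite /F /prof; apply: smooth_sum => i; apply: smoothM; first exact: smooth_cst.
  have sn : smooth (fun x => node m i (dot (k *: (x - x0)) (k *: (x - x0)))).
    under eq_fun do rewrite dotZl dotZr mulrA /node.
    apply: smoothM; last exact: smooth_cst.
    apply: smoothD; last exact: smooth_cst.
    apply: smoothM; last exact: smooth_cst.
    by apply: smoothM => //; exact: smooth_cst.
  apply: smoothM; last exact: smooth_cst.
  apply: smooth_flat; apply: smoothD; first exact: smooth_cst.
  have := smoothM (smooth_cst (-1)) (smooth_flat 0 sn).
  by under eq_fun do rewrite mulN1r.
- have fe : energy (F m) \is a fin_num.
    by rewrite ge0_fin_numE ?energy_ge0// (energy_lty N2 s0 s1 (aF m)).
  by rewrite -(fineK fe) -(fineK few) -EFinD lee_fin ltW.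
- exact: ltW.
Unshelve. all: end_near.
Qed.

End approximation.

(** * Test functions and the first eigenvalue *)

Section test_functions.
Context {R : realType} {N : nat}.
Notation V := 'rV[R]_N.
Notation RN := (RN R N).
Notation mu := (lebm R N).
Implicit Types (phi : V -> R) (Omega : set V).

Lemma mxnorm_le_enorm (x : V) : `|x| <= enorm x.
Proof.
rewrite [leLHS]mx_normrE; elim/big_ind: _ => [|a b ha hb|ij _]; first exact: enorm_ge0.
  by rewrite ge_max ha hb.
by rewrite ord1 coord_le_enorm.
Qed.

Lemma bounded_setP (A : set V) : bounded_set A <-> exists rho, forall x, A x -> enorm x <= rho.
Proof.
split=> [[M [_ HM]]|[rho Hr]].
  exists (N%:R * (M + 1)) => x Ax; apply: (le_trans (enorm_le_sum _)).
  have xM : `|x| <= M + 1 by apply: HM => //; rewrite ltrDl.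
  have -> : N%:R * (M + 1) = \sum_(i < N) (M + 1) by rewrite sumr_const card_ord mulr_natl.
  apply: ler_sum => i _; apply: le_trans xM.
  rewrite [leRHS]mx_normrE; exact: (le_bigmax _ (fun ij => `|x ij.1 ij.2|) (0, i)).
exists rho; split; first exact: num_real.
move=> M rM x Ax; apply: (le_trans (mxnorm_le_enorm x)).
exact: le_trans (Hr x Ax) (ltW rM).
Qed.

Lemma derive_line_at (f : V -> R) (x v : V) (h : R) df :
  is_derive (h *: v + x) v f df -> is_derive h 1 (fun h => f (h *: v + x)) df.
Proof.
have E : (fun t : R => t^-1 *: ((f \o shift (h *: v + x)) (t *: v) - f (h *: v + x))) =
  (fun t : R => t^-1 *: (((fun h => f (h *: v + x)) \o shift h) (t *: 1) - f (h *: v + x))).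
  apply/funext => t; have e1 : t *: (1 : R) = t by rewrite /GRing.scale/= mulr1.
  by rewrite /= e1 scalerDl addrA.
move=> -[d <-]; split.
- by move: d; rewrite /derivable E.
- by rewrite /derive E.
Qed.

Definition supp phi : set V := closure [set x | phi x != 0].

Lemma not_supp phi x : ~ supp phi x -> \forall y \near x, phi y = 0.
Proof.
move=> nx; have op : open (~` supp phi) by apply: closed_openC; exact: closed_closure.
have := open_nbhs_nbhs (conj op nx); apply: filterS => y ny.
by apply/eqP; apply: contrapT => /negP h; apply: ny; exact: subset_closure.
Qed.

Lemma bounded_on_support phi (K : set V) : continuous phi -> compact K ->
  (forall x, ~ K x -> phi x = 0) -> exists M, 0 <= M /\ forall x, `|phi x| <= M.
Proof.
move=> cphi cK K0.
have cont : {within K, continuous phi} by apply: continuous_subspaceT.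
have [M [_ HM]] := compact_bounded (continuous_compact cont cK).
exists (Num.max 0 (M + 1)); split; first by rewrite le_max lexx.
move=> x; have [Kx|nK] := pselect (K x); last by rewrite K0// normr0 le_max lexx.
rewrite le_max; apply/orP; right; apply: (HM (M + 1)); first by rewrite ltrDl.
by exists x.
Qed.

(* Change the coordinates one at a time. *)
Lemma lipschitz_of_partials phi (M : R) : (forall i x, derivable phi x (delta_mx 0 i)) ->
  (forall i x, `|'D_(delta_mx 0 i) phi x| <= M) ->
  forall x y, `|phi x - phi y| <= N%:R * M * enorm (x - y).
Proof.
move=> dphi DM x y.
pose z (k : nat) : V := \row_i (if (i < k)%N then y 0 i else x 0 i).
have step k : (k < N)%N -> `|phi (z k) - phi (z k.+1)| <= M * enorm (x - y).
  move=> kN; pose i0 := Ordinal kN; pose v : V := delta_mx 0 i0.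
  pose p : V := z k - x 0 i0 *: v.
  have zk : z k = x 0 i0 *: v + p by rewrite /p addrC subrK.
  have zk1 : z k.+1 = y 0 i0 *: v + p.
    apply/rowP => i; rewrite !mxE eqxx/=; case: (ltngtP i k) => ik.
    - have -> : (i == i0) = false by apply/negP => /eqP e; move: ik; rewrite e ltnn.
      by rewrite ltnS (ltnW ik) !mulr0 subr0 add0r.
    - have -> : (i == i0) = false by apply/negP => /eqP e; move: ik; rewrite e ltnn.
      by rewrite ltnS leqNgt ik !mulr0 subr0 add0r.
    - have -> : i = i0 by exact: val_inj.
      by rewrite eqxx ltnSn !mulr1 subrr addr0.
  have main a b : a <= b -> `|phi (a *: v + p) - phi (b *: v + p)| <= M * `|a - b|.
    move=> ab; rewrite distrC (distrC a).
    have der (t : R) : is_derive t 1 (fun t => phi (t *: v + p)) ('D_v phi (t *: v + p)).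
      by apply: derive_line_at; split; [exact: dphi|].
    have cont : {within `[a, b], continuous (fun t => phi (t *: v + p))}.
      apply: continuous_subspaceT => t; apply: differentiable_continuous.
      by apply/derivable1_diffP; case: (der t).
    have [c _ ->] := MVT_segment ab (fun t _ => der t) cont.
    by rewrite normrM; apply: ler_wpM2r => //; exact: DM.
  have M0 : 0 <= M by apply: le_trans (DM i0 x).
  rewrite zk zk1; apply: (@le_trans _ _ (M * `|x 0 i0 - y 0 i0|)).
    have [h|h] := leP (x 0 i0) (y 0 i0); first exact: main.
    by rewrite distrC (distrC (x 0 i0)); apply: main; exact: ltW.
  by rewrite ler_wpM2l//; have := coord_le_enorm (x - y) i0; rewrite !mxE.
have z0 : z 0%N = x by apply/rowP => i; rewrite mxE ltn0.
have zN : z N = y by apply/rowP => i; rewrite mxE ltn_ord.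
have tel k : (k <= N)%N -> `|phi (z 0%N) - phi (z k)| <= k%:R * M * enorm (x - y).
  elim: k => [|k IH] kN; first by rewrite subrr normr0 !mul0r.
  apply: (le_trans (ler_distD (phi (z k)) _ _)).
  have := lerD (IH (ltnW kN)) (step k kN); rewrite -natr1 !mulrDl mul1r; exact.
by have := tel N (leqnn N); rewrite z0 zN.
Qed.

(** A test function has bounded partial derivatives, hence is Lipschitz; taking the modulus gives a
    function to which symmetrization applies. *)
Lemma test_fun_admissible Omega phi : test_fun Omega phi ->
  exists L rho M, [/\ 0 <= L, 0 < rho, admissible L rho M (fun x => `|phi x|) &
    measurable_fun setT (phi : RN -> R)].
Proof.
move=> [cphi cK KO]; have c0 : continuous phi by case: (cphi 0%N).
have [_ dphi] := cphi 1%N.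
have out x : ~ supp phi x -> phi x = 0 by move=> /not_supp/nbhs_singleton.
have [M [M0 HM]] := bounded_on_support c0 cK out.
have HD i : exists Mi, 0 <= Mi /\ forall x, `|'D_(delta_mx 0 i) phi x| <= Mi.
  have [di [ci _]] := dphi i; apply: (bounded_on_support ci cK) => x /not_supp h.
  have d0 : is_derive x (delta_mx 0 i) (fun=> 0 : R) 0 by exact: is_derive_cst.
  have := near_eq_is_derive _ d0; move=> /(_ phi) [] //.
  by apply: filterS h => y ->.
have [Mi Hi] := choice HD.
pose D := \sum_i Mi i.
have Dle i x : `|'D_(delta_mx 0 i) phi x| <= D.
  apply: (le_trans ((Hi i).2 x)); rewrite /D (bigD1 i)//= lerDl.
  by apply: sumr_ge0 => j _; exact: (Hi j).1.
have D0 : 0 <= D by apply: sumr_ge0 => i _; exact: (Hi i).1.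
have lip := @lipschitz_of_partials phi D (fun i => (dphi i).1) Dle.
have [rho Hr] := (bounded_setP _).1 (compact_bounded cK).
have L0 : 0 <= N%:R * D by rewrite mulr_ge0.
exists (N%:R * D), (Num.max 0 rho + 1), M; split=> //.
- by rewrite ltr_pwDr// le_max lexx.
- split=> // [x y|x xr].
    by apply: le_trans (lip x y); rewrite ler_dist_dist.
  rewrite out ?normr0// => /Hr; rewrite leNgt => /negP; apply.
  by apply: lt_le_trans xr; rewrite ltr_pwDr// le_max lexx orbT.
- exact: lipschitz_measurable lip.
Qed.

End test_functions.

Section function_space.
Context {R : realType} {N : nat}.
Notation V := 'rV[R]_N.
Notation RN := (RN R N).
Notation mu := (lebm R N).
Notation omega := (omega (R := R) (N := N)).
Variables s q : R.
Hypotheses (N2 : (2 <= N)%N) (s0 : 0 < s) (s1 : s < 1) (q1 : 1 <= q) (q2 : q < crit_exp N s).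
Notation Kf := (@Kf R N s).
Notation energy := (@energy R N s).
Notation pint := (@pint R N q).
Notation p := (@scale_exp R N s q).
Implicit Types (phi u w : V -> R) (Omega : set V).

Let q0 : 0 < q. Proof. exact: lt_le_trans q1. Qed.
Let c1 : 1 <= crit_exp N s. Proof. exact: le_trans (ltW q2). Qed.
Let c0 : 0 < crit_exp N s. Proof. exact: lt_le_trans c1. Qed.

Lemma Lnorm_pow u : (Lnorm mu (crit_exp N s)%:E (EFin \o u) `^ crit_exp N s =
  \int[mu]_x (`|u x| `^ crit_exp N s)%:E)%E.
Proof. by rewrite poweR_Lnorm ?lt0r_neq0//; apply: eq_integral => x _; rewrite /= poweR_EFin. Qed.

Lemma energyN0 u : (forall x, u x = 0) -> energy u = 0%E.
Proof.
move=> u0; rewrite energyE /kernel_energy (_ : (fun z => _) = fun=> 0%E) ?integral0//.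
by apply/funext => z; rewrite !u0 subrr expr0n mul0r.
Qed.

Lemma test_fun_D0 Omega phi : test_fun Omega phi -> D0 s Omega phi.
Proof.
move=> tphi; have [L [rho [M [L0 rho0 ap mp]]]] := test_fun_admissible tphi.
split=> //.
  have np := nni_pow c1 rho0 ap.
  apply: (@lty_poweRy _ _ (crit_exp N s)); first exact: lt0r_neq0.
  by rewrite Lnorm_pow (nintE np) ltry.
exists (fun=> phi); split=> //.
- rewrite (_ : (fun k : nat => _) = fun=> 0%E); first exact: cvg_cst.
  by apply/funext => k; rewrite seminorm2E; apply: energyN0 => x; rewrite /= subrr.
- rewrite (_ : (fun k : nat => _) = fun=> 0%E); first exact: cvg_cst.
  apply/funext => k; apply: (@poweR_eq0_eq0 _ _ (crit_exp N s)).
    exact: Lnorm_ge0.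
  rewrite Lnorm_pow (_ : (fun x => _) = fun=> 0%E) ?integral0//.
  by apply/funext => x; rewrite /= subrr normr0 powR0// lt0r_neq0.
Qed.

Lemma continuous_dist2 (x0 : V) : continuous (fun x : V => dot (x - x0) (x - x0)).
Proof. by apply: smooth_continuous; exact: smooth_dot. Qed.

Lemma closed_eball (x0 : V) r : 0 <= r -> closed [set x | enorm (x - x0) <= r].
Proof.
move=> r0; rewrite (_ : [set _ | _] = (fun x : V => dot (x - x0) (x - x0)) @^-1` [set t | t <= r ^+ 2]).
  by apply: (continuous_closedP _).1; [exact: continuous_dist2|exact: closed_le].
by apply/seteqP; split=> x /=; rewrite -enorm_sqr ler_pXn2r ?nnegrE ?enorm_ge0.
Qed.

Lemma test_fun_ball (F : V -> R) dl (x0 : V) r a : 0 < r -> dl < 1 ->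
  (forall x, dl <= enorm x -> F x = 0) ->
  (forall (x0 : V) (k : R), smooth (fun x => F (k *: (x - x0)))) ->
  test_fun (eball x0 r) (fun x => a * F (r^-1 *: (x - x0))).
Proof.
move=> r0 dl1 Fs sF; set phi := fun x => _.
pose d := Num.max 0 dl; have d1 : d < 1 by rewrite gt_max ltr01.
have d0 : 0 <= d by rewrite le_max lexx.
have sub : supp phi `<=` [set x | enorm (x - x0) <= d * r].
  have cl : closed [set x | enorm (x - x0) <= d * r] by apply: closed_eball; rewrite mulr_ge0// ltW.
  rewrite [X in _ `<=` X]((closure_id _).1 cl).
  apply: closureS => x /=; rewrite leNgt => h; apply/negP => h2; move/negP: h; apply.
  rewrite /phi Fs ?mulr0//; rewrite enormZ gtr0_norm ?invr_gt0// mulrC.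
  rewrite ler_pdivlMr// ltW//; apply: le_lt_trans h2.
  by rewrite ler_wpM2r ?(ltW r0)// le_max lexx orbT.
split.
- move=> k; apply: smooth_Ck; apply: smoothM; [exact: smooth_cst|exact: sF].
- apply: bounded_closed_compact; last exact: closed_closure.
  apply/bounded_setP; exists (d * r + enorm x0) => x /sub /= h.
  by rewrite -[x](subrK x0) (le_trans (enormD _ _))// lerD2r.
- move=> x /sub /= h; rewrite /eball/=; apply: (le_lt_trans h).
  by rewrite gtr_pMl.
Qed.

Lemma ball_translate (F : V -> R) (x0 : V) r : (fun x => F (r^-1 *: (x - x0))) =
  (fun x => F (r^-1 *: x + (- (r^-1 *: x0)))).
Proof. by apply/funext => x; rewrite scalerBr. Qed.

Lemma Lq_norm_pint Omega phi : (forall x, 0 <= phi x) -> nni mu (fun x => phi x `^ q) ->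
  measurable (Omega : set RN) -> (forall x, ~ Omega x -> phi x = 0) ->
  Lq_norm q Omega phi = (pint phi `^ q^-1)%:E.
Proof.
move=> p0 np mO pO; rewrite /Lq_norm -poweR_EFin; congr poweR.
rewrite pintE -(nintE np) [LHS]integral_mkcond; apply: eq_integral => x _.
rewrite patchE; case: ifPn => [_|/negP xO]; first by rewrite ger0_norm.
by rewrite pO ?powR0 ?lt0r_neq0// => h; apply: xO; exact: mem_set.
Qed.

End function_space.

Lemma one_le_sqr1B_mul (R : realFieldType) (e : R) : 0 < e -> e <= 1 / 4 -> 1 <= (1 - e) ^+ 2 * (1 + 4 * e).
Proof.
move=> e0 e4; rewrite -subr_ge0.
have -> : (1 - e) ^+ 2 * (1 + 4 * e) - 1 = e * (2 - 7 * e + 4 * e ^+ 2) by ring.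
by rewrite mulr_ge0 ?(ltW e0)// addr_ge0 ?mulr_ge0 ?sqr_ge0//; lra.
Qed.

Lemma mul1D_le_add (R : realFieldType) (e L : R) : 0 < e -> e <= 1 / 4 ->
  (1 + 4 * e) * (L + 2 * e) <= L + e * (4 + 4 * L).
Proof.
move=> e0 e4; rewrite -subr_ge0.
have -> : L + e * (4 + 4 * L) - (1 + 4 * e) * (L + 2 * e) = e * (2 - 8 * e) by ring.
by rewrite mulr_ge0 ?(ltW e0)//; lra.
Qed.

(** * Upper bound for balls and lower bound by density *)

Section eigenvalue_bounds.
Context {R : realType} {N : nat}.
Notation V := 'rV[R]_N.
Notation RN := (RN R N).
Notation mu := (lebm R N).
Notation omega := (omega (R := R) (N := N)).
Variables s q : R.
Hypotheses (N2 : (2 <= N)%N) (s0 : 0 < s) (s1 : s < 1) (q1 : 1 <= q) (q2 : q < crit_exp N s).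
Notation Kf := (@Kf R N s).
Notation energy := (@energy R N s).
Notation pint := (@pint R N q).
Notation p := (@scale_exp R N s q).
Implicit Types (phi u w : V -> R) (Omega : set V).

Let q0 : 0 < q. Proof. exact: lt_le_trans q1. Qed.
Let c1 : 1 <= crit_exp N s. Proof. exact: le_trans (ltW q2). Qed.
Let c0 : 0 < crit_exp N s. Proof. exact: lt_le_trans c1. Qed.

(** A smoothed almost extremal function of the unit ball is carried to the ball of radius r and
    normalized again; only a factor due to scaling and errors of order e appear. *)
Lemma lambda_ball_le Lam (x0 : V) r : 0 < r -> 0 < Lam ->
  (forall e, 0 < e -> exists w, [/\ nice w, pint w = 1 & (energy w < (Lam + e)%:E)%E]) ->
  (lambda s q (eball x0 r) <= ((r ^+ N) `^ (- p) * Lam)%:E)%E.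
Proof.
move=> r0 L0 Hmin; pose Z := (r ^+ N) `^ (- p).
have rN0 : 0 < r ^+ N by rewrite exprn_gt0.
have Z0 : 0 < Z by rewrite powR_gt0.
have ri0 : 0 < r^-1 by rewrite invr_gt0.
apply/lee_addgt0Pr => eps eps0.
have K0 : 0 < 4 + 4 * Lam by rewrite addr_gt0// mulr_gt0.
(* The normalization costs a factor at most 1 + 4e and the energy is at most Lam + 2e; their product
   is at most Lam + e (4 + 4 Lam) for e up to 1/4. *)
pose e := Num.min (1 / 4) (eps / (Z * (4 + 4 * Lam))).
have e0 : 0 < e by rewrite lt_min !divr_gt0// mulr_gt0.
have e4 : e <= 1 / 4 by rewrite ge_min lexx.
have eE : Z * (e * (4 + 4 * Lam)) <= eps.
  by rewrite mulrCA -ler_pdivlMr ?mulr_gt0// ge_min lexx orbT.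
have [w [nw w1 wE]] := Hmin e e0.
have [F [L [M [dl [aF [dl1 Fs] sF FE Fp]]]]] := approx_nice N2 s0 s1 q1 nw e0.
pose phi x := F (r^-1 *: (x - x0)).
have phiE : phi = fun x => F (r^-1 *: x + (- (r^-1 *: x0))) := ball_translate F x0 r.
have em : 0 < 1 - e by rewrite subr_gt0 (le_lt_trans e4)// ltr_pdivrMr// mul1r ltr1n.
have P0 : 0 < pint F by apply: lt_le_trans Fp; rewrite w1.
have nF := nni_pow q1 ltr01 aF.
have pphi : pint phi = r ^+ N * pint F by rewrite phiE pint_dil// exprVn invrK.
have pphi0 : 0 < pint phi by rewrite pphi mulr_gt0.
pose a := pint phi `^ (- q^-1); have a0 : 0 < a by rewrite powR_gt0.
pose psi x := a * phi x.
have F0 := adm_ge0 aF.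
have tpsi : test_fun (eball x0 r) psi by exact: test_fun_ball r0 dl1 Fs sF.
have psi0 x : 0 <= psi x by rewrite mulr_ge0 ?F0 ?ltW.
have [Lp [rp [Mp [_ rp0 ap mpsi]]]] := test_fun_admissible tpsi.
have npsi : nni mu (fun x => psi x `^ q).
  have := nni_pow q1 rp0 ap; rewrite (_ : (fun x => `|psi x| `^ q) = (fun x => psi x `^ q))//.
  by apply/funext => x; rewrite ger0_norm.
have nphi : nni mu (fun x => phi x `^ q).
  have ai0 : 0 <= a^-1 `^ q := powR_ge0 _ _.
  have := nniZ ai0 npsi; rewrite (_ : (fun x => _ * _) = (fun x => phi x `^ q))//.
  apply/funext => x; rewrite /psi -powRM ?invr_ge0 ?mulr_ge0 ?(ltW a0) ?F0//.
  by rewrite mulKf// lt0r_neq0.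
have psi1 : pint psi = 1.
  rewrite (pintZ nphi (ltW a0)); last by move=> x; exact: F0.
  by rewrite /a -powRrM mulNr (mulVf (lt0r_neq0 q0)) (powR_inv1 (ltW pphi0)) (mulVf (lt0r_neq0 pphi0)).
have out x : ~ eball x0 r x -> psi x = 0.
  move=> h; rewrite /psi /phi (adm_supp aF) ?mulr0// enormZ gtr0_norm// mulrC.
  by rewrite ler_pdivlMr// mul1r leNgt; apply/negP.
have mB : measurable (eball x0 r : set RN) := @eball_measurable R N x0 r.
have Dpsi : D0 s (eball x0 r) psi by apply: (@test_fun_D0 _ _ _ q).
have N1 : Lq_norm q (eball x0 r) psi = 1%E.
  by rewrite (Lq_norm_pint q1 psi0 npsi mB out) psi1 powR1.
apply: (@le_trans _ _ (seminorm2 s psi)).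
  by apply: ereal_inf_lbound; exists psi.
rewrite seminorm2E.
have mphi : measurable_fun setT (phi : RN -> R).
  rewrite (_ : phi = fun x => a^-1 * psi x); last first.
    by apply/funext => x; rewrite /psi mulKf// lt0r_neq0.
  exact: measurable_funM (measurable_cst _) mpsi.
rewrite -/(energy psi) energyZ// phiE energy_dil//; last exact: adm_measurable aF.
have fF : energy F \is a fin_num.
  by rewrite ge0_fin_numE ?energy_ge0// (energy_lty N2 s0 s1 aF).
have fw : energy w \is a fin_num.
  have [Lw [Mw [_ aw _]]] := nw.
  by rewrite ge0_fin_numE ?energy_ge0// (energy_lty N2 s0 s1 aw).
move: FE wE; rewrite -(fineK fF) -(fineK fw) -EFinD !lee_fin lte_fin => FE wE.
have E0 : 0 <= fine (energy F) by rewrite fine_ge0// energy_ge0.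
set E := fine (energy F) in FE E0 *.
have -> : a ^+ 2 * (r^-1 `^ (2 * s - N%:R) * E) = Z * (pint F `^ (- (2 / q)) * E).
  have e1 : a ^+ 2 = r `^ (N%:R * - (2 / q)) * pint F `^ (- (2 / q)).
    rewrite /a -powR_mulrn ?powR_ge0// -powRrM (_ : - q^-1 * 2%:R = - (2 / q)); last by field; rewrite lt0r_neq0.
    by rewrite pphi powRM ?(ltW rN0) ?pint_ge0// -powR_mulrn ?(ltW r0)// -powRrM.
  have e2 : r^-1 `^ (2 * s - N%:R) = r `^ (N%:R - 2 * s).
    by rewrite -(powR_inv1 (ltW r0)) -powRrM mulN1r opprB.
  have e3 : Z = r `^ (N%:R * - (2 / q)) * r `^ (N%:R - 2 * s).
    have nN : N%:R != 0 :> R by rewrite pnatr_eq0 -lt0n (leq_trans _ N2).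
    have rr : (N%:R * - (2 / q) + (N%:R - 2 * s) == 0) ==> (r != 0) by rewrite (lt0r_neq0 r0) implybT.
    rewrite /Z -(powR_mulrn _ (ltW r0)) -powRrM -(powRD rr).
    congr powR; rewrite /scale_exp; field.
    by rewrite nN lt0r_neq0.
  by rewrite e1 e2 e3; ring.
have eb : 1 <= (1 - e) ^+ 2 * (1 + 4 * e).
  exact: one_le_sqr1B_mul.
have h1 : (1 - e) ^+ 2 <= pint F `^ (2 / q).
  apply: (@le_trans _ _ ((1 - e) `^ (2 / q))).
    rewrite -powR_mulrn ?(ltW em)// ger_powR// ?em/=; last by rewrite ler_pdivrMr// ler_peMr.
    by rewrite gerBl ltW.
  have q20 : 0 <= 2 / q by rewrite divr_ge0// ltW.
  have FP : 1 - e <= pint F by rewrite -{1}w1.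
  exact: (ge0_ler_powR q20 (ltW em) (ltW P0) FP).
have h2 : pint F `^ (- (2 / q)) <= 1 + 4 * e.
  rewrite powRN -[leLHS]mul1r ler_pdivrMr ?powR_gt0//; apply: (le_trans eb).
  by rewrite mulrC ler_wpM2l// addr_ge0// mulr_ge0// ltW.
have h3 : pint F `^ (- (2 / q)) * E <= (1 + 4 * e) * (Lam + 2 * e).
  have FE2 : E <= Lam + 2 * e.
    by rewrite mulrDl !mul1r addrA (le_trans FE)// lerD2r ltW.
  exact: ler_pM (powR_ge0 _ _) E0 h2 FE2.
have h4 : (1 + 4 * e) * (Lam + 2 * e) <= Lam + e * (4 + 4 * Lam).
  exact: (mul1D_le_add Lam e0 e4).
have := ler_wpM2l (ltW Z0) (le_trans h3 h4); rewrite [X in _ <= X -> _]mulrDr.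
by move=> /le_trans; apply; rewrite lerD2l.
Qed.

Lemma quad_split (a b e : R) : 0 < e -> a ^+ 2 <= (1 + e) * b ^+ 2 + (1 + e^-1) * (a - b) ^+ 2.
Proof.
move=> e0; rewrite -subr_ge0.
have -> : (1 + e) * b ^+ 2 + (1 + e^-1) * (a - b) ^+ 2 - a ^+ 2 = e^-1 * (e * b - (a - b)) ^+ 2.
  by field; rewrite lt0r_neq0.
by rewrite mulr_ge0 ?sqr_ge0// invr_ge0 ltW.
Qed.

(** The analogue of [quad_split] for the power q: either d <= e f or f < d / e, and in each case one
    term alone suffices. *)
Lemma pow_split (u f d e : R) : 0 < e -> 0 <= u -> 0 <= f -> 0 <= d -> u <= f + d ->
  u `^ q <= (1 + e) `^ q * f `^ q + (1 + e^-1) `^ q * d `^ q.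
Proof.
move=> e0 u0 f0 d0 ufd; have ei0 : 0 < e^-1 by rewrite invr_gt0.
have o1 : 0 <= 1 + e by rewrite addr_ge0// ltW.
have o2 : 0 <= 1 + e^-1 by rewrite addr_ge0// ltW.
rewrite -!powRM//; have [h|h] := leP d (e * f).
  apply: (@le_trans _ _ (((1 + e) * f) `^ q)); last by rewrite lerDl powR_ge0.
  rewrite ge0_ler_powR ?nnegrE ?mulr_ge0 ?(ltW q0)//; apply: (le_trans ufd).
  by rewrite mulrDl mul1r lerD2l.
apply: (@le_trans _ _ (((1 + e^-1) * d) `^ q)); last by rewrite lerDr powR_ge0.
rewrite ge0_ler_powR ?nnegrE ?mulr_ge0 ?(ltW q0)//; apply: (le_trans ufd).
rewrite mulrDl mul1r addrC lerD2l -ler_pdivrMl ?invr_gt0// invrK; exact: ltW.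
Qed.

(** On a set of finite volume this turns smallness in the critical norm into smallness of the
    q-integral, with a free threshold d. *)
Lemma pow_interp (d x : R) : 0 < d -> 0 <= x ->
  x `^ q <= d `^ q + d `^ (q - crit_exp N s) * x `^ crit_exp N s.
Proof.
move=> d0 x0; have [h|h] := leP x d.
  apply: (@le_trans _ _ (d `^ q)); last by rewrite lerDl mulr_ge0 ?powR_ge0.
  by rewrite ge0_ler_powR ?nnegrE ?(ltW q0)// ltW.
have xp := lt_trans d0 h.
apply: (@le_trans _ _ (d `^ (q - crit_exp N s) * x `^ crit_exp N s)); last by rewrite lerDr powR_ge0.
have -> : x `^ q = x `^ (q - crit_exp N s) * x `^ crit_exp N s.
  by rewrite -powRD ?subrK// (lt0r_neq0 xp) implybT.
rewrite ler_wpM2r ?powR_ge0// -opprB !powRN lef_pV2 ?posrE ?powR_gt0//.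
by rewrite ge0_ler_powR ?nnegrE ?subr_ge0 ?(ltW q2) ?(ltW d0) ?(ltW xp)// ltW.
Qed.

Lemma real_limit (k c : R) : 0 <= k -> 0 <= c ->
  (forall e, 0 < e -> e < 1 -> k * (1 - e) ^+ 2 <= (1 + e) ^+ 2 * ((1 + e) * c + e)) -> k <= c.
Proof.
move=> k0' c0' H; apply/ler_addgt0Pr => eps eps0.
(* The first-order errors for e < 1: (1 - e)^2 >= 1 - 2e, (1 + e)^3 <= 1 + 7e and (1 + e)^2 e <=
   4e. *)
have D0 : 0 < 2 * k + 7 * c + 4 by rewrite !ltr_wpDl// ?mulr_ge0// addr_ge0// mulr_ge0.
pose e := Num.min (1 / 2) (eps / (2 * k + 7 * c + 4)).
have e0 : 0 < e by rewrite lt_min !divr_gt0.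
have e1 : e < 1 by rewrite gt_min; apply/orP; left; lra.
have h : e * (2 * k + 7 * c + 4) <= eps by rewrite -ler_pdivlMr// ge_min lexx orbT.
have := H e e0 e1.
have a1 : k * (1 - 2 * e) <= k * (1 - e) ^+ 2 by rewrite ler_wpM2l//; nra.
have a2 : (1 + e) ^+ 2 * (1 + e) <= 1 + 7 * e by nra.
have a3 : (1 + e) ^+ 2 * e <= 4 * e by rewrite ler_wpM2r ?(ltW e0)//; nra.
have a4 : (1 + e) ^+ 2 * (1 + e) * c <= (1 + 7 * e) * c by rewrite ler_wpM2r.
lra.
Qed.

Lemma energy_split_eps phi u e : 0 < e -> measurable_fun setT (phi : RN -> R) ->
  measurable_fun setT (u : RN -> R) ->
  (energy phi <= (1 + e)%:E * energy u + (1 + e^-1)%:E * energy (phi \- u)%R)%E.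
Proof.
move=> e0 mp mu'; have ei0 : 0 < e^-1 by rewrite invr_gt0.
have o1 : 0 <= 1 + e by rewrite addr_ge0// ltW.
have o2 : 0 <= 1 + e^-1 by rewrite addr_ge0// ltW.
have md : measurable_fun setT ((phi \- u) : RN -> R) by exact: measurable_funB.
have m1 := measurable_Kenergy s mu'; have m2 := measurable_Kenergy s md.
have g1 (f : V -> R) (z : RN * RN) : (0 <= ((f z.1 - f z.2) ^+ 2 * Kf (dist2 z))%:E :> \bar R)%E.
  by rewrite lee_fin mulr_ge0 ?sqr_ge0 ?Kf_ge0.
rewrite !energyE /kernel_energy.
rewrite -(@ge0_integral_scale _ _ _ (@mu2 R N) _ _ o1 m1 (g1 u)) -(@ge0_integral_scale _ _ _ (@mu2 R N) _ _ o2 m2 (g1 _)).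
have M1 : measurable_fun setT (fun z : RN * RN => (1 + e)%:E * ((u z.1 - u z.2) ^+ 2 * Kf (dist2 z))%:E)%E.
  by apply/measurable_EFinP; apply: measurable_funM => //; apply/measurable_EFinP.
have M2 : measurable_fun setT (fun z : RN * RN => (1 + e^-1)%:E *
    (((phi \- u) z.1 - (phi \- u) z.2) ^+ 2 * Kf (dist2 z))%:E)%E.
  by apply/measurable_EFinP; apply: measurable_funM => //; apply/measurable_EFinP.
rewrite -ge0_integral_add//.
- apply: le_ge0_integral.
  + exact: measurable_Kenergy.
  + exact: emeasurable_funD.
  + exact: g1.
  move=> z; rewrite -!EFinM -EFinD lee_fin.
  have h := ler_wpM2r (@Kf_ge0 R N s (dist2 z)) (quad_split (phi z.1 - phi z.2) (u z.1 - u z.2) e0).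
  apply: (le_trans h); rewrite le_eqVlt; apply/orP; left; apply/eqP => /=.
  ring.
- by move=> z; rewrite mule_ge0 ?g1// lee_fin.
- by move=> z; rewrite mule_ge0 ?g1// lee_fin.
Qed.

Lemma cvge0_lt (f : nat -> \bar R) (e : R) : (f j @[j --> \oo] --> 0)%E -> 0 < e ->
  \forall j \near \oo, (f j < e%:E)%E.
Proof.
move=> /fine_cvgP[fin cv] e0.
have h : \forall j \near \oo, fine (f j) < e by apply: (cvgr_lt 0) e0; exact: cv.
near=> j; have fj : f j \is a fin_num by near: j.
by rewrite -(fineK fj) lte_fin; near: j.
Unshelve. all: end_near.
Qed.

(** An inequality for test functions passes to the completion: the approximating phi_j has energy at
    most (1 + e) times that of u plus e, and its q-integral times (1 + e)^q is at least 1 - e. *)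
Lemma lambda_ge Omega k : 0 <= k -> measurable (Omega : set RN) -> (mu Omega < +oo)%E ->
  (forall phi, test_fun Omega phi ->
     ((k * pint (fun x => `|phi x|) `^ (2 / q))%:E <= energy phi)%E) ->
  (k%:E <= lambda s q Omega)%E.
Proof.
move=> k0' mO Ooo H; apply: le_ereal_inf_tmp => _ [u [[mu' uL [phi [tphi E0 L0]]] u1] <-].
rewrite seminorm2E -/(energy u).
have := energy_ge0 s u; case Eu : (energy u) => [c| |]//; last by move=> *; rewrite leey.
rewrite !lee_fin => c0'; apply: real_limit => // e e0 e1.
have ei0 : 0 < e^-1 by rewrite invr_gt0.
have o2 : 0 < 1 + e^-1 by rewrite addr_gt0.
have o1 : 0 < 1 + e by rewrite addr_gt0.
pose C2 := (1 + e^-1) `^ q; have C20 : 0 < C2 by rewrite powR_gt0.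
have fO : mu Omega \is a fin_num by rewrite ge0_fin_numE.
pose vol := fine (mu Omega); have vol0 : 0 <= vol by rewrite fine_ge0.
(* The two error terms of [pow_interp] receive e/2 each: d makes the constant term small on Omega,
   and [eta] below is the closeness in the critical norm that makes the other one small for this
   d. *)
pose d := (e / 2 / C2 / (vol + 1)) `^ q^-1.
have vp : 0 < vol + 1 by rewrite ltr_wpDl.
have dq0 : 0 < e / 2 / C2 / (vol + 1) by rewrite !divr_gt0.
have d0 : 0 < d by rewrite powR_gt0.
have dq : C2 * (d `^ q * vol) <= e / 2.
  rewrite /d -powRrM mulVf ?lt0r_neq0// powRr1 ?(ltW dq0)//.
  apply: (@le_trans _ _ (C2 * (e / 2 / C2 / (vol + 1) * (vol + 1)))).
    by rewrite ler_wpM2l ?(ltW C20)// ler_wpM2l ?(ltW dq0)// lerDl.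
  by rewrite divfK ?lt0r_neq0// mulrCA divff ?mulr1// lt0r_neq0.
pose D := d `^ (q - crit_exp N s); have D0 : 0 < D by rewrite powR_gt0.
pose eta := (e / 2 / C2 / D) `^ (crit_exp N s)^-1.
have et0 : 0 < e / 2 / C2 / D by rewrite !divr_gt0.
have eta0 : 0 < eta by rewrite powR_gt0.
have near1 : \forall j \near \oo, (seminorm2 s (phi j \- u)%R < (e / (1 + e^-1))%:E)%E.
  by apply: (cvge0_lt E0); rewrite divr_gt0.
have near2 : \forall j \near \oo,
    (Lnorm mu (crit_exp N s)%:E (EFin \o (phi j \- u)%R) < eta%:E)%E.
  exact: (cvge0_lt L0 eta0).
have [j [h1 h2]] := filter_ex (filterI near1 near2).
have [L [rho [M [_ rho0 ap mp]]]] := test_fun_admissible (tphi j).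
have np := nni_pow q1 rho0 ap.
have md : measurable_fun setT ((phi j \- u) : RN -> R) by exact: measurable_funB.
have mpow (f : V -> R) r : measurable_fun setT (f : RN -> R) ->
    measurable_fun setT (fun x : RN => `|f x| `^ r).
  move=> mf; apply: (measurableT_comp (@measurable_powR R r)); exact: measurableT_comp mf.
have I0 : (\int[mu]_x (`|(phi j \- u) x| `^ crit_exp N s)%:E <= (e / 2 / C2 / D)%:E)%E.
  rewrite -(Lnorm_pow q1 q2).
  have -> : (e / 2 / C2 / D)%:E = (eta%:E `^ crit_exp N s)%E.
    by rewrite poweR_EFin /eta -powRrM mulVf ?lt0r_neq0// powRr1// ltW.
  apply: gt0_ler_poweR; rewrite ?in_itv/= ?leey ?andbT ?lee_fin ?Lnorm_ge0 ?(ltW c0) ?(ltW eta0)//.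
  exact: ltW.
have nd : nni mu (fun x => `|(phi j \- u) x| `^ crit_exp N s).
  split; [exact: mpow|by move=> x; exact: powR_ge0|].
  by apply: (le_lt_trans I0); exact: ltry.
have I0' : nint mu (fun x => `|(phi j \- u) x| `^ crit_exp N s) <= e / 2 / C2 / D.
  by rewrite -lee_fin -(nintE nd).
have nO : nni mu (\1_Omega : V -> R) by apply: nni_indic.
have pos1 : 0 <= (1 + e) `^ q := powR_ge0 _ _.
have n1 := nniZ pos1 np.
have n2 := nniZ (ltW C20) (nniD (nniZ (powR_ge0 d q) nO) (nniZ (ltW D0) nd)).
have n3 := nniD n1 n2.
have mass : 1 <= (1 + e) `^ q * pint (fun x => `|phi j x|) + e.
  have l1 : (\int[mu]_(x in Omega) (`|u x| `^ q)%:E = 1)%E.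
    have := u1; rewrite /Lq_norm => h.
    have : ((\int[mu]_(x in Omega) (`|u x| `^ q)%:E) `^ q^-1 `^ q = 1 `^ q)%E by rewrite -[RHS](congr1 (fun t => (t `^ q)%E) h).
    rewrite -poweRrM mulVf ?lt0r_neq0// poweR1r poweRe1//.
    by apply: integral_ge0 => x _; rewrite lee_fin powR_ge0.
  rewrite -lee_fin -[leLHS]l1 integral_mkcond.
  have T : nint mu (fun x => (1 + e) `^ q * `|phi j x| `^ q + C2 * (d `^ q * \1_Omega x + D * `|(phi j \- u) x| `^ crit_exp N s))
      <= (1 + e) `^ q * pint (fun x => `|phi j x|) + e.
    rewrite (nintD n1 n2) (nintZ pos1 np) (nintZ (ltW C20)); last exact: nniD (nniZ (powR_ge0 d q) nO) (nniZ (ltW D0) nd).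
    rewrite (nintD (nniZ (powR_ge0 d q) nO) (nniZ (ltW D0) nd)) (nintZ (powR_ge0 d q) nO) (nintZ (ltW D0) nd).
    rewrite nint_lebm// lerD2l mulrDr.
    have : C2 * (D * nint mu (fun x => `|(phi j \- u) x| `^ crit_exp N s)) <= e / 2.
      apply: (@le_trans _ _ (C2 * (D * (e / 2 / C2 / D)))).
        by rewrite ler_wpM2l ?(ltW C20)// ler_wpM2l// ltW.
      by rewrite le_eqVlt; apply/orP; left; apply/eqP; field; rewrite !lt0r_neq0.
    rewrite -/vol; move: dq; clear; move: (C2 * _) (C2 * _) => X Y; lra.
  apply: (@le_trans _ _ (nint mu (fun x => (1 + e) `^ q * `|phi j x| `^ q + C2 * (d `^ q * \1_Omega x + D * `|(phi j \- u) x| `^ crit_exp N s)))%:E); last by rewrite lee_fin.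
  rewrite -(nintE n3); apply: le_ge0_integral.
  - apply/(measurable_restrictT _ mO).1; apply: measurable_funTS.
    by apply/measurable_EFinP; exact: mpow.
  - exact: nni_emeasurable n3.
  - by move=> x; rewrite patchE; case: ifP => _ //; rewrite lee_fin powR_ge0.
  move=> x; rewrite patchE indicE; case: ifPn => [xO|_]; last first.
    change (0%E <= ((1 + e) `^ q * `|phi j x| `^ q +
      C2 * (d `^ q * 0%:R + D * `|(phi j \- u)%R x| `^ crit_exp N s))%:E)%E.
    rewrite lee_fin addr_ge0// mulr_ge0 ?powR_ge0// addr_ge0// mulr_ge0 ?powR_ge0//.
  rewrite lee_fin mulr1.
  have tri : `|u x| <= `|phi j x| + `|(phi j \- u) x|.
    rewrite -[X in `|X| <= _](subKr (phi j x)); exact: ler_normB.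
  apply: (le_trans (pow_split e0 (normr_ge0 _) (normr_ge0 _) (normr_ge0 _) tri)).
  by rewrite lerD2l ler_wpM2l ?(ltW C20)// pow_interp.
have en : (energy (phi j) <= ((1 + e) * c + e)%:E)%E.
  apply: (le_trans (energy_split_eps e0 mp mu')); rewrite Eu -EFinM [((_ + e)%:E)%E](EFinD _ e); apply: leeD => //.
  have h1' : (energy (phi j \- u)%R <= (e / (1 + e^-1))%:E)%E by move: h1; rewrite seminorm2E; exact: ltW.
  apply: (@le_trans _ _ ((1 + e^-1)%:E * (e / (1 + e^-1))%:E)%E).
    by apply: lee_wpmul2l => //; rewrite lee_fin ltW.
  by rewrite -EFinM lee_fin mulrCA divff ?mulr1// lt0r_neq0.
have := le_trans (H _ (tphi j)) en; rewrite lee_fin => fin.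
have em : 0 < 1 - e by rewrite subr_gt0.
have P1 : (1 - e) / (1 + e) `^ q <= pint (fun x => `|phi j x|).
  by rewrite ler_pdivrMr ?powR_gt0// mulrC lerBlDr.
have P2 : (1 - e) ^+ 2 / (1 + e) ^+ 2 <= pint (fun x => `|phi j x|) `^ (2 / q).
  apply: (@le_trans _ _ (((1 - e) / (1 + e) `^ q) `^ (2 / q))).
    rewrite -powRN powRM ?powR_ge0 ?(ltW em)// -powRrM.
    have -> : - q * (2 / q) = - 2 by field; rewrite lt0r_neq0.
    rewrite powRN -[X in _ / (1 + e) `^ X]/(2%:R) powR_mulrn ?(ltW o1)// ler_wpM2r ?invr_ge0 ?sqr_ge0//.
    rewrite -powR_mulrn ?(ltW em)// ger_powR// ?em/= ?gerBl ?(ltW e0)//.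
    by rewrite ler_pdivrMr// ler_peMr.
  by rewrite ge0_ler_powR ?nnegrE ?pint_ge0 ?divr_ge0 ?powR_ge0 ?(ltW q0) ?(ltW em).
have o12 : 0 < (1 + e) ^+ 2 by rewrite exprn_gt0.
have := le_trans (ler_wpM2l k0' P2) fin; rewrite mulrA ler_pdivrMr//.
by rewrite [X in _ -> _ <= X]mulrC.
Qed.

End eigenvalue_bounds.

(** * Stability of the first eigenvalue *)

Section faber_krahn.
Context {R : realType} {N : nat}.
Notation V := 'rV[R]_N.
Notation RN := (RN R N).
Notation mu := (lebm R N).
Notation omega := (omega (R := R) (N := N)).
Variables s q : R.
Hypotheses (N2 : (2 <= N)%N) (s0 : 0 < s) (s1 : s < 1) (q1 : 1 <= q) (q2 : q < crit_exp N s).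
Notation energy := (@energy R N s).
Notation pint := (@pint R N q).
Notation p := (@scale_exp R N s q).

Lemma admissible_dil L rho M (u : V -> R) t : 0 < t -> 0 < rho -> admissible L rho M u ->
  admissible (L * t) (rho / t) M (fun x => u (t *: x + 0)).
Proof.
move=> t0 r0 au; split=> [x y|x|x|x].
- by rewrite !addr0 (le_trans (adm_lip au _ _))// -scalerBr enormZ gtr0_norm// mulrA.
- exact: adm_ge0 au _.
- exact: adm_le au _.
- by rewrite ler_pdivrMr// => h; rewrite (adm_supp au)// addr0 enormZ gtr0_norm// mulrC.
Qed.

Lemma dil0_preimage (A : set V) t : 0 < t -> measurable (A : set RN) ->
  measurable (dil t 0 @^-1` A : set RN) /\ mu (dil t 0 @^-1` A) = ((t ^- N)%:E * mu A)%E.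
Proof.
move=> t0 mA; have dm := @dil_map R N t 0 (lt0r_neq0 t0); split.
  by have := leb_map_measurable dm measurableT mA; rewrite setTI.
by rewrite !lebmE dil_scales ?lt0r_neq0// gtr0_norm.
Qed.

Lemma dil0_eball c t : 0 < t -> dil t 0 @^-1` (eball (t *: c) t) = eball c 1 :> set V.
Proof.
move=> t0; apply/seteqP; split=> x; rewrite /eball/= /dil addr0 -scalerBr enormZ gtr0_norm//.
  by rewrite -{2}[t]mulr1 ltr_pM2l.
by rewrite -{2}[t]mulr1 ltr_pM2l.
Qed.

(** The dilation by t brings Omega to volume [omega], where [core_stability] applies to the modulus
    of each rescaled test function; passing to the modulus does not increase the energy. *)
Lemma lambda_stability : exists C Lam, [/\ 0 < C, 0 < Lam,
  forall (x0 : V) r, 0 < r -> (lambda s q (eball x0 r) <= ((r ^+ N) `^ (- p) * Lam)%:E)%E &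
  forall Omega t b, 0 < t -> 0 <= b -> measurable (Omega : set RN) ->
    mu Omega = (t ^+ N * omega)%:E ->
    (forall c, ((t ^+ N * b)%:E <= mu (eball c t `\` Omega))%E) ->
    (((t ^+ N) `^ (- p) * (Lam + C * b ^+ 3))%:E <= lambda s q Omega)%E].
Proof.
have [Lam L0 [HL Hm]] := @sharp_constant R N s q N2 s0 s1 q1 q2.
have [C C0 H] := @core_stability R N s q N2 s0 s1 q1 q2 Lam L0 HL.
exists C, Lam; split=> // [x0 r r0|Omega t b t0 b0 mO Ot Hb].
  exact: lambda_ball_le.
have tN : 0 < t ^+ N by rewrite exprn_gt0.
have bo : b <= omega.
  rewrite -(ler_pM2l tN) -lee_fin (le_trans (Hb 0))// -(mu_eball 0 t0) le_measure ?inE//.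
  - by apply: measurableD => //; exact: eball_measurable.
  - exact: eball_measurable.
have [mO' O'] := dil0_preimage t0 mO.
have O1 : (mu (dil t 0%R @^-1` Omega) <= omega%:E)%E.
  by rewrite O' Ot -EFinM lee_fin mulKf// lt0r_neq0.
have O2 c : (b%:E <= mu (eball c 1 `\` dil t 0%R @^-1` Omega))%E.
  rewrite -(dil0_eball _ t0).
  have mB : measurable (eball (t *: c) t `\` Omega : set RN).
    by apply: measurableD => //; exact: eball_measurable.
  rewrite -[X in mu X]/(dil t 0 @^-1` (eball (t *: c) t `\` Omega)).
  have [_ ->] := dil0_preimage t0 mB.
  rewrite -lee_pdivrMl ?invr_gt0// invrK -EFinM; exact: Hb.
apply: lambda_ge => //.
- by rewrite mulr_ge0 ?powR_ge0// addr_ge0 ?(ltW L0)// mulr_ge0 ?(ltW C0)// exprn_ge0.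
- by rewrite Ot ltry.
move=> phi tphi; have [L [rho [M [L0' rho0 ap mphi]]]] := test_fun_admissible tphi.
have [_ _ K] := tphi.
have au := admissible_dil t0 rho0 ap.
have uO x : 0 < `|phi (t *: x + 0)| -> (dil t 0 @^-1` Omega) x.
  by rewrite normr_gt0 => h; apply: K; apply: subset_closure.
have np := nni_pow q1 rho0 ap.
have Lt0 : 0 <= L * t by rewrite mulr_ge0// ltW.
have rt0 : 0 < rho / t by rewrite divr_gt0.
have := H b _ _ _ _ _ rt0 Lt0 au uO mO' O1 b0 bo O2.
have mp : measurable_fun setT ((fun x => `|phi x|) : RN -> R) by exact: adm_measurable ap.
rewrite (@energy_dil R N s (fun x => `|phi x|) t 0 t0 mp).
rewrite (@pint_dil R N q (fun x => `|phi x|) t 0 t0); last first.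
  exact: np.
move=> h; have le1 : (energy (fun x => `|phi x|)%R <= energy phi)%E.
  by apply: energy_le => // x y; exact: ler_dist_dist.
apply: le_trans le1.
have T0 : 0 < t `^ (2 * s - N%:R) by rewrite powR_gt0.
rewrite -(@lee_pmul2l _ (t `^ (2 * s - N%:R))%:E)//.
apply: le_trans h; rewrite -EFinM lee_fin le_eqVlt; apply/orP; left; apply/eqP.
have nN : N%:R != 0 :> R by rewrite pnatr_eq0 -lt0n (leq_trans _ N2).
have nq : q != 0 by rewrite lt0r_neq0// (lt_le_trans _ q1).
have e1 : t `^ (2 * s - N%:R) * (t ^+ N) `^ (- p) = t `^ (N%:R * - (2 / q)).
  have rr (z : R) : (z == 0) ==> (t != 0) by rewrite (lt0r_neq0 t0) implybT.
  rewrite -(powR_mulrn _ (ltW t0)) -powRrM -(powRD (rr _)).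
  by congr powR; rewrite /scale_exp; field; rewrite nN nq.
have e2 : (t ^- N * pint (fun x => `|phi x|)) `^ (2 / q) =
    t `^ (N%:R * - (2 / q)) * pint (fun x => `|phi x|) `^ (2 / q).
  rewrite powRM ?pint_ge0 ?invr_ge0 ?(ltW tN)//; congr (_ * _).
  rewrite -(powR_inv1 (ltW tN)) -(powR_mulrn _ (ltW t0)) -!powRrM; congr powR; ring.
by rewrite e2 -e1; ring.
Qed.

Lemma mu_setD (A B : set RN) : measurable A -> measurable B -> (mu A < +oo)%E ->
  (mu (A `\` B) = mu A - mu (A `&` B))%E.
Proof. by move=> mA mB Aoo; rewrite measureD. Qed.

Lemma mu_setU (A B : set RN) : measurable A -> measurable B -> A `&` B = set0 ->
  (mu (A `|` B) = mu A + mu B)%E.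
Proof. by move=> mA mB AB; rewrite measureU. Qed.

(** For a ball of the same volume the two halves of the symmetric difference have equal measure, so
    the part of the ball missed by Omega is half of it, whatever the center. *)
Lemma fraenkel_bounds (Omega : set V) t : 0 < t -> measurable (Omega : set RN) ->
  mu Omega = (t ^+ N * omega)%:E ->
  exists A, [/\ fraenkel Omega = A%:E, 0 <= A, A <= 2 &
    forall c, ((t ^+ N * (A * omega / 2))%:E <= mu (eball c t `\` Omega))%E].
Proof.
move=> t0 mO Ot.
have tN : 0 < t ^+ N by rewrite exprn_gt0.
have w0 := @omega_gt0 R N; have v0 : 0 < t ^+ N * omega by rewrite mulr_gt0.
have mB c : measurable (eball c t : set RN) by exact: eball_measurable.
have mD c : measurable (eball c t `\` Omega : set RN) by exact: measurableD.
have mI c : measurable (eball c t `&` Omega : set RN) by exact: measurableI.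
have Boo c : (mu (eball c t) < +oo)%E by rewrite mu_eball// ltry.
have Ooo : (mu Omega < +oo)%E by rewrite Ot ltry.
have eqD c : mu (Omega `\` eball c t) = mu (eball c t `\` Omega).
  by rewrite (mu_setD (mB c) mO (Boo c)) (mu_setD mO (mB c) Ooo) setIC Ot mu_eball.
have sym c : mu (Omega `+` eball c t) = (2%:E * mu (eball c t `\` Omega))%E.
  have dj : (Omega `\` eball c t) `&` (eball c t `\` Omega) = set0.
    by apply/seteqP; split=> x // [[_ nx] [/nx]].
  have mD' : measurable (Omega `\` eball c t : set RN) by exact: measurableD.
  rewrite /setY (mu_setU mD' (mD c) dj) eqD mul2e//; exact: measure_ge0.
have le2 c : (mu (eball c t `\` Omega) <= (t ^+ N * omega)%:E)%E.
  by rewrite -(mu_eball c t0) le_measure ?inE.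
have mf c : mu (eball c t `\` Omega) \is a fin_num.
  by rewrite ge0_fin_numE// (le_lt_trans (le2 c))// ltry.
have lb : (0 <= fraenkel Omega)%E.
  have Ot' : leb R N Omega = (t ^+ N * omega)%:E := Ot.
  apply: le_ereal_inf_tmp => _ [B _ <-]; rewrite Ot' inver (negbTE (lt0r_neq0 v0)).
  by rewrite mule_ge0// lee_fin invr_ge0 ltW.
have ub c : (fraenkel Omega <= mu (Omega `+` eball c t) / mu Omega)%E.
  apply: ereal_inf_lbound; exists (eball c t) => //; split; first by exists c, t.
  by rewrite -[RHS]/(mu Omega) Ot -(mu_eball c t0).
have ub' c : (fraenkel Omega * (t ^+ N * omega)%:E <= 2%:E * mu (eball c t `\` Omega))%E.
  apply: (@le_trans _ _ ((mu (Omega `+` eball c t) / mu Omega) * (t ^+ N * omega)%:E)%E).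
    by apply: lee_wpmul2r => //; rewrite lee_fin ltW.
  by rewrite Ot inver (negbTE (lt0r_neq0 v0)) -muleA -EFinM mulVf ?lt0r_neq0// mule1 sym.
have fF : fraenkel Omega \is a fin_num.
  rewrite ge0_fin_numE// (le_lt_trans (ub 0))// sym Ot inver (negbTE (lt0r_neq0 v0)).
  by rewrite -(fineK (mf 0)) -!EFinM ltry.
have A2 := fine_ge0 lb.
exists (fine (fraenkel Omega)); split; rewrite ?fineK//.
- have e2 : (0 <= 2%:E :> \bar R)%E by rewrite lee_fin.
  have := le_trans (ub' 0) (lee_wpmul2l e2 (le2 0)).
  by rewrite -(fineK fF) -!EFinM lee_fin ler_pM2r.
move=> c; have := ub' c; rewrite -(fineK fF).
rewrite -(fineK (mf c)) -!EFinM !lee_fin => h.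
have -> : t ^+ N * (fine (fraenkel Omega) * omega / 2) = fine (fraenkel Omega) * (t ^+ N * omega) / 2 by ring.
by rewrite ler_pdivrMr// [leRHS]mulrC.
Qed.

Lemma volume_radius (Omega : set V) : Omega !=set0 -> open Omega -> bounded_set Omega ->
  exists2 t, 0 < t & mu Omega = (t ^+ N * omega)%:E.
Proof.
move=> [x Ox] oO bO; have mO := open_leb_measurable oO.
have w0 := @omega_gt0 R N.
have fin : mu Omega \is a fin_num.
  have [rho Hr] := (bounded_setP Omega).1 bO.
  have r0 : 0 < `|rho| + 1 by rewrite ltr_wpDl.
  rewrite ge0_fin_numE// (@le_lt_trans _ _ (mu (eball 0 (`|rho| + 1))))//; last by rewrite mu_eball// ltry.
  rewrite le_measure ?inE//; first exact: eball_measurable.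
  move=> y /Hr h; rewrite /eball/= subr0 (le_lt_trans h)// (le_lt_trans (ler_norm _))// ltrDl//.
have pos : (0 < mu Omega)%E.
  have [r r0 rO] : exists2 r : R, 0 < r & eball x r `<=` Omega.
    have /nbhs_ballP[e /= e0 eO] : nbhs x Omega by exact: open_nbhs_nbhs.
    exists e => // y xy; apply: eO; rewrite -ball_normE/= distrC.
    exact: le_lt_trans (mxnorm_le_enorm _) xy.
  apply: (@lt_le_trans _ _ (mu (eball x r))).
    by rewrite mu_eball// lte_fin mulr_gt0// exprn_gt0.
  by rewrite le_measure ?inE//; exact: eball_measurable.
have nN : N%:R != 0 :> R by rewrite pnatr_eq0 -lt0n (leq_trans _ N2).
have m0 : 0 < fine (mu Omega) by rewrite fine_gt0// pos -ge0_fin_numE.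
have d0 : 0 < fine (mu Omega) / omega by rewrite divr_gt0.
exists ((fine (mu Omega) / omega) `^ N%:R^-1); first by rewrite powR_gt0.
by rewrite -powR_mulrn ?powR_ge0// -powRrM mulVf// powRr1 ?(ltW d0)// divfK ?lt0r_neq0// fineK.
Qed.

Theorem quantitative_faber_krahn : exists2 C, 0 < C & forall Omega : set V,
  Omega !=set0 -> open Omega -> bounded_set Omega -> forall B : set V, is_eball B ->
    (C%:E * fraenkel Omega `^ (2 + s^-1) <=
      leb R N Omega `^ p * lambda s q Omega - leb R N B `^ p * lambda s q B)%E.
Proof.
have [C [Lam [C0 L0 Hball HO]]] := lambda_stability.
have w0 := @omega_gt0 R N.
exists (omega `^ p * C * (omega / 2) ^+ 3 / 2 `^ (s^-1 - 1)).
  by rewrite divr_gt0 ?powR_gt0// !mulr_gt0 ?powR_gt0// exprn_gt0// divr_gt0.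
move=> Omega nO oO bO _ [x0 [r [r0 ->]]].
have mO := open_leb_measurable oO.
have [t t0 Ot] := volume_radius nO oO bO.
have [A [FA A0 A2 HA]] := fraenkel_bounds t0 mO Ot.
have b0 : 0 <= A * omega / 2 by rewrite divr_ge0// mulr_ge0// ltW.
have HOm := HO Omega t _ t0 b0 mO Ot HA.
have tN : 0 < t ^+ N by rewrite exprn_gt0.
have rN : 0 < r ^+ N by rewrite exprn_gt0.
(* Scale invariance: the volume y omega to the power p cancels the factor y^(-p) of the eigenvalue
   bounds, leaving the same power of omega for Omega and for the ball. *)
have vE y (z : R) : 0 < y -> 0 <= z -> (y * omega) `^ p * (y `^ (- p) * z) = omega `^ p * z.
  move=> y0 z0; rewrite powRM ?(ltW y0) ?(ltW w0)// powRN.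
  by field; rewrite lt0r_neq0// powR_gt0.
have Lb0 : 0 <= Lam + C * (A * omega / 2) ^+ 3.
  by rewrite addr_ge0 ?(ltW L0)// mulr_ge0 ?(ltW C0)// exprn_ge0.
have low : ((omega `^ p * (Lam + C * (A * omega / 2) ^+ 3))%:E <=
    leb R N Omega `^ p * lambda s q Omega)%E.
  rewrite -[leb R N Omega]/(mu Omega) Ot poweR_EFin.
  rewrite -(vE _ _ tN Lb0) EFinM; apply: lee_wpmul2l => //.
  by rewrite lee_fin powR_ge0.
have up : (leb R N (eball x0 r) `^ p * lambda s q (eball x0 r) <= (omega `^ p * Lam)%:E)%E.
  rewrite -[leb R N (eball x0 r)]/(mu (eball x0 r)) (mu_eball x0 r0) poweR_EFin.
  rewrite -(vE _ _ rN (ltW L0)) EFinM; apply: lee_wpmul2l; last exact: Hball.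
  by rewrite lee_fin powR_ge0.
apply: (@le_trans _ _ ((omega `^ p * (Lam + C * (A * omega / 2) ^+ 3))%:E - (omega `^ p * Lam)%:E)%E); last first.
  exact: leeB.
rewrite FA poweR_EFin -EFinM -EFinB lee_fin.
have s1' : 0 <= s^-1 - 1 by rewrite subr_ge0 invf_ge1// ltW.
have -> : omega `^ p * (Lam + C * (A * omega / 2) ^+ 3) - omega `^ p * Lam =
    omega `^ p * C * (omega / 2) ^+ 3 * A ^+ 3 by field.
have P0 : 0 < 2 `^ (s^-1 - 1) :> R by rewrite powR_gt0.
have : 0 <= omega `^ p * C * (omega / 2) ^+ 3.
  by rewrite mulr_ge0 ?exprn_ge0 ?divr_ge0 ?(ltW w0)// mulr_ge0 ?powR_ge0 ?(ltW C0).
move: (_ * _ ^+ 3) => K K0; rewrite mulrAC ler_pdivrMr// -mulrA ler_wpM2l//.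
have -> : A `^ (2 + s^-1) = A ^+ 3 * A `^ (s^-1 - 1).
  have nz : 2 + s^-1 != 0 by rewrite lt0r_neq0// addr_gt0// invr_gt0.
  rewrite -powR_mulrn// -powRD; last by rewrite (_ : 3%:R + _ = 2 + s^-1) ?(negbTE nz)//; ring.
  by congr powR; ring.
by rewrite ler_wpM2l ?exprn_ge0// ge0_ler_powR ?nnegrE.
Qed.

End faber_krahn.

Theorem theorem6p3 (R : realType) (N : nat) (s q : R)
    (hN : (2 <= N)%N) (hs0 : 0 < s) (hs1 : s < 1)
    (hq1 : 1 <= q) (hq2 : q < crit_exp N s) :
  (forall rho L : R, 0 < rho ->
    exists C : R, 0 < C /\
      forall Omega : set 'rV[R]_N,
        Omega !=set0 -> open Omega -> bounded_set Omega ->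
        lipschitz_boundary L Omega -> exterior_ball rho Omega ->
        forall B : set 'rV[R]_N, is_eball B ->
          ((C / (1 - s))%:E * fraenkel Omega `^ (2 + s^-1) <=
           leb R N Omega `^ (2 / q - 1 + 2 * s / N%:R) * lambda s q Omega
           - leb R N B `^ (2 / q - 1 + 2 * s / N%:R) * lambda s q B)%E)
  /\
  (forall alpha M : R, 0 < alpha -> alpha < 1 ->
    exists C : R, 0 < C /\
      forall Omega : set 'rV[R]_N,
        Omega !=set0 -> open Omega -> bounded_set Omega ->
        C1alpha_boundary alpha M Omega ->
        forall B : set 'rV[R]_N, is_eball B ->
          ((C / (1 - s))%:E * fraenkel Omega `^ (2 + s^-1) <=
           leb R N Omega `^ (2 / q - 1 + 2 * s / N%:R) * lambda s q Omega
           - leb R N B `^ (2 / q - 1 + 2 * s / N%:R) * lambda s q B)%E).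
Proof.
have [C C0 H] := quantitative_faber_krahn hN hs0 hs1 hq1 hq2.
have s1 : 0 < 1 - s by rewrite subr_gt0.
split=> [rho L _|alpha M _ _]; exists (C * (1 - s)); split; rewrite ?mulr_gt0// => Omega nO oO bO *.
  by rewrite mulfK ?lt0r_neq0//; exact: H.
by rewrite mulfK ?lt0r_neq0//; exact: H.
Qed.
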